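(* Let $\lambda\in\mathbb{R}$ with $|\lambda|>1$, let $\alpha$ be Diophantine, and let $L=\ln|\lambda|$. For the almost Mathieu operators $H_\theta$ ($\theta\in[0,1]$) with coupling $\lambda$ and frequency $\alpha$, define $$\gamma_+ := \limsup_{k\to\infty}\left( -\frac{\ln \mathbb{E}\big(\sum_{s} |\varphi_{\theta;s}(0)|\cdot |\varphi_{\theta;s} (k)|\big)}{|k|}\right),\qquad \gamma_- := \liminf_{k\to\infty}\left( -\frac{\ln \mathbb{E}\big(\sum_{s} |\varphi_{\theta;s}(0)|\cdot |\varphi_{\theta;s} (k)|\big)}{|k|}\right),$$ where $\mathbb{E}$ denotes the integral $\int_0^1 \cdot \,d\theta$ over the phase $\theta$. Then $\gamma_+=\gamma_-=L$.
   Context: For $\theta\in\mathbb{R}$, the almost Mathieu operator $H_\theta$ acts on $u\in\ell^2(\mathbb{Z})$ by $(H_\theta u)(n)=u(n+1)+u(n-1)+2\lambda\cos(2\pi(\theta+n\alpha))u(n)$. The frequency $\alpha$ is Diophantine if there exist $\kappa>0,\tau>0$ such that $\|k\alpha\|_{\mathbb{R}/\mathbb{Z}}\ge \tau/|k|^{\kappa}$ for all integers $k\neq 0$, where $\|x\|_{\mathbb{R}/\mathbb{Z}}=\inf_{j\in\mathbb{Z}}|x-j|$. For $|\lambda|>1$ and Diophantine $\alpha$, $H_\theta$ has pure point spectrum for almost every $\theta$; for such $\theta$, $\{\varphi_{\theta;s}\}_s$ denotes a complete orthonormal basis of $\ell^2(\mathbb{Z})$ consisting of eigenfunctions of $H_\theta$.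 *)

(* Defs.v *)
From HB Require Import structures.
From mathcomp Require Import all_boot all_order all_algebra.
From mathcomp Require Import all_classical all_reals all_analysis.
From mathcomp Require Import complex.
Set Implicit Arguments. Unset Strict Implicit. Unset Printing Implicit Defensive.
Import Order.TTheory GRing.Theory Num.Theory numFieldNormedType.Exports.
Local Open Scope classical_set_scope.
Local Open Scope ring_scope.

Section AMO.
Variable R : realType.

Definition distZ (x : R) : R := inf [set `|x - j%:~R| | j in [set: int]].

Definition diophantine (alpha : R) : Prop :=
  exists kappa tau : R, 0 < kappa /\ 0 < tau /\
    forall k : int, k != 0 ->
      tau / (`|k|%:~R) `^ kappa <= distZ (k%:~R * alpha).

Definition cmod (z : R[i]) : R := Num.sqrt (complex.Re z ^+ 2 + complex.Im z ^+ 2).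

Definition cvec := int -> R[i].

Definition sqnorm (u : cvec) : \bar R :=
  \esum_(n in [set: int]) ((cmod (u n)) ^+ 2)%:E.
Definition in_l2 (u : cvec) : Prop := (sqnorm u < +oo)%E.

Definition symsum (f : int -> R) (N : nat) : R :=
  \sum_(i < (N.*2).+1) f (i%:Z - N%:Z).

(* l^2 inner product <u, v> = \sum_n u(n) conj(v(n)) (series absolutely
   convergent for u, v in l^2, so symmetric partial sums give its value) *)
Definition inner (u v : cvec) : R[i] :=
  Complex (limn (symsum (fun n => complex.Re (u n * conjc (v n)))))
          (limn (symsum (fun n => complex.Im (u n * conjc (v n))))).

Definition amo (lam alpha theta : R) (u : cvec) : cvec :=
  fun n => u (n + 1) + u (n - 1)
           + ((2 * lam * cos (2 * pi * (theta + n%:~R * alpha)))%:C)%C * u n.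

Definition eigen_onb (lam alpha theta : R) (B : set cvec) : Prop :=
  [/\ (forall u, B u -> in_l2 u /\ inner u u = 1),
      (forall u v, B u -> B v -> u <> v -> inner u v = 0),
      (forall w, in_l2 w -> (forall u, B u -> inner w u = 0) -> w = (fun=> 0)) &
      (forall u, B u -> exists E : R[i], amo lam alpha theta u = (fun n => E * u n))].

Definition corr (phi : R -> set cvec) (k : nat) : \bar R :=
  (\int[@lebesgue_measure R]_(theta in `[0%R, 1%R])
     \esum_(u in phi theta) (cmod (u 0) * cmod (u k%:Z))%:E)%E.

Definition rate (phi : R -> set cvec) (k : nat) : \bar R :=
  (- lne (corr phi k) * ((k%:R)^-1)%:E)%E.

End AMO.

(* Main.v *)
(* Two inequalities for the eigenfunction correlator at almost every phase theta, with F_k(theta) the sum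
   over an eigenbasis of |u(0) u(k)|:
     c e^{-(L + eps) k} <= F_k(theta) <= e^{-(L - eps) k} poly(k) / r_k(theta),
   where r_k(theta) is the least distance of 2 theta + n alpha to the integers over |n| <= 100 k.
   Since the set where r_k < s has measure O(k s), and F_k <= 1, a layer-cake integration over theta turns
   these into matching exponential rates.

   Upper bound.  Box determinants of E - H are continuants; a box of m sites is, by reflection symmetry, a
   polynomial of degree m in cos(2 pi z) with leading coefficient lam^m up to sign, so Lagrange interpolation
   at Diophantine orbit points forces one of any m + 1 consecutive boxes (or two windows of boxes) to have a
   determinant of size at least e^{(L - eps) m}, up to resonances.  Green's formula then lets one of the two
   points x, y in |u(x) u(y)| move by d at the price e^{-(L - eps) d}; a single use of the resonant step
   suffices to get past the mirror point x + y = n_0.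

   The sharp upper bound e^{(L + eps) j} for continuants needed here is proved for eigenvalues of periodic
   (ring) approximants beta_l -> alpha: faster growth would, by interpolation on two ellipses, make every
   site regular at a rate exceeding what Chambers' formula allows for a Floquet solution.  Eigenvectors of the
   rings converge along an ultrafilter; for almost every theta no mass escapes, so the limits are a complete
   set of localized eigenfunctions of H_theta inheriting the growth bound.

   Lower bound.  The continuant of order k is monic of degree k in E, so completeness of the eigenfunctions
   gives sum_u K_k(E_u) u(k) conj(u(0)) = 1, and |K_k(E_u)| <= C e^{(L + eps) k}. *)

Require Import Defs.
From HB Require Import structures.
From mathcomp Require Import all_boot all_order all_algebra.
From mathcomp Require Import all_classical all_reals all_analysis.
From mathcomp Require Import measurable_realfun complex.
From mathcomp Require Import ring lra zify.
Set Implicit Arguments. Unset Strict Implicit. Unset Printing Implicit Defensive.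
Import Order.TTheory GRing.Theory Num.Theory numFieldNormedType.Exports.
Local Open Scope classical_set_scope.
Local Open Scope ring_scope.

(** The first power of $r_k$ is what makes the exponent sharp: the integral of $\min(1,
    e^{-Lk}/r_k)$ is $e^{-Lk}$ up to a polynomial factor, whereas $r_k^{-2}$ would only give the
    rate $L/2$. This is why the resonant step must rest on a single box and be used once, while all
    other steps may lose any subexponential factor. The hypothesis on [phi] speaks about a phase
    only if an eigenbasis exists there, so pure point spectrum for almost every phase has to be
    proved as well. Rings serve both needs: a Hermitian matrix has an orthonormal eigenbasis, and at
    a ring eigenvalue the trace over one period is known, so that Chambers' formula controls it off
    the unit circle too. At energies outside the spectrum continuants do grow faster than $e^{Lj}$,
    so some such restriction on the energy is unavoidable. Constants are uniform over the
    approximants because the Diophantine condition is asked of $\beta_l$ only below its period. *)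

(** * Moduli of complex numbers, the unit circle and chordal distance *)

Section Modulus.
Variable R : realType.
Implicit Types (x y z : R[i]) (s t : R).

Lemma cmodE z : ((cmod z)%:C)%C = `|z|.
Proof. by rewrite normc_def. Qed.

Lemma cmod_ge0 z : 0 <= cmod z. Proof. exact: sqrtr_ge0. Qed.

Lemma cmodM x y : cmod (x * y) = cmod x * cmod y.
Proof. by apply: (@complexI R); rewrite rmorphM /= !cmodE normrM. Qed.

Lemma cmod0 : cmod (0 : R[i]) = 0.
Proof. by apply: (@complexI R); rewrite cmodE normr0. Qed.

Lemma cmod1 : cmod (1 : R[i]) = 1.
Proof. by apply: (@complexI R); rewrite cmodE normr1. Qed.

Lemma cmod_eq0 z : (cmod z == 0) = (z == 0).
Proof. by rewrite -(inj_eq (@complexI R)) cmodE normr_eq0. Qed.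

Lemma cmod_gt0 z : (0 < cmod z) = (z != 0).
Proof. by rewrite lt_neqAle cmod_ge0 andbT eq_sym cmod_eq0. Qed.

Lemma cmodN x : cmod (- x) = cmod x.
Proof. by apply: (@complexI R); rewrite !cmodE normrN. Qed.

Lemma cmodV x : cmod (x^-1) = (cmod x)^-1.
Proof.
apply: (@complexI R); rewrite cmodE normfV -cmodE.
by rewrite -(fmorphV (real_complex R)).
Qed.

Lemma cmodX x n : cmod (x ^+ n) = cmod x ^+ n.
Proof. by apply: (@complexI R); rewrite cmodE normrX -cmodE -(rmorphXn (real_complex R)). Qed.

Lemma cmodD x y : cmod (x + y) <= cmod x + cmod y.
Proof. by rewrite -lecR rmorphD /= !cmodE ler_normD. Qed.

Lemma cmodB x y : cmod (x - y) <= cmod x + cmod y.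
Proof. by rewrite -(cmodN y) cmodD. Qed.

Lemma cmodBC x y : cmod (x - y) = cmod (y - x).
Proof. by rewrite -cmodN opprB. Qed.

Lemma cmodB_ge x y : cmod x - cmod y <= cmod (x - y).
Proof. by rewrite lerBlDr -{1}(subrK y x) cmodD. Qed.

Lemma cmod_sum I (r : seq I) (P : pred I) (F : I -> R[i]) :
  cmod (\sum_(i <- r | P i) F i) <= \sum_(i <- r | P i) cmod (F i).
Proof.
elim/big_ind2 : _ => //=; first by rewrite cmod0.
by move=> a b c d ab cd; apply: (le_trans (cmodD _ _)); rewrite lerD.
Qed.

Lemma cmod_prod I (r : seq I) (P : pred I) (F : I -> R[i]) :
  cmod (\prod_(i <- r | P i) F i) = \prod_(i <- r | P i) cmod (F i).
Proof. by apply: (big_morph (@cmod R) cmodM cmod1). Qed.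

Lemma cmodR t : cmod (t%:C)%C = `|t|.
Proof. by rewrite /cmod /= expr0n addr0 sqrtr_sqr. Qed.

Lemma cmod_nat n : cmod (n%:R : R[i]) = n%:R.
Proof. by apply: (@complexI R); rewrite cmodE normr_nat rmorph_nat. Qed.

Lemma cmod_sqr z : cmod z ^+ 2 = complex.Re z ^+ 2 + complex.Im z ^+ 2.
Proof. by rewrite /cmod sqr_sqrtr// addr_ge0 ?sqr_ge0. Qed.

Lemma cmod_conj z : cmod (conjc z) = cmod z.
Proof. by case: z => a b; rewrite /cmod /= sqrrN. Qed.

Lemma Re_le_cmod z : `|complex.Re z| <= cmod z.
Proof.
by rewrite -(@ler_pXn2r _ 2)// ?nnegrE ?cmod_ge0// cmod_sqr real_normK ?num_real// lerDl sqr_ge0.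
Qed.

Lemma Im_le_cmod z : `|complex.Im z| <= cmod z.
Proof.
by rewrite -(@ler_pXn2r _ 2)// ?nnegrE ?cmod_ge0// cmod_sqr real_normK ?num_real// lerDr sqr_ge0.
Qed.

Lemma mulcJ z : z * conjc z = ((cmod z ^+ 2)%:C)%C.
Proof.
by rewrite cmod_sqr; case: z => a b; apply/eqP; rewrite eq_complex /=; apply/andP; split; apply/eqP; ring.
Qed.

Definition expi t : R[i] := Complex (cos (2 * pi * t)) (sin (2 * pi * t)).

Lemma expiD s t : expi (s + t) = expi s * expi t.
Proof.
rewrite /expi mulrDr cosD sinD.
by apply/eqP; rewrite eq_complex /=; apply/andP; split; apply/eqP; ring.
Qed.

Lemma expi0 : expi 0 = 1.
Proof. by rewrite /expi mulr0 cos0 sin0. Qed.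

Lemma expi_neq0 t : expi t != 0.
Proof.
apply/eqP => h; have : expi (t + - t) = 1 by rewrite subrr expi0.
by rewrite expiD h mul0r => /eqP; rewrite eq_sym oner_eq0.
Qed.

Lemma expiN t : expi (- t) = (expi t)^-1.
Proof.
by apply: (mulfI (expi_neq0 t)); rewrite -expiD subrr expi0 divff ?expi_neq0.
Qed.

Lemma cmod_expi t : cmod (expi t) = 1.
Proof. by rewrite /cmod /= cos2Dsin2 sqrtr1. Qed.

Lemma expi_conj t : conjc (expi t) = expi (- t).
Proof. by rewrite /expi /= mulrN cosN sinN. Qed.

Lemma expi1 : expi 1 = 1.
Proof. by rewrite /expi mulr1 (mulr_natl pi 2) cos2pi sin2pi. Qed.

Lemma expiX t n : expi (n%:R * t) = expi t ^+ n.
Proof.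
elim: n => [|n IH]; first by rewrite mul0r expi0 expr0.
by rewrite -natr1 mulrDl mul1r expiD IH exprSr.
Qed.

Lemma expi_nat n : expi n%:R = 1.
Proof. by rewrite -[n%:R]mulr1 expiX expi1 expr1n. Qed.

Lemma expi_int (j : int) : expi j%:~R = 1.
Proof.
case: j => n; first exact: expi_nat.
by rewrite NegzE mulrNz expiN -[_%:~R]/(n.+1%:R) expi_nat invr1.
Qed.

Lemma expiDz t (j : int) : expi (t + j%:~R) = expi t.
Proof. by rewrite expiD expi_int mulr1. Qed.

Lemma expi_cos t : expi t + expi (- t) = ((2 * cos (2 * pi * t))%:C)%C.
Proof.
rewrite /expi mulrN cosN sinN.
by apply/eqP; rewrite eq_complex /=; apply/andP; split; apply/eqP; ring.
Qed.

Lemma cmod_expi_sub s t : cmod (expi s - expi t) = cmod (1 - expi (t - s)).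
Proof.
rewrite -[LHS]mul1r -(cmod_expi (- s)) -cmodM mulrBr -!expiD addNr expi0.
by rewrite [- s + t]addrC.
Qed.

Lemma cmod_oneB_sqr (r t : R) :
  cmod (1 - (r%:C)%C * expi t) ^+ 2 = 1 - 2 * r * cos (2 * pi * t) + r ^+ 2.
Proof.
rewrite cmod_sqr /=; set c := cos _; set s := sin _.
transitivity (1 - 2 * r * c + r ^+ 2 * (c ^+ 2 + s ^+ 2)); first by ring.
by rewrite cos2Dsin2 mulr1.
Qed.

(** A stand-in for the distance from t to the nearest integer, to which it is comparable
    ([chord_int], [chord_le]). Differences of interpolation nodes factor into chords exactly. *)
Definition chord t := cmod (1 - expi t).

Lemma chord_ge0 t : 0 <= chord t. Proof. exact: cmod_ge0. Qed.

Lemma chord_le2 t : chord t <= 2.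
Proof. by apply: (le_trans (cmodB _ _)); rewrite cmod1 cmod_expi. Qed.

Lemma chordN t : chord (- t) = chord t.
Proof.
rewrite /chord -expi_conj.
have -> : 1 - conjc (expi t) = conjc (1 - expi t) by rewrite rmorphB rmorph1.
exact: cmod_conj.
Qed.

Lemma cmod_expiB s t : cmod (expi s - expi t) = chord (s - t).
Proof. by rewrite cmod_expi_sub -/(chord _) -chordN opprB. Qed.

Lemma chordD s t : chord (s + t) <= chord s + chord t.
Proof.
have -> : chord (s + t) = cmod (expi s - expi (- t)) by rewrite cmod_expiB opprK.
have -> : expi s - expi (- t) = (1 - expi (- t)) - (1 - expi s) by ring.
by apply: (le_trans (cmodB _ _)); rewrite addrC -/(chord _) -/(chord _) chordN.
Qed.

Lemma chordB s t : chord (s - t) <= chord s + chord t.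
Proof. by rewrite -(chordN t) chordD. Qed.

Lemma chordDz t (j : int) : chord (t + j%:~R) = chord t.
Proof. by rewrite /chord expiDz. Qed.

Lemma chord_sin t : chord t = 2 * `|sin (pi * t)|.
Proof.
apply/eqP; rewrite -(@eqrXn2 _ 2)// ?chord_ge0 ?mulr_ge0//.
rewrite exprMn real_normK ?num_real// /chord.
have := cmod_oneB_sqr 1 t; rewrite rmorph1 mul1r => ->.
have -> : 2 * pi * t = (pi * t) *+ 2 by rewrite -mulr_natl; ring.
rewrite cos_mulr2n sin2cos2 -mulr_natl; apply/eqP; ring.
Qed.

Lemma chord_int t : exists j : int, `|t - j%:~R| <= chord t.
Proof.
have [j hj] : exists j : int, `|t - j%:~R| <= 1 / 2.
  exists (Num.floor (t + 1 / 2)); have := floor_itv (t + 1 / 2).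
  rewrite intrD; move: (Num.floor _) => j /andP[]; rewrite ler_norml => h1 h2.
  by apply/andP; split; move: h1 h2; rewrite -[1%:~R]/(1 : R); lra.
exists j; have -> : chord t = chord `|t - j%:~R|.
  have -> : chord t = chord (t - j%:~R) by rewrite -mulrNz chordDz.
  by case: (ger0P (t - j%:~R)) => // _; rewrite chordN.
have [x xE] : exists x : R, x = `|t - j%:~R| by eexists.
rewrite -!xE in hj *; have t0 : 0 <= x by rewrite xE.
clear xE t; rename x into t; rename hj into t2.
rewrite chord_sin; have pi2 := pi_ge2 R.
have st0 : 0 <= sin (pi * t).
  by apply: sin_ge0_pi; rewrite mulr_ge0 ?pi_ge0//= ler_piMr ?pi_ge0//; lra.
rewrite ger0_norm//.
(* From 0 < cos 1 = 2 cos^2(1/2) - 1. *)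
have c12 : 7 / 10 <= cos (1 / 2 : R).
  have h := cos1_gt0 R; have := cos_mulr2n (1 / 2 : R).
  have -> : (1 / 2 : R) *+ 2 = 1 by rewrite -mulr_natl; field.
  have : 0 < cos (1 / 2 : R) by apply: cos_gt0_pihalf; have := pihalf_ge1 R; lra.
  set c := cos (1 / 2 : R) => c0; rewrite -[c ^+ 2 *+ 2]mulr_natl => c1; case: leP => // lt.
  have : c * c <= 7 / 10 * (7 / 10) by apply: ler_pM; lra.
  by rewrite -expr2; lra.
have [t1|t1] := leP (pi * t) (1 / 2); last first.
  have : sin (1 / 2) <= sin (pi * t).
    apply: ltW; rewrite ltr_sin// in_itv /=; have := pihalf_ge1 R; nra.
  have : 7 / 20 <= sin (1 / 2 : R).
    have := sin_mulr2n (1 / 2 : R); have := cos_mulr2n (1 : R).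
    have -> : (1 / 2 : R) *+ 2 = 1 by rewrite -mulr_natl; field.
    have := cos2Dsin2 (1 : R); have := sin2_gt0 (_ : 0 < (1 : R) < 2).
    have h4 := cos_le1 (1 / 2 : R).
    have -> : (1 : R) *+ 2 = 2 by [].
    have := cos2_lt0 R.
    rewrite -[cos 1 ^+ 2 *+ 2]mulr_natl -[(cos _ * sin _) *+ 2]mulr_natl => h0 h1 h2 h3 h5.
    have {}h1 := h1 ltac:(lra).
    have : 7 / 10 <= sin (1 : R).
      set a := sin (1 : R) in h2 h1 *; case: leP => // lt.
      have : a * a <= 7 / 10 * (7 / 10) by apply: ler_pM; lra.
      by rewrite -expr2; lra.
    set a := sin (1 : R) in h5 *; set b := sin (1 / 2 : R) in h5 *; set c := cos (1 / 2 : R) in h4 h5 c12 *.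
    move=> ha; case: leP => // lt.
    have b0 : 0 <= b by rewrite -(@pmulr_rge0 _ c); lra.
    have : c * b <= b by rewrite ler_piMl.
    lra.
  lra.
have [->|t0'] := eqVneq t 0; first by rewrite mulr0 sin0 mulr0.
have [c hc] : exists2 c : R, c \in `]0, pi * t[ & sin (pi * t) - sin 0 = cos c * (pi * t - 0).
  apply: MVT; first by rewrite mulr_gt0 ?pi_gt0// lt_neqAle eq_sym t0'.
  by apply: continuous_subspaceT => x; exact: continuous_sin.
rewrite sin0 !subr0 => ->.
have : 7 / 10 <= cos c.
  apply: (le_trans c12); move: hc; rewrite in_itv /= => /andP[c0 c1]; apply: ltW.
  by rewrite ltr_cos ?in_itv /=; lra.
move=> hcos; have pt : 2 * t <= pi * t by rewrite ler_wpM2r.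
have : 7 / 10 * (2 * t) <= cos c * (pi * t) by apply: ler_pM => //; lra.
lra.
Qed.

Lemma chord_le t : chord t <= 8 * `|t|.
Proof.
wlog t0 : t / 0 < t => [hw|].
  have [/hw//|] := ltP 0 t; rewrite le_eqVlt => /predU1P[->|t0].
    by rewrite chord_sin mulr0 sin0 normr0 mulr0.
  by rewrite -chordN -normrN; apply: hw; rewrite oppr_gt0.
have p := pi_gt0 R.
have [c hc] : exists2 c : R, c \in `]0, pi * t[ & sin (pi * t) - sin 0 = cos c * (pi * t - 0).
  apply: MVT; first by rewrite mulr_gt0.
  by apply: continuous_subspaceT => x; exact: continuous_sin.
rewrite sin0 !subr0 chord_sin => ->; rewrite normrM (gtr0_norm t0) [`|pi * t|]gtr0_norm ?mulr_gt0//.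
have := cos_max c; have := pihalf_lt2 R; have := normr_ge0 (cos c) => h0 h1 h2.
have : `|cos c| * (pi * t) <= 1 * (pi * t) by rewrite ler_pM2r// mulr_gt0.
have : pi * t <= 4 * t by rewrite ler_pM2r//; lra.
lra.
Qed.

Lemma cmod_oneB_sqr_chord (r t : R) :
  cmod (1 - (r%:C)%C * expi t) ^+ 2 = (1 - r) ^+ 2 + r * chord t ^+ 2.
Proof.
rewrite cmod_oneB_sqr /chord; have := cmod_oneB_sqr 1 t.
by rewrite rmorph1 mul1r => ->; ring.
Qed.

End Modulus.

(** * Logarithmic sums along Diophantine orbits *)

Section Orbit.
Variable R : realType.
Implicit Types (r t x beta tau eps : R).

(* The condition is truncated at [M] so that it also makes sense for rational [beta] with denominator [M]. *)
Definition dioph_upto (kappa : nat) tau beta (M : nat) :=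
  forall j, (0 < j < M)%N -> tau / j%:R ^+ kappa <= chord (j%:R * beta).

Lemma exists_expr_lt r eps : 0 <= r < 1 -> 0 < eps -> exists J : nat, r ^+ J < eps.
Proof.
move=> /andP[r0 r1] e0.
have : (fun n => r ^+ n) @ \oo --> 0 by apply: cvg_expr; rewrite ger0_norm.
move/cvgrPdist_lt => /(_ _ e0) [N _ h]; exists N.
by have := h N (leqnn N); rewrite /= sub0r normrN ger0_norm// exprn_ge0.
Qed.

Lemma Re_sum I (s : seq I) (P : pred I) (f : I -> R[i]) :
  complex.Re (\sum_(i <- s | P i) f i) = \sum_(i <- s | P i) complex.Re (f i).
Proof. by apply: (big_morph (@complex.Re R)) => // -[a b] [c d]. Qed.

Lemma geom_cos beta x (j n : nat) : 0 < chord (j%:R * beta) ->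
  `|\sum_(i < n) cos (2 * pi * (j%:R * (x + i%:R * beta)))| <= 2 / chord (j%:R * beta).
Proof.
move=> c0; set w := expi (j%:R * beta).
have -> : \sum_(i < n) cos (2 * pi * (j%:R * (x + i%:R * beta))) =
    complex.Re (expi (j%:R * x) * \sum_(i < n) w ^+ i).
  rewrite mulr_sumr Re_sum; apply: eq_bigr => i _.
  by rewrite -expiX -expiD /expi /=; congr cos; ring.
apply: (le_trans (Re_le_cmod _)); rewrite cmodM cmod_expi mul1r.
rewrite ler_pdivlMr// mulrC /chord -cmodM -/w.
have -> : (1 - w) * (\sum_(i < n) w ^+ i) = 1 - w ^+ n by rewrite -opprB mulNr -subrX1 opprB.
by apply: (le_trans (cmodB _ _)); rewrite cmod1 cmodX cmod_expi expr1n.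
Qed.

(** The remainder after N modes of the Fourier series of 2 ln |1 - r e(t)|, where e(t) is
    [expi t]. *)
Definition logtail (N : nat) t r :=
  ln (1 - 2 * r * cos (2 * pi * t) + r ^+ 2)
  + \sum_(j < N) (2 * cos (2 * pi * (j.+1%:R * t)) / j.+1%:R) * r ^+ j.+1.

(** Closed form of a truncated Poisson kernel. It collapses the derivative of [logtail] in its
    radius to two terms of order s^N. *)
Lemma cos_poly_id (N : nat) t s :
  (1 - 2 * s * cos (2 * pi * t) + s ^+ 2) * \sum_(j < N) cos (2 * pi * (j.+1%:R * t)) * s ^+ j =
  cos (2 * pi * t) - s - s ^+ N * cos (2 * pi * (N.+1%:R * t)) + s ^+ N.+1 * cos (2 * pi * (N%:R * t)).
Proof.
elim: N => [|N IH].
  by rewrite big_ord0 mulr0 expr0 !mul1r expr1 mul0r mulr0 cos0; ring.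
rewrite big_ord_recr /= mulrDr IH.
have -> : cos (2 * pi * (N.+2%:R * t)) =
  2 * cos (2 * pi * t) * cos (2 * pi * (N.+1%:R * t)) - cos (2 * pi * (N%:R * t)).
  have -> : 2 * pi * (N.+2%:R * t) = 2 * pi * (N.+1%:R * t) + 2 * pi * t by rewrite -[N.+2%:R]natr1; ring.
  have -> : 2 * pi * (N%:R * t) = 2 * pi * (N.+1%:R * t) - 2 * pi * t by rewrite -[N.+1%:R]natr1; ring.
  by rewrite cosD cosB; ring.
by rewrite !exprS; ring.
Qed.

Lemma quad_ge t s : 0 <= s <= 1 -> (1 - s) ^+ 2 <= 1 - 2 * s * cos (2 * pi * t) + s ^+ 2.
Proof.
move=> /andP[s0 _]; rewrite -subr_ge0.
have -> : 1 - 2 * s * cos (2 * pi * t) + s ^+ 2 - (1 - s) ^+ 2 = 2 * s * (1 - cos (2 * pi * t)) by ring.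
by rewrite mulr_ge0 ?mulr_ge0// subr_ge0 cos_le1.
Qed.

Lemma is_derive_sumX N (a : nat -> R) (s : R) :
  is_derive s 1 (fun s : R => \sum_(j < N) a j * s ^+ j.+1) (\sum_(j < N) a j * j.+1%:R * s ^+ j).
Proof.
elim: N => [|N IH].
  have -> : (fun s : R => \sum_(j < 0) a j * s ^+ j.+1) = cst 0 by apply/funext => y; rewrite big_ord0.
  by rewrite big_ord0; exact: is_derive_cst.
have -> : (fun s : R => \sum_(j < N.+1) a j * s ^+ j.+1) =
   (fun s : R => \sum_(j < N) a j * s ^+ j.+1) + (a N \*: (id ^+ N.+1)).
  apply/funext => y; rewrite big_ord_recr /=.
  by rewrite -[RHS]/(_ + a N *: (id ^+ N.+1 : R -> R) y) exprfctE.
rewrite big_ord_recr; apply: is_deriveD.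
apply: (is_derive_eq (is_deriveZ _ (is_deriveX N.+1 (is_derive_id s 1)))).
by rewrite /GRing.scale /=; ring.
Qed.

Lemma is_derive_logtail N t s : 0 < 1 - 2 * s * cos (2 * pi * t) + s ^+ 2 ->
  is_derive s 1 (logtail N t) ((2 * s - 2 * cos (2 * pi * t)) / (1 - 2 * s * cos (2 * pi * t) + s ^+ 2)
     + \sum_(j < N) 2 * cos (2 * pi * (j.+1%:R * t)) * s ^+ j).
Proof.
move=> h; pose D (s : R) := 1 - 2 * s * cos (2 * pi * t) + s ^+ 2.
pose b j := if j is 0 then - (2 * cos (2 * pi * t)) else 1.
have dD : is_derive s 1 D (2 * s - 2 * cos (2 * pi * t)).
  have -> : D = cst 1 + (fun s : R => \sum_(j < 2) b j * s ^+ j.+1).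
    by apply/funext => y; rewrite /D fctE !big_ord_recr big_ord0 /= /b; ring.
  apply: (is_derive_eq (is_deriveD (is_derive_cst _ _ _) (is_derive_sumX 2 b s))).
  by rewrite !big_ord_recr big_ord0 /= /b; ring.
have -> : logtail N t = (@ln R \o D) +
   (fun s : R => \sum_(j < N) (2 * cos (2 * pi * (j.+1%:R * t)) / j.+1%:R) * s ^+ j.+1).
  by apply/funext => y; rewrite fctE.
apply: is_deriveD.
  have := @is_derive1_comp R (@ln R) D s (D s)^-1 _ (is_derive1_ln h) dD.
  by rewrite mulrC.
apply: (is_derive_eq (is_derive_sumX N (fun j => 2 * cos (2 * pi * (j.+1%:R * t)) / j.+1%:R) s)).
by apply: eq_bigr => j _; rewrite mulfVK.
Qed.

(** The remainder vanishes at radius 0, so the mean value theorem bounds it by its derivative, whose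
    denominator is at least (1 - r)^2. *)
Lemma logtail_le N t r : 0 < r < 1 -> `|logtail N t r| <= 4 * r ^+ N / (1 - r) ^+ 2.
Proof.
move=> /andP[r0 r1].
pose D (s : R) := 1 - 2 * s * cos (2 * pi * t) + s ^+ 2.
have D0 (s : R) : 0 <= s <= r -> 0 < D s.
  move=> /andP[s0 s1]; apply: lt_le_trans (quad_ge t _); last by lra.
  by rewrite exprn_gt0// subr_gt0; lra.
pose dh (s : R) := (2 * s - 2 * cos (2 * pi * t)) / D s + \sum_(j < N) 2 * cos (2 * pi * (j.+1%:R * t)) * s ^+ j.
have dl (s : R) : 0 <= s <= r -> is_derive s 1 (logtail N t) (dh s).
  by move=> sr; apply: is_derive_logtail; apply: D0.
have [s sr] : exists2 s : R, s \in `]0, r[ & logtail N t r - logtail N t 0 = dh s * (r - 0).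
  apply: MVT => //; first by move=> s; rewrite in_itv /= => /andP[s0 s1]; apply: dl; lra.
  by apply: derivable_within_continuous => s; rewrite in_itv /= => /dl [].
have -> : logtail N t 0 = 0.
  rewrite /logtail mulr0 mul0r subr0 expr0n addr0 ln1 big1 ?addr0// => i _.
  by rewrite expr0n mulr0.
rewrite !subr0 => ->; move: sr; rewrite in_itv /= => /andP[s0 s1].
have Ds := D0 s ltac:(lra).
have -> : dh s = 2 * (s ^+ N.+1 * cos (2 * pi * (N%:R * t)) - s ^+ N * cos (2 * pi * (N.+1%:R * t))) / D s.
  rewrite /dh; have := cos_poly_id N t s; rewrite -/(D s) => h.
  have -> : \sum_(j < N) 2 * cos (2 * pi * (j.+1%:R * t)) * s ^+ j
    = 2 * (D s * \sum_(j < N) cos (2 * pi * (j.+1%:R * t)) * s ^+ j) / D s.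
    rewrite -[RHS]mulrA [D s * _]mulrC mulfK ?gt_eqF//.
    by rewrite mulr_sumr; apply: eq_bigr => i _; exact: esym (mulrA _ _ _).
  rewrite h; field; exact: lt0r_neq0.
set C1 := cos _; set C2 := cos _.
have hC : `|s ^+ N.+1 * C1 - s ^+ N * C2| <= 2 * r ^+ N.
  have sN : 0 <= s ^+ N <= r ^+ N by rewrite exprn_ge0 ?lerXn2r ?nnegrE; lra.
  have sN' : 0 <= s ^+ N.+1 <= s ^+ N by apply/andP; split; [rewrite exprn_ge0; lra|rewrite exprS ler_piMl; lra].
  apply: (le_trans (ler_normB _ _)); rewrite !normrM.
  have c1 := cos_max (2 * pi * (N%:R * t)); have c2 := cos_max (2 * pi * (N.+1%:R * t)).
  have : `|s ^+ N.+1| * `|C1| <= r ^+ N * 1 by apply: ler_pM; rewrite // ger0_norm; lra.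
  have : `|s ^+ N| * `|C2| <= r ^+ N * 1 by apply: ler_pM; rewrite // ger0_norm; lra.
  lra.
rewrite !normrM normfV (gtr0_norm Ds) (gtr0_norm r0) (@ger0_norm _ 2)//.
have q : (1 - r) ^+ 2 <= D s.
  apply: le_trans (quad_ge t _); last lra.
  by rewrite lerXn2r ?nnegrE; lra.
have q0 : 0 < (1 - r) ^+ 2 by rewrite exprn_gt0; lra.
have rN : 0 <= r ^+ N by rewrite exprn_ge0; lra.
have -> : 4 * r ^+ N / (1 - r) ^+ 2 = (2 * (2 * r ^+ N)) / (1 - r) ^+ 2 * 1 by rewrite mulr1; congr (_ / _); ring.
apply: ler_pM; rewrite ?mulr_ge0 ?invr_ge0//; try lra.
apply: ler_pM; rewrite ?mulr_ge0 ?invr_ge0//; try lra.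
by rewrite lef_pV2.
Qed.

Lemma lncmod_oneB t r : 0 < r < 1 ->
  ln (cmod (1 - (r%:C)%C * expi t)) * 2 = ln (1 - 2 * r * cos (2 * pi * t) + r ^+ 2).
Proof.
move=> r01; rewrite -cmod_oneB_sqr lnXn ?mulr_natr//.
rewrite cmod_gt0; apply/eqP => h; have := cmod_oneB_sqr r t.
rewrite h cmod0 expr0n /= => h2; have := @quad_ge t r ltac:(lra).
have : 0 < (1 - r) ^+ 2 by rewrite exprn_gt0; lra.
lra.
Qed.

(* Fourier side: the geometric sums of the first J modes are bounded uniformly in n,
   the remaining modes contribute O(r^J) per point. *)
Lemma orbit_log_mean (kappa : nat) tau r eps : 0 < tau -> 0 < r < 1 -> 0 < eps ->
  exists (C : R) (J : nat), 0 <= C /\ forall beta M, (J < M)%N -> dioph_upto kappa tau beta M ->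
  forall n x, `|\sum_(i < n) ln (cmod (1 - (r%:C)%C * expi (x + i%:R * beta)))| <= eps * n%:R + C.
Proof.
move=> t0 r01 e0; have /andP[r0 r1] := r01.
have q0 : 0 < (1 - r) ^+ 2 by rewrite exprn_gt0; lra.
have [J hJ] : exists J : nat, r ^+ J < eps * (1 - r) ^+ 2 / 2.
  apply: exists_expr_lt; first lra.
  by apply: divr_gt0 => //; apply: mulr_gt0.
exists (\sum_(j < J) 2 * j.+1%:R ^+ kappa / tau), J; split.
  by apply: sumr_ge0 => j _; rewrite divr_ge0 ?mulr_ge0 ?exprn_ge0//; lra.
move=> beta M JM dc n x.
have -> : \sum_(i < n) ln (cmod (1 - (r%:C)%C * expi (x + i%:R * beta))) =
  \sum_(i < n) (logtail J (x + i%:R * beta) r / 2) -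
  \sum_(j < J) (r ^+ j.+1 / j.+1%:R) * \sum_(i < n) cos (2 * pi * (j.+1%:R * (x + i%:R * beta))).
  under [in X in _ = _ - X]eq_bigr do rewrite mulr_sumr.
  rewrite exchange_big /= -sumrB; apply: eq_bigr => i _.
  rewrite /logtail -lncmod_oneB// mulrDl mulfK// mulr_suml -addrA -sumrB big1 ?addr0// => j _.
  have : (j.+1%:R : R) != 0 by rewrite pnatr_eq0.
  by move: (j.+1%:R : R) => w w0; field.
apply: (le_trans (ler_normB _ _)); apply: lerD.
  apply: (le_trans (ler_norm_sum _ _ _)).
  have -> : eps * n%:R = \sum_(i < n) eps by rewrite sumr_const card_ord mulr_natr.
  apply: ler_sum => i _; rewrite normrM normfV (@ger0_norm _ 2)// ler_pdivrMr//.
  apply: (le_trans (logtail_le _ _ r01)); rewrite ler_pdivrMr//; lra.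
apply: (le_trans (ler_norm_sum _ _ _)); apply: ler_sum => j _.
have jd : tau / j.+1%:R ^+ kappa <= chord (j.+1%:R * beta) by apply: dc; rewrite /=; have := ltn_ord j; lia.
have j0 : 0 < j.+1%:R ^+ kappa :> R by rewrite exprn_gt0// ltr0Sn.
have d0 : 0 < chord (j.+1%:R * beta) by apply: lt_le_trans jd; rewrite divr_gt0.
rewrite normrM -[leRHS]mul1r; apply: ler_pM => //.
  rewrite ger0_norm ?divr_ge0 ?exprn_ge0//; last lra.
  rewrite ler_pdivrMr// mul1r; have : r ^+ j.+1 <= 1 by apply: exprn_ile1; lra.
  by move/le_trans; apply; rewrite ler1n.
apply: (le_trans (geom_cos _ _ d0)); rewrite -mulrA ler_pM2l//.
by rewrite -[_ / tau]invf_div lef_pV2// posrE divr_gt0.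
Qed.

End Orbit.

(** * Continuants and their reflection symmetry *)

Section Continuant.
Variable F : comNzRingType.
Implicit Types (c u : nat -> F).

(* [continuant c m] is the determinant of the tridiagonal matrix of size [m] with diagonal [c] and
   off-diagonal entries 1; with [c i = E - V (n + i)] these are the determinants of boxes of [E - H]. *)
Fixpoint continuant c (m : nat) : F :=
  match m with
  | 0 => 1
  | m1.+1 => match m1 with 0 => c 0%N | m2.+1 => c m1 * continuant c m1 - continuant c m2 end
  end.

Definition sh c (s : nat) : nat -> F := fun i => c (i + s)%N.

Lemma continuant0 c : continuant c 0 = 1. Proof. by []. Qed.
Lemma continuant1 c : continuant c 1 = c 0%N. Proof. by []. Qed.
Lemma continuantSS c m : continuant c m.+2 = c m.+1 * continuant c m.+1 - continuant c m. Proof. by []. Qed.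

Arguments continuant : simpl never.

Lemma nat_ind2 (P : nat -> Prop) :
  P 0%N -> P 1%N -> (forall n, P n -> P n.+1 -> P n.+2) -> forall n, P n.
Proof.
move=> h0 h1 h n; suff : P n /\ P n.+1 by case.
by elim: n => [//|n [h2 h3]]; split=> //; exact: h.
Qed.

Lemma eq_continuant c c' m : (forall i, (i < m)%N -> c i = c' i) -> continuant c m = continuant c' m.
Proof.
elim/nat_ind2: m => [//|h|m IH0 IH1 h]; first by rewrite !continuant1 h.
rewrite !continuantSS IH0 ?IH1 ?h// => i im; apply: h; first exact: ltnW.
by rewrite ltnW// ltnS ltnW.
Qed.

Lemma continuantSSl c m : continuant c m.+2 = c 0%N * continuant (sh c 1) m.+1 - continuant (sh c 2) m.
Proof.
elim/nat_ind2: m => [||m IH0 IH1].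
- by rewrite continuantSS !continuant1 /sh /= mulrC.
- by rewrite !continuantSS !continuant1 !continuant0 /sh /=; ring.
- rewrite continuantSS IH1 IH0 [continuant (sh c 1) m.+3]continuantSS [continuant (sh c 2) m.+2]continuantSS.
  have -> : sh c 1 m.+2 = c m.+3 by rewrite /sh addn1.
  have -> : sh c 2 m.+1 = c m.+3 by rewrite /sh addn2.
  ring.
Qed.

Lemma continuant_rev c m : continuant (fun i => c (m.-1 - i)%N) m = continuant c m.
Proof.
elim/nat_ind2: m c => [//|//|m IH0 IH1 c].
rewrite continuantSS [RHS]continuantSSl /= subnn; congr (_ * _ - _).
  rewrite -[RHS]IH1; apply: eq_continuant => i im; rewrite /sh; congr c; lia.
rewrite -[RHS]IH0; apply: eq_continuant => i im; rewrite /sh; congr c; lia.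
Qed.

Lemma continuantD c m n : continuant c (m.+1 + n.+1) =
  continuant c m.+1 * continuant (sh c m.+1) n.+1 - continuant c m * continuant (sh c m.+2) n.
Proof.
elim/nat_ind2: n => [||n IH0 IH1].
- by rewrite addn1 continuantSS continuant1 continuant0 /sh add0n; ring.
- rewrite addn2 continuantSS [continuant c m.+2]continuantSS !continuantSS !continuant1 !continuant0 /sh !add0n !add1n; ring.
- rewrite !addnS continuantSS -!addnS IH1 IH0 [continuant (sh c m.+1) n.+3]continuantSS [continuant (sh c m.+2) n.+2]continuantSS.
  have -> : c (m.+1 + n.+2)%N = sh c m.+1 n.+2 by rewrite /sh addnC.
  have -> : sh c m.+2 n.+1 = sh c m.+1 n.+2 by rewrite /sh; congr c; lia.
  ring.
Qed.

Lemma continuant_sol c u m : (forall i, (i <= m)%N -> u i.+2 = c i * u i.+1 - u i) ->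
  u m.+2 = continuant c m.+1 * u 1%N - continuant (sh c 1) m * u 0%N.
Proof.
elim/nat_ind2: m => [|| m IH0 IH1] h.
- by rewrite h// continuant1 continuant0 mul1r.
- by rewrite h// h// !continuantSS !continuant1 !continuant0 /sh add0n; ring.
- rewrite h// IH1; last by move=> i im; apply: h; lia.
  rewrite IH0; last by move=> i im; apply: h; lia.
  rewrite [continuant c m.+3]continuantSS [continuant (sh c 1) m.+2]continuantSS.
  have -> : sh c 1 m.+1 = c m.+2 by rewrite /sh addn1.
  ring.
Qed.

Lemma continuant_det c m :
  continuant c m.+2 * continuant (sh c 1) m - continuant c m.+1 * continuant (sh c 1) m.+1 = -1.
Proof.
elim: m => [|m IH]; first by rewrite continuantSS !continuant1 !continuant0 /sh add0n; ring.
rewrite continuantSS [continuant (sh c 1) m.+2]continuantSS -IH.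
have -> : sh c 1 m.+1 = c m.+2 by rewrite /sh addn1.
ring.
Qed.

(** Cramer's rule for the Dirichlet problem on the box with boundary values [u 0] and [u m.+1]. *)
Lemma continuant_green c u m n : (n < m)%N ->
  (forall i, (i < m)%N -> u i.+2 = c i * u i.+1 - u i) ->
  continuant c m * u n.+1 = continuant (sh c n.+1) (m - n.+1) * u 0%N + continuant c n * u m.+1.
Proof.
move=> nm h; set k := (m - n.+1)%N; have mE : m = (k + n.+1)%N by rewrite /k; lia.
rewrite mE in h *; clearbody k; clear mE nm m.
(* The case where the point is the last site of the box; the induction on [k] then extends the box
   to the right. *)
have D : forall j, (j <= n)%N -> continuant c j.+1 * u j.+1 = u 0%N + continuant c j * u j.+2.
  elim=> [_|j IH jn].
    rewrite continuant1 continuant0 h; [ring|lia].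
  have := IH (ltnW jn); rewrite continuantSS (h j.+1); last lia.
  rewrite [u j.+2]h; last lia.
  move=> /(congr1 (fun a => a - continuant c j * (c j * u j.+1 - u j))); rewrite addrK => <-; ring.
elim/nat_ind2: k h => [||k IH0 IH1] h.
- by rewrite continuant0 mul1r D.
- rewrite add1n continuantSS continuant1 (h n.+1); last lia.
  have := D n (leqnn _) => /(congr1 (fun a => a - continuant c n * u n.+2)); rewrite addrK => <-.
  by rewrite /sh add0n; ring.
- have e1 := IH1 (fun i hi => h i ltac:(lia)); have e0 := IH0 (fun i hi => h i ltac:(lia)).
  rewrite !addSn continuantSS mulrBl -mulrA -addSn e1 e0 [continuant (sh c n.+1) k.+2]continuantSS.
  rewrite addnS [u (k + n).+4]h; last lia.
  have -> : sh c n.+1 k.+1 = c (k + n).+2 by rewrite /sh; congr c; lia.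
  by rewrite ?addSn ?addnS; ring.
Qed.

End Continuant.

(** * Box determinants of the almost Mathieu operator as polynomials *)

Section Potential.
Variable R : realType.
Implicit Types (lam beta : R) (E z : R[i]).

Lemma continuant_bound (c : nat -> R[i]) (A : R) m :
  (forall i, (i < m)%N -> cmod (c i) + 1 <= A) -> cmod (continuant c m) <= A ^+ m.
Proof.
have [->|m0] := posnP m; first by rewrite continuant0 cmod1 expr0.
move=> h; have A1 : 1 <= A by apply: le_trans (h _ m0); rewrite lerDr cmod_ge0.
elim/nat_ind2: m h {m0} => [|h|m IH0 IH1 h]; first by rewrite cmod1 expr0.
  by rewrite continuant1 expr1; apply: le_trans (h 0%N isT); rewrite lerDl.
rewrite continuantSS; apply: (le_trans (cmodB _ _)); rewrite cmodM.
have {}IH0 := IH0 (fun i hi => h i ltac:(lia)).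
have {}IH1 := IH1 (fun i hi => h i ltac:(lia)).
have hm := h m.+1 (leqnn _).
have : cmod (c m.+1) * cmod (continuant c m.+1) <= (A - 1) * A ^+ m.+1.
  by apply: ler_pM; rewrite ?cmod_ge0// lerBrDr.
have : A ^+ m <= A ^+ m.+1 by rewrite ler_weXn2l.
have -> : A ^+ m.+2 = (A - 1) * A ^+ m.+1 + A ^+ m.+1 by rewrite [A ^+ m.+2]exprS; ring.
lra.
Qed.

(** The phase enters through a free complex z, equal to [expi theta] for the operator itself, so
    that determinants can also be studied off the unit circle. *)
Definition site_coef lam E beta z (i : nat) : R[i] :=
  E - (lam%:C)%C * (z * expi (i%:R * beta) + (z * expi (i%:R * beta))^-1).

Lemma sh_site_coef lam E beta z s :
  sh (site_coef lam E beta z) s = site_coef lam E beta (z * expi (s%:R * beta)).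
Proof.
apply/funext => i; rewrite /sh /site_coef; suff -> : z * expi ((i + s)%:R * beta) =
  z * expi (s%:R * beta) * expi (i%:R * beta) by [].
by rewrite natrD addrC mulrDl expiD mulrA.
Qed.

(** Only the product of all diagonal entries reaches the powers z^m and z^-m, which gives the
    modulus of the two extreme coefficients. *)
Lemma continuant_laurent lam E beta m : exists F : {poly R[i]},
  [/\ forall i, (m.*2 < i)%N -> F`_i = 0, cmod F`_0 = `|lam| ^+ m,
      cmod F`_(m.*2) = `|lam| ^+ m &
      forall z, z != 0 -> z ^+ m * continuant (site_coef lam E beta z) m = F.[z]].
Proof.
pose w i : {poly R[i]} := E *: 'X - ((lam%:C)%C * expi (i%:R * beta)) *: 'X^2
   - ((lam%:C)%C * expi (- (i%:R * beta)))%:P.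
have wE i z : z != 0 -> z * site_coef lam E beta z i = (w i).[z].
  move=> z0; rewrite /w /site_coef !hornerE /= expiN; field.
  by rewrite expi_neq0 z0.
have e1 t : cmod (- ((lam%:C)%C * expi t)) = `|lam| by rewrite cmodN cmodM cmodR cmod_expi mulr1.
have w0 i : (w i)`_0 = - ((lam%:C)%C * expi (- (i%:R * beta))).
  by rewrite /w !coefB !coefZ coefX coefXn coefC /=; ring.
have w1 i : (w i)`_1 = E by rewrite /w !coefB !coefZ coefX coefXn coefC /=; ring.
have w2 i : (w i)`_2 = - ((lam%:C)%C * expi (i%:R * beta)).
  by rewrite /w !coefB !coefZ coefX coefXn coefC /=; ring.
have w3 i j : (w i)`_j.+3 = 0 by rewrite /w !coefB !coefZ coefX coefXn coefC /=; ring.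
elim/nat_ind2: m => [||m].
- exists 1; split => [i i0|||z z0]; rewrite ?coef1 ?eqxx ?cmod1//.
    by rewrite (gtn_eqF i0).
  by rewrite expr0 continuant0 mul1r hornerE.
- exists (w 0%N); split => [i i2|||z z0]; last by rewrite -wE.
  + by case: i i2 => [|[|[|i]]].
  + by rewrite w0 e1 expr1.
  + by rewrite w2 e1 expr1.
- move=> [F0 [h00 h01 h02 h03]] [F1 [h10 h11 h12 h13]].
  exists (w m.+1 * F1 - 'X^2 * F0).
  have cw i : (w m.+1 * F1)`_i.+2 = E * F1`_i.+1
     - (lam%:C)%C * expi (m.+1%:R * beta) * F1`_i - (lam%:C)%C * expi (- (m.+1%:R * beta)) * F1`_i.+2.
    rewrite {1}/w !mulrBl !coefB -!scalerAl !coefZ coefXM coefXnM /= coefCM.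
    by rewrite subn2 /=; ring.
  split=> [i im|||z z0].
  + case: i im => [|[|i]]//; rewrite doubleS !ltnS => im.
    rewrite coefB cw coefXnM /= subn2 /= !h10 ?h00; try (by rewrite ?doubleS; lia).
    by rewrite !mulr0 !subr0.
  + by rewrite coefB coefXnM /= subr0 coef0M cmodM w0 e1 h11 -exprS.
  + rewrite doubleS coefB cw coefXnM /= subn2 /=.
    rewrite [F1`_m.+1.*2.+1]h10// [F1`_m.+1.*2.+2]h10// h00; last by rewrite doubleS; lia.
    by rewrite !mulr0 !subr0 sub0r -mulNr cmodM e1 h12 -exprS.
  + rewrite hornerD hornerN hornerM [('X^2 * _).[_]]hornerM hornerXn -h13// -h03// -wE// continuantSS !exprS; ring.
Qed.

(* Any Laurent polynomial in z is S(y) + z T(y) with y = z + 1/z; the continuant of a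
   reflection symmetric box is invariant under z -> 1/z, which kills T. *)
Lemma continuant_split lam E (v : nat -> R[i]) m : (forall i, v i != 0) ->
  exists S T : {poly R[i]},
  [/\ forall i, (m < i)%N -> S`_i = 0, forall i, (m <= i)%N -> T`_i = 0,
      S`_m = \prod_(i < m) (- ((lam%:C)%C / v i)) &
      forall z, z != 0 -> continuant (fun i => E - (lam%:C)%C * (z * v i + (z * v i)^-1)) m =
        S.[z + z^-1] + z * T.[z + z^-1]].
Proof.
move=> v0; set l := (lam%:C)%C.
(* The entry is A(y) + z B. As z^2 = y z - 1, it sends S + z T to (A S - B T) + z (B S + D T) with D
   = A + B y. *)
pose A i : {poly R[i]} := E%:P - (l / v i) *: 'X.
pose B i : R[i] := - l * (v i - (v i)^-1).
pose D i : {poly R[i]} := E%:P - (l * v i) *: 'X.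
have AE i z : z != 0 -> E - l * (z * v i + (z * v i)^-1) = (A i).[z + z^-1] + z * B i.
  by move=> z0; rewrite /A /B hornerD hornerN hornerZ hornerC hornerX; field; rewrite v0 z0.
have BE i z : z != 0 -> (A i).[z + z^-1] + B i * (z + z^-1) = (D i).[z + z^-1].
  by move=> z0; rewrite /A /B /D !(hornerD, hornerN, hornerZ, hornerC, hornerX); field; rewrite v0 z0.
have cA i (P : {poly R[i]}) j : (A i * P)`_j.+1 = E * P`_j.+1 - l / v i * P`_j.
  by rewrite /A mulrBl coefB coefCM -scalerAl coefZ coefXM.
have cD i (P : {poly R[i]}) j : (D i * P)`_j.+1 = E * P`_j.+1 - l * v i * P`_j.
  by rewrite /D mulrBl coefB coefCM -scalerAl coefZ coefXM.
elim/nat_ind2: m => [||m].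
- exists 1, 0; split => [i i0|i i0||z z0].
  + by rewrite coef1 (gtn_eqF i0).
  + by rewrite coef0.
  + by rewrite coef1 big_ord0.
  + by rewrite continuant0 -polyC1 hornerC horner0 mulr0 addr0.
- exists (A 0%N), (B 0%N)%:P; split => [[|[|i]]// _|[|i]// _||z z0].
  + by rewrite /A coefB coefC coefZ coefX /= mulr0 subr0.
  + by rewrite coefC.
  + by rewrite big_ord1 /A coefB coefC coefZ coefX /= mulr1 sub0r.
  + by rewrite continuant1 AE// hornerC.
- clearbody A B D; move=> [S0 [T0 [s00 t00 l0 e0]]] [S1 [T1 [s10 t10 l1 e1]]].
  exists (A m.+1 * S1 - B m.+1 *: T1 - S0), (B m.+1 *: S1 + D m.+1 * T1 - T0).
  split => [[|i]// im|[|i]// im||z z0].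
  + rewrite !coefB cA coefZ s10; last lia.
    rewrite s10; last lia.
    rewrite t10; last lia.
    by rewrite s00; [ring|lia].
  + rewrite coefB coefD coefZ cD s10; last lia.
    rewrite t10; last lia.
    rewrite t10; last lia.
    by rewrite t00; [ring|lia].
  + rewrite !coefB cA coefZ s10; last lia.
    rewrite t10; last lia.
    rewrite s00; last lia.
    by rewrite big_ord_recr /= l1; ring.
  + rewrite continuantSS e1// e0// AE// !(hornerD, hornerN) !hornerZ !hornerM.
    rewrite -BE//; set y := z + z^-1.
    have : z * z = y * z - 1 by rewrite /y; field.
    set a := (A _).[y]; set b := B _; set s1 := S1.[y]; set t1 := T1.[y] => zz.
    have -> : (a + z * b) * (s1 + z * t1) = a * s1 + z * (b * s1 + a * t1) + b * t1 * (z * z) by ring.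
    by rewrite zz; ring.
Qed.

Definition joukowski z : R[i] := z + z^-1.

Lemma joukowskiB z w : z != 0 -> w != 0 ->
  joukowski z - joukowski w = (z - w) * (1 - (z * w)^-1).
Proof. by move=> z0 w0; rewrite /joukowski; field; rewrite z0 w0. Qed.

Lemma continuant_sym_poly lam E (v : nat -> R[i]) m : (forall i, v i != 0) ->
  (forall i, (i < m)%N -> v (m.-1 - i)%N = (v i)^-1) -> (forall i, cmod (v i) = 1) ->
  exists Q : {poly R[i]}, [/\ forall i, (m < i)%N -> Q`_i = 0,
    cmod Q`_m = `|lam| ^+ m &
    forall z, z != 0 -> continuant (fun i => E - (lam%:C)%C * (z * v i + (z * v i)^-1)) m = Q.[z + z^-1]].
Proof.
move=> v0 vs v1; have [S [T [s0 t0 sm e]]] := continuant_split lam E m v0.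
exists S; split => //.
  rewrite sm cmod_prod; under eq_bigr do rewrite cmodN cmodM cmodR cmodV v1 invr1 mulr1.
  by rewrite prodr_const card_ord.
have h z : z != 0 -> (z - z^-1) * T.[z + z^-1] = 0.
  move=> z0; have := e _ z0; rewrite -continuant_rev.
  rewrite (@eq_continuant _ _ (fun i => E - (lam%:C)%C * (z^-1 * v i + (z^-1 * v i)^-1))); last first.
    move=> i im; rewrite vs//; congr (_ - _ * _).
    by rewrite [RHS]addrC invfM invrK [in RHS]invfM invrK.
  rewrite e ?invr_eq0// invrK [z^-1 + z]addrC => /eqP.
  by rewrite (inj_eq (addrI _)) eq_sym -subr_eq0 -mulrBl => /eqP.
have T0 : T = 0.
  apply/eqP/negPn/negP => Tn0.
  (* The points 2, 3, 4, ... have distinct images under z + 1/z and satisfy z <> 1/z, so T would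
     have more roots than its degree allows. *)
  pose y (i : nat) := joukowski (i.+2%:R : R[i]).
  have y0 i : (i.+2%:R : R[i]) != 0 by rewrite pnatr_eq0.
  have yi : injective y.
    move=> i j; rewrite /y => /eqP; rewrite -subr_eq0 joukowskiB//.
    rewrite mulf_eq0 !subr_eq0 => /orP[|].
      by rewrite eqr_nat => /eqP [].
    rewrite -natrM eq_sym invr_eq1 pnatr_eq1 muln_eq1; lia.
  have := @max_poly_roots _ T [seq y i | i <- iota 0 (size T)] Tn0.
  rewrite size_map size_iota ltnn map_inj_uniq// iota_uniq => /(_ _ isT); apply/implyP.
  apply/allP => _ /mapP[i _ ->]; rewrite /root.
  have := h _ (y0 i) => /eqP; rewrite mulf_eq0 => /orP[|//].
  rewrite subr_eq0 -(inj_eq (mulfI (y0 i))) divff// -natrM pnatr_eq1 muln_eq1; lia.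
by move=> z z0; rewrite e// T0 horner0 mulr0 addr0.
Qed.

Lemma continuant_poly lam E beta m : exists Q : {poly R[i]}, [/\ forall i, (m < i)%N -> Q`_i = 0,
    cmod Q`_m = `|lam| ^+ m &
    forall z, z != 0 -> continuant (site_coef lam E beta z) m =
      Q.[joukowski (z * expi ((m%:R - 1) / 2 * beta))]].
Proof.
(* Phases measured from the centre of the box, so that reflecting the box inverts [v]. *)
pose v i := expi ((i%:R - (m%:R - 1) / 2) * beta).
have v0 i : v i != 0 by exact: expi_neq0.
have [||Q [q0 qm e]] := @continuant_sym_poly lam E v m v0.
- move=> i im; rewrite /v -expiN natrB; last lia.
  have -> : m = m.-1.+1 by lia.
  by rewrite /= -natr1; congr expi; field.
- by move=> i; exact: cmod_expi.
exists Q; split => // z z0; rewrite /joukowski -e ?mulf_neq0 ?expi_neq0//.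
apply: eq_continuant => i im; rewrite /site_coef -mulrA -expiD.
by have -> : (m%:R - 1) / 2 * beta + (i%:R - (m%:R - 1) / 2) * beta = i%:R * beta by ring.
Qed.

End Potential.

(** * Lower bounds for products of distances along an orbit *)

Section Products.
Variable R : realType.
Implicit Types (r t x beta tau eps : R).

Definition orb x beta (i : nat) : R := chord (x + i%:R * beta).

Lemma orb_sub kappa tau beta M x (i j : nat) : dioph_upto kappa tau beta M -> (i < j)%N -> (j - i < M)%N ->
  tau / (j - i)%:R ^+ kappa <= orb x beta i + orb x beta j.
Proof.
move=> dc ij jM; have := dc (j - i)%N; rewrite subn_gt0 ij jM => /(_ isT) /le_trans; apply.
have -> : (j - i)%:R * beta = (x + j%:R * beta) - (x + i%:R * beta) by rewrite (natrB _ (ltnW ij)); ring.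
by rewrite [leRHS]addrC; exact: chordB.
Qed.

(** With t = |S|, two of the t + 1 indices in S and i0 share one of t blocks. Their difference is at
    most n/t, so by the Diophantine condition the two distances add up to at least tau (t/n)^kappa.
    As i0 is the minimiser, half of this is reached inside S. *)
Lemma near_pigeon kappa tau beta M x n (i0 : 'I_n) (S : {set 'I_n}) :
  0 < tau -> dioph_upto kappa tau beta M -> (n <= M)%N -> (forall i : 'I_n, orb x beta i0 <= orb x beta i) ->
  i0 \notin S -> (0 < #|S|)%N ->
  exists2 i, i \in S & tau / 2 * (#|S|%:R / n%:R) ^+ kappa <= orb x beta i.
Proof.
move=> t0 dc nM mi i0S S0; set t := #|S| in S0 *.
have n0 : (0 < n)%N by case: n i0 {S mi i0S t S0 nM} => [[]|].
(* The block length for which t blocks cover n indices and two indices of a block differ by at most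
   (n - 1)/t. *)
pose w := (n.-1 %/ t).+1.
have blk (i : 'I_n) : (i %/ w < t)%N.
  rewrite ltn_divLR//; apply: (@leq_trans n) => //.
  rewrite /w mulnS {1}(_ : n = n.-1.+1); last lia.
  have := divn_eq n.-1 t; have := ltn_pmod n.-1 S0; move: (_ %/ _)%N (_ %% _)%N => a b; nia.
pose f (i : 'I_n) := Ordinal (blk i).
have : ~~ [forall i in i0 |: S, [forall j in i0 |: S, (f i == f j) ==> (i == j)]].
  apply/negP => /forall_inP h.
  have fi : {in i0 |: S &, injective f}.
    move=> i j iS jS /eqP fij; have /forall_inP/(_ j jS)/implyP := h i iS.
    by move=> /(_ fij)/eqP.
  have := max_card (f @: (i0 |: S)); rewrite card_in_imset// cardsU1 i0S card_ord -/t; lia.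
move=> /forall_inPn[i iS /forall_inPn[j jS]]; rewrite negb_imply => /andP[/eqP [fij] ij].
wlog lij : i j iS jS fij ij / (i < j)%N => [hw|].
  have [lt|lt|e] := ltngtP i j; first exact: (hw i j).
    by apply: (hw j i) => //; rewrite eq_sym.
  by move: ij; rewrite -val_eqE /= e eqxx.
have dlt : (j - i < w)%N.
  have := divn_eq i w; have := divn_eq j w; rewrite fij; have := @ltn_pmod j w isT; lia.
have dt : ((j - i) * t <= n)%N.
  have : (j - i <= n.-1 %/ t)%N by move: dlt; rewrite /w; lia.
  have := leq_divM n.-1 t; nia.
have jM : (j - i < M)%N by have := ltn_ord j; lia.
have := orb_sub x dc lij jM.
have d0 : 0 < (j - i)%:R :> R by rewrite ltr0n subn_gt0.
have hk : tau * (t%:R / n%:R) ^+ kappa <= tau / (j - i)%:R ^+ kappa.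
  rewrite ler_pM2l// -exprVn lerXn2r ?nnegrE ?divr_ge0 ?invr_ge0 ?ler0n//.
  rewrite ler_pdivrMr ?ltr0n// mulrC ler_pdivlMr// -natrM ler_nat mulnC; lia.
move=> hs; have {hk}hs := le_trans hk hs.
have [iin|] := boolP (i \in S); have [jin|] := boolP (j \in S).
- have [h|h] := leP (tau / 2 * (t%:R / n%:R) ^+ kappa) (orb x beta i); first by exists i.
  by exists j => //; move: h hs; set p := _ ^+ kappa; lra.
- move=> jn; exists i => //.
  have je : j = i0 by apply/eqP; move: jS; rewrite in_setU1 (negPf jn) orbF.
  by have := mi i; rewrite -je; move: hs; set p := _ ^+ kappa; lra.
- move=> in_; exists j => //.
  have ie : i = i0 by apply/eqP; move: iS; rewrite in_setU1 (negPf in_) orbF.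
  by have := mi j; rewrite -ie; move: hs; set p := _ ^+ kappa; lra.
- move=> jn in_; move: iS jS; rewrite !in_setU1 (negPf jn) (negPf in_) !orbF => /eqP e1 /eqP e2.
  by move: ij; rewrite e1 e2 eqxx.
Qed.

(** Peel off the point found by [near_pigeon] and recurse; the factors t/n for t = |S|, ..., 1
    multiply to the factorial. *)
Lemma near_prod kappa tau beta M x n (i0 : 'I_n) (S : {set 'I_n}) :
  0 < tau -> dioph_upto kappa tau beta M -> (n <= M)%N -> (forall i : 'I_n, orb x beta i0 <= orb x beta i) ->
  i0 \notin S ->
  (tau / 2) ^+ #|S| * ((#|S|)`!%:R / n%:R ^+ #|S|) ^+ kappa <= \prod_(i in S) orb x beta i.
Proof.
move=> t0 dc nM mi.
have [t] := ubnP #|S|; elim: t S => // t IH S St i0S.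
have [S0|S0] := posnP #|S|.
  by rewrite S0 fact0 !expr0 divr1 expr1n mulr1 (eqP (_ : S == finset.set0)) ?big_set0// -cards_eq0 S0.
have [i iS hi] := near_pigeon t0 dc nM mi i0S S0.
have cS : #|S| = #|S :\ i|.+1 by rewrite (cardsD1 i S) iS.
rewrite (big_setD1 i)//=.
have := IH (S :\ i); rewrite in_setD1 (negPf i0S) andbF => /(_ _ isT).
rewrite -ltnS -cS => /(_ St).
set p := \prod_(_ in _) _; set m := #|S :\ i| => hp.
have -> : (tau / 2) ^+ #|S| * ((#|S|)`!%:R / n%:R ^+ #|S|) ^+ kappa =
  (tau / 2 * (#|S|%:R / n%:R) ^+ kappa) * ((tau / 2) ^+ m * (m`!%:R / n%:R ^+ m) ^+ kappa).
  rewrite cS -/m factS natrM [_ ^+ m.+1]exprS [n%:R ^+ m.+1]exprS mulrACA -!exprMn mulf_div.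
  by [].
by apply: ler_pM => //; rewrite mulr_ge0 ?exprn_ge0 ?divr_ge0 ?exprn_ge0//; lra.
Qed.


Lemma lnX_natl (a : R) n : 0 < a -> ln (a ^+ n) = n%:R * ln a.
Proof. by move=> a0; rewrite lnXn// mulr_natl. Qed.

Lemma ln_fact_ge (T : nat) : T%:R * ln T%:R - T%:R <= ln (T`!%:R) :> R.
Proof.
case: T => [|T]; first by rewrite mul0r subr0 fact0 ln1.
have T0 : 0 < T.+1%:R :> R by rewrite ltr0n.
have f0 : 0 < (T.+1)`!%:R :> R by rewrite ltr0n fact_gt0.
have := expR_ge1Dxn T (ltW T0) => h.
have {h} : T.+1%:R ^+ T.+1 / (T.+1)`!%:R <= expR T.+1%:R :> R by apply: le_trans h; rewrite lerDr.
rewrite -ler_ln ?posrE ?expR_gt0 ?divr_gt0 ?exprn_gt0// expRK.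
by rewrite ln_div ?posrE ?exprn_gt0// lnX_natl//; lra.
Qed.

(** By Stirling the T near points lose about T ln(n/T), which is only of order mu n as long as T <=
    mu^2 n. *)
Lemma near_log (T n kappa : nat) tau mu (S : R) : 0 < mu -> mu <= 1 -> 0 < tau ->
  T%:R <= mu ^+ 2 * n%:R ->
  (tau / 2) ^+ T * (T`!%:R / n%:R ^+ T) ^+ kappa <= S ->
  - (n%:R * (mu * (`|ln (tau / 2)| + kappa%:R * 4))) <= ln S.
Proof.
move=> m0 m1 t0 Tn hS.
have mm : mu ^+ 2 <= mu by rewrite expr2 ler_piMl// ltW.
have n0 : 0 <= n%:R :> R by rewrite ler0n.
have [T0|T0] := posnP T.
  move: hS; rewrite T0 fact0 !expr0 divr1 expr1n mulr1 => S1.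
  apply: (@le_trans _ _ 0); last exact: ln_ge0.
  by rewrite oppr_le0 !mulr_ge0 ?addr_ge0 ?mulr_ge0// ltW.
have np : 0 < n%:R :> R.
  rewrite lt_neqAle n0 andbT eq_sym; apply/eqP => e; move: Tn; rewrite e mulr0 lern0; lia.
have Tp : 0 < T%:R :> R by rewrite ltr0n.
have fp : 0 < T`!%:R :> R by rewrite ltr0n fact_gt0.
have t20 : 0 < tau / 2 by rewrite divr_gt0.
have qp : 0 < T`!%:R / n%:R ^+ T :> R by rewrite divr_gt0 ?exprn_gt0.
have p0 : 0 < (tau / 2) ^+ T * (T`!%:R / n%:R ^+ T) ^+ kappa by rewrite mulr_gt0 ?exprn_gt0.
have {hS} : ln ((tau / 2) ^+ T * (T`!%:R / n%:R ^+ T) ^+ kappa) <= ln S.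
  by rewrite ler_ln ?posrE// (lt_le_trans p0).
rewrite lnM ?posrE ?exprn_gt0// !lnX_natl// [ln (_`!%:R / _)]ln_div ?posrE ?exprn_gt0// lnX_natl//.
move=> hS; apply: le_trans hS.
have h1 : - (n%:R * (mu * `|ln (tau / 2)|)) <= T%:R * ln (tau / 2).
  have : T%:R * - `|ln (tau / 2)| <= T%:R * ln (tau / 2) by rewrite ler_pM2l// lerNl ler_normr lexx orbT.
  have : T%:R * `|ln (tau / 2)| <= mu * n%:R * `|ln (tau / 2)|.
    by rewrite ler_wpM2r// (le_trans Tn)// ler_wpM2r.
  lra.
have h2 : - (n%:R * mu * 4) <= ln T`!%:R - T%:R * ln n%:R.
  have := ln_fact_ge T.
  (* Split n/T into (n/T) mu^2 and mu^-2 and use ln x < x on each part; after multiplication by T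
     both contribute O(mu n). *)
  have hl : ln n%:R - ln T%:R <= n%:R / T%:R * mu ^+ 2 + 2 / mu.
    have -> : ln n%:R - ln T%:R = ln (n%:R / T%:R * mu ^+ 2) + 2 * ln (mu^-1) :> R.
      rewrite lnM ?posrE ?divr_gt0 ?exprn_gt0// lnX_natl// lnV ?posrE// ln_div ?posrE//; ring.
    apply: lerD; first by rewrite ltW// ln_sublinear// mulr_gt0 ?divr_gt0 ?exprn_gt0.
    by rewrite ler_pM2l// ltW// ln_sublinear// invr_gt0.
  have {hl} : T%:R * (ln n%:R - ln T%:R) <= T%:R * (n%:R / T%:R * mu ^+ 2 + 2 / mu) by rewrite ler_pM2l.
  have -> : T%:R * (n%:R / T%:R * mu ^+ 2 + 2 / mu) = n%:R * mu ^+ 2 + 2 * (T%:R / mu) :> R.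
    by field; rewrite !gt_eqF.
  have : T%:R / mu <= mu * n%:R by rewrite ler_pdivrMr// mulrAC -expr2.
  have : n%:R * mu ^+ 2 <= n%:R * mu by rewrite ler_wpM2l.
  have : T%:R <= mu * n%:R by apply: (le_trans Tn); rewrite ler_wpM2r.
  lra.
have : kappa%:R * - (n%:R * mu * 4) <= kappa%:R * (ln T`!%:R - T%:R * ln n%:R) by rewrite ler_wpM2l.
lra.
Qed.

(** Replace |1 - e| by |1 - r e| with r close to 1, whose logarithms are averaged by
    [orbit_log_mean]. At far points the change is negligible; the near points are few, and
    [near_log] bounds their true product. *)
Lemma orbit_prod (kappa : nat) tau eps : 0 < tau -> 0 < eps ->
  exists (C : R) (M0 : nat), 0 <= C /\ forall beta M n x, (M0 <= M)%N -> dioph_upto kappa tau beta M ->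
  (0 < n <= M)%N -> exists i0 : 'I_n, (forall i : 'I_n, orb x beta i0 <= orb x beta i) /\
    expR (- (eps * n%:R + C)) <= \prod_(i < n | i != i0) orb x beta i.
Proof.
move=> t0 e0.
pose A : R := `|ln (tau / 2)| + kappa%:R * 4 + 1.
have A0 : 0 < A by rewrite ltr_wpDl// addr_ge0// mulr_ge0.
pose mu := Num.min (1 / 2) (eps / (2 * A)).
have mu0 : 0 < mu by rewrite lt_min; apply/andP; split; [lra|rewrite divr_gt0// mulr_gt0].
have mu1 : mu <= 1 / 2 by rewrite ge_min lexx.
have muA : mu * A <= eps / 2.
  have : mu <= eps / (2 * A) by rewrite ge_min lexx orbT.
  by rewrite -(ler_pM2r A0) => /le_trans; apply; rewrite le_eqVlt; apply/orP; left; apply/eqP; field; rewrite gt_eqF.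
have mm : mu ^+ 2 <= mu / 2 by rewrite expr2 ler_pM2l//; lra.
(* The threshold of nearness: among more than mu^2 n near points, [near_pigeon] would find one at
   distance at least s0. *)
pose s0 := Num.min (1 / 2) (tau / 2 * (mu ^+ 2) ^+ kappa).
have s00 : 0 < s0 by rewrite lt_min; apply/andP; split; [lra|rewrite mulr_gt0 ?divr_gt0 ?exprn_gt0].
have s01 : s0 <= 1 / 2 by rewrite ge_min lexx.
have s0t : s0 <= tau / 2 * (mu ^+ 2) ^+ kappa by rewrite ge_min lexx orbT.
(* At a far point d >= s0, hence eta <= mu d, and regularising changes d^2 by at most the factor 1 +
   mu^2. *)
pose eta := s0 * mu; have eta0 : 0 < eta by rewrite mulr_gt0.
have eta1 : eta <= 1 / 4.
  have -> : (1 / 4 : R) = 1 / 2 * (1 / 2) by field.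
  by apply: ler_pM => //; exact: ltW.
pose r := 1 - eta; have r01 : 0 < r < 1 by rewrite /r; apply/andP; split; lra.
have e20 : 0 < eps / 2 by rewrite divr_gt0.
have [C1 [J [C10 hJ]]] := orbit_log_mean kappa t0 r01 e20.
exists (C1 + 1), J.+1; split; first by rewrite addr_ge0.
move=> beta M n x JM dc /andP[n0 nM].
have [i0 mi] : exists i0 : 'I_n, forall i : 'I_n, orb x beta i0 <= orb x beta i.
  by have [i0 _ h] := @arg_minP _ _ _ (Ordinal n0) xpredT (fun i : 'I_n => orb x beta i) isT; exists i0 => i; exact: h.
exists i0; split => //.
pose d (i : 'I_n) := orb x beta i.
pose m (i : 'I_n) := cmod (1 - (r%:C)%C * expi (x + i%:R * beta)).
have np : 0 < n%:R :> R by rewrite ltr0n.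
have d0 i : i != i0 -> 0 < d i.
  move=> ii0; have := @near_pigeon kappa tau beta M x n i0 [set i]%SET t0 dc nM mi.
  rewrite finset.in_set1 eq_sym ii0 cards1 => /(_ isT isT)[j].
  rewrite finset.in_set1 => /eqP ->; apply: lt_le_trans.
  by rewrite mulr_gt0 ?divr_gt0 ?exprn_gt0 ?divr_gt0.
have m2 i : m i ^+ 2 = eta ^+ 2 + r * d i ^+ 2.
  by rewrite /m cmod_oneB_sqr_chord /r subKr.
have m0 i : 0 < m i.
  have : 0 < m i ^+ 2.
    rewrite m2; apply: ltr_pwDl; first by rewrite exprn_gt0.
    by rewrite mulr_ge0 ?sqr_ge0//; lra.
  by rewrite exprn_even_gt0//= lt_neqAle cmod_ge0 eq_sym => ->.
have md i : m i ^+ 2 <= eta ^+ 2 + d i ^+ 2.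
  by rewrite m2 lerD2l ler_piMl ?sqr_ge0//; lra.
pose S := [set i | (i != i0) && (d i < s0)]%SET.
have i0S : i0 \notin S by rewrite inE eqxx.
have TS : #|S|%:R <= mu ^+ 2 * n%:R.
  have [->|S0] := posnP #|S|; first by rewrite mulr_ge0// exprn_ge0// ltW.
  rewrite leNgt; apply/negP => lt.
  case: (near_pigeon t0 dc nM mi i0S S0) => i; rewrite inE => /andP[_ ds]; apply/negP; rewrite -ltNge.
  apply: (lt_le_trans ds); apply: (le_trans s0t); rewrite ler_pM2l ?divr_gt0//.
  have lt' := ltW lt.
  by apply: lerXn2r; rewrite ?nnegrE ?divr_ge0 ?ler0n ?sqr_ge0// ler_pdivlMr.
have mu1' : mu <= 1 by lra.
have hS := near_log mu0 mu1' t0 TS (near_prod t0 dc nM mi i0S).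
rewrite -(@lnK _ (\prod_(i < n | i != i0) orb x beta i)) ?posrE ?prodr_gt0// ler_expR.
have lnp (P : pred 'I_n) : (forall i, P i -> 0 < d i) -> ln (\prod_(i < n | P i) d i) = \sum_(i < n | P i) ln (d i).
  move=> hP; suff : 0 < \prod_(i < n | P i) d i /\ ln (\prod_(i < n | P i) d i) = \sum_(i < n | P i) ln (d i) by case.
  apply: (big_ind2 (fun a b => 0 < a /\ ln a = b)); first by rewrite ln1.
    by move=> a b a' b' [a0 <-] [b0 <-]; rewrite mulr_gt0// lnM ?posrE.
  by move=> i /hP.
rewrite lnp//; rewrite (lnp (fun i => i \in S)) in hS; last first.
  by move=> i; rewrite inE => /andP[/d0].
rewrite (bigID (fun i => i \in S)) /=.
have -> : \sum_(i < n | (i != i0) && (i \in S)) ln (d i) = \sum_(i in S) ln (d i).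
  by apply: eq_bigl => i; rewrite !inE andbA andbb.
have hm := hJ beta M JM dc n x; rewrite -/(m _) in hm.
have hm1 : - (eps / 2 * n%:R + C1) <= \sum_(i < n) ln (m i).
  by rewrite lerNl; apply: le_trans hm; rewrite -normrN ler_norm.
move: hm1; rewrite (bigD1 i0)//= (bigID (fun i => i \in S)) /= => hm1.
(* Near points have regularised modulus at most 1, so the lower bound on the whole sum passes to the
   far points. *)
have h2 : \sum_(i < n | (i != i0) && (i \in S)) ln (m i) <= 0.
  rewrite -oppr_ge0 -sumrN; apply: sumr_ge0 => i; rewrite inE => /and3P[_ _ ds].
  rewrite oppr_ge0 ln_le0// -(@expr_le1 _ 2)// ?cmod_ge0//.
  apply: (le_trans (md i)).
  have a1 : eta ^+ 2 <= 1 / 2 * (1 / 2) by rewrite expr2; apply: ler_pM; clear -eta0 eta1; lra.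
  have a2 : d i ^+ 2 <= 1 / 2 * (1 / 2) by rewrite expr2; apply: ler_pM; rewrite ?chord_ge0//; clear -ds s01; lra.
  by clear -a1 a2; lra.
have h3 : ln (m i0) <= 1.
  have : m i0 <= 2.
    apply: (le_trans (cmodB _ _)); rewrite cmod1 cmodM cmodR cmod_expi mulr1.
    by case/andP: (r01) => ra rb; rewrite ger0_norm; clear -ra rb; lra.
  have := @le_ln1Dx R (m i0 - 1); rewrite addrCA subrr addr0 => /(_ ltac:(have := m0 i0; lra)) hl ha; clear -hl ha; lra.
have h4 : \sum_(i < n | (i != i0) && (i \notin S)) ln (m i) - n%:R * mu / 2 <=
          \sum_(i < n | (i != i0) && (i \notin S)) ln (d i).
  rewrite lerBlDr -lerBlDl -sumrB.
  apply: (@le_trans _ _ (\sum_(i < n) mu / 2)); last by rewrite sumr_const card_ord -[leLHS]mulr_natl mulrA.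
  rewrite [leRHS](bigID (fun i => (i != i0) && (i \notin S))) /=.
  apply: (@le_trans _ _ (\sum_(i < n | (i != i0) && (i \notin S)) mu / 2)); last first.
    by rewrite lerDl sumr_ge0// => i _; rewrite divr_ge0// ltW.
  apply: ler_sum => i /andP[ii0]; rewrite inE ii0 /= -leNgt => ds.
  have di := d0 _ ii0.
  have : m i ^+ 2 <= d i ^+ 2 * (1 + mu ^+ 2).
    apply: (le_trans (md i)); rewrite mulrDr mulr1 addrC lerD2l /eta exprMn.
    rewrite ler_pM2r ?exprn_gt0//; apply: lerXn2r => //; rewrite nnegrE; exact: ltW.
  have mp : 0 < 1 + mu ^+ 2 by rewrite addr_gt0 ?exprn_gt0.
  rewrite -ler_ln ?posrE ?mulr_gt0 ?exprn_gt0// lnM ?posrE ?exprn_gt0// !lnX_natl//.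
  have := @le_ln1Dx R (mu ^+ 2) ltac:(have := sqr_ge0 mu; lra).
  lra.
have : n%:R * (mu * A) <= n%:R * (eps / 2) by rewrite ler_pM2l.
have : n%:R * mu >= 0 by rewrite mulr_ge0 ?ltW.
move: hS hm1 h2 h3 h4; rewrite /A.
set s1 := \sum_(_ in _) _; set s2 := \sum_(_ < _ | _) _; set s3 := \sum_(_ < _ | _) _; set s4 := \sum_(_ < _ | _) _.
lra.
Qed.

(* The excluded index j0 may differ from the minimiser i0: swapping the two factors
   costs only the lower bound eta for the minimal factor and a factor 2. *)
Lemma orbit_prod_except kappa tau eps : 0 < tau -> 0 < eps ->
  exists (C : R) (M0 : nat), 0 <= C /\ forall beta M n x, (M0 <= M)%N -> dioph_upto kappa tau beta M ->
  (n <= M)%N -> forall eta (j0 : 'I_n), 0 < eta <= 1 ->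
  (forall i : 'I_n, i != j0 -> eta <= orb x beta i) ->
  eta * expR (- (eps * n%:R + C)) <= \prod_(i < n | i != j0) orb x beta i.
Proof.
move=> t0 e0; have [C [M0 [C0 h]]] := orbit_prod kappa t0 e0.
exists (C + 1), M0; split; first by rewrite addr_ge0.
move=> beta M n x MM dc nM eta j0 /andP[eta0 eta1] hd.
have n0 : (0 < n)%N by case: n j0 {nM hd} => [[]|].
have := h beta M n x MM dc; rewrite n0 nM => /(_ isT)[i0 [mi hi]].
have -> : eta * expR (- (eps * n%:R + (C + 1))) = eta * expR (- 1) * expR (- (eps * n%:R + C)).
  by rewrite -mulrA -expRD; congr (_ * expR _); ring.
have e1 : expR (- 1) <= 1 / 2 :> R.
  rewrite expRN div1r lef_pV2 ?posrE ?expR_gt0//; have := expR_ge1Dx (1 : R); lra.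
have ex0 := expR_gt0 (- (eps * n%:R + C)).
have [e|ne] := eqVneq i0 j0.
  rewrite -e; apply: le_trans hi; rewrite ler_piMl ?ltW//.
  apply: (@le_lt_trans _ _ (1 * (1 / 2))); last lra.
  by apply: ler_pM; rewrite ?expR_ge0 ?(ltW eta0).
have di0 : eta <= orb x beta i0 by apply: hd.
have dj0 : 0 < orb x beta j0 by apply: lt_le_trans (mi j0); apply: lt_le_trans di0.
have p : \prod_(i < n | i != j0) orb x beta i * orb x beta j0 =
         \prod_(i < n | i != i0) orb x beta i * orb x beta i0.
  transitivity (\prod_(i < n) orb x beta i); first by rewrite [RHS](bigD1 j0)//= mulrC.
  by rewrite [LHS](bigD1 i0)//= mulrC.
have : eta * expR (- 1) * expR (- (eps * n%:R + C)) * 2 <= \prod_(i < n | i != j0) orb x beta i * orb x beta j0.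
  rewrite p mulrC mulrA [leRHS]mulrC mulrA.
  have q : 2 * eta * expR (- 1) <= orb x beta i0.
    have : eta * expR (- 1) <= eta * (1 / 2) by rewrite ler_pM2l.
    lra.
  by apply: ler_pM => //; rewrite ?mulr_ge0 ?expR_ge0 ?(ltW eta0).
have : \prod_(i < n | i != j0) orb x beta i * orb x beta j0 <= \prod_(i < n | i != j0) orb x beta i * 2.
  by rewrite ler_wpM2l ?prodr_ge0// => [i _|]; [exact: chord_ge0|exact: chord_le2].
lra.
Qed.

Lemma orbit_prod_all kappa tau eps : 0 < tau -> 0 < eps ->
  exists (C : R) (M0 : nat), 0 <= C /\ forall beta M n x, (M0 <= M)%N -> dioph_upto kappa tau beta M ->
  (n <= M)%N -> forall eta, 0 < eta <= 1 -> (forall i : 'I_n, eta <= orb x beta i) ->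
  eta * expR (- (eps * n%:R + C)) <= \prod_(i < n) orb x beta i.
Proof.
move=> t0 e0; have [C [M0 [C0 h]]] := orbit_prod kappa t0 e0.
exists C, M0; split => // beta M n x MM dc nM eta /andP[eta0 eta1] hd.
have [->|n0] := posnP n.
  by rewrite big_ord0 mulr0 add0r -[leRHS]mulr1; apply: ler_pM; rewrite ?expR_ge0 ?expR_le1 ?oppr_le0// ltW.
have := h beta M n x MM dc; rewrite n0 nM => /(_ isT)[i0 [mi hi]].
by rewrite (bigD1 i0)//=; apply: ler_pM => //; rewrite ?expR_ge0 ?(ltW eta0).
Qed.

End Products.

(** * Large box determinants *)

Section Lagrange.
Variables (F : fieldType) (T : finType) (y : T -> F).
Hypothesis yi : injective y.

Let W (a : T) : {poly F} := \prod_(b | b != a) ('X - (y b)%:P).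

Let size_W a : size (W a) = #|T|.
Proof.
rewrite /W -big_filter size_prod_XsubC size_filter -sum1_count.
by rewrite (sum1_card (predC1 a)) cardC1 prednK//; apply/card_gt0P; exists a.
Qed.

Let monic_W a : W a \is monic.
Proof. exact: monic_prod_XsubC. Qed.

Lemma lagrange_poly (p : {poly F}) : (size p <= #|T|)%N ->
  p = \sum_a (p.[y a] / \prod_(b | b != a) (y a - y b)) *: W a.
Proof.
move=> sp; apply/eqP; rewrite -subr_eq0; apply/negPn/negP => q0; move: q0.
set q := (p - _) => q0.
have sq : (size q <= #|T|)%N.
  rewrite /q (leq_trans (size_polyD _ _))// geq_max sp size_polyN.
  apply: (leq_trans (size_sum _ _ _)); apply/bigmax_leqP => a _.
  by apply: (leq_trans (size_scale_leq _ _)); rewrite size_W.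
have := @max_poly_roots _ q [seq y a | a <- enum T] q0.
rewrite size_map -cardE map_inj_uniq// enum_uniq => h.
have /h/(_ isT) : all (root q) [seq y a | a <- enum T]; last by move=> lt; have := leq_trans lt sq; rewrite ltnn.
apply/allP => _ /mapP[c _ ->]; rewrite /root /q hornerD hornerN horner_sum (bigD1 c)//=.
rewrite [X in - (_ + X)]big1 => [|a ac].
  rewrite addr0 hornerZ /W horner_prod.
  under [X in _ / _ * X]eq_bigr do rewrite hornerXsubC.
  rewrite divfK ?subrr//; apply/prodf_neq0 => b bc; rewrite subr_eq0 inj_eq//.
  by rewrite eq_sym.
by rewrite hornerZ /W horner_prod [X in _ * X](bigD1 c) 1?eq_sym//= hornerXsubC subrr mul0r mulr0.
Qed.

Lemma lagrange_eval (p : {poly F}) x : (size p <= #|T|)%N ->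
  p.[x] = \sum_a p.[y a] * \prod_(b | b != a) ((x - y b) / (y a - y b)).
Proof.
move=> sp; rewrite {1}(lagrange_poly sp) horner_sum; apply: eq_bigr => a _.
rewrite hornerZ /W horner_prod -mulrA; congr (_ * _).
rewrite big_split /= prodfV mulrC; congr (_ * _).
by apply: eq_bigr => b _; rewrite hornerXsubC.
Qed.

(** A known leading coefficient forces a large value at some node; this is how $|\lambda|^m$
    enters. *)
Lemma lagrange_lead (p : {poly F}) : (size p <= #|T|)%N ->
  p`_(#|T|.-1) = \sum_a p.[y a] / \prod_(b | b != a) (y a - y b).
Proof.
move=> sp; rewrite {1}(lagrange_poly sp) coef_sum; apply: eq_bigr => a _.
rewrite coefZ; have := monic_W a; rewrite monicE /lead_coef size_W => /eqP ->.
by rewrite mulr1.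
Qed.

End Lagrange.

Section Boxes.
Variable R : realType.
Implicit Types (t beta tau eps eta lam : R) (E : R[i]).

Lemma poly_le_exp (kappa : nat) tau eps : 0 < tau -> 0 < eps -> exists C : R, 0 <= C /\
  forall m : nat, expR (- (eps * m%:R + C)) <= Num.min 1 (tau / m.+1%:R ^+ kappa).
Proof.
move=> t0 e0; pose d := eps / (kappa%:R + 1).
have k0 : 0 < kappa%:R + 1 :> R by rewrite ltr_wpDl.
have d0 : 0 < d by rewrite divr_gt0.
exists (`|ln tau| + kappa%:R * `|ln d| + eps); split.
  by rewrite !addr_ge0 ?mulr_ge0// ltW.
move=> m; rewrite le_min; apply/andP; split.
  by rewrite expR_le1 oppr_le0 !addr_ge0 ?mulr_ge0// ltW.
have m0 : 0 < m.+1%:R :> R by rewrite ltr0n.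
have ml : ln m.+1%:R <= d * m.+1%:R + `|ln d| :> R.
  have := @ln_sublinear R (d * m.+1%:R) (mulr_gt0 d0 m0); rewrite lnM ?posrE//.
  have : - ln d <= `|ln d| by rewrite -normrN ler_norm.
  lra.
rewrite -[leRHS]lnK ?posrE ?divr_gt0 ?exprn_gt0// ler_expR ln_div ?posrE ?exprn_gt0// lnX_natl//.
have : - ln tau <= `|ln tau| by rewrite -normrN ler_norm.
have : kappa%:R * ln m.+1%:R <= kappa%:R * (d * m.+1%:R + `|ln d|) by rewrite ler_wpM2l.
have : kappa%:R * (d * m.+1%:R) <= eps * m.+1%:R.
  have -> : eps * m.+1%:R = (kappa%:R + 1) * (d * m.+1%:R).
    by rewrite /d; field; rewrite natr1 pnatr_eq0.
  by rewrite ler_wpM2r ?mulr_ge0 ?ltW// ltrDl.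
have -> : eps * m.+1%:R = eps * m%:R + eps by rewrite -natr1; ring.
rewrite mulrDr; lra.
Qed.

(** If all determinants were small, the Lagrange formula for the leading coefficient of modulus
    |lam|^m would fail. By [joukowskiB] a difference of nodes is a chord of the difference of phases
    times a chord of their sum; the sum is where resonances enter. *)
Lemma box_nodes (T : finType) (p : T -> int) lam E beta t m (D : R) :
  #|T| = m.+1 -> 0 < D ->
  (forall a, D <= \prod_(b | b != a) (chord ((p b)%:~R * beta - (p a)%:~R * beta) *
      chord (2 * t + ((p a)%:~R + (p b)%:~R + m%:R - 1) * beta))) ->
  (forall a b, a != b -> 0 < chord ((p b)%:~R * beta - (p a)%:~R * beta) *
      chord (2 * t + ((p a)%:~R + (p b)%:~R + m%:R - 1) * beta)) ->
  exists a, `|lam| ^+ m * D / m.+1%:R <= cmod (continuant (site_coef lam E beta (expi (t + (p a)%:~R * beta))) m).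
Proof.
move=> cT D0 hD w0; have [Q [q0 qm e]] := continuant_poly lam E beta m.
pose z a := expi (t + (p a)%:~R * beta) * expi ((m%:R - 1) / 2 * beta).
have z0 a : z a != 0 by rewrite mulf_neq0 ?expi_neq0.
pose y a := joukowski (z a).
have yB a b : cmod (y a - y b) = chord ((p b)%:~R * beta - (p a)%:~R * beta) *
      chord (2 * t + ((p a)%:~R + (p b)%:~R + m%:R - 1) * beta).
  rewrite /y joukowskiB// cmodM; congr (_ * _).
    by rewrite /z -mulrBl cmodM cmod_expi mulr1 cmod_expiB -chordN; congr chord; ring.
  rewrite /z -!expiD -expiN -/(chord _) chordN; congr chord; by field.
have yi : injective y.
  move=> a b yab; apply/eqP/negPn/negP => ab; have := w0 _ _ ab.
  by rewrite -yB yab subrr cmod0 ltxx.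
have sQ : (size Q <= #|T|)%N.
  by rewrite cT; apply/leq_sizeP => i mi; apply: q0.
have := lagrange_lead yi sQ; rewrite cT /= => /(congr1 (@cmod R)); rewrite qm => hl.
apply: contrapT => /forallNP hc.
have : `|lam| ^+ m < `|lam| ^+ m.
  rewrite {1}hl; apply: (le_lt_trans (cmod_sum _ _ _)).
  apply: (@lt_le_trans _ _ (\sum_(a : T) `|lam| ^+ m / m.+1%:R)); last first.
    by rewrite sumr_const cT -[leLHS]mulr_natr divfK// pnatr_eq0.
  have [a0 _] : exists a0 : T, a0 \in T by apply/card_gt0P; rewrite cT.
  apply: ltr_sum => [|a _]; first by apply/hasP; exists a0 => //; rewrite mem_index_enum.
  rewrite cmodM cmodV cmod_prod ltr_pdivrMr; last first.
    by apply: lt_le_trans D0 _; under eq_bigr do rewrite yB; exact: hD.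
  have := hc a => /negP; rewrite -ltNge e ?expi_neq0//.
  move=> /lt_le_trans; apply; under [X in _ <= _ * X]eq_bigr do rewrite yB.
  by rewrite mulrAC ler_wpM2l// divr_ge0 ?exprn_ge0.
by rewrite ltxx.
Qed.


Definition polyfac (kappa : nat) tau (N : nat) : R := Num.min 1 (tau / N.+1%:R ^+ kappa).

Lemma polyfac_gt0 kappa tau N : 0 < tau -> 0 < polyfac kappa tau N.
Proof. by move=> t0; rewrite lt_min ltr01 divr_gt0// exprn_gt0// ltr0n. Qed.

Lemma polyfac_le1 kappa tau N : polyfac kappa tau N <= 1.
Proof. by rewrite ge_min lexx. Qed.

Lemma DC_int kappa tau beta M N (k : int) : 0 < tau -> dioph_upto kappa tau beta M -> (N < M)%N ->
  k != 0 -> (`|k| <= N)%N -> polyfac kappa tau N <= chord (k%:~R * beta).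
Proof.
move=> t0 dc NM k0 kN; have -> : chord (k%:~R * beta) = chord (`|k|%:R * beta).
  case: (intP k) => [|n|n] //.
  by rewrite mulrNz mulNr chordN.
apply: (@le_trans _ _ (tau / `|k|%:R ^+ kappa)); last first.
  by apply: dc; rewrite absz_gt0 k0 (leq_ltn_trans kN).
apply: (@le_trans _ _ (tau / N.+1%:R ^+ kappa)); first by rewrite ge_min lexx orbT.
rewrite ler_pM2l// lef_pV2 ?posrE ?exprn_gt0 ?ltr0n ?absz_gt0//.
by apply: lerXn2r; rewrite ?nnegrE ?ler0n// ler_nat ltnW.
Qed.

Definition node_dist beta t (m : nat) (pa pb : int) : R :=
  chord (pb%:~R * beta - pa%:~R * beta) *
  chord (2 * t + (pa%:~R + pb%:~R + m%:R - 1) * beta).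

(** Along a window of starts the differences of phases form an orbit segment, and so do the sums, so
    each product is an orbit product. [pa] may lie outside the window, as happens when two windows
    are combined. *)
Lemma node_pieces kappa tau eps : 0 < tau -> 0 < eps -> exists (C : R) (M0 : nat), 0 <= C /\
  forall beta M, (M0 <= M)%N -> dioph_upto kappa tau beta M ->
  forall t (s pa : int) (n N m : nat) eta, (N < M)%N -> (n <= M)%N -> 0 < eta <= 1 ->
  (forall i : 'I_n, s + i%:Z != pa -> (`|(s + i%:Z - pa)%R| <= N)%N) ->
  (forall i : 'I_n, s + i%:Z != pa -> eta <= chord (2 * t + (pa%:~R + (s + i%:Z)%:~R + m%:R - 1) * beta)) ->
  polyfac kappa tau N * eta * expR (- (eps * n%:R + C)) <=
    \prod_(i < n | s + i%:Z != pa) node_dist beta t m pa (s + i%:Z).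
Proof.
move=> t0 e0; have e20 : 0 < eps / 2 by rewrite divr_gt0.
have [C1 [M1 [C10 h1]]] := orbit_prod_except kappa t0 e20.
have [C2 [M2 [C20 h2]]] := orbit_prod_all kappa t0 e20.
exists ((C1 + C2) *+ 2), (maxn M1 M2); split; first by rewrite mulrn_wge0// addr_ge0.
move=> beta M; rewrite geq_max => /andP[MM1 MM2] dc t s pa n N m eta NM nM /andP[eta0 eta1] hN he.
have p0 := polyfac_gt0 kappa N t0; have p1 := polyfac_le1 kappa tau N.
pose X := expR (- (eps / 2 * n%:R + (C1 + C2))).
have -> : polyfac kappa tau N * eta * expR (- (eps * n%:R + (C1 + C2) *+ 2)) =
    (polyfac kappa tau N * X) * (eta * X).
  rewrite mulrACA; congr (_ * _); rewrite /X -expRD mulr2n; congr expR; by field.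
have X0 : 0 <= X by exact: expR_ge0.
have X1 : X <= expR (- (eps / 2 * n%:R + C1)) by rewrite ler_expR lerN2 lerD2l lerDl.
have X2 : X <= expR (- (eps / 2 * n%:R + C2)) by rewrite ler_expR lerN2 lerD2l lerDr.
pose x1 := - (pa - s)%:~R * beta; pose x2 := 2 * t + (pa%:~R + s%:~R + m%:R - 1) * beta.
have e1 (i : 'I_n) : chord ((s + i%:Z)%:~R * beta - pa%:~R * beta) = orb x1 beta i.
  by rewrite /orb /x1; congr chord; rewrite !intrD mulrNz -[i%:~R]/(i%:R); ring.
have e2 (i : 'I_n) : chord (2 * t + (pa%:~R + (s + i%:Z)%:~R + m%:R - 1) * beta) = orb x2 beta i.
  by rewrite /orb /x2; congr chord; rewrite !intrD -[i%:~R]/(i%:R); ring.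
have hd (i : 'I_n) : s + i%:Z != pa -> polyfac kappa tau N <= orb x1 beta i.
  move=> ip; rewrite -e1 -mulrBl -intrB; apply: (DC_int t0 dc NM); first by rewrite subr_eq0.
  exact: hN.
rewrite big_split /=; under eq_bigr do rewrite e1; under [X in _ <= _ * X]eq_bigr do rewrite e2.
have [/existsP[j0 /eqP ej]|] := boolP [exists j : 'I_n, s + j%:Z == pa].
  have P (i : 'I_n) : (s + i%:Z != pa) = (i != j0).
    by rewrite -ej (inj_eq (addrI _)) eqz_nat.
  rewrite (eq_bigl _ _ P) [X in _ <= _ * X](eq_bigl _ _ P).
  apply: ler_pM; rewrite ?mulr_ge0 ?(ltW p0) ?(ltW eta0)//.
    apply: le_trans (h1 beta M n x1 MM1 dc nM (polyfac kappa tau N) j0 _ _); rewrite ?p0//.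
      by rewrite ler_pM2l.
    by move=> i ij; apply: hd; rewrite P.
  apply: le_trans (h1 beta M n x2 MM1 dc nM eta j0 _ _); rewrite ?eta0//.
    by rewrite ler_pM2l.
  by move=> i ij; rewrite -e2; apply: he; rewrite P.
rewrite negb_exists => /forallP P.
have P' (i : 'I_n) : (s + i%:Z != pa) = true by rewrite P.
rewrite (eq_bigl _ _ P') [X in _ <= _ * X](eq_bigl _ _ P').
apply: ler_pM; rewrite ?mulr_ge0 ?(ltW p0) ?(ltW eta0)//.
  apply: le_trans (h2 beta M n x1 MM2 dc nM (polyfac kappa tau N) _ _); rewrite ?p0//.
    by rewrite ler_pM2l.
  by move=> i; apply: hd.
apply: le_trans (h2 beta M n x2 MM2 dc nM eta _ _); rewrite ?eta0//.
  by rewrite ler_pM2l.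
by move=> i; rewrite -e2; apply: he.
Qed.

Lemma box_one kappa tau eps : 0 < tau -> 0 < eps -> exists (C : R) (M0 : nat), 0 <= C /\
  forall beta M, (M0 <= M)%N -> dioph_upto kappa tau beta M ->
  forall lam E t (s : int) (m : nat) eta, (m < M)%N -> 0 < eta <= 1 ->
  (forall i j : nat, (i <= m)%N -> (j <= m)%N -> i != j ->
     eta <= chord (2 * t + ((s + i%:Z)%:~R + (s + j%:Z)%:~R + m%:R - 1) * beta)) ->
  exists2 i, (i <= m)%N & `|lam| ^+ m * (eta * expR (- (eps * m%:R + C))) <=
    cmod (continuant (site_coef lam E beta (expi (t + (s + i%:Z)%:~R * beta))) m).
Proof.
move=> t0 e0; have e40 : 0 < eps / 4 by rewrite divr_gt0.
have [C1 [M1 [C10 h1]]] := node_pieces kappa t0 e40.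
have [C2 [C20 h2]] := poly_le_exp kappa t0 e40.
have [C3 [C30 h3]] := poly_le_exp 1 (@ltr01 R) e40.
exists (C1 + C2 + C3 + eps), M1; split; first by rewrite !addr_ge0// ltW.
move=> beta M MM dc lam E t s m eta mM eta01 he; have /andP[eta0 eta1] := eta01.
have hD (a : 'I_m.+1) : polyfac kappa tau m * eta * expR (- (eps / 4 * m.+1%:R + C1)) <=
    \prod_(b < m.+1 | b != a) node_dist beta t m (s + a%:Z) (s + b%:Z).
  have P (b : 'I_m.+1) : (s + b%:Z != s + a%:Z) = (b != a) by rewrite (inj_eq (addrI _)) eqz_nat.
  rewrite -(eq_bigl _ _ P); apply: (h1 beta M MM dc) => //.
    by move=> i _; have := ltn_ord i; have := ltn_ord a; clear; lia.
  by move=> i; rewrite P => ia; apply: he; rewrite ?leq_ord// eq_sym.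
have p0 := polyfac_gt0 kappa m t0.
have D0 : 0 < polyfac kappa tau m * eta * expR (- (eps / 4 * m.+1%:R + C1)).
  by rewrite !mulr_gt0 ?expR_gt0.
have [||a ha] := @box_nodes 'I_m.+1 (fun a => s + a%:Z) lam E beta t m _ (card_ord _) D0.
- by move=> a; exact: hD.
- move=> a b ab; rewrite mulr_gt0//.
    rewrite -mulrBl -intrB; apply: (lt_le_trans p0); apply: (DC_int t0 dc mM).
      by rewrite subr_eq0 (inj_eq (addrI _)) eqz_nat eq_sym.
    by have := ltn_ord b; have := ltn_ord a; clear; lia.
  by apply: (lt_le_trans eta0); apply: he; rewrite ?leq_ord.
exists a; first exact: leq_ord.
apply: le_trans ha; rewrite -mulrA ler_wpM2l ?exprn_ge0//.
have -> : expR (- (eps * m%:R + (C1 + C2 + C3 + eps))) =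
  expR (- (eps / 4 * m%:R + C2)) * expR (- (eps / 4 * m.+1%:R + C1)) * expR (- (eps / 4 * m%:R + C3))
  * expR (- (eps / 4 * m%:R + eps * (3 / 4))).
  by rewrite -!expRD; congr expR; rewrite -natr1; field.
have x1 : expR (- (eps / 4 * m%:R + eps * (3 / 4))) <= 1.
  rewrite expR_le1 oppr_le0; have : 0 <= eps / 4 * m%:R by rewrite mulr_ge0// ltW.
  lra.
have x2 := h2 m; have x3 : expR (- (eps / 4 * m%:R + C3)) <= m.+1%:R^-1.
  by apply: (le_trans (h3 m)); rewrite ge_min expr1 mul1r lexx orbT.
rewrite -/(polyfac kappa tau m) in x2.
move: x1 x2 x3 (expR_ge0 (- (eps / 4 * m%:R + eps * (3 / 4)))) (expR_ge0 (- (eps / 4 * m%:R + C2)))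
  (expR_ge0 (- (eps / 4 * m%:R + C3))) (expR_ge0 (- (eps / 4 * m.+1%:R + C1))).
set y1 := expR _; set y2 := expR _; set y3 := expR _; set y4 := expR _ => x1 x2 x3 z1 z2 z3 z4.
rewrite [eta * _]mulrC [polyfac _ _ _ * eta]mulrC.
have -> : eta * polyfac kappa tau m * y4 / m.+1%:R = (polyfac kappa tau m * y4 / m.+1%:R * 1) * eta by ring.
rewrite ler_pM2r//; apply: ler_pM; rewrite ?mulr_ge0//; apply: ler_pM; rewrite ?mulr_ge0//.
by rewrite ler_wpM2r.
Qed.

(** The Lagrange product splits over the two windows and each costs one factor eta, hence the
    square. *)
Lemma box_two kappa tau eps : 0 < tau -> 0 < eps -> exists (C : R) (M0 : nat), 0 <= C /\
  forall beta M, (M0 <= M)%N -> dioph_upto kappa tau beta M ->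
  forall lam E t (s1 s2 : int) (n1 n2 m N : nat) eta, (n1 + n2 = m.+1)%N -> (m < N < M)%N -> 0 < eta <= 1 ->
  let S := [set p : int | (s1 <= p < s1 + n1%:Z) || (s2 <= p < s2 + n2%:Z)] in
  s1 + n1%:Z <= s2 \/ s2 + n2%:Z <= s1 ->
  (forall p q : int, S p -> S q -> (`|(p - q)%R| <= N)%N) ->
  (forall p q : int, S p -> S q -> p != q -> eta <= chord (2 * t + (p%:~R + q%:~R + m%:R - 1) * beta)) ->
  exists2 p : int, S p & `|lam| ^+ m * (eta ^+ 2 * expR (- (eps * N%:R + C))) <=
    cmod (continuant (site_coef lam E beta (expi (t + p%:~R * beta))) m).
Proof.
move=> t0 e0; have e80 : 0 < eps / 8 by rewrite divr_gt0.
have [C1 [M1 [C10 h1]]] := node_pieces kappa t0 e80.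
have [C2 [C20 h2]] := poly_le_exp kappa t0 e80.
have [C3 [C30 h3]] := poly_le_exp 1 (@ltr01 R) e80.
exists (C1 *+ 2 + C2 *+ 2 + C3), M1; split; first by rewrite !addr_ge0 ?mulrn_wge0.
move=> beta M MM dc lam E t s1 s2 n1 n2 m N eta n12 /andP[mN NM] eta01 S dis hN he.
have /andP[eta0 eta1] := eta01.
pose pp (a : 'I_n1 + 'I_n2) : int := match a with inl i => s1 + i%:Z | inr j => s2 + j%:Z end.
have Sp a : S (pp a).
  by rewrite /S /=; case: a => i /=; apply/orP; [left|right]; have := ltn_ord i; clear -i; lia.
have pi : injective pp.
  move=> [i|i] [j|j] /= e; have := ltn_ord i; have := ltn_ord j => hi hj.
  - by congr inl; apply/val_inj => /=; clear -e; lia.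
  - by exfalso; clear -e hi hj dis; lia.
  - by exfalso; clear -e hi hj dis; lia.
  - by congr inr; apply/val_inj => /=; clear -e; lia.
have p0 := polyfac_gt0 kappa N t0.
pose Y (n : nat) := polyfac kappa tau N * eta * expR (- (eps / 8 * n%:R + C1)).
have Y0 n : 0 < Y n by rewrite !mulr_gt0 ?expR_gt0.
have cT : #|{: 'I_n1 + 'I_n2}| = m.+1 by rewrite card_sum !card_ord.
have hD a : Y n1 * Y n2 <= \prod_(b | b != a) node_dist beta t m (pp a) (pp b).
  rewrite big_sumType /=; apply: ler_pM; rewrite ?(ltW (Y0 _))//.
    rewrite (eq_bigl (fun i : 'I_n1 => s1 + i%:Z != pp a)); last first.
      by move=> i; rewrite -(inj_eq pi).
    apply: (h1 beta M MM dc) => //; first by clear -n12 mN NM; lia.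
      by move=> i _; apply: hN => //; exact: (Sp (inl i)).
    by move=> i ia; apply: he => //; [exact: (Sp (inl i))|rewrite eq_sym].
  rewrite (eq_bigl (fun i : 'I_n2 => s2 + i%:Z != pp a)); last first.
    by move=> i; rewrite -(inj_eq pi).
  apply: (h1 beta M MM dc) => //; first by clear -n12 mN NM; lia.
    by move=> i _; apply: hN => //; exact: (Sp (inr i)).
  by move=> i ia; apply: he => //; [exact: (Sp (inr i))|rewrite eq_sym].
have [||a ha] := @box_nodes _ pp lam E beta t m _ cT (mulr_gt0 (Y0 n1) (Y0 n2)).
- by move=> a; exact: hD.
- move=> a b ab; rewrite mulr_gt0//.
    rewrite -mulrBl -intrB; apply: (lt_le_trans p0); apply: (DC_int t0 dc NM).
      by rewrite subr_eq0 (inj_eq pi) eq_sym.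
    by apply: hN.
  by apply: (lt_le_trans eta0); apply: he => //; rewrite (inj_eq pi).
exists (pp a) => //; apply: le_trans ha; rewrite -mulrA ler_wpM2l ?exprn_ge0//.
have x3 : expR (- (eps / 8 * m%:R + C3)) <= m.+1%:R^-1.
  by apply: (le_trans (h3 m)); rewrite ge_min expr1 mul1r lexx orbT.
have x2 := h2 N; rewrite -/(polyfac kappa tau N) in x2.
have mN' : m.+1%:R <= N%:R :> R by rewrite ler_nat.
have nn : n1%:R + n2%:R = m.+1%:R :> R by rewrite -natrD n12.
have N0 : 0 <= eps / 8 * N%:R by rewrite mulr_ge0// ltW.
have m1 : eps / 8 * m.+1%:R <= eps / 8 * N%:R by rewrite ler_pM2l.
have m2 : eps / 8 * m%:R <= eps / 8 * N%:R by rewrite ler_pM2l// ler_nat ltnW.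
apply: (@le_trans _ _ (eta ^+ 2 * (expR (- (eps / 8 * N%:R + C2)) ^+ 2 * expR (- (eps / 8 * m.+1%:R + C1 *+ 2)) *
   expR (- (eps / 8 * m%:R + C3))))).
  rewrite ler_pM2l ?exprn_gt0// -expRM_natl -!expRD ler_expR.
  by rewrite !mulr2n -nn in m1 *; lra.
have -> : Y n1 * Y n2 / m.+1%:R = eta ^+ 2 * (polyfac kappa tau N ^+ 2 * expR (- (eps / 8 * m.+1%:R + C1 *+ 2)) / m.+1%:R).
  rewrite /Y -nn; have -> : expR (- (eps / 8 * (n1%:R + n2%:R) + C1 *+ 2)) =
    expR (- (eps / 8 * n1%:R + C1)) * expR (- (eps / 8 * n2%:R + C1)).
    by rewrite -expRD mulr2n; congr expR; ring.
  ring.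
rewrite ler_pM2l ?exprn_gt0//; apply: ler_pM; rewrite ?mulr_ge0 ?exprn_ge0 ?expR_ge0//.
rewrite ler_wpM2r ?expR_ge0//; apply: lerXn2r => //; rewrite nnegrE ?expR_ge0//; exact: ltW.
Qed.

End Boxes.

(** * Decay of eigenfunctions *)

Section Moves.
Implicit Types (x y n : int) (d t g N : nat).

Definition moved x y x' y' d :=
  (y' = y /\ absz (x' - x) = d) \/ (x' = x /\ absz (y' - y) = d).

Lemma moved_free x y x' y' n d t N : moved x y x' y' d -> (d <= t)%N ->
  (absz x + t <= N)%N -> (absz y + t <= N)%N ->
  (t <= absz (x - y)%R)%N -> (t <= absz (x + y - n)%R)%N ->
  [/\ (absz x' + (t - d) <= N)%N, (absz y' + (t - d) <= N)%N,
      (t - d <= absz (x' - y')%R)%N & (t - d <= absz (x' + y' - n)%R)%N].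
Proof. by case=> -[-> hd] *; split; lia. Qed.

Lemma moved_dist x y x' y' d t N : moved x y x' y' d -> (d <= t)%N ->
  (absz x + t <= N)%N -> (absz y + t <= N)%N -> (t <= absz (x - y)%R)%N ->
  [/\ (absz x' + (t - d) <= N)%N, (absz y' + (t - d) <= N)%N & (t - d <= absz (x' - y')%R)%N].
Proof. by case=> -[-> hd] *; split; lia. Qed.

(** The move shifts x + y by d, and t <= |x - y| <= 2d makes the remaining budget t - d at most
    d. *)
Lemma moved_mirror x y x' y' n d t g N : moved x y x' y' d -> (d <= t)%N ->
  (absz x + t <= N)%N -> (absz y + t <= N)%N -> (t <= absz (x - y)%R)%N ->
  (absz (x - y)%R <= 2 * d)%N -> (absz (x + y - n)%R < 2 * g)%N ->
  [/\ (absz x' + (t - d - 2 * g) <= N)%N, (absz y' + (t - d - 2 * g) <= N)%N,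
      (t - d - 2 * g <= absz (x' - y')%R)%N & (t - d - 2 * g <= absz (x' + y' - n)%R)%N].
Proof. by case=> -[-> hd] *; split; lia. Qed.

Lemma moved_far x y x' y' d N N' : moved x y x' y' d -> (absz x <= N)%N -> (absz y <= N)%N ->
  (d <= 2 * absz (x - y)%R + 2)%N -> (5 * N + 2 <= N')%N -> (absz x' <= N')%N /\ (absz y' <= N')%N.
Proof. by case=> -[-> hd] *; split; lia. Qed.

Lemma steps_left J g d t : (t <= J.+1 * g)%N -> (g <= d)%N -> (t - d <= J * g)%N.
Proof. by rewrite mulSn; lia. Qed.

Lemma leq_addl_trans a t N : (a + t <= N)%N -> (a <= N)%N.
Proof. by lia. Qed.

End Moves.

Section Walk.
Variable R : realType.
Variables (Lam Z Zb Psi : R) (Phi : int -> int -> R) (m g N1 N2 : nat) (n0 : int).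
Hypotheses (Lam1 : 1 <= Lam) (Z1 : 1 <= Z) (Zb1 : 1 <= Zb) (Psi0 : 0 <= Psi).
Hypotheses (g0 : (0 < g)%N) (gm : (2 * g <= m)%N) (N12 : (5 * N1 + 2 <= N2)%N).

Hypothesis HS : forall x y : int, (absz x <= N1)%N -> (absz y <= N1)%N ->
  (4 * m <= absz (x - y)%R)%N -> (2 * g <= absz (x + y - n0)%R)%N ->
  exists x' y' d, [/\ moved x y x' y' d, (g <= d <= m)%N & Phi x y <= Z / Lam ^+ d * Phi x' y'].
Hypothesis HB : forall x y : int, (absz x <= N1)%N -> (absz y <= N1)%N -> x <> y ->
  exists x' y' d, [/\ moved x y x' y' d, (absz (x - y)%R <= 2 * d)%N, (d <= 2 * absz (x - y)%R + 2)%N &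
     Phi x y <= Zb / Lam ^+ d * Phi x' y'].
Hypothesis HPsi : forall x y : int, (absz x <= N2)%N -> (absz y <= N2)%N -> Phi x y <= Psi.

Let Lam0 : 0 < Lam. Proof. exact: lt_le_trans Lam1. Qed.
Let LamX n : 0 < Lam ^+ n. Proof. exact: exprn_gt0. Qed.
Let LamX1 n : 1 <= Lam ^+ n. Proof. exact: exprn_ege1. Qed.
Let ZX1 n : 1 <= Z ^+ n. Proof. exact: exprn_ege1. Qed.

Let trivial_bound (A B : R) (w t : nat) : 1 <= A -> 1 <= B -> (t <= w)%N ->
  Psi <= B * A * Lam ^+ w / Lam ^+ t * Psi.
Proof.
move=> A1 B1 tw; rewrite -{1}[Psi]mul1r ler_wpM2r//.
rewrite ler_pdivlMr// mul1r -[leLHS]mul1r; apply: ler_pM; rewrite ?ler01 ?(ltW (LamX _))//.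
  by rewrite -[leLHS]mulr1; apply: ler_pM.
by rewrite ler_weXn2l.
Qed.

Let le_Psi x y t : (absz x + t <= N1)%N -> (absz y + t <= N1)%N -> Phi x y <= Psi.
Proof. by move=> xN yN; apply: HPsi; clear -xN yN N12; lia. Qed.

(** t is a budget: no constraint (ends of the range, coincidence, mirror) can be met before the
    points have travelled t. A step of length d spends d and gains Lam^-d. As d >= g there are at
    most J steps, and stopping at t <= 4m loses Lam^(4m). *)
Lemma walk_free J (t : nat) (x y : int) : (t <= J * g)%N ->
  (absz x + t <= N1)%N -> (absz y + t <= N1)%N ->
  (t <= absz (x - y)%R)%N -> (t <= absz (x + y - n0)%R)%N ->
  Phi x y <= Z ^+ J * Lam ^+ (4 * m) / Lam ^+ t * Psi.
Proof.
elim: J t x y => [|J IH] t x y tJ xN yN txy tn.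
  apply: le_trans (le_Psi xN yN) _.
  have := @trivial_bound 1 1 (4 * m) t (lexx _) (lexx _); rewrite expr0 mul1r; apply.
  by rewrite mul0n leqn0 in tJ; rewrite (eqP tJ).
have [t4|t4] := leqP t (4 * m).
  apply: le_trans (le_Psi xN yN) _.
  by have := @trivial_bound (Z ^+ J.+1) 1 (4 * m) t (ZX1 _) (lexx _); rewrite mul1r; apply.
have t2g : (2 * g <= t)%N by clear -gm t4; lia.
have [x' [y' [d [mv /andP[gd dm] h]]]] := HS (leq_addl_trans xN) (leq_addl_trans yN)
  (leq_trans (ltnW t4) txy) (leq_trans t2g tn).
apply: (le_trans h).
have dt : (d <= t)%N by clear -dm t4; lia.
have [h1 h2 h3 h4] := moved_free mv dt xN yN txy tn.
have {h1 h2 h3 h4} h2 := IH _ _ _ (steps_left tJ gd) h1 h2 h3 h4.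
have hd' : 0 <= Z / Lam ^+ d by rewrite divr_ge0 ?(ltW (LamX _))// (le_trans ler01).
apply: (le_trans (ler_wpM2l hd' h2)); rewrite le_eqVlt; apply/orP; left; apply/eqP.
rewrite exprS -{2}(subnK dt) exprD; field; by rewrite !expf_neq0// gt_eqF.
Qed.

(* Each use of HB costs Zb.  It moves one point by at least half the distance, so coming
   back to the mirror strip x + y ~ n0 costs the other half: one use suffices. *)
Lemma walk_mirror J (t : nat) (x y : int) : (t <= J * g)%N ->
  (absz x + t <= N1)%N -> (absz y + t <= N1)%N -> (t <= absz (x - y)%R)%N ->
  Phi x y <= Zb * Z ^+ J * Lam ^+ (5 * m) / Lam ^+ t * Psi.
Proof.
elim: J t x y => [|J IH] t x y tJ xN yN txy.
  apply: le_trans (le_Psi xN yN) _; apply: trivial_bound => //.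
  by rewrite mul0n leqn0 in tJ; rewrite (eqP tJ).
have [t4|t4] := leqP t (5 * m).
  by apply: le_trans (le_Psi xN yN) _; apply: trivial_bound.
have t4m : (4 * m <= t)%N by clear -t4; lia.
have [tn|tn] := leqP (2 * g) (absz (x + y - n0)%R).
  have [x' [y' [d [mv /andP[gd dm] h]]]] := HS (leq_addl_trans xN) (leq_addl_trans yN)
    (leq_trans t4m txy) tn.
  apply: (le_trans h).
  have dt : (d <= t)%N by clear -dm t4; lia.
  have [h1 h2 h3] := moved_dist mv dt xN yN txy.
  have {h1 h2 h3} h2 := IH _ _ _ (steps_left tJ gd) h1 h2 h3.
  have hd' : 0 <= Z / Lam ^+ d by rewrite divr_ge0 ?(ltW (LamX _))// (le_trans ler01).
  apply: (le_trans (ler_wpM2l hd' h2)); rewrite le_eqVlt; apply/orP; left; apply/eqP.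
  rewrite exprS -{2}(subnK dt) exprD; field; by rewrite !expf_neq0// gt_eqF.
have xy : x <> y by move=> e; move: txy; rewrite e subrr absz0; clear -t4; lia.
have [x' [y' [d [mv d1 d2 h]]]] := HB (leq_addl_trans xN) (leq_addl_trans yN) xy.
have Zb0 : 0 <= Zb by rewrite (le_trans ler01).
have hd' : 0 <= Zb / Lam ^+ d by rewrite divr_ge0 ?(ltW (LamX _)).
apply: (le_trans h).
(* A move longer than the budget already gives the full decay; its end point only has to stay in the
   larger range N2. *)
have [td|td] := leqP t d.
  have [a1 a2] := moved_far mv (leq_addl_trans xN) (leq_addl_trans yN) d2 N12.
  apply: (le_trans (ler_wpM2l hd' (HPsi a1 a2))); rewrite ler_wpM2r//.
  apply: ler_pM; rewrite ?invr_ge0 ?(ltW (LamX _))//; last by rewrite lef_pV2 ?posrE// ler_weXn2l.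
  rewrite -[leLHS]mulr1 -mulrA; apply: ler_pM => //.
  by rewrite -[leLHS]mulr1; apply: ler_pM.
have [h1 h2 h3 h4] := moved_mirror mv (ltnW td) xN yN txy d1 tn.
have tJ' : (t - d - 2 * g <= J.+1 * g)%N by apply: leq_trans tJ; clear; lia.
have {h1 h2 h3 h4} h2 := walk_free tJ' h1 h2 h3 h4.
apply: (le_trans (ler_wpM2l hd' h2)); rewrite mulrA ler_wpM2r//.
have -> : Zb / Lam ^+ d * (Z ^+ J.+1 * Lam ^+ (4 * m) / Lam ^+ (t - d - 2 * g)) =
  Zb * Z ^+ J.+1 * (Lam ^+ (4 * m) / (Lam ^+ d * Lam ^+ (t - d - 2 * g))).
  by field; rewrite !expf_neq0// gt_eqF.
rewrite -[leRHS]mulrA ler_wpM2l ?mulr_ge0 ?(le_trans ler01 (ZX1 _))//.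
rewrite ler_pdivrMr ?mulr_gt0// mulrAC ler_pdivlMr// -!exprD ler_weXn2l//.
by clear -gm td; lia.
Qed.

End Walk.

(** * Moving one point of a pair by Green's formula *)

Section Step.
Variable R : realType.
Implicit Types (t beta tau eps eta lam theta : R) (E : R[i]) (u : int -> R[i]).

Definition is_sol lam beta theta E u := forall n : int,
  u (n + 1) + u (n - 1) + ((2 * lam * cos (2 * pi * (theta + n%:~R * beta)))%:C)%C * u n = E * u n.

Definition growth_bound lam beta E (Cu epsu : R) := forall t (j : nat),
  cmod (continuant (site_coef lam E beta (expi t)) j) <= Cu * `|lam| ^+ j * expR (epsu * j%:R).

Lemma sol_rec lam beta theta E u (p : int) (i : nat) : is_sol lam beta theta E u ->
  u (p + i%:Z + 1) = site_coef lam E beta (expi (theta + p%:~R * beta)) i * u (p + i%:Z) - u (p + i%:Z - 1).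
Proof.
move=> h; have := h (p + i%:Z) => /(congr1 (fun a => a - u (p + i%:Z - 1) -
  ((2 * lam * cos (2 * pi * (theta + (p + i%:Z)%:~R * beta)))%:C)%C * u (p + i%:Z))).
have -> : forall a b c : R[i], a + b + c - b - c = a by move=> a b c; ring.
move=> ->; rewrite /site_coef -expiD -expiN expi_cos.
have -> : theta + p%:~R * beta + i%:R * beta = theta + (p + i%:Z)%:~R * beta.
  by rewrite intrD -[i%:Z%:~R]/(i%:R); ring.
rewrite (_ : 2 * lam * _ = lam * (2 * cos (2 * pi * (theta + (p + i%:Z)%:~R * beta)))); last ring.
by rewrite rmorphM; ring.
Qed.

(** Keep the larger of the two boundary terms of Green's formula at the price of a factor 2;
    [growth_bound] controls the minors in the numerator. *)
Lemma green_step lam beta theta E u Cu epsu (D : R) (p x : int) (m : nat) :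
  lam != 0 -> 0 < D -> 0 <= Cu -> 0 <= epsu -> is_sol lam beta theta E u -> growth_bound lam beta E Cu epsu ->
  `|lam| ^+ m * D <= cmod (continuant (site_coef lam E beta (expi (theta + p%:~R * beta))) m) ->
  p <= x -> x < p + m%:Z ->
  exists x' d, [/\ absz (x' - x) = d, (d = absz (x - p + 1)%R \/ d = absz (p + m%:Z - x)%R) &
    cmod (u x) <= (2 * Cu * expR (epsu * m%:R) / D) / `|lam| ^+ d * cmod (u x')].
Proof.
move=> l0 D0 Cu0 eu0 su gb hD px xm.
pose n := absz (x - p); pose c := site_coef lam E beta (expi (theta + p%:~R * beta)).
have nm : (n < m)%N by rewrite /n; lia.
pose v (i : nat) := u (p - 1 + i%:Z).
have L0 : 0 < `|lam| by rewrite normr_gt0.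
have := @continuant_green _ c v m n nm => /(_ _) hg.
have {}hg : continuant c m * u x = continuant (sh c n.+1) (m - n.+1) * u (p - 1) + continuant c n * u (p + m%:Z).
  have -> : x = p - 1 + n.+1%:Z by rewrite /n; lia.
  rewrite hg; last first.
    move=> i im; rewrite /v; have := sol_rec p i su.
    by rewrite (_ : p - 1 + i.+2%:Z = p + i%:Z + 1); [rewrite (_ : p - 1 + i.+1%:Z = p + i%:Z);
      [rewrite (_ : p - 1 + i%:Z = p + i%:Z - 1)//; lia|lia]|lia].
  rewrite /v addr0; congr (_ * u _ + _ * u _); lia.
have k0 : 0 < cmod (continuant c m) by apply: lt_le_trans hD; rewrite mulr_gt0 ?exprn_gt0.
pose a1 := cmod (u (p - 1)) / `|lam| ^+ n.+1; pose a2 := cmod (u (p + m%:Z)) / `|lam| ^+ (m - n).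
have em j : (j <= m)%N -> expR (epsu * j%:R) <= expR (epsu * m%:R).
  by move=> jm; rewrite ler_expR ler_wpM2l// ler_nat.
pose A := Cu * expR (epsu * m%:R) / D.
have A0 : 0 <= A by rewrite divr_ge0 ?mulr_ge0 ?expR_ge0// ltW.
have main : cmod (u x) <= A * (a1 + a2).
  have -> : cmod (u x) = cmod (continuant c m * u x) / cmod (continuant c m) by rewrite cmodM mulrAC divff ?mul1r// gt_eqF.
  rewrite hg ler_pdivrMr//.
  have h1 : cmod (continuant (sh c n.+1) (m - n.+1)) <= Cu * `|lam| ^+ (m - n.+1) * expR (epsu * m%:R).
    rewrite /c sh_site_coef -expiD; apply: (le_trans (gb _ _)); rewrite ler_wpM2l ?mulr_ge0 ?exprn_ge0// em//.
    exact: leq_subr.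
  have h2 : cmod (continuant c n) <= Cu * `|lam| ^+ n * expR (epsu * m%:R).
    by apply: (le_trans (gb _ _)); rewrite ler_wpM2l ?mulr_ge0 ?exprn_ge0// em// ltnW.
  apply: (le_trans (cmodD _ _)); rewrite !cmodM.
  apply: (@le_trans _ _ (A * (a1 + a2) * (`|lam| ^+ m * D))); last first.
    by rewrite ler_wpM2l// mulr_ge0// addr_ge0// divr_ge0 ?cmod_ge0 ?exprn_ge0.
  have -> : A * (a1 + a2) * (`|lam| ^+ m * D) =
    Cu * `|lam| ^+ (m - n.+1) * expR (epsu * m%:R) * cmod (u (p - 1)) +
    Cu * `|lam| ^+ n * expR (epsu * m%:R) * cmod (u (p + m%:Z)).
    have e0 : `|lam| ^+ m = `|lam| ^+ (m - n.+1) * `|lam| ^+ n.+1.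
      by rewrite -exprD; congr (_ ^+ _); clear -nm; lia.
    have e1 : `|lam| ^+ m = `|lam| ^+ (m - n) * `|lam| ^+ n.
      by rewrite -exprD; congr (_ ^+ _); clear -nm; lia.
    rewrite /A /a1 /a2 mulrDr mulrDl; congr (_ + _).
      by rewrite e0; field; rewrite expf_neq0 ?gt_eqF.
    by rewrite e1; field; rewrite expf_neq0 ?gt_eqF.
  by apply: lerD; rewrite ler_wpM2r ?cmod_ge0.
have e2 : 2 * Cu * expR (epsu * m%:R) / D = A * 2 by rewrite /A; ring.
have f1 : absz (p + m%:Z - x)%R = (m - n)%N by rewrite /n; clear -px xm; lia.
have f2 : absz (x - p + 1)%R = n.+1 by rewrite /n; clear -px xm; lia.
have f3 : absz (p - 1 - x)%R = n.+1 by rewrite /n; clear -px xm; lia.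
rewrite e2; clearbody A.
have [le12|/ltW le12] := leP a1 a2.
  exists (p + m%:Z), (m - n)%N; split => //; first by right.
  apply: (le_trans main); rewrite -!mulrA ler_wpM2l// [_^-1 * _]mulrC -/a2; lra.
exists (p - 1), n.+1; split => //; first by left.
apply: (le_trans main); rewrite -!mulrA ler_wpM2l// [_^-1 * _]mulrC -/a1; lra.
Qed.

(* Windows for the two-point step: all box starts for which one point is at distance >= g
   from both ends of the box, plus 2g-1 such starts for the other point, chosen on the side
   away from the mirror image so that no two centres are exchanged by the reflection. *)
Lemma window_choice (x y n0 : int) (m g : nat) : (0 < g)%N -> (6 * g < m)%N ->
  (4 * m <= absz (x - y)%R)%N -> (2 * g <= absz (x + y - n0)%R)%N ->
  exists s1 s2 : int,
    let n1 := (m + 2 - 2 * g)%N in let n2 := (2 * g - 1)%N in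
    let S := fun p : int => (s1 <= p < s1 + n1%:Z) || (s2 <= p < s2 + n2%:Z) in
    [/\ s1 + n1%:Z <= s2 \/ s2 + n2%:Z <= s1,
     forall p, S p -> (x - m%:Z + g%:Z <= p <= x - g%:Z + 1) || (y - m%:Z + g%:Z <= p <= y - g%:Z + 1) &
     forall p q, S p -> S q -> p != q -> p + q + m%:Z - 1 != n0].
Proof.
move=> g0 gm xy xyn.
have [c1|c1] := leqP (absz (n0 - 2 * x)%R) (2 * m).
  have [c|c] := lerP n0 (2 * x).
    by exists (y - m%:Z + g%:Z), (x - 3 * g%:Z + 3); split=> [|p|p q]; lia.
  by exists (y - m%:Z + g%:Z), (x - m%:Z + g%:Z); split=> [|p|p q]; lia.
have [c2|c2] := leqP (absz (n0 - 2 * y)%R) (2 * m).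
  have [c|c] := lerP n0 (2 * y).
    by exists (x - m%:Z + g%:Z), (y - 3 * g%:Z + 3); split=> [|p|p q]; lia.
  by exists (x - m%:Z + g%:Z), (y - m%:Z + g%:Z); split=> [|p|p q]; lia.
have [c|c] := lerP (x + y) n0.
  by exists (x - m%:Z + g%:Z), (y - m%:Z + g%:Z); split=> [|p|p q]; lia.
by exists (x - m%:Z + g%:Z), (y - 3 * g%:Z + 3); split=> [|p|p q]; lia.
Qed.


(** Two orders that are both nearly resonant would make their difference a small divisor. *)
Lemma resonance_unique kappa tau beta M N theta (n n0 : int) : 0 < tau -> dioph_upto kappa tau beta M ->
  (2 * N < M)%N -> (absz n <= N)%N -> (absz n0 <= N)%N -> n != n0 ->
  chord (2 * theta + n0%:~R * beta) <= chord (2 * theta + n%:~R * beta) ->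
  polyfac kappa tau (2 * N) / 2 <= chord (2 * theta + n%:~R * beta).
Proof.
move=> t0 dc NM nN n0N nn le.
have : polyfac kappa tau (2 * N) <= chord ((n - n0)%:~R * beta).
  by apply: (DC_int t0 dc NM); [rewrite subr_eq0|clear -nN n0N; lia].
have -> : (n - n0)%:~R * beta = (2 * theta + n%:~R * beta) - (2 * theta + n0%:~R * beta).
  by rewrite intrB; ring.
have := chordB (2 * theta + n%:~R * beta) (2 * theta + n0%:~R * beta).
lra.
Qed.

Lemma exists_resonance (f : int -> R) N : exists2 n0 : int, (absz n0 <= N)%N &
  forall n : int, (absz n <= N)%N -> f n0 <= f n.
Proof.
pose h (i : 'I_(N.*2).+1) := f (i%:Z - N%:Z).
have [i _ hi] := @arg_minP _ _ _ (ord0 : 'I_(N.*2).+1) xpredT h isT.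
exists (i%:Z - N%:Z); first by have := ltn_ord i; clear; lia.
move=> n nN; have jN : (absz (n + N%:Z)%R < (N.*2).+1)%N by clear -nN; lia.
have := hi (Ordinal jN) isT; rewrite /h /=; congr (_ <= f _); clear -nN; lia.
Qed.

(** Only the order n0 may be strongly resonant, and the windows of [window_choice] never meet it.
    They hold x or y at depth g inside the box, whence d >= g. *)
Lemma small_step kappa tau eps : 0 < tau -> 0 < eps -> exists (C : R) (M0 : nat), 0 <= C /\
  forall beta M, (M0 <= M)%N -> dioph_upto kappa tau beta M ->
  forall lam theta E u Cu epsu (eta : R) (x y n0 : int) (m g N : nat),
  lam != 0 -> 0 <= Cu -> 0 <= epsu -> is_sol lam beta theta E u -> growth_bound lam beta E Cu epsu ->
  0 < eta <= 1 -> (0 < g)%N -> (6 * g < m)%N ->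
  (4 * m <= absz (x - y)%R)%N -> (2 * g <= absz (x + y - n0)%R)%N ->
  (absz (x - y)%R + m <= N < M)%N ->
  (forall p q : int, (absz (p - x)%R <= m)%N || (absz (p - y)%R <= m)%N ->
     (absz (q - x)%R <= m)%N || (absz (q - y)%R <= m)%N -> p + q + m%:Z - 1 != n0 ->
     eta <= chord (2 * theta + (p + q + m%:Z - 1)%:~R * beta)) ->
  exists x' y' d, [/\ moved x y x' y' d, (g <= d <= m)%N &
    cmod (u x) * cmod (u y) <=
     (2 * Cu * expR (epsu * m%:R) / (eta ^+ 2 * expR (- (eps * N%:R + C)))) / `|lam| ^+ d *
     (cmod (u x') * cmod (u y'))].
Proof.
move=> t0 e0; have [C [M0 [C0 hb]]] := box_two kappa t0 e0.
exists C, M0; split => // beta M MM dc lam theta E u Cu epsu eta x y n0 m g N l0 Cu0 eu0 su gb eta01 g0 gm xy xyn /andP[xyN NM] he.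
have [s1 [s2 [dis hS hn]]] := window_choice g0 gm xy xyn.
have /andP[eta0 _] := eta01.
have [||||||p pS hp] := hb beta M MM dc lam E theta s1 s2 (m + 2 - 2 * g)%N (2 * g - 1)%N m N eta.
- by clear -g0 gm; lia.
- by rewrite NM andbT; clear -g0 gm xy xyN; lia.
- by [].
- exact: dis.
- move=> p q pS qS; have := hS p pS; have := hS q qS; clear -g0 gm xy xyN; lia.
- move=> p q pS qS pq; have := hS p pS; have := hS q qS => h1 h2.
  have := he p q; rewrite !intrD intrN -[m%:~R]/(m%:R); apply.
  + by clear -h2 g0 gm; lia.
  + by clear -h1 g0 gm; lia.
  + exact: hn.
have D0 : 0 < eta ^+ 2 * expR (- (eps * N%:R + C)) by rewrite mulr_gt0 ?exprn_gt0 ?expR_gt0.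
have [/andP[p1 p2]|/andP[p1 p2]] := orP (hS p pS).
  have px : p <= x by clear -p2 g0; lia.
  have xp : x < p + m%:Z by clear -p1 g0; lia.
  have [x' [d [d1 d2 hd]]] := green_step l0 D0 Cu0 eu0 su gb hp px xp.
  exists x', y, d; split; [by left| |].
    by clear -d2 p1 p2 px xp g0; lia.
  by rewrite mulrA ler_wpM2r ?cmod_ge0.
have px : p <= y by clear -p2 g0; lia.
have xp : y < p + m%:Z by clear -p1 g0; lia.
have [x' [d [d1 d2 hd]]] := green_step l0 D0 Cu0 eu0 su gb hp px xp.
exists x, x', d; split; [by right| |].
  by clear -d2 p1 p2 px xp g0; lia.
by rewrite [leLHS]mulrC [cmod (u x) * _]mulrC mulrA ler_wpM2r ?cmod_ge0.
Qed.

(* Here [eta] is the distance to resonance, which enters only to the first power because a single box is used. *)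
Lemma big_step kappa tau eps : 0 < tau -> 0 < eps -> exists (C : R) (M0 : nat), 0 <= C /\
  forall beta M, (M0 <= M)%N -> dioph_upto kappa tau beta M ->
  forall lam theta E u Cu epsu (eta : R) (x y : int),
  lam != 0 -> 0 <= Cu -> 0 <= epsu -> is_sol lam beta theta E u -> growth_bound lam beta E Cu epsu ->
  0 < eta <= 1 -> x <> y -> (2 * absz (x - y)%R + 2 < M)%N ->
  (forall n : int, (absz (n - x - y)%R <= 6 * absz (x - y)%R + 6)%N ->
     eta <= chord (2 * theta + n%:~R * beta)) ->
  exists x' y' d, [/\ moved x y x' y' d, (absz (x - y)%R <= 2 * d)%N, (d <= 2 * absz (x - y)%R + 2)%N &
    cmod (u x) * cmod (u y) <=
     (2 * Cu * expR (epsu * (2 * absz (x - y)%R + 2)%:R) /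
       (eta * expR (- (eps * (2 * absz (x - y)%R + 2)%:R + C)))) / `|lam| ^+ d *
     (cmod (u x') * cmod (u y'))].
Proof.
move=> t0 e0; have [C [M0 [C0 hb]]] := box_one kappa t0 e0.
exists C, M0; split => // beta M MM dc lam theta E u Cu epsu eta x y l0 Cu0 eu0 su gb eta01 xy mM he.
wlog xly : x y xy mM he / x < y => [hw|].
  have [lt|gt|e] := ltgtP x y; [exact: (hw x y)| |by case: xy].
  have e1 : absz (y - x)%R = absz (x - y)%R by clear; lia.
  have := hw y x; rewrite e1 => /(_ (nesym xy) mM).
  have he' : forall n : int, (absz (n - y - x)%R <= 6 * absz (x - y)%R + 6)%N ->
     eta <= chord (2 * theta + n%:~R * beta).
    by move=> n hn; apply: he; clear -hn; lia.
  move=> /(_ he' gt) [y' [x' [d [mv d1 d2 h]]]]; exists x', y', d; split => //.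
    by case: mv => -[a b]; [right|left].
  by rewrite [leLHS]mulrC [cmod (u x') * _]mulrC.
set D := absz (x - y)%R in mM he *; set m := (2 * D + 2)%N in mM *.
pose g := (D.+1 %/ 2)%N.
have Dg : (D <= 2 * g <= D.+1)%N by rewrite /g; clear; lia.
have yE : y = x + D%:Z by rewrite /D; clear -xly; lia.
have D0 : (0 < D)%N by rewrite /D; clear -xly; lia.
have g0 : (0 < g)%N by clear -Dg D0; lia.
(* With m = 2D + 2 and 2g about D, each of the m + 1 boxes from here on holds x or y at depth at
   least g, so that 2d >= D. *)
pose s := x - m%:Z + g%:Z.
have /andP[eta0 _] := eta01.
have [|i im hp] := hb beta M MM dc lam E theta s m eta mM eta01.
  move=> i j im jm ij; have := he (s + i%:Z + (s + j%:Z) + m%:Z - 1).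
  rewrite !intrD intrN -[m%:~R]/(m%:R); apply; rewrite /s yE; clear -im jm ij Dg.
  by rewrite /m; lia.
have hD : 0 < eta * expR (- (eps * m%:R + C)) by rewrite mulr_gt0 ?expR_gt0.
have [c|c] := leqP i (m - 2 * g + 1).
  have px : s + i%:Z <= x by rewrite /s; clear -c im Dg D0 g0; rewrite /m in c *; lia.
  have xp : x < s + i%:Z + m%:Z by rewrite /s; clear -g0; lia.
  have [x' [d [d1 d2 hd]]] := green_step l0 hD Cu0 eu0 su gb hp px xp.
  exists x', y, d; split; [by left| | |].
  - by move: d2; rewrite /s; clear -c im Dg D0 g0; rewrite /m in c im *; lia.
  - by move: d2; rewrite /s; clear -c im Dg D0 g0; rewrite /m in c im *; lia.
  - by rewrite mulrA ler_wpM2r ?cmod_ge0.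
have px : s + i%:Z <= y by rewrite /s yE; clear -c im Dg D0 g0; rewrite /m in c im *; lia.
have xp : y < s + i%:Z + m%:Z by rewrite /s yE; clear -c im Dg D0 g0; rewrite /m in c im *; lia.
have [x' [d [d1 d2 hd]]] := green_step l0 hD Cu0 eu0 su gb hp px xp.
exists x, x', d; split; [by right| | |].
- by move: d2; rewrite /s yE; clear -c im Dg D0 g0; rewrite /m in c im *; lia.
- by move: d2; rewrite /s yE; clear -c im Dg D0 g0; rewrite /m in c im *; lia.
- by rewrite [leLHS]mulrC [cmod (u x) * _]mulrC mulrA ler_wpM2r ?cmod_ge0.
Qed.

End Step.

(** * The two-point estimate with sharp rate *)

Section Decay.
Variable R : realType.
Implicit Types (t beta tau eps eta lam theta : R) (E : R[i]) (u : int -> R[i]).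

Lemma archi_nat (x : R) : exists n : nat, x <= n%:R.
Proof. by exists (Num.bound `|x|); apply: ltW; apply: le_lt_trans (archi_boundP (normr_ge0 x)); exact: ler_norm. Qed.

(** The box size is a small fraction of k and the minimal step a small fraction of it, yet the
    number of steps stays below 4 P^2, independently of k. *)
Lemma scales (P k : nat) : (10 <= P)%N -> (4 * P * P <= k)%N ->
  [/\ (0 < (k %/ P) %/ P)%N, (6 * ((k %/ P) %/ P) < k %/ P)%N & (k <= 4 * P * P * ((k %/ P) %/ P))%N].
Proof.
move=> P10 Pk; have P0 : (0 < P)%N by lia.
have := divn_eq k P; have := ltn_pmod k P0; have := divn_eq (k %/ P) P; have := ltn_pmod (k %/ P) P0.
move: (k %/ P)%N (k %% P)%N => m b; move: (m %/ P)%N (m %% P)%N => g a h1 h2 h3 h4.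
have g0 : (0 < g)%N.
  rewrite lt0n; apply/eqP => g0; move: h2; rewrite g0 mul0n add0n => e; nia.
split => //; first nia.
have : (4 * (m * P + b) <= 4 * (P * P * g + P * P + P))%N by nia.
nia.
Qed.

Lemma scales_le (P k : nat) : (10 <= P)%N -> (k %/ P * P <= k)%N /\ (10 * (k %/ P) <= k)%N.
Proof.
move=> P10; have := leq_divM k P; move: (k %/ P)%N => m h; split=> //; nia.
Qed.

Theorem two_point_decay (kappa : nat) tau lam eps : 0 < tau -> 1 < `|lam| -> 0 < eps ->
  exists2 epsu, 0 < epsu & forall Cu, 1 <= Cu -> exists k0 : nat, forall k, (k0 <= k)%N ->
  forall beta M, (100 * k < M)%N -> dioph_upto kappa tau beta M ->
  forall theta E u, is_sol lam beta theta E u -> growth_bound lam beta E Cu epsu ->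
  forall r0, 0 < r0 -> (forall n : int, (absz n <= 100 * k)%N -> r0 <= chord (2 * theta + n%:~R * beta)) ->
  forall Psi, 0 <= Psi -> (forall x y : int, (absz x <= 100 * k)%N -> (absz y <= 100 * k)%N ->
    cmod (u x) * cmod (u y) <= Psi) ->
  cmod (u 0) * cmod (u k%:Z) <= expR (- ((ln `|lam| - eps) * k%:R)) / r0 * Psi.
Proof.
move=> t0 l1 e0; have L0 : 0 < ln `|lam| by exact: ln_gt0.
have lp : 0 < `|lam| by apply: lt_trans l1.
have ln0 : lam != 0 by rewrite -normr_gt0.
(* The walk stops with a budget of at most 5m left, where m = k/P; P is chosen so that |lam|^(5m) <=
   e^(eps k/4). *)
have [P1 hP1] := archi_nat (20 * ln `|lam| / eps).
pose P := (10 + P1)%N; have P10 : (10 <= P)%N by rewrite leq_addr.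
have hP : 20 * ln `|lam| <= eps * P%:R.
  by move: hP1; rewrite ler_pdivrMr// => /le_trans; apply; rewrite mulrC ler_pM2l// ler_nat leq_addl.
pose J := (4 * P * P)%N.
(* Each ordinary step costs 171 = 1 + 160 + 10 units of e1 k: the growth factor, eta^2 at orders up
   to 80k, and the box products at range 10k. The one resonant step costs 20. *)
pose e1 := eps / (4 * (20 + 171 * J%:R)).
have J0 : 0 <= J%:R :> R by rewrite ler0n.
have den0 : 0 < 4 * (20 + 171 * J%:R) :> R by lra.
have e10 : 0 < e1 by rewrite divr_gt0.
have e1E : e1 * (20 + 171 * J%:R) = eps / 4 by rewrite /e1; field; lra.
exists e1 => // Cu Cu1; have Cu0 : 0 <= Cu by lra.
have [C1 [M1 [C10 hs]]] := small_step kappa t0 e10.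
have [C2 [M2 [C20 hb]]] := big_step kappa t0 e10.
have [C3 [C30 hp]] := poly_le_exp kappa t0 e10.
pose K1 := ln (8 * Cu) + 2 * C3 + C1; pose K2 := ln (4 * Cu) + C2.
have lnC8 : 0 <= ln (8 * Cu) by apply: ln_ge0; lra.
have lnC4 : 0 <= ln (4 * Cu) by apply: ln_ge0; lra.
have K10 : 0 <= K1 by rewrite /K1; lra.
have [k1 hk1] := archi_nat ((K2 + J%:R * K1) * 4 / eps).
exists (J + k1 + M1 + M2 + 10)%N => k hk beta M kM dc theta E u su gb r0 r00 hr Psi Psi0 hPsi.
have kJ : (J <= k)%N by clear -hk; lia.
have k10 : (10 <= k)%N by clear -hk; lia.
have M1M : (M1 <= M)%N by clear -hk kM; lia.
have M2M : (M2 <= M)%N by clear -hk kM; lia.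
have k1k : (k1 <= k)%N by clear -hk; lia.
clear hk.
have kR : 0 < k%:R :> R by rewrite ltr0n; apply: leq_trans k10.
have [g0 gm kg] := scales P10 kJ; have [mP m10] := scales_le k P10.
set m := (k %/ P)%N in g0 gm kg mP m10; set g := (m %/ P)%N in g0 gm kg.
(* The strongest resonance in range; by [resonance_unique] every other order is at distance at least
   eta. *)
have [n0 n0N hn0] := exists_resonance (fun n : int => chord (2 * theta + n%:~R * beta)) (40 * k).
pose eta := polyfac kappa tau (2 * (40 * k)) / 2.
have eta0 : 0 < eta by rewrite divr_gt0// polyfac_gt0.
have eta1 : eta <= 1 by rewrite ler_pdivrMr// mul1r (le_trans (polyfac_le1 _ _ _))// ler1n.
have etaE : expR (- (e1 * (2 * (40 * k))%:R + C3)) / 2 <= eta.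
  by rewrite /eta ler_pM2r ?invr_gt0//; exact: hp.
have r02 : r0 <= 2.
  by apply: le_trans (chord_le2 (2 * theta + 0%:~R * beta)); apply: hr.
pose Z := expR (K1 + 171 * e1 * k%:R); pose Zb := expR (K2 + 20 * e1 * k%:R) / r0.
have Zb1 : 1 <= Zb.
  rewrite ler_pdivlMr// mul1r; apply: (le_trans r02).
  apply: (@le_trans _ _ (expR (ln (4 * Cu)))); first by rewrite lnK ?posrE; clear -Cu1; lra.
  by rewrite ler_expR /K2 -addrA lerDl; apply: addr_ge0; [exact: C20|rewrite -mulrA; apply: mulr_ge0 => //; apply: mulr_ge0 => //; exact: ltW].
have e1k : 0 <= e1 * k%:R by apply: mulr_ge0; first exact: ltW.
have Z1 : 1 <= Z.
  by rewrite -expR0 ler_expR -mulrA; apply: addr_ge0; [exact: K10|apply: mulr_ge0].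
have main := @walk_mirror R `|lam| Z Zb Psi (fun x y => cmod (u x) * cmod (u y)) m g (2 * k) (12 * k) n0.
have gm2 : (2 * g <= m)%N by clear -gm; lia.
have N12 : (5 * (2 * k) + 2 <= 12 * k)%N by clear -k10; lia.
have {}main := main (ltW l1) Z1 Zb1 Psi0 gm2 N12.
have HS (x y : int) : (absz x <= 2 * k)%N -> (absz y <= 2 * k)%N ->
  (4 * m <= absz (x - y)%R)%N -> (2 * g <= absz (x + y - n0)%R)%N ->
  exists x' y' d, [/\ moved x y x' y' d, (g <= d <= m)%N &
    cmod (u x) * cmod (u y) <= Z / `|lam| ^+ d * (cmod (u x') * cmod (u y'))].
  move=> xk yk xy xyn.
  have eta01 : 0 < eta <= 1 by rewrite eta0.
  have [|p q hpx hqx pqn|x' [y' [d [mv hd h]]]] := hs beta M M1M dc lam theta E u Cu e1 eta x y n0 m g (10 * k)%N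
    ln0 Cu0 (ltW e10) su gb eta01 g0 gm xy xyn.
  - by clear -xk yk m10 kM; lia.
  - have pk : (absz p <= 2 * k + m)%N by clear -hpx xk yk; lia.
    have qk : (absz q <= 2 * k + m)%N by clear -hqx xk yk; lia.
    have nN : (absz (p + q + m%:Z - 1)%R <= 40 * k)%N by clear -pk qk m10 k10; lia.
    apply: (resonance_unique t0 dc (N := 40 * k) (n0 := n0)) => //; first by clear -kM; lia.
    exact: hn0.
  exists x', y', d; split => //; apply: (le_trans h).
  rewrite ler_wpM2r ?mulr_ge0 ?cmod_ge0// ler_wpM2r ?invr_ge0 ?exprn_ge0//.
  have x1 : expR (e1 * m%:R) <= expR (e1 * k%:R).
    by rewrite ler_expR ler_pM2l// ler_nat; clear -m10; lia.
  have x2 : (expR (- (e1 * (2 * (40 * k))%:R + C3)) / 2) ^+ 2 <= eta ^+ 2.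
    apply: lerXn2r; [by rewrite nnegrE divr_ge0 ?expR_ge0|by rewrite nnegrE; exact: ltW|exact: etaE].
  rewrite ler_pdivrMr; last by rewrite mulr_gt0 ?exprn_gt0// expR_gt0.
  apply: (@le_trans _ _ (2 * Cu * expR (e1 * k%:R))); first by rewrite ler_wpM2l// mulr_ge0.
  apply: (@le_trans _ _ (Z * ((expR (- (e1 * (2 * (40 * k))%:R + C3)) / 2) ^+ 2 * expR (- (e1 * (10 * k)%:R + C1))))); last first.
    by rewrite ler_wpM2l ?expR_ge0// ler_wpM2r ?expR_ge0.
  have -> : Z * ((expR (- (e1 * (2 * (40 * k))%:R + C3)) / 2) ^+ 2 * expR (- (e1 * (10 * k)%:R + C1))) =
    2 * Cu * expR (e1 * k%:R).
    have -> : 2 * Cu = expR (ln (8 * Cu)) / 4 by rewrite lnK ?posrE; [field|clear -Cu1; lra].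
    rewrite expr_div_n -expRM_natl.
    have -> : Z = expR (e1 * k%:R) * expR (ln (8 * Cu)) * expR (2%:R * (e1 * (2 * (40 * k))%:R + C3)) * expR (e1 * (10 * k)%:R + C1).
      by rewrite /Z -!expRD; congr expR; rewrite /K1 !natrM; ring.
    rewrite mulrN !expRN; field; rewrite !gt_eqF ?expR_gt0//.
  exact: lexx.
have HB (x y : int) : (absz x <= 2 * k)%N -> (absz y <= 2 * k)%N -> x <> y ->
  exists x' y' d, [/\ moved x y x' y' d, (absz (x - y)%R <= 2 * d)%N, (d <= 2 * absz (x - y)%R + 2)%N &
    cmod (u x) * cmod (u y) <= Zb / `|lam| ^+ d * (cmod (u x') * cmod (u y'))].
  move=> xk yk xy.
  have r01 : 0 < r0 / 2 <= 1 by clear -r00 r02; apply/andP; split; lra.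
  have [||x' [y' [d [mv d1 d2 h]]]] := hb beta M M2M dc lam theta E u Cu e1 (r0 / 2) x y
    ln0 Cu0 (ltW e10) su gb r01 xy.
  - by clear -xk yk kM k10; lia.
  - move=> n hn; apply: (@le_trans _ _ r0); first by clear -r00; lra.
    by apply: hr; clear -hn xk yk k10; lia.
  exists x', y', d; split => //; apply: (le_trans h).
  rewrite ler_wpM2r ?mulr_ge0 ?cmod_ge0// ler_wpM2r ?invr_ge0 ?exprn_ge0//.
  set D := (2 * absz (x - y)%R + 2)%N.
  have Dk : e1 * D%:R <= e1 * (10 * k%:R).
    by rewrite ler_pM2l// -natrM ler_nat /D; clear -xk yk k10; lia.
  rewrite ler_pdivrMr; last by rewrite mulr_gt0 ?expR_gt0// divr_gt0.
  have -> : 2 * Cu = expR (ln (4 * Cu)) / 2 by rewrite lnK ?posrE; [field|clear -Cu1; lra].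
  have -> : Zb * (r0 / 2 * expR (- (e1 * D%:R + C2))) = (expR (K2 + 20 * e1 * k%:R) * expR (- (e1 * D%:R + C2))) / 2.
    by rewrite /Zb; field; rewrite gt_eqF.
  rewrite mulrAC ler_pM2r ?invr_gt0// -!expRD ler_expR /K2.
  by clear -Dk; lra.
have HPsi (x y : int) : (absz x <= 12 * k)%N -> (absz y <= 12 * k)%N -> cmod (u x) * cmod (u y) <= Psi.
  by move=> xk yk; apply: hPsi; [clear -xk; lia|clear -yk; lia].
have {main HS HB HPsi} := main HS HB HPsi J k 0 k%:Z.
have a1 : (k <= J * g)%N by exact: kg.
have a2 : (absz 0 + k <= 2 * k)%N by rewrite absz0; clear; lia.
have a3 : (absz k%:Z + k <= 2 * k)%N by rewrite absz_nat; clear; lia.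
have a4 : (k <= absz (0 - k%:Z)%R)%N by clear; lia.
move=> /(_ a1 a2 a3 a4) /le_trans; apply; rewrite ler_wpM2r//.
have LX n : `|lam| ^+ n = expR (ln `|lam| * n%:R) by rewrite expRM_natr lnK.
rewrite !LX /Zb /Z -expRM_natl -expRN.
have -> : expR (K2 + 20 * e1 * k%:R) / r0 * expR (J%:R * (K1 + 171 * e1 * k%:R)) *
  expR (ln `|lam| * (5 * m)%:R) * expR (- (ln `|lam| * k%:R)) =
  expR ((K2 + 20 * e1 * k%:R) + (J%:R * (K1 + 171 * e1 * k%:R)) + (ln `|lam| * (5 * m)%:R) - (ln `|lam| * k%:R)) / r0.
  by rewrite !expRD; field; rewrite gt_eqF.
rewrite ler_pM2r ?invr_gt0// ler_expR.
have h1 : (20 * e1 + J%:R * (171 * e1)) * k%:R = eps / 4 * k%:R by rewrite -e1E; ring.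
have h2 : ln `|lam| * (5 * m)%:R <= eps / 4 * k%:R.
  have : 20 * ln `|lam| * m%:R <= eps * P%:R * m%:R by rewrite ler_wpM2r.
  have : eps * (P%:R * m%:R) <= eps * k%:R by rewrite ler_pM2l// -natrM ler_nat mulnC.
  rewrite natrM; clear; lra.
have h3 : K2 + J%:R * K1 <= eps / 4 * k%:R.
  have : k1%:R <= k%:R :> R by rewrite ler_nat.
  move/(le_trans hk1); rewrite ler_pdivrMr//; clear; lra.
have h4 : 0 <= eps * k%:R by rewrite mulr_ge0 ?ltW.
move: h1 h2 h3 h4; clear; move: K1 K2 (J%:R : R) (k%:R : R) (ln `|lam|) ((5 * m)%:R : R) => K1 K2 j continuant L mm.
lra.
Qed.

End Decay.

(** * Growth of continuants at ring eigenvalues *)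

Section Ring.
Variable R : realType.
Arguments continuant : simpl never.
Implicit Types (t beta tau lam theta : R) (E z : R[i]).

Lemma expi_natz beta (q : nat) (i : nat) : expi (q%:R * beta) = 1 -> expi ((i + q)%:R * beta) = expi (i%:R * beta).
Proof. by move=> h; rewrite natrD mulrDl expiD h mulr1. Qed.

Lemma DC_expi_neq1 kappa tau beta q (i : nat) : 0 < tau -> dioph_upto kappa tau beta q -> (0 < i < q)%N ->
  expi (i%:R * beta) != 1.
Proof.
move=> t0 dc iq; apply/eqP => e; have := dc i iq; rewrite /chord e subrr cmod0.
by rewrite leNgt divr_gt0// exprn_gt0// ltr0n; case/andP: iq.
Qed.

Lemma root_sum (w : R[i]) q : w ^+ q = 1 -> w != 1 -> \sum_(j < q) w ^+ j = 0.
Proof.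
move=> wq w1; have := subrX1 w q; rewrite wq subrr => /esym/eqP.
by rewrite mulf_eq0 subr_eq0 (negPf w1) => /eqP.
Qed.

Section Fix.
Variables (kappa : nat) (tau beta : R) (q : nat).
Hypotheses (tau0 : 0 < tau) (q0 : (0 < q)%N) (zq : expi (q%:R * beta) = 1) (dc : dioph_upto kappa tau beta q).
Let zeta := expi beta.

Let zetaE i : expi (i%:R * beta) = zeta ^+ i. Proof. exact: expiX. Qed.
Let zetaq : zeta ^+ q = 1. Proof. by rewrite -zetaE. Qed.
Let zeta1 i : (0 < i < q)%N -> zeta ^+ i != 1.
Proof. by move=> iq; rewrite -zetaE; exact: DC_expi_neq1 dc iq. Qed.
Let zeta0 : zeta != 0. Proof. exact: expi_neq0. Qed.
Let qC : (q%:R : R[i]) != 0. Proof. by rewrite pnatr_eq0 -lt0n. Qed.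

(** A Cauchy estimate: below degree q, averaging over the q-th roots of unity recovers each
    coefficient. *)
Lemma unit_coef (P : {poly R[i]}) (B : R) : (forall i, (q <= i)%N -> P`_i = 0) ->
  (forall t, cmod P.[expi t] <= B) -> forall i, cmod P`_i <= B.
Proof.
move=> Pq hB i; have [iq|iq] := leqP q i.
  by rewrite Pq// cmod0; apply: le_trans (hB 0); exact: cmod_ge0.
have sP : (size P <= q)%N by apply/leq_sizeP.
have e : q%:R * P`_i = \sum_(j < q) P.[zeta ^+ j] * zeta ^- (i * j).
  under eq_bigr => j _ do rewrite (horner_coef_wide _ sP) mulr_suml.
  rewrite exchange_big (bigD1 (Ordinal iq))//= [X in _ + X]big1 => [|k ki].
    rewrite addr0; under eq_bigr => j _.
      rewrite -exprM mulnC mulfK ?expf_neq0//; over.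
    by rewrite sumr_const card_ord mulr_natl.
  have -> : \sum_(j < q) P`_k * zeta ^+ j ^+ k * zeta ^- (i * j) =
    P`_k * \sum_(j < q) (zeta ^+ k / zeta ^+ i) ^+ j.
    rewrite mulr_sumr; apply: eq_bigr => j _.
    by rewrite -mulrA expr_div_n -!exprM [(k * j)%N]mulnC.
  rewrite root_sum ?mulr0//.
    by rewrite expr_div_n -!exprM ![(_ * q)%N]mulnC !exprM zetaq !expr1n divr1.
  apply/eqP => /(congr1 (fun a => a * zeta ^+ i)); rewrite divfK ?expf_neq0// mul1r => eki.
  have {}ki : k != i :> nat by move: ki; rewrite -val_eqE.
  have [lt|gt|] := ltngtP k i; last by move/eqP: ki.
    have := @zeta1 (i - k)%N; rewrite subn_gt0 lt (leq_ltn_trans (leq_subr _ _) iq) => /(_ isT)/eqP; apply.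
    by apply: (mulfI (expf_neq0 k zeta0)); rewrite -exprD subnKC ?mulr1// ltnW.
  have := @zeta1 (k - i)%N; rewrite subn_gt0 gt (leq_ltn_trans (leq_subr _ _) (ltn_ord k)) => /(_ isT)/eqP; apply.
  by apply: (mulfI (expf_neq0 i zeta0)); rewrite -exprD subnKC ?mulr1 ?eki// ltnW.
have : q%:R * cmod P`_i <= q%:R * B.
  rewrite -(cmod_nat R q) -cmodM e; apply: (le_trans (cmod_sum _ _ _)).
  have -> : cmod (q%:R : R[i]) * B = \sum_(j < q) B by rewrite cmod_nat sumr_const card_ord mulr_natl.
  apply: ler_sum => j _; rewrite cmodM cmodV cmodX cmod_expi expr1n invr1 mulr1.
  by rewrite -zetaE; exact: hB.
by rewrite ler_pM2l// ltr0n.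
Qed.

(** The Laurent coefficients are bounded by [unit_coef], and at radius r each monomial grows by at
    most r^m. *)
Lemma continuant_radius lam E (m : nat) (B r : R) z : 1 <= r -> (m.*2 < q)%N -> cmod z = r ->
  (forall t, cmod (continuant (site_coef lam E beta (expi t)) m) <= B) ->
  cmod (continuant (site_coef lam E beta z) m) <= (m.*2.+1)%:R * r ^+ m * B.
Proof.
move=> r1 mq zr hB; have [F [F0 _ _ hF]] := continuant_laurent lam E beta m.
have z0 : z != 0 by rewrite -cmod_gt0 zr; lra.
have cF := @unit_coef F B.
have {}cF : forall i, cmod F`_i <= B.
  apply: cF => [i iq|t]; first by apply: F0; apply: leq_trans mq iq.
  by rewrite -hF ?expi_neq0// cmodM cmodX cmod_expi expr1n mul1r.
have r0 : 0 < r by lra.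
have rm : 0 < r ^+ m by rewrite exprn_gt0.
have -> : cmod (continuant (site_coef lam E beta z) m) = cmod F.[z] / r ^+ m.
  by rewrite -hF// cmodM cmodX zr mulrAC divff ?mul1r// gt_eqF.
rewrite ler_pdivrMr// (_ : _ * B * _ = \sum_(i < m.*2.+1) B * r ^+ m.*2); last first.
  by rewrite sumr_const card_ord -[RHS]mulr_natl -addnn exprD; ring.
rewrite (horner_coef_wide _ (_ : (size F <= m.*2.+1)%N)); last by apply/leq_sizeP => j; exact: F0.
apply: (le_trans (cmod_sum _ _ _)); apply: ler_sum => i _; rewrite cmodM cmodX zr.
apply: ler_pM; rewrite ?cmod_ge0 ?exprn_ge0 ?(ltW r0)//.
by apply: ler_weXn2l => //; rewrite -ltnS.
Qed.

(** The trace of the transfer matrix over one period, the Hill discriminant. *)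
Definition ring_trace lam E z := continuant (site_coef lam E beta z) q - continuant (sh (site_coef lam E beta z) 1) (q - 2).

Lemma cpot_per lam E z i : site_coef lam E beta z (i + q) = site_coef lam E beta z i.
Proof. by rewrite /site_coef expi_natz. Qed.

Hypothesis q3 : (2 < q)%N.

(** Cyclicity of the trace: starting one site later conjugates the monodromy matrix. *)
Lemma ring_trace_shift lam E z : ring_trace lam E (z * zeta) = ring_trace lam E z.
Proof.
have {1}-> : z * zeta = z * expi (1%:R * beta) by rewrite mul1r.
rewrite /ring_trace -sh_site_coef; set c := site_coef _ _ _ _.
have -> : sh (sh c 1) 1 = sh c 2 by apply/funext => i; rewrite /sh; congr c; lia.
have [m qm] : exists m, q = m.+2 by exists (q - 2)%N; lia.
have cm : c m.+2 = c 0%N by rewrite -qm -[q]add0n /c cpot_per.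
rewrite qm !subSS subn0 (continuantSSl c) (continuantSS (sh c 1)) (_ : sh c 1 m.+1 = c 0%N); last by rewrite /sh addn1.
ring.
Qed.

(** Chambers' formula: invariance under z -> zeta z leaves only the powers z^-q, 1, z^q. The outer
    coefficients have modulus |lam|^q, and the trace 2 at z1 bounds the middle one. *)
Lemma ring_trace_bound lam E z z1 (r : R) : 1 <= `|lam| -> 1 <= r -> cmod z = r -> cmod z1 = 1 ->
  ring_trace lam E z1 = 2 -> cmod (ring_trace lam E z) <= 6 * (`|lam| ^+ q * r ^+ q).
Proof.
move=> l1 r1 zr z11 tr2.
have [F1 [a1 b1 c1 e1]] := continuant_laurent lam E beta q.
have [F2 [a2 b2 c2 e2]] := continuant_laurent lam E beta (q - 2).
(* z^q times the trace as a polynomial; zeta^-(q-2) cancels the power of zeta in (zeta z)^(q-2). *)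
pose F := F1 - zeta ^- (q - 2) *: ('X^2 * (F2 \Po (zeta *: 'X))).
have compc i : (F2 \Po (zeta *: 'X))`_i = F2`_i * zeta ^+ i.
  rewrite coef_comp_poly; under eq_bigr => j _ do rewrite exprZn coefZ coefXn.
  have [iF|iF] := ltnP i (size F2).
    rewrite (bigD1 (Ordinal iF))//= eqxx mulr1 big1 ?addr0// => j ji.
    by move: ji; rewrite -val_eqE /= eq_sym => /negPf ->; rewrite !mulr0.
  rewrite big1 ?nth_default ?mul0r// => j _.
  by rewrite (gtn_eqF (leq_trans (ltn_ord j) iF)) !mulr0.
have FE w : w != 0 -> F.[w] = w ^+ q * ring_trace lam E w.
  move=> w0; rewrite /F hornerD hornerN hornerZ [('X^2 * _).[_]]hornerM hornerXn horner_comp hornerZ hornerX.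
  rewrite -e1// -e2 ?mulf_neq0//.
  have -> : site_coef lam E beta (zeta * w) = sh (site_coef lam E beta w) 1 by rewrite sh_site_coef mul1r mulrC.
  rewrite /ring_trace mulrBr; congr (_ - _).
  have -> : w ^+ q = w ^+ 2 * w ^+ (q - 2) by rewrite -exprD; congr (_ ^+ _); lia.
  by rewrite exprMn; field; exact: expf_neq0.
have F2q i : (q.*2 < i)%N -> F`_i = 0.
  move=> iq; rewrite /F coefB coefZ coefXnM compc a1// ltnNge (_ : (2 <= i)%N) /=; last by lia.
  by rewrite a2 ?mul0r ?mulr0 ?subr0//; lia.
have F0 : cmod F`_0 = `|lam| ^+ q by rewrite /F coefB coefZ coefXnM /= mulr0 subr0.
have Ftop : cmod F`_(q.*2) = `|lam| ^+ q.
  rewrite /F coefB coefZ coefXnM compc ltnNge (_ : (2 <= q.*2)%N) /=; last by lia.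
  by rewrite a2 ?mul0r ?mulr0 ?subr0//; lia.
have Fsh w : w != 0 -> F.[w * zeta] = F.[w].
  by move=> w0; rewrite !FE ?mulf_neq0// ring_trace_shift exprMn zetaq mulr1.
have Fsh' w j : w != 0 -> F.[w * zeta ^+ j] = F.[w].
  move=> w0; elim: j => [|j IH]; first by rewrite expr0 mulr1.
  by rewrite exprSr mulrA Fsh// mulf_neq0// expf_neq0.
(* Averaging over the orbit of w under zeta kills every exponent that q does not divide. *)
have F3 w : w != 0 -> F.[w] = F`_0 + F`_q * w ^+ q + F`_(q.*2) * w ^+ q.*2.
  move=> w0; apply: (mulfI qC).
  have -> : q%:R * F.[w] = \sum_(j < q) F.[w * zeta ^+ j].
    by under eq_bigr do rewrite Fsh'//; rewrite sumr_const card_ord mulr_natl.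
  have sF : (size F <= q.*2.+1)%N by apply/leq_sizeP => j; exact: F2q.
  under eq_bigr do rewrite (horner_coef_wide _ sF).
  rewrite exchange_big /=.
  have rs (i : nat) : \sum_(j < q) F`_i * (w * zeta ^+ j) ^+ i =
      F`_i * w ^+ i * \sum_(j < q) (zeta ^+ i) ^+ j.
    by rewrite mulr_sumr; apply: eq_bigr => j _; rewrite exprMn -mulrA -!exprM mulnC.
  have rs1 (i : nat) : zeta ^+ i = 1 -> \sum_(j < q) (zeta ^+ i) ^+ j = q%:R.
    by move=> ->; under eq_bigr do rewrite expr1n; rewrite sumr_const card_ord.
  have i0 : (0 < q.*2.+1)%N by []. have i1 : (q < q.*2.+1)%N by lia. have i2 : (q.*2 < q.*2.+1)%N by [].
  rewrite (bigD1 (Ordinal i0))//= (bigD1 (Ordinal i1))/=; last by rewrite -val_eqE /=; lia.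
  rewrite (bigD1 (Ordinal i2))/=; last by rewrite -!val_eqE /=; apply/andP; split; lia.
  rewrite [X in _ + (_ + (_ + X))]big1; last first.
    move=> i; case/andP; case/andP; rewrite -!val_eqE /= => n0 n1 n2; rewrite rs root_sum ?mulr0//.
      by rewrite -exprM mulnC exprM zetaq expr1n.
    have := ltn_ord i => iq.
    have [lt|ge] := ltnP i q; first by apply: zeta1; rewrite lt lt0n n0.
    have -> : zeta ^+ i = zeta ^+ (i - q) by rewrite -{1}(subnK ge) exprD zetaq mulr1.
    by apply: zeta1; rewrite subn_gt0 ltn_neqAle eq_sym n1 ge; lia.
  rewrite !rs !rs1 ?expr0// ?zetaq//; last by rewrite -addnn exprD zetaq mulr1.
  ring.
have z10 : z1 != 0 by rewrite -cmod_gt0 z11.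
have z0 : z != 0 by rewrite -cmod_gt0 zr; lra.
have l0 : 0 <= `|lam| ^+ q by rewrite exprn_ge0.
have lq : 1 <= `|lam| ^+ q by rewrite exprn_ege1.
have rq : 1 <= r ^+ q by rewrite exprn_ege1.
have Fq : cmod F`_q <= 2 + 2 * `|lam| ^+ q.
  have -> : cmod F`_q = cmod (F`_q * z1 ^+ q) by rewrite cmodM cmodX z11 expr1n mulr1.
  have -> : F`_q * z1 ^+ q = F.[z1] - F`_0 - F`_(q.*2) * z1 ^+ q.*2 by rewrite F3//; ring.
  rewrite FE// tr2; apply: (le_trans (cmodB _ _)).
  have := cmodB (z1 ^+ q * 2) F`_0; rewrite !cmodM !cmodX z11 !expr1n !mul1r !mulr1 F0 Ftop.
  have -> : cmod (2 : R[i]) = 2 by exact: (cmod_nat R 2).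
  lra.
have -> : cmod (ring_trace lam E z) = cmod F.[z] / r ^+ q.
  by rewrite FE// cmodM cmodX zr mulrAC divff ?mul1r// gt_eqF// (lt_le_trans ltr01).
rewrite ler_pdivrMr ?(lt_le_trans ltr01)// F3//.
apply: (le_trans (cmodD _ _)); have := cmodD F`_0 (F`_q * z ^+ q).
rewrite !cmodM !cmodX zr F0 Ftop -addnn exprD.
have h1 : cmod F`_q * r ^+ q <= (2 + 2 * `|lam| ^+ q) * r ^+ q by rewrite ler_wpM2r// (le_trans ler01).
move: l0 lq rq h1; move: (`|lam| ^+ q : R) (r ^+ q : R) (cmod F`_q * r ^+ q) => L r' fq l0 lq rq h1.
have p1 : L <= L * (r' * r').
  by rewrite ler_peMr// -[leLHS]mulr1; apply: ler_pM => //; lra.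
have p2 : r' <= L * r' * r' by rewrite ler_peMl//; [lra|nra].
have p3 : L * r' <= L * r' * r' by rewrite ler_peMr ?mulr_ge0//; lra.
have -> : 6 * (L * r') * r' = 6 * (L * r' * r') by ring.
rewrite mulrA in p1; rewrite mulrA; lra.
Qed.

(* The transfer matrix over one period, written with continuants, has determinant 1 ([continuant_det]). *)
Lemma monodromy (c u : nat -> R[i]) : (forall i, u i.+2 = c i * u i.+1 - u i) ->
  u q = continuant c q.-1 * u 1%N - continuant (sh c 1) (q - 2) * u 0%N /\
  u q.+1 = continuant c q * u 1%N - continuant (sh c 1) q.-1 * u 0%N.
Proof.
move=> h; have [m qm] : exists m, q = m.+2 by exists (q - 2)%N; lia.
have hs k : forall i, (i <= k)%N -> u i.+2 = c i * u i.+1 - u i by [].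
by rewrite qm !subSS subn0; split; rewrite (continuant_sol (hs _)).
Qed.

(** A periodic solution is an eigenvector with eigenvalue 1 of a matrix of determinant 1, whose
    trace is therefore 2. *)
Lemma ring_trace_eigen lam E z (u : nat -> R[i]) : 
  (forall i, u i.+2 = site_coef lam E beta z i * u i.+1 - u i) ->
  (forall i, u (i + q)%N = u i) -> (u 0%N != 0) || (u 1%N != 0) -> ring_trace lam E z = 2.
Proof.
move=> h per u0; have [h0 h1] := monodromy h.
have [m qm] : exists m, q = m.+2 by exists (q - 2)%N; lia.
have := continuant_det (site_coef lam E beta z) m; rewrite /ring_trace.
have := per 0%N; have := per 1%N; rewrite add0n add1n h0 h1 qm !subSS subn0 /=.
move: (continuant _ m.+2) (continuant _ m.+1) (continuant (sh _ 1) m.+1) (continuant (sh _ 1) m) u0 => a b d f u0.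
move: (u 0%N) (u 1%N) u0 => x y xy e1 e2 det.
have : (a - f - 2) * x = 0 /\ (a - f - 2) * y = 0.
  split.
    have -> : (a - f - 2) * x = (a - 1) * (x - (b * y - f * x)) + b * ((a * y - d * x) - y)
      - (a * f - b * d + 1) * x by ring.
    by rewrite det e1 e2 subrr addNr; ring.
  have -> : (a - f - 2) * y = (1 + f) * ((a * y - d * x) - y) + d * (x - (b * y - f * x))
      - (a * f - b * d + 1) * y by ring.
  by rewrite det e1 e2 subrr addNr; ring.
case=> ex ey; apply/eqP; rewrite -subr_eq0; apply/eqP.
case/orP: xy => n0; [move: ex|move: ey] => /eqP; rewrite mulf_eq0 (negPf n0) orbF => /eqP //.
Qed.

(** The roots of mu^2 - tr mu + 1 are inverse to each other; take one of modulus at least 1 and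
    start from its eigenvector. Then mu = tr - 1/mu bounds it. *)
Lemma floquet lam E z : z != 0 -> exists (u : nat -> R[i]) (mu : R[i]),
  [/\ forall i, u i.+2 = site_coef lam E beta z i * u i.+1 - u i,
      forall i, u (i + q)%N = mu * u i, exists i, u i != 0,
      1 <= cmod mu & cmod mu <= cmod (ring_trace lam E z) + 1].
Proof.
move=> z0.
pose tr := ring_trace lam E z.
have [mu [mu0 hmu mu1]] : exists mu : R[i], [/\ mu != 0, mu ^+ 2 - tr * mu + 1 = 0 & 1 <= cmod mu].
  have [x xe] := @solve_monicpoly R[i] 2 (fun i => if i == 0%N then -1 else tr) isT.
  have {}xe : x ^+ 2 - tr * x + 1 = 0.
    rewrite xe !big_ord_recl big_ord0 /= expr0 expr1; ring.
  have x0 : x != 0.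
    by apply/eqP => x0; move: xe => /eqP; rewrite x0 expr0n mulr0 subr0 add0r oner_eq0.
  have [x1|/ltW x1] := lerP 1 (cmod x); first by exists x.
  exists x^-1; split; rewrite ?invr_eq0//.
    have -> : x^-1 ^+ 2 - tr * x^-1 + 1 = (x ^+ 2 - tr * x + 1) * x^-1 ^+ 2 by field.
    by rewrite xe mul0r.
  by rewrite cmodV invf_ge1// cmod_gt0.
have mub : cmod mu <= cmod tr + 1.
  have mp : 0 < cmod mu by rewrite cmod_gt0.
  have e : mu = tr - mu^-1.
    apply: (mulfI mu0); rewrite mulrBr divff//; apply/eqP; rewrite -subr_eq0; apply/eqP.
    rewrite -hmu; ring.
  rewrite {1}e; apply: (le_trans (cmodB _ _)); rewrite lerD2l cmodV invf_le1//.
pose c := site_coef lam E beta z.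
pose st := fix st (x y : R[i]) (i : nat) : R[i] * R[i] :=
  if i is j.+1 then ((st x y j).2, c j * (st x y j).2 - (st x y j).1) else (x, y).
pose U x y i := (st x y i).1.
have U0 x y : U x y 0%N = x by [].
have U1 x y : U x y 1%N = y by [].
have Urec x y i : U x y i.+2 = c i * U x y i.+1 - U x y i by [].
have [m qm] : exists m, q = m.+2 by exists (q - 2)%N; lia.
have det := continuant_det c m.
have trE : tr = continuant c q - continuant (sh c 1) m by rewrite /tr /ring_trace; congr (_ - continuant _ _); lia.
have key (x y : R[i]) : (x != 0) || (y != 0) ->
  continuant c m.+1 * y - continuant (sh c 1) m * x = mu * x -> continuant c m.+2 * y - continuant (sh c 1) m.+1 * x = mu * y ->
  exists (u : nat -> R[i]) (mu : R[i]),
  [/\ forall i, u i.+2 = site_coef lam E beta z i * u i.+1 - u i,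
      forall i, u (i + q)%N = mu * u i, exists i, u i != 0,
      1 <= cmod mu & cmod mu <= cmod (ring_trace lam E z) + 1].
  move=> xy e0 e1; exists (U x y), mu; split => //.
    have [h0 h1] := monodromy (Urec x y).
    apply: nat_ind2 => [||i IH0 IH1].
    - by rewrite add0n h0 U0 U1 qm !subSS subn0.
    - by rewrite add1n h1 U0 U1 qm.
    - by rewrite !addSn Urec -addSn IH1 IH0 Urec /c cpot_per; ring.
  by case/orP: xy => ?; [exists 0%N|exists 1%N].
rewrite trE qm in hmu.
(* If the off-diagonal entry b is nonzero, the eigenvector is (b, mu + f); otherwise the matrix is
   triangular with eigenvalues a and -f. *)
have [b0|b0] := eqVneq (continuant c m.+1) 0; last first.
  apply: (key (continuant c m.+1) (mu + continuant (sh c 1) m)); first by rewrite b0.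
    ring.
  apply/eqP; rewrite -subr_eq0; apply/eqP; rewrite -[RHS]oppr0 -hmu.
  rewrite mulrDr.
  have -> : continuant c m.+2 * continuant (sh c 1) m = -1 + continuant c m.+1 * continuant (sh c 1) m.+1.
    by rewrite -det; ring.
  ring.
move: det; rewrite b0 mul0r subr0 => det.
move: hmu b0 key det; move: (continuant _ m.+2) (continuant _ m.+1) (continuant (sh _ 1) m.+1) (continuant (sh _ 1) m) => a b d f hmu b0 key det.
have : (mu - a) * (mu + f) = 0.
  by rewrite -[RHS]hmu -[X in _ = _ + X]opprK -det; ring.
move/eqP; rewrite mulf_eq0 subr_eq0 => /orP[/eqP mua|muf].
  by apply: (key 0 1); rewrite ?oner_eq0 ?orbT ?mua ?b0//; ring.
have [mua|mua] := eqVneq mu a; first by apply: (key 0 1); rewrite ?oner_eq0 ?orbT ?mua ?b0//; ring.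
have {}muf : mu = - f by apply/eqP; rewrite -addr_eq0.
have af : a + f != 0 by rewrite -[f]opprK -muf subr_eq0 eq_sym.
by apply: (key 1 (d / (a + f))); rewrite ?oner_eq0 ?muf ?b0//; field.
Qed.

End Fix.
End Ring.

(** * Interpolation on two ellipses *)

Section Ellipse.
Variable R : realType.
Implicit Types (t beta tau lam theta x rr : R).

Lemma prod_expR_ln n (P : pred 'I_n) (f : 'I_n -> R) : (forall i, 0 < f i) ->
  \prod_(i < n | P i) f i = expR (\sum_(i < n | P i) ln (f i)).
Proof. by move=> f0; rewrite expR_sum; apply: eq_bigr => i _; rewrite lnK// posrE. Qed.

Lemma cmod_oneB_conj (r x : R) : cmod (1 - (r%:C)%C * expi (- x)) = cmod (1 - (r%:C)%C * expi x).
Proof. by rewrite -expi_conj -[RHS]cmod_conj rmorphB rmorph1 rmorphM /= oppr0. Qed.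

Lemma cmod_oneB_ge (r x : R) : 0 <= r -> 1 - r <= cmod (1 - (r%:C)%C * expi x).
Proof.
move=> r0; apply: le_trans (cmodB_ge _ _).
by rewrite cmod1 cmodM cmodR cmod_expi mulr1 ger0_norm.
Qed.

Lemma cmod_oneB_le (r x : R) : 0 <= r -> cmod (1 - (r%:C)%C * expi x) <= 1 + r.
Proof.
move=> r0; apply: (le_trans (cmodB _ _)).
by rewrite cmod1 cmodM cmodR cmod_expi mulr1 ger0_norm.
Qed.

(** An orbit on the circle of radius rr, seen in the variable z + 1/z in which determinants are
    polynomials; the circle becomes an ellipse. *)
Definition ellipse_node rr x beta (c : nat) : R[i] := joukowski ((rr%:C)%C * expi (x + c%:R * beta)).

Lemma realC_neq0 rr : rr != 0 -> ((rr%:C)%C : R[i]) != 0.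
Proof. by move=> r0; rewrite -cmod_gt0 cmodR normr_gt0. Qed.

Lemma realC_inv rr : ((rr^-1)%:C)%C = ((rr%:C)%C)^-1 :> R[i].
Proof. exact: (fmorphV (real_complex R)). Qed.

Lemma ellipse_circle rr x beta t c : 1 < rr ->
  cmod (joukowski (expi t) - ellipse_node rr x beta c) =
  rr * (cmod (1 - (rr^-1%:C)%C * expi (x - t + c%:R * beta)) * cmod (1 - (rr^-1%:C)%C * expi (x + t + c%:R * beta))).
Proof.
move=> r1; have r0 : rr != 0 by lra.
have rC := realC_neq0 r0.
rewrite -[cmod (1 - _ * expi (x - t + _))]cmod_oneB_conj -[cmod (1 - _ * expi (x + t + _))]cmod_oneB_conj.
rewrite /ellipse_node joukowskiB ?expi_neq0 ?mulf_neq0 ?expi_neq0// cmodM.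
have -> : cmod (expi t - (rr%:C)%C * expi (x + c%:R * beta)) =
    rr * cmod (1 - (rr^-1%:C)%C * expi (- (x - t + c%:R * beta))).
  have -> : expi t - (rr%:C)%C * expi (x + c%:R * beta) =
    - ((rr%:C)%C * expi (x + c%:R * beta) * (1 - (rr^-1%:C)%C * expi (- (x - t + c%:R * beta)))).
    have -> : expi t = expi (x + c%:R * beta) * expi (- (x - t + c%:R * beta)) by rewrite -expiD; congr expi; ring.
    by rewrite realC_inv; field.
  by rewrite cmodN !cmodM cmodR cmod_expi mulr1 ger0_norm//; lra.
rewrite -mulrA; congr (_ * (_ * cmod (1 - _))).
by rewrite !invfM -!expiN mulrCA -expiD realC_inv; congr (_ * expi _); ring.
Qed.

(** By [ellipse_circle] each distance is rr times two moduli regularised with r = 1/rr, so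
    [orbit_log_mean] suffices. Leaving out one factor costs at most the constant 1/d. *)
Lemma ellipse_upper kappa tau rr eps : 0 < tau -> 1 < rr -> 0 < eps ->
  exists (C : R) (J : nat), 0 <= C /\ forall beta M, (J < M)%N -> dioph_upto kappa tau beta M ->
  forall n x t, 
    \prod_(c < n) cmod (joukowski (expi t) - ellipse_node rr x beta c) <= rr ^+ n * expR (eps * n%:R + C) /\
    forall c0 : 'I_n, \prod_(c < n | c != c0) cmod (joukowski (expi t) - ellipse_node rr x beta c) 
      <= rr ^+ n * expR (eps * n%:R + C).
Proof.
move=> tau0 r1 e0; have e20 : 0 < eps / 2 by rewrite divr_gt0.
have r0 : 0 < rr by lra.
have ri : 0 < rr^-1 < 1 by rewrite invr_gt0 r0 invf_lt1.
have [C [J [C0 h]]] := orbit_log_mean kappa tau0 ri e20.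
pose d : R := rr * (1 - rr^-1) ^+ 2.
have d0 : 0 < d by rewrite mulr_gt0// exprn_gt0// subr_gt0; case/andP: ri.
exists (2 * C + `|ln d|), J; split; first by rewrite addr_ge0// mulr_ge0.
move=> beta M JM dc n x t.
have p0 y : 0 < cmod (1 - (rr^-1%:C)%C * expi y).
  case/andP: ri => a b; apply: lt_le_trans (cmod_oneB_ge _ _); rewrite ?subr_gt0//; lra.
have U : \prod_(c < n) cmod (joukowski (expi t) - ellipse_node rr x beta c) <= rr ^+ n * expR (eps * n%:R + 2 * C).
  under eq_bigr do rewrite ellipse_circle//.
  rewrite !big_split /= prodr_const card_ord ler_wpM2l ?exprn_ge0//; first lra.
  rewrite !prod_expR_ln; try by move=> i; exact: p0.
  rewrite -expRD ler_expR.
  have := h _ _ JM dc n (x - t); have := h _ _ JM dc n (x + t); rewrite !ler_norml.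
  by move=> /andP[_ a] /andP[_ b]; lra.
have e1 : expR (eps * n%:R + (2 * C + `|ln d|)) = expR (eps * n%:R + 2 * C) * expR `|ln d| by rewrite -expRD addrA.
have x1 : 1 <= expR `|ln d| by rewrite -expR0 ler_expR.
have x2 : d^-1 <= expR `|ln d|.
  by rewrite -{1}[d]lnK ?posrE// -expRN ler_expR -normrN ler_norm.
split=> [|c0].
  apply: (le_trans U); rewrite ler_wpM2l ?exprn_ge0 ?(ltW r0)// e1 ler_peMr ?expR_ge0//.
have : d * \prod_(c < n | c != c0) cmod (joukowski (expi t) - ellipse_node rr x beta c) <= rr ^+ n * expR (eps * n%:R + 2 * C).
  apply: le_trans U; rewrite [leRHS](bigD1 c0)//=; apply: ler_wpM2r.
    by apply: prodr_ge0 => i _; exact: cmod_ge0.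
  rewrite ellipse_circle// ler_wpM2l ?(ltW r0)//.
  have a0 : 0 <= rr^-1 by case/andP: ri => /ltW.
  have a1 : rr^-1 <= 1 by case/andP: ri => _ /ltW.
  by rewrite expr2; apply: ler_pM; rewrite ?subr_ge0 ?cmod_oneB_ge.
rewrite mulrC -ler_pdivlMr// => /le_trans; apply.
by rewrite -mulrA ler_wpM2l ?exprn_ge0 ?(ltW r0)// e1 ler_wpM2l ?expR_ge0.
Qed.

Lemma ellipse_pair rr x beta (b c : nat) : 1 < rr ->
  cmod (ellipse_node rr x beta b - ellipse_node rr x beta c) =
  rr * (chord (- (b%:R * beta) + c%:R * beta) * cmod (1 - ((rr ^- 2)%:C)%C * expi (2 * x + b%:R * beta + c%:R * beta))).
Proof.
move=> r1; have r0 : rr != 0 by lra.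
have rC := realC_neq0 r0.
rewrite -[cmod (1 - _)]cmod_oneB_conj.
rewrite /ellipse_node joukowskiB ?mulf_neq0 ?expi_neq0// cmodM -mulrBr cmodM cmodR ger0_norm; last lra.
rewrite cmod_expiB -mulrA; congr (_ * (_ * cmod (1 - _))).
  by rewrite -chordN; congr chord; ring.
have -> : ((rr ^- 2)%:C)%C = (rr%:C)%C^-1 * (rr%:C)%C^-1 :> R[i] by rewrite realC_inv rmorphXn expr2 invfM.
rewrite !invfM -!expiN mulrACA -expiD.
by congr (_ * _ * expi _); ring.
Qed.

(** On an ellipse the factor from the sum of phases is regularised by rr^-2, so no condition on
    resonances of x appears; small divisors occur only in differences of phases. *)
Lemma ellipse_lower kappa tau rr eps : 0 < tau -> 1 < rr -> 0 < eps ->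
  exists (C : R) (J : nat), 0 <= C /\ forall beta M, (J < M)%N -> dioph_upto kappa tau beta M ->
  forall n x, (n < M)%N -> forall c0 : 'I_n,
    rr ^+ n * expR (- (eps * n%:R + C)) <=
    \prod_(c < n | c != c0) cmod (ellipse_node rr x beta c0 - ellipse_node rr x beta c).
Proof.
move=> tau0 r1 e0; have e30 : 0 < eps / 3 by rewrite divr_gt0.
have r0 : 0 < rr by lra.
have ri : 0 < rr ^- 2 < 1 by rewrite invr_gt0 exprn_gt0//= invf_lt1 ?exprn_gt0// exprn_egt1// ltW.
have [C1 [J1 [C10 h1]]] := orbit_log_mean kappa tau0 ri e30.
have [C2 [J2 [C20 h2]]] := orbit_prod_except kappa tau0 e30.
have [C3 [C30 h3]] := poly_le_exp kappa tau0 e30.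
exists (C1 + C2 + C3 + 1 + ln rr), (J1 + J2)%N; split.
  by rewrite !addr_ge0// ln_ge0// ltW.
move=> beta M JM dc n x nM' c0; have nM := ltnW nM'.
have p0 y : 0 < cmod (1 - ((rr ^- 2)%:C)%C * expi y).
  case/andP: ri => a b; apply: lt_le_trans (cmod_oneB_ge _ _); rewrite ?subr_gt0//; lra.
under eq_bigr do rewrite ellipse_pair//.
rewrite !big_split /= prodr_const cardC1 card_ord.
have P1 : expR (- (eps / 3 * n%:R + C1 + 1)) <= 
    \prod_(c < n | c != c0) cmod (1 - ((rr ^- 2)%:C)%C * expi (2 * x + c0%:R * beta + c%:R * beta)).
  rewrite prod_expR_ln// ler_expR.
  have := h1 beta M (leq_ltn_trans (leq_addr _ _) JM) dc n (2 * x + c0%:R * beta).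
  rewrite (bigD1 c0)//= ler_norml => /andP[+ _].
  set a := ln _; set b := \sum_(_ | _) _ => ab; have : a <= 1; last by lra.
  have /andP[i0 /ltW i1] := ri; apply: le_trans i1; rewrite /a.
  have n1 : -1 < rr ^- 2 by lra.
  by apply: le_trans (le_ln1Dx n1); rewrite ler_ln ?posrE ?cmod_oneB_le ?ltW// -[ltLHS]addr0 ltrD.
have P2 : expR (- (eps / 3 * n%:R + C3)) * expR (- (eps / 3 * n%:R + C2)) <= 
    \prod_(c < n | c != c0) chord (- (c0%:R * beta) + c%:R * beta).
  apply: le_trans (h2 beta M n _ _ dc nM (polyfac kappa tau n) c0 _ _); last 3 first.
  - by apply: ltnW; apply: leq_ltn_trans (leq_addl _ _) JM.
  - by rewrite polyfac_gt0// polyfac_le1.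
  - move=> i ic; rewrite /orb.
    have -> : - (c0%:R * beta) + i%:R * beta = ((i%:Z - c0%:Z)%:~R : R) * beta by rewrite intrB; ring.
    apply: (DC_int tau0 dc nM'); first by rewrite subr_eq0 eqz_nat.
    by have := ltn_ord i; have := ltn_ord c0; clear; lia.
  by rewrite ler_wpM2r ?expR_ge0// h3.
have -> : rr ^+ n * expR (- (eps * n%:R + (C1 + C2 + C3 + 1 + ln rr))) =
  rr ^+ n.-1 * ((expR (- (eps / 3 * n%:R + C3)) * expR (- (eps / 3 * n%:R + C2))) * expR (- (eps / 3 * n%:R + C1 + 1))).
  have n0 : (0 < n)%N by apply: leq_ltn_trans (ltn_ord c0).
  rewrite -{1}(prednK n0) exprSr -mulrA; congr (_ * _).
  by rewrite -{1}[rr]lnK ?posrE// -!expRD; congr expR; field.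
rewrite ler_wpM2l ?exprn_ge0 ?(ltW r0)//; apply: ler_pM; rewrite ?mulr_ge0 ?expR_ge0//.
Qed.


Lemma cmod_joukowski_le (z : R[i]) (r : R) : 1 <= r -> cmod z = r -> cmod (joukowski z) <= r + 1.
Proof.
move=> r1 zr; rewrite /joukowski; apply: (le_trans (cmodD _ _)).
by rewrite cmodV zr lerD2l invf_le1//; lra.
Qed.

Lemma cmod_joukowski_ge (z : R[i]) (r : R) : 1 <= r -> cmod z = r -> r - 1 <= cmod (joukowski z).
Proof.
move=> r1 zr; have -> : joukowski z = z - - z^-1 by rewrite opprK.
by apply: le_trans (cmodB_ge _ _); rewrite cmodN cmodV zr lerD2l lerN2 invf_le1//; lra.
Qed.

Lemma cmod_node rr x beta c : 0 < rr -> cmod ((rr%:C)%C * expi (x + c%:R * beta)) = rr.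
Proof. by move=> r0; rewrite cmodM cmodR cmod_expi mulr1 gtr0_norm. Qed.

Lemma outer_dist X x beta c (y : R[i]) : 5 <= X -> cmod y <= 3 ->
  X - 4 <= cmod (y - ellipse_node X x beta c) <= X + 4.
Proof.
move=> X5 y3; have X1 : 1 <= X by lra. have X0 : 0 < X by lra.
have a := cmod_joukowski_le X1 (cmod_node x beta c X0).
have b := cmod_joukowski_ge X1 (cmod_node x beta c X0).
have := cmodB y (ellipse_node X x beta c); have := cmodB_ge (ellipse_node X x beta c) y.
by rewrite cmodBC -/(ellipse_node X x beta c) in a b *; move=> h1 h2; apply/andP; split; lra.
Qed.

(** In the application there are fewer good nodes on the inner ellipse than the degree requires. The
    missing N are put on a large ellipse, where a crude bound V2 is affordable because the Lagrange
    weights carry (rr/(X - 4))^n. *)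
Lemma two_circle_bound kappa tau rr X eps : 0 < tau -> 1 < rr -> rr <= 2 -> 5 <= X -> 0 < eps ->
  exists (C : R) (J : nat), 0 <= C /\ forall beta M, (J < M)%N -> dioph_upto kappa tau beta M ->
  forall n N, (n < M)%N -> (N < M)%N -> forall x t (p : {poly R[i]}) (V1 V2 : R),
    (size p <= n + N)%N -> 0 <= V1 -> 0 <= V2 ->
    (forall c, (c < n)%N -> cmod p.[ellipse_node rr x beta c] <= V1) ->
    (forall c, (c < N)%N -> cmod p.[ellipse_node X x beta c] <= V2) ->
  cmod p.[joukowski (expi t)] <=
    n%:R * (V1 * (expR (2 * (eps * n%:R + C)) * ((X + 4) / (X - 4)) ^+ N)) +
    N%:R * (V2 * (expR (eps * n%:R + eps * N%:R + 2 * C) * ((rr / (X - 4)) ^+ n * ((X + 4) / X) ^+ N))).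
Proof.
move=> t0 r1 r2 X5 e0; have X1 : 1 < X by lra.
have [C1 [J1 [C10 up]]] := ellipse_upper kappa t0 r1 e0.
have [C2 [J2 [C20 low]]] := ellipse_lower kappa t0 r1 e0.
have [C3 [J3 [C30 lowX]]] := ellipse_lower kappa t0 X1 e0.
exists (C1 + C2 + C3), (J1 + J2 + J3)%N; split; first by rewrite !addr_ge0.
move=> beta M JM dc n N nM NM x t p V1 V2 sp V10 V20 hV1 hV2.
have {}up := up beta M ltac:(clear -JM; lia) dc n x t.
have {}low := low beta M ltac:(clear -JM; lia) dc n x nM.
have {}lowX := lowX beta M ltac:(clear -JM; lia) dc N x NM.
have r0 : 0 < rr by lra. have X0 : 0 < X by lra. have X4 : 0 < X - 4 by lra.
have ys : cmod (joukowski (expi t)) <= 3.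
  by apply: le_trans (cmod_joukowski_le (lexx 1) (cmod_expi t)) _; lra.
have yc c : cmod (ellipse_node rr x beta c) <= 3.
  by apply: le_trans (cmod_joukowski_le (ltW r1) (cmod_node x beta c r0)) _; lra.
have lp n' C (r : R) : 0 < r -> 0 < r ^+ n' * expR C by move=> r'; rewrite mulr_gt0 ?exprn_gt0 ?expR_gt0.
pose y (a : 'I_n + 'I_N) := match a with inl c => ellipse_node rr x beta c | inr c => ellipse_node X x beta c end.
have sep0 c c' : y (inl c) - y (inr c') != 0.
  by rewrite -cmod_gt0; case/andP: (outer_dist x beta c' X5 (yc c)) => h _; apply: lt_le_trans h.
have neq0 m (r C : R) (F : 'I_m -> R[i]) c0 : 0 < r -> r ^+ m * expR C <= \prod_(c < m | c != c0) cmod (F c) ->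
   forall c, c != c0 -> F c != 0.
  move=> r' h c cc; apply/eqP => e; have := lt_le_trans (lp m C r r') h.
  by rewrite (bigD1 c)//= e cmod0 mul0r ltxx.
have yi : injective y.
  move=> [c|c] [c'|c'] /= e.
  - congr inl; apply/eqP/negPn/negP => cc; have := neq0 _ _ _ (fun c => y (inl c') - y (inl c)) c' r0 (low c') c cc.
    by rewrite /= e subrr eqxx.
  - by have := sep0 c c'; rewrite /= e subrr eqxx.
  - by have := sep0 c' c; rewrite /= e subrr eqxx.
  - congr inr; apply/eqP/negPn/negP => cc; have := neq0 _ _ _ (fun c => y (inr c') - y (inr c)) c' X0 (lowX c') c cc.
    by rewrite /= e subrr eqxx.
rewrite (@lagrange_eval _ _ y yi); last by rewrite card_sum !card_ord.
rewrite big_sumType /=; apply: (le_trans (cmodD _ _)).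
have sumle (m : nat) (F : 'I_m -> R[i]) (B : R) : (forall i, cmod (F i) <= B) -> cmod (\sum_(i < m) F i) <= m%:R * B.
  move=> h; apply: (le_trans (cmod_sum _ _ _)); rewrite mulr_natl -[m in leRHS]card_ord -sumr_const.
  by apply: ler_sum => i _.
have prod0 (m : nat) (F : 'I_m -> R[i]) (P : pred 'I_m) : 0 <= \prod_(i < m | P i) cmod (F i).
  by apply: prodr_ge0 => i _; exact: cmod_ge0.
apply: lerD; apply: sumle => c; rewrite cmodM; apply: ler_pM; rewrite ?cmod_ge0 ?hV1 ?hV2//.
- rewrite cmod_prod big_sumType /=; apply: ler_pM; [exact: prod0|exact: prod0| |].
    under eq_bigr do rewrite cmodM cmodV.
    rewrite big_split /= prodfV ler_pdivrMr; last by apply: lt_le_trans (low c); exact: lp.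
    apply: (le_trans (up.2 c)).
    apply: (@le_trans _ _ (expR (2 * (eps * n%:R + (C1 + C2 + C3))) * (rr ^+ n * expR (- (eps * n%:R + C2))))).
      rewrite mulrCA -expRD ler_wpM2l ?exprn_ge0 ?(ltW r0)// ler_expR.
      by lra.
    by rewrite ler_wpM2l ?expR_ge0//; exact: (low c).
  rewrite -[N in leRHS]card_ord -prodr_const; apply: ler_prod => i _; rewrite cmod_ge0 /= cmodM cmodV.
  have /andP[a1 a2] := outer_dist x beta i X5 ys; have /andP[b1 b2] := outer_dist x beta i X5 (yc c).
  by apply: ler_pM; rewrite ?invr_ge0 ?cmod_ge0// lef_pV2 ?posrE//; apply: lt_le_trans b1.
- rewrite cmod_prod big_sumType /=.
  have -> : expR (eps * n%:R + eps * N%:R + 2 * (C1 + C2 + C3)) * ((rr / (X - 4)) ^+ n * ((X + 4) / X) ^+ N) =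
    (expR (eps * n%:R + (C1 + C2 + C3)) * (rr / (X - 4)) ^+ n) * (((X + 4) / X) ^+ N * expR (eps * N%:R + (C1 + C2 + C3))).
    rewrite (_ : eps * _ + _ + _ = (eps * n%:R + (C1 + C2 + C3)) + (eps * N%:R + (C1 + C2 + C3))); last by ring.
    by rewrite expRD; ring.
  apply: ler_pM; [exact: prod0|exact: prod0| |].
    apply: (@le_trans _ _ (\prod_(i < n) (cmod (joukowski (expi t) - y (inl i)) * (X - 4)^-1))).
      apply: ler_prod => i _; rewrite cmod_ge0 /= cmodM cmodV ler_wpM2l ?cmod_ge0//.
      have /andP[b1 b2] := outer_dist x beta c X5 (yc i).
      by rewrite cmodBC lef_pV2 ?posrE//; apply: lt_le_trans b1.
    rewrite big_split /= prodr_const card_ord expr_div_n mulrA exprVn.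
    rewrite ler_wpM2r ?invr_ge0 ?exprn_ge0 ?(ltW X4)// mulrC.
    by apply: (le_trans up.1); rewrite ler_wpM2l ?exprn_ge0 ?(ltW r0)// ler_expR; lra.
  under eq_bigr do rewrite cmodM cmodV.
  rewrite big_split /= prodfV ler_pdivrMr; last by apply: lt_le_trans (lowX c); exact: lp.
  apply: (@le_trans _ _ ((X + 4) ^+ N)).
    rewrite [leRHS](_ : _ = \prod_(i < N) (X + 4)); last by rewrite prodr_const card_ord.
    rewrite [leRHS](bigD1 c)//= -[leLHS]mul1r; apply: ler_pM => //; first by rewrite prodr_ge0// => i _; rewrite cmod_ge0.
      by lra.
    by apply: ler_prod => i _; rewrite cmod_ge0 /=; case/andP: (outer_dist x beta i X5 ys).
  apply: (@le_trans _ _ (((X + 4) / X) ^+ N * expR (eps * N%:R + (C1 + C2 + C3)) * (X ^+ N * expR (- (eps * N%:R + C3))))).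
    rewrite mulrACA -exprMn divfK ?gt_eqF// -expRD ler_peMr ?exprn_ge0//; first by lra.
    by rewrite -expR0 ler_expR; lra.
  rewrite ler_wpM2l//; last exact: (lowX c).
  by rewrite mulr_ge0 ?expR_ge0 ?exprn_ge0// divr_ge0; lra.
Qed.

End Ellipse.

(** * Ring eigenvalues exclude continuants that grow too fast *)

Section NoRingEigen.
Variable R : realType.
Arguments continuant : simpl never.
Implicit Types (t beta tau lam theta x rr : R) (E z : R[i]).

Lemma periodic_max (v : nat -> R) q : (0 < q)%N -> (forall i, v (i + q)%N = v i) ->
  exists i0, forall i, v i <= v i0.
Proof.
move=> q0 per.
have [i0 hi0] : exists i0 : 'I_q, forall i : 'I_q, v i <= v i0.
  have := @Order.TotalTheory.arg_maxP _ R 'I_q (Ordinal q0) predT v isT.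
  by case=> i _ h; exists i => j; exact: h.
exists i0 => i; have perm k j : v (j + k * q)%N = v j.
  by elim: k => [|k IH]; rewrite ?addn0// mulSn addnCA [(q + _)%N]addnC per IH.
rewrite (divn_eq i q) addnC perm.
exact: (hi0 (Ordinal (ltn_pmod i q0))).
Qed.

(** With rho^q = |mu|, dividing the Floquet solution by rho^i leaves a q-periodic modulus, which
    attains its maximum. The site is moved by one period to leave room on its left. *)
Lemma floquet_max kappa tau beta q lam E z : 0 < tau -> (2 < q)%N -> expi (q%:R * beta) = 1 -> dioph_upto kappa tau beta q ->
  z != 0 -> exists (u : nat -> R[i]) (rho : R) (i1 : nat),
  [/\ forall i, u i.+2 = site_coef lam E beta z i * u i.+1 - u i, u i1 != 0, (q <= i1)%N,
      1 <= rho /\ rho ^+ q <= cmod (ring_trace beta q lam E z) + 1 &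
      forall i, cmod (u i) * rho ^+ i1 <= cmod (u i1) * rho ^+ i].
Proof.
move=> tau0 q3 zq dc z0; have q0 : (0 < q)%N by lia.
have [u [mu [rec per [j uj] mu1 mu2]]] := floquet tau0 q0 zq q3 lam E z0.
have mu0 : 0 < cmod mu by lra.
pose rho := expR (ln (cmod mu) / q%:R).
have rhoq : rho ^+ q = cmod mu.
  by rewrite -expRM_natl mulrCA divff ?mulr1 ?lnK// pnatr_eq0 -lt0n.
have r1 : 1 <= rho by rewrite -expR0 ler_expR divr_ge0// ln_ge0.
have r0 : 0 < rho by lra.
pose v i := cmod (u i) / rho ^+ i.
have vper i : v (i + q)%N = v i.
  rewrite /v per cmodM exprD rhoq; field.
  by rewrite !gt_eqF ?exprn_gt0.
have [i0 hi0] := periodic_max q0 vper.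
have vE i : cmod (u i) = v i * rho ^+ i by rewrite /v divfK// gt_eqF// exprn_gt0.
exists u, rho, (i0 + q)%N; split => //; last first.
- move=> i; rewrite (vE i) (vE (i0 + q)%N) vper; move: (hi0 i); move: (v i) (v i0) => a b ab.
  by rewrite -!mulrA [rho ^+ i * _]mulrC ler_wpM2r// mulr_ge0 ?exprn_ge0 ?(ltW r0).
- by rewrite rhoq.
- exact: leq_addl.
rewrite -cmod_gt0 vE vper mulr_gt0 ?exprn_gt0//; apply: lt_le_trans (hi0 j).
by rewrite divr_gt0 ?cmod_gt0 ?exprn_gt0.
Qed.

(** Green's formula read backwards at the maximal site i1: the determinant times u(i1) is a sum of
    shorter continuants times boundary values, which are at most |u(i1)| on the left and |u(i1)|
    rho^(K - n) on the right. Chambers' formula bounds rho. *)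
Lemma floquet_window kappa tau beta q lam E rr (K : nat) (B : nat -> R) z1 : 0 < tau -> 1 <= `|lam| -> 1 <= rr ->
  (K.*2.+2 < q)%N -> expi (q%:R * beta) = 1 -> dioph_upto kappa tau beta q ->
  cmod z1 = 1 -> ring_trace beta q lam E z1 = 2 ->
  (forall j t, (j <= K)%N -> cmod (continuant (site_coef lam E beta (expi t)) j) <= B j) ->
  exists i1 : nat, (K <= i1)%N /\ forall n, (n < K)%N ->
   cmod (continuant (site_coef lam E beta ((rr%:C)%C * expi ((i1 - n.+1)%:R * beta))) K) <=
     (K.*2.+1)%:R * (rr ^+ (K - n.+1) * B (K - n.+1)%N + rr ^+ n * B n * (7 * (`|lam| * rr) ^+ (K - n))).
Proof.
move=> tau0 l1 r1 Kq zq dc z11 tr2 hB.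
have r0 : 0 < rr by lra.
have rC : ((rr%:C)%C : R[i]) != 0 by apply: realC_neq0; rewrite gt_eqF.
have q3 : (2 < q)%N by lia. have q0 : (0 < q)%N by lia.
have [u [rho [i1 [rec ui qi [rho1 rhoq] hmax]]]] := floquet_max lam E tau0 q3 zq dc rC.
have rr_abs : cmod ((rr%:C)%C : R[i]) = rr by rewrite cmodR gtr0_norm.
have {}rhoq : rho ^+ q <= 7 * (`|lam| * rr) ^+ q.
  apply: (le_trans rhoq); have := ring_trace_bound tau0 q0 zq dc q3 l1 r1 rr_abs z11 tr2.
  have : 1 <= (`|lam| * rr) ^+ q by rewrite exprn_ege1// -[leLHS]mulr1; apply: ler_pM.
  by rewrite exprMn; move: (ring_trace _ _ _ _ _) => ?; lra.
have lr1 : 1 <= `|lam| * rr by rewrite -[leLHS]mulr1; apply: ler_pM.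
have lr0 : 0 < `|lam| * rr by lra.
have rho0 : 0 < rho by lra.
(* Take powers j/q; the constant only improves, as 7^(j/q) <= 7. *)
have rhoj j : (j <= q)%N -> rho ^+ j <= 7 * (`|lam| * rr) ^+ j.
  move=> jq; have qR : (0 : R) < q%:R by rewrite ltr0n.
  have : ln (rho ^+ q) <= ln (7 * (`|lam| * rr) ^+ q).
    by rewrite ler_ln// posrE ?mulr_gt0 ?exprn_gt0.
  rewrite lnM ?posrE ?exprn_gt0// !lnX_natl// => h.
  rewrite -ler_ln ?posrE ?mulr_gt0 ?exprn_gt0// lnM ?posrE ?exprn_gt0// !lnX_natl//.
  have l7 : 0 <= ln (7 : R) by rewrite ln_ge0; lra.
  have h2 : j%:R * (q%:R * ln rho) <= q%:R * ln 7 + j%:R * (q%:R * ln (`|lam| * rr)).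
    apply: (@le_trans _ _ (j%:R * (ln 7 + q%:R * ln (`|lam| * rr)))); first by rewrite ler_wpM2l.
    by rewrite mulrDr lerD2r ler_wpM2r// ler_nat.
  rewrite -(ler_pM2l qR) mulrDr; move: h2.
  by rewrite mulrCA [j%:R * (q%:R * ln (_ * _))]mulrCA.
exists i1; split; first by clear -qi Kq; lia.
move=> n nK; set a := (i1 - n.+1)%N.
have ia : i1 = (a + n.+1)%N by rewrite /a; clear -qi Kq nK; lia.
have h0 : forall i, (i < K)%N -> u (a + i.+2)%N = sh (site_coef lam E beta ((rr%:C)%C)) a i * u (a + i.+1)%N - u (a + i)%N.
  by move=> i _; rewrite !addnS rec /sh addnC.
have := @continuant_green _ _ (fun i => u (a + i)%N) K n nK h0.
rewrite -ia addn0; have -> : sh (sh (site_coef lam E beta (rr%:C)%C) a) n.+1 = sh (site_coef lam E beta (rr%:C)%C) (a + n.+1).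
  by apply/funext => i; rewrite /sh; congr site_coef; clear; lia.
rewrite !sh_site_coef => e.
have kb j y : (j <= K)%N -> cmod (continuant (site_coef lam E beta ((rr%:C)%C * expi y)) j) <= (K.*2.+1)%:R * (rr ^+ j * B j).
  move=> jK; have jq : (j.*2 < q)%N by clear -jK Kq; lia.
  have rz : cmod ((rr%:C)%C * expi y) = rr by rewrite cmodM rr_abs cmod_expi mulr1.
  have := continuant_radius tau0 q0 zq dc r1 jq rz (fun t => hB j t jK) => /le_trans; apply.
  rewrite -mulrA ler_wpM2r ?ler_nat ?ltnS ?leq_double// mulr_ge0 ?exprn_ge0 ?(ltW r0)//.
  by apply: le_trans (hB j 0 jK); exact: cmod_ge0.
have Bj j : (j <= K)%N -> 0 <= B j by move=> jK; apply: le_trans (hB j 0 jK); exact: cmod_ge0.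
have up : 0 < cmod (u i1) by rewrite cmod_gt0.
rewrite -(ler_pM2r up) -cmodM e; apply: (le_trans (cmodD _ _)); rewrite !cmodM mulrDr mulrDl.
have ua : cmod (u a) <= cmod (u i1).
  have := hmax a; rewrite [X in rho ^+ X]ia exprD mulrA [cmod (u a) * rho ^+ a]mulrC [_ * rho ^+ a]mulrC -mulrA ler_pM2l ?exprn_gt0// => h.
  by apply: le_trans h; rewrite ler_peMr ?cmod_ge0// exprn_ege1.
have ub : cmod (u (a + K.+1)%N) <= cmod (u i1) * (7 * (`|lam| * rr) ^+ (K - n)).
  have := hmax (a + K.+1)%N; rewrite (_ : (a + K.+1 = i1 + (K - n))%N); last by rewrite ia; clear -nK; lia.
  rewrite exprD mulrA [_ * rho ^+ i1]mulrC [_ * rho ^+ i1]mulrC -mulrA ler_pM2l ?exprn_gt0// => /le_trans; apply.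
  by rewrite ler_wpM2l ?cmod_ge0// rhoj//; clear -Kq; lia.
apply: lerD.
  have := kb (K - n.+1)%N ((a + n.+1)%:R * beta) (leq_subr _ _) => kb1.
  by apply: ler_pM; rewrite ?cmod_ge0.
apply: (@le_trans _ _ ((K.*2.+1)%:R * (rr ^+ n * B n) * (cmod (u i1) * (7 * (`|lam| * rr) ^+ (K - n))))).
  by apply: ler_pM; rewrite ?cmod_ge0 ?ub ?(kb _ _ (ltnW nK)).
by rewrite le_eqVlt; apply/orP; left; apply/eqP; ring.
Qed.


Lemma continuant_node lam E beta m : exists Q : {poly R[i]}, (size Q <= m.+1)%N /\
  (forall t, continuant (site_coef lam E beta (expi t)) m = Q.[joukowski (expi (t + (m%:R - 1) / 2 * beta))]) /\
  (forall rr y (c : nat), 0 < rr -> continuant (site_coef lam E beta ((rr%:C)%C * expi (y + c%:R * beta))) m =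
     Q.[ellipse_node rr (y + (m%:R - 1) / 2 * beta) beta c]).
Proof.
have [Q [Q0 _ hQ]] := continuant_poly lam E beta m; exists Q; split; first by apply/leq_sizeP => j; exact: Q0.
split=> [t|rr y c r0].
  by rewrite hQ ?expi_neq0// -expiD.
rewrite hQ ?mulf_neq0 ?expi_neq0 ?realC_neq0 ?gt_eqF// /ellipse_node -mulrA -expiD.
by rewrite addrAC.
Qed.

(** On a large circle the diagonal entries are |lam| X (1 + O(1/X)), so the crude product bound has
    nearly the right exponent. *)
Lemma continuant_outer lam E beta X A m y : 1 <= `|lam| -> 1 <= X -> cmod E <= A ->
  cmod (continuant (site_coef lam E beta ((X%:C)%C * expi y)) m) <= expR ((ln `|lam| + ln X + (A + 2) / X) * m%:R).
Proof.
move=> l1 X1 EA; have X0 : 0 < X by lra. have l0 : 0 < `|lam| by lra.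
have zX : cmod ((X%:C)%C * expi y) = X by rewrite cmodM cmodR cmod_expi mulr1 gtr0_norm.
have xi1 : X^-1 <= 1 by rewrite invf_le1.
have A0 : 0 <= A by apply: le_trans EA; exact: cmod_ge0.
apply: (@le_trans _ _ ((`|lam| * X * (1 + (A + 2) / X)) ^+ m)).
  apply: continuant_bound => i _; rewrite /site_coef.
  have zi : cmod ((X%:C)%C * expi y * expi (i%:R * beta)) = X by rewrite cmodM zX cmod_expi mulr1.
  have h : cmod ((X%:C)%C * expi y * expi (i%:R * beta) + ((X%:C)%C * expi y * expi (i%:R * beta))^-1) <= X + 1.
    by apply: (le_trans (cmodD _ _)); rewrite cmodV zi lerD2l.
  have := cmodB E ((lam%:C)%C * ((X%:C)%C * expi y * expi (i%:R * beta) + ((X%:C)%C * expi y * expi (i%:R * beta))^-1)).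
  move: h; move: (_ + _^-1) => w h; rewrite cmodM cmodR => h2.
  have h3 : `|lam| * cmod w <= `|lam| * (X + 1) by rewrite ler_wpM2l.
  have -> : `|lam| * X * (1 + (A + 2) / X) = `|lam| * X + `|lam| * (A + 2) by field; rewrite gt_eqF.
  have h4 : A + 2 <= `|lam| * (A + 2) + 0 by rewrite addr0 ler_peMl//; lra.
  have h5 : 1 * (A + 1) <= `|lam| * (A + 1) by rewrite ler_wpM2r//; lra.
  nra.
have q0 : 0 <= (A + 2) / X by rewrite divr_ge0 ?addr_ge0// ltW.
rewrite expRM_natr; apply: lerXn2r; rewrite ?nnegrE ?expR_ge0 ?mulr_ge0 ?addr_ge0 ?(ltW X0)//.
by rewrite !expRD !lnK ?posrE// ler_wpM2l ?mulr_ge0 ?(ltW X0)// expR_ge1Dx.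
Qed.

(** The inner nodes gain e^(-eps w), the outer ones about e^(-eps K) because gam exceeds L by eps;
    both gains beat the polynomial factors and the losses of rate e0. *)
Lemma two_circle_numeric (gam L eps X A e0 C C' C4 : R) (K w : nat) :
  gam = L + eps -> 0 < eps -> 5 <= X -> 128 + 16 * (A + 2) <= (X - 4) * eps -> 0 <= A -> 0 < e0 -> e0 <= eps / 32 ->
  0 <= C -> 0 <= C' -> (w.*2 <= K)%N ->
  (K.+1)%:R ^+ 2 <= expR (e0 * K%:R + C4) ->
  272 + C4 + (C' + 4 * C + 2 * eps + e0) <= 2 * e0 * K%:R ->
  e0 * K%:R <= eps / 8 * (w%:R + 1) -> 2 * w%:R * ln X <= eps / 8 * K%:R ->
  (K - w.*2)%:R * ((2 * K%:R + 1) * (8 * expR ((gam + 2 * e0) * K%:R - eps * w%:R + C')) *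
     (expR (2 * (e0 * (K - w.*2)%:R + C)) * ((X + 4) / (X - 4)) ^+ (w.*2.+1))) +
  (w.*2.+1)%:R * (expR ((L + ln X + (A + 2) / X) * K%:R) * 
     (expR (e0 * (K - w.*2)%:R + e0 * (w.*2.+1)%:R + 2 * C) *
       ((expR e0 / (X - 4)) ^+ (K - w.*2) * ((X + 4) / X) ^+ (w.*2.+1)))) <= expR (gam * K%:R) / 16.
Proof.
move=> gE eps0 X5 Xe A0 e00 e02 C0 C'0 wK poly K1e ek eX.
have nE : (K - w.*2)%:R = K%:R - 2 * w%:R :> R by rewrite natrB// -mul2n natrM.
have NE : (w.*2.+1)%:R = 2 * w%:R + 1 :> R by rewrite -natr1 -mul2n natrM.
have wkR : 2 * w%:R <= K%:R :> R by rewrite -natrM mul2n ler_nat.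
have X0 : 0 < X by lra. have X4 : 0 < X - 4 by lra.
have a1 : 8 / (X - 4) <= eps / 16 by rewrite ler_pdivrMr//; lra.
have a2 : 4 / X <= eps / 32 by rewrite ler_pdivrMr//; nra.
have a3 : (A + 2) / X <= eps / 16 by rewrite ler_pdivrMr//; nra.
have b1 : ((X + 4) / (X - 4)) ^+ (w.*2.+1) <= expR (eps / 16 * (2 * w%:R + 1)).
  rewrite -NE expRM_natr; apply: lerXn2r; rewrite ?nnegrE ?expR_ge0 ?divr_ge0//; [lra|exact: ltW|].
  apply: le_trans (expR_ge1Dx _); have -> : (X + 4) / (X - 4) = 1 + 8 / (X - 4) by field; rewrite gt_eqF.
  by rewrite lerD2l.
have b2 : ((X + 4) / X) ^+ (w.*2.+1) <= expR (eps / 32 * (2 * w%:R + 1)).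
  rewrite -NE expRM_natr; apply: lerXn2r; rewrite ?nnegrE ?expR_ge0 ?divr_ge0//; [lra|exact: ltW|].
  apply: le_trans (expR_ge1Dx _); have -> : (X + 4) / X = 1 + 4 / X by field; rewrite gt_eqF.
  by rewrite lerD2l.
have b3 : (expR e0 / (X - 4)) ^+ (K - w.*2) <= expR ((e0 - ln X + eps / 32) * (K%:R - 2 * w%:R)).
  rewrite -nE expRM_natr; apply: lerXn2r; rewrite ?nnegrE ?expR_ge0 ?divr_ge0 ?expR_ge0//; first exact: ltW.
  rewrite !expRD -mulrA ler_pM2l ?expR_gt0// expRN lnK ?posrE//.
  have : X / (X - 4) <= expR (eps / 32).
    apply: le_trans (expR_ge1Dx _); have -> : X / (X - 4) = 1 + 8 / (X - 4) / 2 by field; rewrite gt_eqF.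
    rewrite lerD2l; lra.
  by move=> h; rewrite ler_pdivlMl.
have k0 : 0 <= K%:R :> R by []. have W0 : 0 <= w%:R :> R by [].
have c2 : 0 <= ((X + 4) / X) ^+ (w.*2.+1).
  by apply: exprn_ge0; apply: divr_ge0; clear -X5; lra.
have c3 : 0 <= (expR e0 / (X - 4)) ^+ (K - w.*2) by rewrite exprn_ge0// divr_ge0 ?expR_ge0// ltW.
move: poly; rewrite -natr1 nE NE; move: b1 b2 b3 c2 c3 k0 W0 K1e ek eX wkR.
move: (((X + 4) / (X - 4)) ^+ (w.*2.+1)) (((X + 4) / X) ^+ (w.*2.+1)) ((expR e0 / (X - 4)) ^+ (K - w.*2)).
move: (K%:R : R) (w%:R : R) => k W Y1 Y2 Y3 b1 b2 b3 c2 c3 k0 W0 K1e ek eX wkR poly.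
have lX0 : 0 <= ln X by rewrite ln_ge0; clear -X5; lra.
set D := C' + _ + _ + _ in K1e.
pose G := expR (gam * k - 3 * e0 * k + D).
have T1 : (k - 2 * W) * ((2 * k + 1) * (8 * expR ((gam + 2 * e0) * k - eps * W + C')) *
     (expR (2 * (e0 * (k - 2 * W) + C)) * Y1)) <= 16 * (k + 1) ^+ 2 * G.
  have h : expR ((gam + 2 * e0) * k - eps * W + C') * (expR (2 * (e0 * (k - 2 * W) + C)) * Y1) <= G.
    apply: (@le_trans _ _ (expR ((gam + 2 * e0) * k - eps * W + C') * (expR (2 * (e0 * (k - 2 * W) + C)) * expR (eps / 16 * (2 * W + 1))))).
      by rewrite !ler_wpM2l ?expR_ge0.
    rewrite -!expRD ler_expR /D; have : 0 <= e0 * W by rewrite mulr_ge0// ltW.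
    clear -ek C0 C'0 eps0 e00; lra.
  have -> : (k - 2 * W) * ((2 * k + 1) * (8 * expR ((gam + 2 * e0) * k - eps * W + C')) *
     (expR (2 * (e0 * (k - 2 * W) + C)) * Y1)) =
     ((k - 2 * W) * ((2 * k + 1) * 8)) * (expR ((gam + 2 * e0) * k - eps * W + C') * (expR (2 * (e0 * (k - 2 * W) + C)) * Y1)) by ring.
  apply: (@le_trans _ _ (((k - 2 * W) * ((2 * k + 1) * 8)) * G)).
    apply: ler_wpM2l h; apply: mulr_ge0; clear -W0 k0 wkR; lra.
  rewrite ler_wpM2r ?expR_ge0//; clear -W0 k0; nra.
have T2 : (2 * W + 1) * (expR ((L + ln X + (A + 2) / X) * k) * 
     (expR (e0 * (k - 2 * W) + e0 * (2 * W + 1) + 2 * C) * (Y3 * Y2))) <= (k + 1) ^+ 2 * G.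
  apply: (@le_trans _ _ ((2 * W + 1) * (expR ((L + ln X + (A + 2) / X) * k) * 
     (expR (e0 * (k - 2 * W) + e0 * (2 * W + 1) + 2 * C) * (expR ((e0 - ln X + eps / 32) * (k - 2 * W)) * expR (eps / 32 * (2 * W + 1))))))).
    apply: ler_wpM2l; first by clear -W0; lra.
    by rewrite ler_wpM2l ?expR_ge0// ler_wpM2l ?expR_ge0// ler_pM.
  apply: ler_pM; rewrite ?mulr_ge0 ?expR_ge0//; [clear -W0; lra|clear -W0 k0 wkR; nra|].
  rewrite -!expRD ler_expR /D gE.
  have h1 : (A + 2) / X * k <= eps / 16 * k by rewrite ler_wpM2r.
  have h2 : e0 * k <= eps / 32 * k by rewrite ler_wpM2r.
  have h3 : 0 <= e0 * W by rewrite mulr_ge0// ltW.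
  have h4 : 0 <= eps * W by rewrite mulr_ge0// ltW.
  have h5 : 2 * (eps * W) <= eps * k by rewrite mulrCA ler_wpM2l// ltW.
  move: h1; move: ((A + 2) / X) => y h1.
  clear -h1 h2 h3 h4 h5 eX C0 C'0 eps0 e00 e02 k0; lra.
apply: (le_trans (lerD T1 T2)).
have -> : 16 * (k + 1) ^+ 2 * G + (k + 1) ^+ 2 * G = (k + 1) ^+ 2 * (17 * G) by ring.
apply: (@le_trans _ _ (expR (e0 * k + C4) * (17 * G))).
  by rewrite ler_wpM2r// mulr_ge0// expR_ge0.
rewrite ler_pdivlMr// (_ : _ * 16 = 272 * (expR (e0 * k + C4) * G)); last by ring.
rewrite /G -expRD.
(* 272 = 17 * 16: seventeen copies of (k + 1)^2 G against the required factor 1/16. *)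
have x272 : 272 * expR (- (2 * e0 * k - D - C4)) <= 1.
  rewrite expRN ler_pdivrMr ?expR_gt0// mul1r; apply: le_trans (expR_ge1Dx _).
  clear -K1e; lra.
have -> : e0 * k + C4 + (gam * k - 3 * e0 * k + D) = gam * k + (- (2 * e0 * k - D - C4)) by ring.
rewrite expRD.
by rewrite mulrCA ler_piMr ?expR_ge0.
Qed.

(** A self-improvement available at ring eigenvalues: growth at a rate slightly above gam up to
    order K is pushed below gam at order K. It contradicts gam being the true rate. *)
Lemma no_ring_eigen kappa tau lam A gam : 0 < tau -> 1 < `|lam| -> ln `|lam| < gam -> 0 <= A ->
  exists2 e0, 0 < e0 & forall C', 0 <= C' -> exists K0, forall K, (K0 <= K)%N -> forall beta q,
  (K.*2.+2 < q)%N -> expi (q%:R * beta) = 1 -> dioph_upto kappa tau beta q -> forall E z1, cmod E <= A ->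
  cmod z1 = 1 -> ring_trace beta q lam E z1 = 2 ->
  (forall j t, (j <= K)%N -> cmod (continuant (site_coef lam E beta (expi t)) j) <= expR ((gam + e0) * j%:R + C')) ->
  forall t, cmod (continuant (site_coef lam E beta (expi t)) K) <= expR (gam * K%:R) / 16.
Proof.
move=> tau0 l1 Lg A0; set L := ln `|lam| in Lg *; pose eps := gam - L.
have eps0 : 0 < eps by rewrite /eps; lra.
have L0 : 0 < L by rewrite /L ln_gt0.
have lam0 : 0 < `|lam| by lra.
(* Makes each of the corrections (A + 2)/X, 4/X and 8/(X - 4) at most eps/16. *)
pose X : R := 5 + (128 + 16 * (A + 2)) / eps.
have X5 : 5 <= X by rewrite /X lerDl divr_ge0 ?(ltW eps0)//; lra.
have X0 : 0 < X by lra. have X4 : 0 < X - 4 by lra.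
have Xe : 128 + 16 * (A + 2) <= (X - 4) * eps.
  have -> : (X - 4) * eps = eps + (128 + 16 * (A + 2)) by rewrite /X; field; rewrite gt_eqF.
  lra.
have lX0 : 0 <= ln X by rewrite ln_ge0; clear -X5; lra.
have [P hP] := archi_nat (16 * ln X / eps + eps + 4).
have P4 : 4 <= P%:R :> R.
  apply: le_trans hP; rewrite lerDr addr_ge0 ?divr_ge0 ?mulr_ge0 ?(ltW eps0)//.
have P0 : (0 < P)%N by rewrite -(ltr0n R); lra.
have PX : 16 * ln X <= eps * P%:R.
  rewrite [leRHS]mulrC -ler_pdivrMr//; lra.
have Pe : eps <= P%:R by apply: le_trans hP; rewrite addrAC lerDr addr_ge0 ?divr_ge0 ?mulr_ge0 ?(ltW eps0).
(* With w = K/P, the loss e0 K is then at most eps (w + 1)/8, a fraction of the gain eps w. *)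
pose e0 := eps / (8 * P%:R).
have e00 : 0 < e0 by rewrite divr_gt0// mulr_gt0//; lra.
have eP : e0 * P%:R = eps / 8 by rewrite /e0; field; rewrite gt_eqF//; lra.
have e01 : e0 <= 1 / 8 by nra.
have e02 : e0 <= eps / 32 by nra.
clearbody e0; clearbody X.
pose rr := expR e0.
have r1 : 1 < rr by rewrite -expR0 ltr_expR.
have r2 : rr <= 2.
  rewrite /rr -[e0]opprK expRN -[leRHS]invrK lef_pV2 ?posrE ?invr_gt0 ?expR_gt0//.
  by apply: le_trans (expR_ge1Dx _); lra.
have [C [J [C0 twoc]]] := two_circle_bound kappa tau0 r1 r2 X5 e00.
have [C4 [C40 poly]] := poly_le_exp 2 (@ltr01 R) e00.
exists e0 => // C' C'0.
pose D := C' + 4 * C + 2 * eps + e0.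
have D0 : 0 <= D by rewrite /D !addr_ge0 ?mulr_ge0// ltW.
have [K1 hK1] := archi_nat ((272 + C4 + D) / (2 * e0)).
exists (K1 + J)%N => K KK beta q Kq zq dc E z1 EA z11 tr2 hB t.
have K1e : 272 + C4 + D <= 2 * e0 * K%:R.
  rewrite [leRHS]mulrC -ler_pdivrMr ?mulr_gt0//; apply: (le_trans hK1).
  by rewrite ler_nat; clear -KK; lia.
have [Q [sQ [hQ hQn]]] := continuant_node lam E beta K.
have [i1 [Ki hw]] := floquet_window tau0 (ltW l1) (ltW r1) Kq zq dc z11 tr2 hB.
pose w := (K %/ P)%N.
have wK : (w.*2 <= K)%N.
  have P2 : (2 <= P)%N by rewrite -(ler_nat R); clear -P4; lra.
  by rewrite -muln2; apply: leq_trans (leq_divM K P); rewrite leq_mul2l P2 orbT.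
pose k : R := K%:R; pose W : R := w%:R.
have hW1 : W * P%:R <= k by rewrite -natrM ler_nat leq_divM.
have hW2 : k <= (W + 1) * P%:R by rewrite natr1 -natrM ler_nat ltnW// ltn_ceil.
have W0 : 0 <= W by []. have k0 : 0 <= k by [].
pose n := (K - w.*2)%N; pose N := w.*2.+1.
have nE : n%:R = k - 2 * W :> R by rewrite natrB// -mul2n natrM.
have NE : N%:R = 2 * W + 1 :> R by rewrite /N -natr1 -mul2n natrM.
have ek : e0 * k <= eps / 8 * (W + 1).
  by apply: (@le_trans _ _ (e0 * ((W + 1) * P%:R))); [rewrite ler_wpM2l// ltW|rewrite mulrCA eP; clear; lra].
have eX : 2 * W * ln X <= eps / 8 * k.
  by apply: (@le_trans _ _ (eps / 8 * (W * P%:R))); [clear -PX W0; nra|rewrite ler_wpM2l//; clear -eps0; lra].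
pose V1 := (2 * k + 1) * (8 * expR ((gam + 2 * e0) * k - eps * W + C')).
pose V2 := expR ((L + ln X + (A + 2) / X) * k).
have rn j : rr ^+ j = expR (e0 * j%:R) by rewrite expRM_natr.
(* Box c starts at i1 - K + w + c and so holds the maximal site at depth at least w; the summand (K
   - 1)/2 moves to the centre of the box. *)
have := twoc beta q _ dc n N _ _ ((i1 - K + w)%:R * beta + (K%:R - 1) / 2 * beta)
  (t + (K%:R - 1) / 2 * beta) Q V1 V2.
rewrite -hQ.
have J1 : (J < q)%N by clear -KK Kq; lia.
have J2 : (n < q)%N by rewrite /n; clear -Kq; lia.
have J3 : (N < q)%N by rewrite /N; clear -Kq wK; lia.
have J4 : (size Q <= n + N)%N by apply: (leq_trans sQ); rewrite /n /N; clear -wK; lia.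
have V10 : 0 <= V1 by rewrite /V1; apply: mulr_ge0; [clear -k0; lra|apply: mulr_ge0; rewrite ?expR_ge0].
move=> /(_ J1 J2 J3 J4 V10 (expR_ge0 _)) h.
apply: le_trans (h _ _) _; clear h.
- move=> c cn; rewrite -hQn; last exact: expR_gt0.
  pose n' := (K - w - c).-1.
  have n'K : (n' < K)%N by rewrite /n'; clear -cn; rewrite /n in cn; lia.
  have := hw n' n'K.
  have -> : (i1 - n'.+1)%:R * beta = (i1 - K + w)%:R * beta + c%:R * beta.
    rewrite -mulrDl -natrD; congr (_%:R * _); rewrite /n'; clear -cn Ki; rewrite /n in cn; lia.
  move=> /le_trans; apply; rewrite /V1.
  have -> : (K.*2.+1)%:R = 2 * k + 1 :> R by rewrite -natr1 -mul2n natrM.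
  apply: ler_wpM2l; first by apply: addr_ge0 => //; apply: mulr_ge0 => //; exact: ler0n.
  have [p1 p2] : ((K - n'.+1)%:R <= k - W :> R) /\ (W <= (K - n')%:R :> R).
    rewrite /k /W -natrB; last by clear -wK; lia.
    by rewrite !ler_nat /n'; clear -cn wK; rewrite /n in cn; split; lia.
  have p3 : (n'%:R : R) = k - (K - n')%:R by rewrite natrB ?(ltnW n'K)// subKr.
  rewrite !rn exprMn !rn -[`|lam|]lnK ?posrE// -/L -expRM_natr -!expRD p3.
  set p := (K - n')%:R in p2 *; set p' := (K - n'.+1)%:R in p1 *.
  have p0 : 0 <= p' by []. clearbody p p'; clear -p0 p1 p2 e00 L0 Lg W0 eps0.
  have -> : 8 * expR ((gam + 2 * e0) * k - eps * W + C') = expR ((gam + 2 * e0) * k - eps * W + C') + 7 * expR ((gam + 2 * e0) * k - eps * W + C') by ring.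
  apply: lerD.
    rewrite ler_expR.
    have : (gam + 2 * e0) * p' <= (gam + 2 * e0) * (k - W) by rewrite ler_wpM2l//; rewrite /eps in eps0; lra.
    have : eps * W <= (gam + 2 * e0) * W by rewrite ler_wpM2r// /eps; lra.
    lra.
  rewrite mulrCA ler_wpM2l// -expRD ler_expR.
  have : (eps + e0) * W <= (eps + e0) * p by rewrite ler_wpM2l//; lra.
  have : 0 <= e0 * W by rewrite mulr_ge0// ltW.
  rewrite /eps; lra.
- move=> c cN; rewrite -hQn//; apply: (le_trans (continuant_outer beta K _ (ltW l1) (_ : 1 <= X) EA)); first by clear -X5; lra.
  exact: lexx.
rewrite /V1 /V2 /n /N; apply: (@two_circle_numeric gam L eps X A e0 C C' C4) => //; first by rewrite /eps; clear; lra.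
have := poly K; rewrite expRN => h; rewrite -lef_pV2 ?posrE ?expR_gt0 ?exprn_gt0//.
by apply: (le_trans h); rewrite ge_min mul1r lexx orbT.
Qed.


End NoRingEigen.

(** * A uniform growth bound at ring eigenvalues *)

Section RingGrowth.
Variable R : realType.
Arguments continuant : simpl never.
Implicit Types (t beta tau lam theta x : R) (E z : R[i]).

Lemma continuant_close (c c' : nat -> R[i]) (A d : R) m : 1 <= A -> 0 <= d ->
  (forall i, (i < m)%N -> cmod (c i) + 1 <= A) -> (forall i, (i < m)%N -> cmod (c' i) + 1 <= A) ->
  (forall i, (i < m)%N -> cmod (c i - c' i) <= d) -> cmod (continuant c m - continuant c' m) <= m%:R * A ^+ m * d.
Proof.
move=> A1 d0; elim/nat_ind2: m => [|hc hc' hd|m IH0 IH1 hc hc' hd].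
- by rewrite !continuant0 subrr cmod0 !mul0r.
- by rewrite !continuant1 mul1r expr1; apply: (le_trans (hd 0%N isT)); rewrite ler_peMl.
have {}IH0 := IH0 (fun i hi => hc i (leq_trans hi (leqW (leqnSn m)))) (fun i hi => hc' i (leq_trans hi (leqW (leqnSn m))))
  (fun i hi => hd i (leq_trans hi (leqW (leqnSn m)))).
have {}IH1 := IH1 (fun i hi => hc i (leq_trans hi (leqnSn _))) (fun i hi => hc' i (leq_trans hi (leqnSn _)))
  (fun i hi => hd i (leq_trans hi (leqnSn _))).
have kb : cmod (continuant c' m.+1) <= A ^+ m.+1.
  by apply: continuant_bound => i im; apply: hc'; apply: ltnW.
rewrite !continuantSS.
have -> : c m.+1 * continuant c m.+1 - continuant c m - (c' m.+1 * continuant c' m.+1 - continuant c' m) =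
  (c m.+1 * (continuant c m.+1 - continuant c' m.+1) + (c m.+1 - c' m.+1) * continuant c' m.+1) - (continuant c m - continuant c' m) by ring.
apply: (le_trans (cmodB _ _)); apply: (le_trans (lerD (cmodD _ _) (lexx _))); rewrite !cmodM.
have h1 : cmod (c m.+1) * cmod (continuant c m.+1 - continuant c' m.+1) <= (A - 1) * (m.+1%:R * A ^+ m.+1 * d).
  by apply: ler_pM; rewrite ?cmod_ge0// lerBrDr hc.
have h2 : cmod (c m.+1 - c' m.+1) * cmod (continuant c' m.+1) <= d * A ^+ m.+1.
  by apply: ler_pM; rewrite ?cmod_ge0// hd.
have h3 : A ^+ m * (m%:R * d) <= A ^+ m.+1 * (m%:R * d) by rewrite ler_wpM2r ?mulr_ge0// ler_weXn2l.
have h4 : 0 <= A ^+ m.+2 * d by rewrite mulr_ge0 ?exprn_ge0; lra.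
have -> : m.+2%:R * A ^+ m.+2 * d = m.+1%:R * A ^+ m.+2 * d + A ^+ m.+2 * d by rewrite -[m.+2%:R]natr1; ring.
apply: le_trans (lerD (lerD h1 h2) IH0) _.
have -> : (A - 1) * (m.+1%:R * A ^+ m.+1 * d) = m.+1%:R * A ^+ m.+2 * d - m.+1%:R * A ^+ m.+1 * d.
  by rewrite [A ^+ m.+2]exprS; ring.
rewrite -[in X in _ - X + _ + _]natr1 mulrDl mulrDl mul1r.
move: h3 h4; rewrite mulrA [A ^+ m * _]mulrC mulrA [A ^+ m.+1 * _]mulrC; lra.
Qed.

Lemma cpot_close lam E E' beta beta' t i :
  cmod (site_coef lam E beta (expi t) i - site_coef lam E' beta' (expi t) i) <=
  cmod (E - E') + `|lam| * (16 * (i%:R * `|beta - beta'|)).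
Proof.
rewrite /site_coef -!expiD -!expiN.
set a := t + _; set b := t + _.
have -> : E - (lam%:C)%C * (expi a + expi (- a)) - (E' - (lam%:C)%C * (expi b + expi (- b))) =
  (E - E') - (lam%:C)%C * ((expi a - expi b) + (expi (- a) - expi (- b))) by ring.
apply: (le_trans (cmodB _ _)); rewrite lerD2l cmodM cmodR ler_wpM2l//.
apply: (le_trans (cmodD _ _)); rewrite !cmod_expiB -opprD chordN.
have := chord_le (a - b); rewrite (_ : a - b = i%:R * (beta - beta')); last by rewrite /a /b; ring.
by rewrite normrM normr_nat; lra.
Qed.

Lemma cpot_bound lam E beta t i : cmod E <= 3 + 2 * `|lam| -> cmod (site_coef lam E beta (expi t) i) + 1 <= 4 + 4 * `|lam|.
Proof.
move=> hE; rewrite /site_coef -!expiD -!expiN.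
have := cmodB E ((lam%:C)%C * (expi (t + i%:R * beta) + expi (- (t + i%:R * beta)))).
rewrite cmodM cmodR => h.
have : `|lam| * cmod (expi (t + i%:R * beta) + expi (- (t + i%:R * beta))) <= `|lam| * 2.
  by rewrite ler_wpM2l//; apply: (le_trans (cmodD _ _)); rewrite !cmod_expi.
lra.
Qed.

(** Stands for a bound on the transfer matrix over k sites, whose entries are continuants of orders
    k, k - 1 and k - 2; hence it is submultiplicative up to a factor 2. *)
Definition tri_bound lam beta E (k : nat) (b : R) := forall i t, (k <= i.+2)%N -> (i <= k)%N ->
  cmod (continuant (site_coef lam E beta (expi t)) i) <= b.

Lemma tri_mul lam beta E m n a b : (2 <= m)%N -> (2 <= n)%N -> tri_bound lam beta E m a -> tri_bound lam beta E n b ->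
  tri_bound lam beta E (m + n) (2 * (a * b)).
Proof.
move=> m2 n2 ha hb i t mi im.
have key j l : (m <= j.+2)%N -> (j < m)%N -> (n <= l.+2)%N -> (l < n)%N -> i = (j.+1 + l.+1)%N ->
    cmod (continuant (site_coef lam E beta (expi t)) i) <= 2 * (a * b).
  move=> j1 j2 l1 l2 ->; rewrite continuantD !sh_site_coef -!expiD; apply: (le_trans (cmodB _ _)); rewrite !cmodM.
  have -> : 2 * (a * b) = a * b + a * b by ring.
  by apply: lerD; apply: ler_pM; rewrite ?cmod_ge0 ?ha ?hb//; clear -j1 j2 l1 l2 m2 n2; lia.
have [e|[e|e]] : i = (m.-1.+1 + n.-1.+1)%N \/ i = (m.-1.+1 + n.-2.+1)%N \/ i = (m.-2.+1 + n.-2.+1)%N.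
- by clear key; lia.
- by apply: key e; clear -m2 n2; lia.
- by apply: key e; clear -m2 n2; lia.
- by apply: key e; clear -m2 n2; lia.
Qed.

Lemma tri_triv lam beta E k : cmod E <= 3 + 2 * `|lam| -> tri_bound lam beta E k ((4 + 4 * `|lam|) ^+ k).
Proof.
move=> hE i t _ ik; apply: (@le_trans _ _ ((4 + 4 * `|lam|) ^+ i)).
  by apply: continuant_bound => j _; exact: cpot_bound.
by apply: ler_weXn2l => //; have := normr_ge0 lam; lra.
Qed.

(** Cut j sites into blocks of k and a remainder of 2 to k + 1 sites under the trivial bound; the 2
    in 2b pays for each junction. *)
Lemma tri_growth lam beta E k b g : cmod E <= 3 + 2 * `|lam| -> (2 <= k)%N -> tri_bound lam beta E k b ->
  2 * b <= expR (g * k%:R) -> 0 <= g -> forall j t,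
  cmod (continuant (site_coef lam E beta (expi t)) j) <= (4 + 4 * `|lam|) ^+ k.+2 * expR (g * j%:R).
Proof.
move=> hE k2 hk bg g0 j t; set A := 4 + 4 * `|lam|.
have A1 : 1 <= A by rewrite /A; have := normr_ge0 lam; lra.
have A0 : 0 <= A by exact: le_trans A1.
have b0 : 0 <= b by apply: le_trans (hk k 0 _ _); rewrite ?cmod_ge0// ltnW.
have it s r : (2 <= r)%N -> (r <= k.+2)%N -> tri_bound lam beta E (s * k + r) (A ^+ k.+2 * expR (g * (s * k)%:R)).
  move=> r2 rk; elim: s => [|s IH].
    rewrite mul0n add0n mulr0 expR0 mulr1 => i t' ri ir; apply: (le_trans (tri_triv beta hE t' ri ir)).
    exact: ler_weXn2l.
  have := tri_mul k2 _ hk IH; rewrite mulSn -addnA => /(_ _) h.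
  have {}h : tri_bound lam beta E (k + (s * k + r)) (2 * (b * (A ^+ k.+2 * expR (g * (s * k)%:R)))).
    by apply: h; clear -r2; lia.
  move=> i t' ri ir; apply: (le_trans (h i t' ri ir)).
  rewrite natrD mulrDr expRD mulrCA [leRHS]mulrCA mulrA.
  apply: ler_wpM2r; last by rewrite mulrC.
  by apply: mulr_ge0; rewrite ?expR_ge0 ?exprn_ge0.
have [j2|j2] := ltnP j 2.
  apply: (@le_trans _ _ (A ^+ k.+2)); last by rewrite ler_peMr ?exprn_ge0// -expR0 ler_expR mulr_ge0.
  apply: (@le_trans _ _ (A ^+ j)); first by apply: continuant_bound => i _; exact: cpot_bound.
  by apply: ler_weXn2l => //; apply: leq_trans (ltnW j2) _.
have jE : j = ((j - 2) %/ k * k + ((j - 2) %% k + 2))%N by rewrite addnA -divn_eq subnK.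
have rk : ((j - 2) %% k + 2 <= k.+2)%N by rewrite addn2 !ltnS ltnW// ltn_mod ltnW.
have := it ((j - 2) %/ k)%N _ (leq_addl _ _) rk j t; rewrite -jE => /(_ (leqW (leqnSn _)) (leqnn _)) /le_trans; apply.
rewrite ler_wpM2l ?exprn_ge0// ler_expR ler_wpM2l// ler_nat.
by rewrite [leqRHS]jE leq_addr.
Qed.


Lemma continuant_near lam alpha E j (d : R) : cmod E <= 3 + 2 * `|lam| -> 0 < d -> exists2 r, 0 < r &
  forall beta E' t, cmod E' <= 3 + 2 * `|lam| -> `|beta - alpha| < r -> cmod (E' - E) < r ->
  forall i, (i <= j)%N -> cmod (continuant (site_coef lam E' beta (expi t)) i - continuant (site_coef lam E alpha (expi t)) i) <= d.
Proof.
move=> hE d0; pose A := 4 + 4 * `|lam|.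
have A1 : 1 <= A by rewrite /A; have := normr_ge0 lam; lra.
pose G : R := (j%:R * A ^+ j) * (1 + `|lam| * (16 * j%:R)) + 1.
have G0 : 0 < G by rewrite ltr_wpDl// !(mulr_ge0, addr_ge0, exprn_ge0, normr_ge0)//; lra.
exists (d / G); first by rewrite divr_gt0.
move=> beta E' t hE' hb hEE i ij; set r := d / G in hb hEE.
have r0 : 0 < r by rewrite divr_gt0.
have p0 : 0 <= r * (1 + `|lam| * (16 * j%:R)).
  by apply: mulr_ge0; [exact: ltW|rewrite addr_ge0// !mulr_ge0].
have := @continuant_close (site_coef lam E' beta (expi t)) (site_coef lam E alpha (expi t)) A (r * (1 + `|lam| * (16 * j%:R))) i A1 p0.
move=> /(_ (fun l _ => cpot_bound beta t l hE') (fun l _ => cpot_bound alpha t l hE)) h.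
apply: (le_trans (h _)) => [l li|].
  apply: (le_trans (cpot_close _ _ _ _ _ _ _)); rewrite mulrDr mulr1; apply: lerD; first exact: ltW.
  have -> : r * (`|lam| * (16 * j%:R)) = `|lam| * (16 * (j%:R * r)) by ring.
  rewrite ler_wpM2l// ler_wpM2l//; apply: ler_pM => //; last exact: ltW.
  by rewrite ler_nat; apply: leq_trans ij; apply: ltnW.
apply: (@le_trans _ _ (j%:R * A ^+ j * (r * (1 + `|lam| * (16 * j%:R))))).
  apply: ler_wpM2r => //; apply: ler_pM; rewrite ?exprn_ge0 ?ler_nat//; first lra.
  exact: ler_weXn2l.
rewrite mulrCA /r mulrAC ler_pdivrMr// ler_wpM2l ?(ltW d0)// /G lerDl//.
Qed.

Section Sequence.
Variables (kappa : nat) (tau lam alpha : R) (beta : nat -> R) (q : nat -> nat).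
Hypotheses (tau0 : 0 < tau) (l1 : 1 < `|lam|).
Hypothesis (zq : forall l, expi ((q l)%:R * beta l) = 1).
Hypothesis (dc : forall l, dioph_upto kappa tau (beta l) (q l)).
Hypothesis (betaa : forall d : R, 0 < d -> exists l0, forall l, (l0 <= l)%N -> `|beta l - alpha| < d).
Hypothesis (qinf : forall M, exists l0, forall l, (l0 <= l)%N -> (M <= q l)%N).

Definition ring_eig l (e : R) := exists theta0, ring_trace (beta l) (q l) lam ((e%:C)%C) (expi theta0) = 2.

Lemma expR_reach (C : R) : exists2 C', 0 <= C' & C <= expR C'.
Proof.
exists (Num.max C 0); first by rewrite le_max lexx orbT.
apply: le_trans (expR_ge1Dx _); apply: (@le_trans _ _ (Num.max C 0)); first by rewrite le_max lexx.
by rewrite lerDr.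
Qed.

(** An alternative at energy e and frequency alpha. Either some block length beats the rate L + eps,
    and by continuity it does so for all nearby energies and approximants; or the growth rate gam is
    at least L + eps, and [no_ring_eigen] leaves no ring eigenvalue nearby. *)
Lemma ring_growth_near eps (e : R) : 0 < eps -> `|e| < 3 + 2 * `|lam| -> exists2 r, 0 < r &
  exists n0, forall n, (n0 <= n)%N -> forall e', `|e' - e| < r -> `|e'| <= 3 + 2 * `|lam| -> forall l, (n <= l)%N ->
  ring_eig l e' -> growth_bound lam (beta l) ((e'%:C)%C) n%:R eps.
Proof.
move=> eps0 eA.
have l0 : 0 < `|lam| := lt_trans ltr01 l1.
have L0 : 0 < ln `|lam| by rewrite ln_gt0.
pose g0 := ln `|lam| + eps; have g00 : 0 < g0 by rewrite addr_gt0.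
have hE : cmod ((e%:C)%C : R[i]) <= 3 + 2 * `|lam| by rewrite cmodR ltW.
have diffE e' : cmod ((e'%:C)%C - (e%:C)%C : R[i]) = `|e' - e| by rewrite -rmorphB cmodR.
have [[k [b [k2 [hk bg]]]]|no] := pselect (exists k b, (2 <= k)%N /\ tri_bound lam alpha ((e%:C)%C) k b /\ 2 * b < expR (g0 * k%:R)).
  pose d := (expR (g0 * k%:R) - 2 * b) / 2.
  have d0 : 0 < d by rewrite divr_gt0// subr_gt0.
  have [r r0 hr] := @continuant_near lam alpha ((e%:C)%C) k d hE d0.
  have [l1' hl1] := betaa r0.
  have [C hC] := archi_nat ((4 + 4 * `|lam|) ^+ k.+2).
  exists r => //; exists (l1' + C)%N => n nn e' ee' e'A l nl _ t j.
  have hE' : cmod ((e'%:C)%C : R[i]) <= 3 + 2 * `|lam| by rewrite cmodR.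
  have hk' : tri_bound lam (beta l) ((e'%:C)%C) k (b + d).
    move=> i t' ki ik.
    have := hr (beta l) ((e'%:C)%C) t' hE' _ _ i ik; rewrite diffE => /(_ (hl1 _ _) ee') h.
    have := cmodB_ge (continuant (site_coef lam (e'%:C)%C (beta l) (expi t')) i) (continuant (site_coef lam (e%:C)%C alpha (expi t')) i).
    have := hk i t' ki ik; have := h _; rewrite (_ : (l1' <= l)%N); last by clear -nn nl; lia.
    move=> /(_ isT); clear; lra.
  have bd : 2 * (b + d) <= expR (g0 * k%:R) by rewrite /d; lra.
  apply: (le_trans (tri_growth hE' k2 hk' bd (ltW g00) j t)).
  have -> : n%:R * `|lam| ^+ j * expR (eps * j%:R) = n%:R * expR (g0 * j%:R).
    by rewrite /g0 mulrDl expRD expRM_natr lnK ?posrE// mulrA.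
  by rewrite ler_wpM2r ?expR_ge0// (le_trans hC)// ler_nat; clear -nn; lia.
pose S := [set x | exists k b, [/\ (2 <= k)%N, 0 < b, tri_bound lam alpha ((e%:C)%C) k b & x = ln (2 * b) / k%:R]].
have Slb x : S x -> g0 <= x.
  move=> [k [b [k2 b0 hk ->]]]; rewrite ler_pdivlMr ?ltr0n//; last exact: ltnW.
  rewrite leNgt; apply/negP => h; apply: no; exists k, b; split => //; split => //.
  by rewrite -[2 * b]lnK ?posrE ?mulr_gt0// ltr_expR.
have S0 : S !=set0.
  exists (ln (2 * (4 + 4 * `|lam|) ^+ 2) / 2%:R), 2%N, ((4 + 4 * `|lam|) ^+ 2); split => //.
  exact: tri_triv.
have Sinf : has_inf S by split => //; exists g0.
pose gam := inf S.
have gl : ln `|lam| < gam.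
  apply: (@lt_le_trans _ _ g0); first by rewrite /g0; lra.
  exact: lb_le_inf.
have glow k b : (2 <= k)%N -> 0 < b -> tri_bound lam alpha ((e%:C)%C) k b -> expR (gam * k%:R) <= 2 * b.
  move=> k2 b0 hk; rewrite -[leRHS]lnK ?posrE ?mulr_gt0// ler_expR -ler_pdivlMr ?ltr0n//; last exact: ltnW.
  by apply: ge_inf; [exists g0|exists k, b].
have A0 : 0 <= 3 + 2 * `|lam| by lra.
have [e0 e00 noeig] := no_ring_eigen kappa tau0 l1 gl A0.
have [_ [k [b [k2 b0 hk ->]]] xg] := inf_adherent e00 Sinf.
have bg : 2 * b <= expR ((gam + e0) * k%:R).
  rewrite -[leLHS]lnK ?posrE ?mulr_gt0// ler_expR -ler_pdivrMr ?ltr0n//; last exact: ltnW.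
  exact: ltW.
have gr := tri_growth hE k2 hk bg (ltW (addr_gt0 (lt_trans L0 gl) e00)).
have [C' C'0 hC'] := expR_reach ((4 + 4 * `|lam|) ^+ k.+2 + 1).
have [K0 hK0] := noeig C' C'0.
(* Otherwise the block length K0 + 2 would undercut the infimum gam. The gap between 1/8 and the
   1/16 of [no_ring_eigen] leaves room for the perturbation d. *)
have [K [t [KK ht]]] : exists K t, (K0 <= K)%N /\ expR (gam * K%:R) / 8 < cmod (continuant (site_coef lam ((e%:C)%C) alpha (expi t)) K).
  apply: contrapT => nK.
  have : tri_bound lam alpha ((e%:C)%C) K0.+2 (expR (gam * K0.+2%:R) / 8).
    move=> i t ki ik; rewrite leNgt; apply/negP => h; apply: nK; exists i, t; split; first by clear -ki; lia.
    apply: le_lt_trans h; rewrite ler_pM2r// ler_expR ler_wpM2l ?ler_nat//.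
    by apply: ltW; apply: lt_trans gl.
  move=> /(glow _ _ _ _); rewrite divr_gt0 ?expR_gt0// => /(_ isT isT).
  by have := expR_gt0 (gam * K0.+2%:R); lra.
pose d := Num.min 1 (expR (gam * K%:R) / 16).
have d0 : 0 < d by rewrite lt_min ltr01 divr_gt0// expR_gt0.
have [r r0 hr] := @continuant_near lam alpha ((e%:C)%C) K d hE d0.
have [l1' hl1] := betaa r0.
have [l2' hl2] := qinf K.*2.+3.
exists r => //; exists (l1' + l2')%N => n nn e' ee' e'A l nl [th eig]; exfalso.
have hE' : cmod ((e'%:C)%C : R[i]) <= 3 + 2 * `|lam| by rewrite cmodR.
have ee : cmod ((e'%:C)%C - (e%:C)%C : R[i]) < r by rewrite diffE.
have ln1 : (l1' <= l)%N by clear -nn nl; lia.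
have ln2 : (l2' <= l)%N by clear -nn nl; lia.
have near i t' (iK : (i <= K)%N) := hr (beta l) ((e'%:C)%C) t' hE' (hl1 _ ln1) ee i iK.
have := hK0 K KK (beta l) (q l) (hl2 _ ln2) (zq l) (dc (l:=l)) ((e'%:C)%C) (expi th) hE' (cmod_expi _) eig _ t.
have gb j t' : (j <= K)%N -> cmod (continuant (site_coef lam (e'%:C)%C (beta l) (expi t')) j) <= expR ((gam + e0) * j%:R + C').
  move=> jK; have := near j t' jK; have := gr j t'.
  have := cmodB_ge (continuant (site_coef lam (e'%:C)%C (beta l) (expi t')) j) (continuant (site_coef lam (e%:C)%C alpha (expi t')) j).
  have : d <= 1 by rewrite ge_min lexx.
  have : 1 <= expR ((gam + e0) * j%:R) by rewrite -expR0 ler_expR mulr_ge0// addr_ge0 ?(ltW e00)// ltW// (lt_trans L0).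
  rewrite expRD => x1 h1 h2 h3 h4.
  apply: (@le_trans _ _ (expR ((gam + e0) * j%:R) * ((4 + 4 * `|lam|) ^+ k.+2 + 1))); last by rewrite ler_wpM2l ?expR_ge0.
  by rewrite mulrDr mulr1 mulrC; lra.
move=> /(_ gb); have := near K t (leqnn _); rewrite cmodBC.
have := cmodB_ge (continuant (site_coef lam (e%:C)%C alpha (expi t)) K) (continuant (site_coef lam (e'%:C)%C (beta l) (expi t)) K).
have : d <= expR (gam * K%:R) / 16 by rewrite ge_min lexx orbT.
move: ht; clear; lra.
Qed.

(** Compactness of the segment of possible energies makes the local statement uniform; one n serves
    as constant and as first index. *)
Lemma ring_growth eps : 0 < eps -> exists n : nat, forall e, `|e| <= 2 + 2 * `|lam| -> forall l, (n <= l)%N ->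
  ring_eig l e -> growth_bound lam (beta l) ((e%:C)%C) n%:R eps.
Proof.
move=> eps0.
pose B := 2 + 2 * `|lam|.
pose P n e := `|e| <= 3 + 2 * `|lam| -> forall l, (n <= l)%N ->
  ring_eig l e -> growth_bound lam (beta l) ((e%:C)%C) n%:R eps.
have cov : near_covering (`[- B, B]%classic : set R).
  by apply/compact_near_coveringP; exact: segment_compact.
have [|n0 _ hn] := cov nat \oo P _.
  move=> x; rewrite /= in_itv /= -ler_norml => xB.
  have [|r r0 [n0 hn]] := @ring_growth_near eps x eps0; first by rewrite /B in xB; lra.
  exists (ball x r, [set i | (n0 <= i)%N]); first by split => /=; [exact: nbhsx_ballx|exists n0].
  by move=> [x' i] /= [xx ni] xA l il; apply: hn => //; move: xx; rewrite /ball /= distrC.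
exists n0 => e eB l nl; apply: (hn n0 _ e) => //=; last by lra.
by rewrite in_itv /= -ler_norml.
Qed.

End Sequence.
End RingGrowth.

(** * Rational approximants and ring eigenvectors *)

Section Approximants.
Variable R : realType.
Implicit Types (alpha tau kappa : R).

Lemma chord_ge_dist (t d : R) : (forall n : int, d <= `|t - n%:~R|) -> d <= chord t.
Proof. by move=> h; have [j hj] := chord_int t; apply: le_trans (h j) hj. Qed.

Lemma dirichlet alpha (Q : nat) : (0 < Q)%N -> exists (q : nat) (p : int),
  (0 < q <= Q)%N /\ `|q%:R * alpha - p%:~R| < Q%:R^-1.
Proof.
move=> Q0; have QR : 0 < Q%:R :> R by rewrite ltr0n.
pose fr (j : nat) : R := j%:R * alpha - (Num.floor (j%:R * alpha))%:~R.
have fr01 j : 0 <= fr j < 1.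
  have /andP[a b] := mem_rg1_floor (j%:R * alpha).
  by rewrite /fr subr_ge0 a /= ltrBlDl.
pose c j := Num.truncn (Q%:R * fr j).
have cQ j : (c j < Q)%N.
  have /andP[a b] := fr01 j.
  have /andP[h _] : (c j)%:R <= Q%:R * fr j < (c j).+1%:R by apply: truncn_itv; rewrite mulr_ge0.
  rewrite -(ltr_nat R); apply: le_lt_trans h _; by rewrite gtr_pMr.
pose f (j : 'I_Q.+1) : 'I_Q := Ordinal (cQ j).
have : ~~ injectiveb f.
  by apply/negP => /injectiveP /leq_card; rewrite !card_ord ltnn.
case/injectivePn => j [j' jj' ff].
wlog lt : j j' jj' ff / (j < j')%N.
  move=> h; have [lt|gt|] := ltngtP j j'; [exact: (h j j')| |by move/val_inj => e; rewrite e eqxx in jj'].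
  by apply: (h j' j) => //; rewrite eq_sym.
exists (j' - j)%N, (Num.floor (j'%:R * alpha) - Num.floor (j%:R * alpha)).
have ltj := ltn_ord j'; split; first by apply/andP; split; clear -lt ltj; lia.
have -> : (j' - j)%:R * alpha - (Num.floor (j'%:R * alpha) - Num.floor (j%:R * alpha))%:~R = fr j' - fr j.
  by rewrite /fr natrB ?(ltnW lt)// intrB; ring.
rewrite -(ltr_pM2l QR) divff ?gt_eqF// -{1}(gtr0_norm QR) -normrM mulrBr.
have I i : (c i)%:R <= Q%:R * fr i < (c i).+1%:R.
  by apply: truncn_itv; rewrite mulr_ge0//; case/andP: (fr01 i).
have cc : c j = c j' by have := congr1 val ff.
have /andP[a1 a2] := I j; have /andP[b1 b2] := I j'.
rewrite -cc in b1 b2; rewrite -natr1 in a2 b2.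
by rewrite ltr_norml; apply/andP; split; lra.
Qed.

Lemma dirichlet_coprime alpha (Q : nat) : (0 < Q)%N -> exists (q : nat) (p : int),
  [/\ (0 < q <= Q)%N, coprime q (absz p) & `|q%:R * alpha - p%:~R| < Q%:R^-1].
Proof.
move=> Q0; have [q [p [/andP[q0 qQ] h]]] := dirichlet alpha Q0.
pose g := gcdn q (absz p); have g0 : (0 < g)%N by rewrite gcdn_gt0 q0.
have /dvdnP[q' qE] : (g %| q)%N by exact: dvdn_gcdl.
have /dvdnP[p1 pE] : (g %| absz p)%N by exact: dvdn_gcdr.
pose p' : int := Num.sg p * p1%:Z.
have pE' : p = p' * g%:Z by rewrite /p' -mulrA -PoszM -pE abszE -numEsg.
have q'0 : (0 < q')%N by move: q0; rewrite qE muln_gt0 => /andP[].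
exists q', p'; split.
- rewrite q'0 /=; apply: leq_trans qQ; rewrite qE leq_pmulr//.
- have : gcdn (q' * g) (p1 * g) = g by rewrite -qE -pE.
  rewrite -muln_gcdl => /eqP; rewrite -[X in _ == X]mul1n eqn_pmul2r// => /eqP e.
  case: (ltrgt0P p) => hp.
  - by rewrite /p' gtr0_sg// mul1r /coprime e.
  - by rewrite /p' ltr0_sg// mulN1r abszN /coprime e.
  move: pE; rewrite hp absz0 => /esym/eqP; rewrite muln_eq0 (gtn_eqF g0) orbF => /eqP p10.
  by rewrite /p' hp sgr0 mul0r /coprime /= -e p10.
apply: le_lt_trans h; rewrite qE natrM pE' intrM.
have -> : q'%:R * g%:R * alpha - p'%:~R * (g%:Z)%:~R = g%:R * (q'%:R * alpha - p'%:~R) by rewrite -pmulrn; ring.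
by rewrite normrM normr_nat ler_peMl// ler1n.
Qed.

Lemma diophantine_DC alpha : diophantine alpha -> exists (kap : nat) (tau : R), [/\ 0 < tau,
  forall M, dioph_upto kap tau alpha M & forall (k : nat) (n : int), (0 < k)%N -> tau / k%:R ^+ kap <= `|k%:R * alpha - n%:~R| ].
Proof.
move=> [kappa [tau [k0 [t0 h]]]]; have [kap hk] := archi_nat kappa.
have H (k : nat) (n : int) : (0 < k)%N -> tau / k%:R ^+ kap <= `|k%:R * alpha - n%:~R|.
  move=> kp; have := h k%:Z; rewrite eqz_nat -lt0n kp => /(_ isT) hh.
  apply: (@le_trans _ _ (distZ (k%:R * alpha))).
    apply: le_trans hh; have -> : (`|k%:Z|)%:~R = k%:R :> R by [].
    rewrite ler_pM2l// lef_pV2 ?posrE ?exprn_gt0 ?ltr0n ?powR_gt0 ?ltr0n//.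
    by rewrite -powR_mulrn ?ler0n// ler_powR// ler1n.
  apply: ge_inf; last by exists n.
  by exists 0 => _ [j _ <-].
exists kap, tau; split => // M j /andP[j0 _]; apply: chord_ge_dist => n; exact: H.
Qed.

(** The constant tau/2 works for all l: for j < q either the bound for alpha survives the change of
    frequency, which moves j alpha by at most 1/(l + 1), or it is so small that 1/q, the least
    distance of a nonintegral j p/q to the integers, is enough. *)
Lemma ring_approximants alpha : diophantine alpha -> exists (kap : nat) (tau : R) (beta : nat -> R) (q : nat -> nat),
  [/\ 0 < tau /\ (forall M, dioph_upto kap tau alpha M),
      forall l, expi ((q l)%:R * beta l) = 1,
      forall l, dioph_upto kap tau (beta l) (q l),
      forall d : R, 0 < d -> exists l0, forall l, (l0 <= l)%N -> `|beta l - alpha| < d &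
      (forall M, exists l0, forall l, (l0 <= l)%N -> (M <= q l)%N) /\
      forall l, (0 < q l)%N /\ (q l)%:R * `|beta l - alpha| <= 1].
Proof.
move=> dio; have [kap [tau [t0 dc ht]]] := diophantine_DC dio.
have /choice [qp hqp] : forall l : nat, exists qp : nat * int,
  [/\ (0 < qp.1 <= l.+1)%N, coprime qp.1 (absz qp.2) & `|qp.1%:R * alpha - qp.2%:~R| < l.+1%:R^-1 :> R].
  by move=> l; have [q [p h]] := dirichlet_coprime alpha (ltn0Sn l); exists (q, p).
pose q l := (qp l).1; pose p l := (qp l).2; pose beta l : R := (p l)%:~R / (q l)%:R.
have q0 l : (0 < q l)%N by have [/andP[]] := hqp l.
have qR l : 0 < (q l)%:R :> R by rewrite ltr0n.
have db l : (q l)%:R * `|beta l - alpha| < l.+1%:R^-1.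
  have [_ _] := hqp l; apply: le_lt_trans; rewrite -[X in X * _](gtr0_norm (qR l)) -normrM /beta mulrBr.
  by rewrite mulrC divfK ?gt_eqF// distrC.
have db1 l : `|beta l - alpha| < l.+1%:R^-1.
  by apply: le_lt_trans (db l); rewrite ler_peMl// ler1n.
have tau2 : 0 < tau / 2 by rewrite divr_gt0.
exists kap, (tau / 2), beta, q; split.
- split=> // M j jM; apply: le_trans (dc M j jM); rewrite ler_pM2r ?invr_gt0 ?exprn_gt0 ?ltr0n//; last by case/andP: jM.
  by lra.
- by move=> l; rewrite /beta mulrC divfK ?gt_eqF// expi_int.
- move=> l j /andP[j0 jq]; apply: chord_ge_dist => n.
  have jR : 0 < j%:R ^+ kap :> R by rewrite exprn_gt0 ?ltr0n.
  have j1 : 1 <= j%:R ^+ kap :> R by rewrite exprn_ege1// ler1n.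
  have L0 : 0 < l.+1%:R :> R by rewrite ltr0n.
  have [cop le] : coprime (q l) (absz (p l)) /\ (q l <= l.+1)%N by have [/andP[]] := hqp l.
  have dj : j%:R * `|beta l - alpha| <= l.+1%:R^-1.
    by apply: le_trans (ltW (db l)); rewrite ler_wpM2r// ler_nat ltnW.
  have tri_bound : `|j%:R * alpha - n%:~R| <= `|j%:R * beta l - n%:~R| + j%:R * `|beta l - alpha|.
    rewrite -[X in _ + X * _]normr_nat -normrM distrC [`|j%:R * beta l - _|]distrC.
    have -> : n%:~R - j%:R * alpha = (n%:~R - j%:R * beta l) + j%:R * (beta l - alpha) by ring.
    exact: ler_normD.
  have hj := ht j n j0.
  have [big|small] := lerP (2 / l.+1%:R) (tau / j%:R ^+ kap).
    rewrite mulrAC; move: hj big dj tri_bound; move: (tau / j%:R ^+ kap) (l.+1%:R^-1) => T b; lra.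
  apply: (@le_trans _ _ (q l)%:R^-1).
    apply: (@le_trans _ _ (l.+1%:R^-1)); last by rewrite lef_pV2 ?posrE ?ltr0n// ler_nat.
    by rewrite mulrAC; move: small; move: (tau / j%:R ^+ kap) (l.+1%:R^-1) => T b; lra.
  have -> : j%:R * beta l - n%:~R = (j%:Z * p l - n * (q l)%:Z)%:~R / (q l)%:R.
    have e1 (i : nat) : (i%:Z)%:~R = i%:R :> R by [].
    by rewrite /beta intrB !intrM !e1 [RHS]mulrBl mulfK ?gt_eqF// mulrA.
  rewrite normrM [`|_^-1|]gtr0_norm ?invr_gt0// ler_peMl ?invr_ge0 ?ler0n//.
  rewrite -intr_norm (ler_int R 1) -gtz0_ge1 normr_gt0 subr_eq0; apply/eqP => e.
  have : (q l %| j * absz (p l))%N by rewrite -[j]absz_nat -abszM e abszM dvdn_mull.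
  by rewrite Gauss_dvdl// => /(dvdn_leq j0); rewrite leqNgt jq.
- move=> d d0; have [l0 hl] := archi_nat d^-1; exists l0 => l ll; apply: lt_trans (db1 l) _.
  rewrite -[d]invrK ltf_pV2 ?posrE ?invr_gt0 ?ltr0n//; apply: le_lt_trans hl _.
  by rewrite ltr_nat ltnS.
- split; last first.
    move=> l; split; first exact: q0.
    by apply: le_trans (ltW (db l)) _; rewrite invf_le1 ?ler1n ?ltr0n.
  move=> M; have [l0 hl] := archi_nat (M%:R ^+ kap / tau); exists l0 => l ll.
  rewrite leqNgt; apply/negP => qM.
  have := ht (q l) (p l) (q0 l); have [_ _ h] := hqp l => /le_lt_trans /(_ h).
  have qk : 0 < (q l)%:R ^+ kap :> R by rewrite exprn_gt0.
  rewrite ltr_pdivrMr// mulrC ltr_pdivlMr ?ltr0n// => h1.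
  have h2 : (q l)%:R ^+ kap <= M%:R ^+ kap :> R by apply: lerXn2r; rewrite ?nnegrE ?ler_nat// ltnW.
  move: hl; rewrite ler_pdivrMr// => h3.
  have : tau * l%:R < tau * l.+1%:R by rewrite ltr_pM2l// ltr_nat.
  have : l0%:R * tau <= tau * l%:R by rewrite mulrC ler_wpM2l ?(ltW t0)// ler_nat.
  lra.
Qed.

End Approximants.

(** * Eigenbases of rings and their localisation *)

Section RingBasis.
Variable R : realType.
Arguments continuant : simpl never.
Implicit Types (t beta tau lam theta x : R) (E z : R[i]).

Lemma conjcR (x : R) : (x%:C)%C^* = (x%:C)%C :> R[i].
Proof. by apply/eqP; rewrite eq_complex /= oppr0 !eqxx. Qed.

Lemma expi_period_int beta (q : nat) (n : int) : expi (q%:R * beta) = 1 ->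
  expi ((n + q%:Z)%:~R * beta) = expi (n%:~R * beta).
Proof. by move=> h; rewrite intrD mulrDl expiD [X in _ * X]h mulr1. Qed.

Lemma cos_expi (x y : R) : expi x = expi y -> cos (2 * pi * x) = cos (2 * pi * y).
Proof. by move=> /(congr1 (@complex.Re R)). Qed.

Section Basis.
Variables (lam beta theta : R) (q' : nat).
Let q := q'.+1.
Hypothesis zq : expi (q%:R * beta) = 1.

Let site (n : int) : 'I_q := inord (absz (n %% q%:Z)%Z).
Let V (n : int) : R := 2 * lam * cos (2 * pi * (theta + n%:~R * beta)).

Let site_per n : site (n + q%:Z) = site n.
Proof. by rewrite /site modzDr. Qed.

Let siteE (n : int) : (site n)%:Z = (n %% q%:Z)%Z.
Proof.
have h0 : 0 <= (n %% q%:Z)%Z by rewrite modz_ge0.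
have h1 : (n %% q%:Z)%Z < q%:Z by rewrite ltz_pmod.
by rewrite /site inordK; [rewrite gez0_abs|rewrite -ltz_nat gez0_abs].
Qed.

Let ordq (i : 'I_q) : 0 <= i%:Z < q%:Z.
Proof. by rewrite lez_nat ltz_nat ltn_ord. Qed.

Let site_nat (i : 'I_q) : site i%:Z = i.
Proof. by apply/val_inj/eqP; rewrite /= -eqz_nat siteE modz_small// ordq. Qed.

Let V_site n : V (site n)%:Z = V n.
Proof.
rewrite /V siteE; congr (_ * _); apply: cos_expi; rewrite !expiD; congr (_ * _).
have P (k : nat) m : expi ((m + k%:Z * q%:Z)%:~R * beta) = expi (m%:~R * beta).
  elim: k => [|k IH]; first by rewrite mul0r addr0.
  by rewrite -addn1 PoszD mulrDl mul1r addrA expi_period_int.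
have Pz (k m : int) : expi ((m + k * q%:Z)%:~R * beta) = expi (m%:~R * beta).
  case: k => k; first exact: P.
  by rewrite -(P k.+1); congr (expi (_%:~R * _)); rewrite NegzE; ring.
by rewrite [in RHS](divz_eq n q%:Z) addrC Pz.
Qed.

(** Adding the indicators keeps the matrix correct for q = 1 and q = 2, where neighbours
    coincide. *)
Let A : 'M[R[i]]_q := \matrix_(i, j) ((j == site (i%:Z + 1))%:R + (j == site (i%:Z - 1))%:R + (j == i)%:R * ((V i%:Z)%:C)%C).

Let site_shift (i j : 'I_q) : (j == site (i%:Z + 1)) = (i == site (j%:Z - 1)).
Proof.
have key (m : int) (i' j' : 'I_q) : (j' == site (i'%:Z + m)) = (q%:Z %| (j'%:Z - i'%:Z - m))%Z.
  rewrite -val_eqE -eqz_nat /= siteE -{1}(modz_small (ordq j')).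
  by rewrite eqz_mod_dvd; congr (_ %| _)%Z; ring.
by rewrite !key !dvdzE -(abszN (i%:Z - j%:Z - -1)); congr (_ %| absz _)%N; ring.
Qed.

Let A_sym (i j : 'I_q) : A i j = A j i.
Proof.
rewrite !mxE site_shift [in X in _ + X + _ = _](_ : (j == site (i%:Z - 1)) = (i == site (j%:Z + 1))); last by rewrite site_shift.
rewrite [X in X + _ = _]addrC; congr (_ + _).
by rewrite eq_sym; case: eqP => [->|] //; rewrite !mul0r.
Qed.

(** The eigenvectors are the rows of a unitary matrix; its columns are orthonormal too, which is the
    completeness in the last clause. *)
Lemma ring_basis : exists (phi : 'I_q -> int -> R[i]) (e : 'I_q -> R),
  [/\ forall s, is_sol lam beta theta ((e s)%:C)%C (phi s),
      forall s n, phi s (n + q%:Z) = phi s n,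
      forall s s', \sum_(j < q) phi s j%:Z * conjc (phi s' j%:Z) = (s == s')%:R &
      forall n, \sum_(s < q) phi s n * conjc (phi s n) = 1].
Proof.
have Ah : A \is hermsymmx.
  apply/is_hermitianmxP; rewrite expr0 scale1r; apply/matrixP => i j; rewrite [RHS]mxE [in RHS]mxE -A_sym.
  have -> : A j i = ((((i == site (j%:Z + 1))%:R + (i == site (j%:Z - 1))%:R + (i == j)%:R * V j%:Z)%:C)%C : R[i]).
    rewrite mxE; move: (V _) => v; rewrite (rmorphD (real_complex R)) (rmorphD (real_complex R)) (rmorphM (real_complex R)).
    by rewrite !(rmorph_nat (real_complex R)).
  by rewrite conjcR.
have Aeq := orthomx_spectralP (hermitian_normalmx Ah).
have dreal := hermitian_spectral_diag_real Ah.
set P := spectralmx A in Aeq; set d := spectral_diag A in Aeq dreal.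
have PU : P \is unitarymx := spectral_unitarymx A.
have PA : P *m A = diag_mx d *m P by rewrite Aeq !mulmxA mulmxV ?mul1mx// spectral_unit.
have PP := unitarymxP PU.
have PP2 := mulmx1C PP.
pose phi s n := P s (site n); pose e s := complex.Re (d 0 s).
have dE s : d 0 s = ((e s)%:C)%C.
  by have /mxOverP /(_ 0 s) := dreal; rewrite /e; case: (d 0 s) => x y; rewrite complex_real /= => /eqP ->.
exists phi, e; split.
- move=> s n; have /matrixP /(_ s (site n)) := PA.
  rewrite mul_diag_mx [RHS]mxE dE => <-; rewrite mxE /phi.
  under [RHS]eq_bigr => j _ do rewrite A_sym mxE !mulrDr.
  rewrite !big_split /=.
  have S1 (c : 'I_q) : \sum_j P s j * (j == c)%:R = P s c.
    by rewrite (bigD1 c)//= eqxx mulr1 big1 ?addr0// => j /negPf ->; rewrite mulr0.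
  have S2 (c : 'I_q) (z : R[i]) : \sum_j P s j * ((j == c)%:R * z) = z * P s c.
    by under eq_bigr do rewrite mulrA; rewrite -mulr_suml S1 mulrC.
  rewrite !S1 S2 V_site; congr (P s _ + P s _ + _).
    by apply/val_inj/eqP; rewrite /= -eqz_nat !siteE -modzDml.
  by apply/val_inj/eqP; rewrite /= -eqz_nat !siteE -modzDml.
- by move=> s n; rewrite /phi site_per.
- move=> s s'; have /matrixP /(_ s s') := PP; rewrite mxE [RHS]mxE => <-.
  by apply: eq_bigr => j _; rewrite !mxE /phi site_nat.
- move=> n; have /matrixP /(_ (site n) (site n)) := PP2; rewrite mxE [RHS]mxE eqxx => PPn; apply: (etrans _ PPn).
  by apply: eq_bigr => s _; rewrite !mxE /phi mulrC.
Qed.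

End Basis.

Lemma sol_zero lam beta theta E u p : is_sol lam beta theta E u -> u p = 0 -> u (p + 1) = 0 -> forall n, u n = 0.
Proof.
move=> h u0 u1 n.
have fw (k : nat) : u (p + k%:Z) = 0 /\ u (p + k%:Z + 1) = 0.
  elim: k => [|k [a b]]; first by rewrite addr0.
  have e1 : p + k.+1%:Z = p + k%:Z + 1 by rewrite -addn1 PoszD addrA.
  rewrite e1; split => //; have := h (p + k%:Z + 1).
  by rewrite b addrK a !mulr0 !addr0.
have bw (k : nat) : u (p - k%:Z) = 0 /\ u (p - k%:Z + 1) = 0.
  elim: k => [|k [a b]]; first by rewrite subr0.
  have e1 : p - k.+1%:Z = p - k%:Z - 1 by rewrite -addn1 PoszD opprD addrA.
  rewrite e1 subrK; split => //; have := h (p - k%:Z).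
  by rewrite b a !mulr0 addr0 add0r.
rewrite -(subrKC p n); case: (n - p) => k; first by case: (fw k).
by rewrite NegzE; case: (bw k.+1).
Qed.

Section Periodic.
Variables (lam beta theta : R) (q : nat) (e : R) (u : int -> R[i]).
Hypotheses (q3 : (2 < q)%N) (zq : expi (q%:R * beta) = 1).
Hypotheses (su : is_sol lam beta theta ((e%:C)%C) u) (per : forall n, u (n + q%:Z) = u n).
Hypothesis (un0 : exists n, u n != 0).

Lemma ring_sol_trace : ring_trace beta q lam ((e%:C)%C) (expi theta) = 2.
Proof.
pose v (i : nat) := u (i%:Z - 1).
have vrec i : v i.+2 = site_coef lam ((e%:C)%C) beta (expi theta) i * v i.+1 - v i.
  rewrite /v -addn1 -addn1 !PoszD -addrA subrr addr0 addrK.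
  by have := sol_rec 0 i su; rewrite !add0r mul0r addr0.
apply: (ring_trace_eigen ltr01 (ltn_trans (ltn0Sn 1) q3) q3 vrec).
  by move=> i; rewrite /v PoszD addrAC per.
apply: contraT; rewrite negb_or !negbK => /andP[/eqP v0 /eqP v1].
have [n] := un0; rewrite (@sol_zero _ _ _ _ _ (-1) su) ?eqxx//.
Qed.

(** Read the equation at a site where the periodic solution has maximal modulus. *)
Lemma ring_sol_bound : `|e| <= 2 + 2 * `|lam|.
Proof.
have [n un] := un0.
have [i0 hi0] : exists i0 : nat, forall i : nat, cmod (u (n + i%:Z)) <= cmod (u (n + i0%:Z)).
  apply: (@periodic_max _ (fun i => cmod (u (n + i%:Z))) q); first by lia.
  by move=> i; rewrite PoszD addrA per.
set N := n + i0%:Z.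
have uN0 : 0 < cmod (u N).
  by apply: lt_le_trans (hi0 0%N); rewrite addr0 cmod_gt0.
have up : cmod (u (N + 1)) <= cmod (u N).
  by have := hi0 i0.+1; rewrite -addn1 PoszD addrA.
have dn : cmod (u (N - 1)) <= cmod (u N).
  have -> : u (N - 1) = u (n + (i0 + q.-1)%N%:Z).
    by rewrite -per; congr u; rewrite /N; clear -q3; lia.
  exact: hi0.
have := su N; set V := 2 * lam * cos _ => eqN.
have : cmod (((e%:C)%C) * u N) <= (2 + 2 * `|lam|) * cmod (u N).
  rewrite -eqN; apply: (le_trans (cmodD _ _)); apply: (le_trans (lerD (cmodD _ _) (lexx _))).
  rewrite cmodM cmodR.
  have : `|V| * cmod (u N) <= 2 * `|lam| * cmod (u N).
    rewrite ler_wpM2r ?cmod_ge0// /V normrM normrM ger0_norm// -[leRHS]mulr1 ler_wpM2l ?mulr_ge0//.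
    by rewrite ler_norml cos_geN1 cos_le1.
  lra.
by rewrite cmodM cmodR ler_pM2r.
Qed.

End Periodic.

(* At distance D a single box of size about D / 4 suffices: it moves one of the two points by a
   definite fraction of D while all resonances are polynomially weak. *)
Lemma tail_decay kappa tau lam : 0 < tau -> 1 < `|lam| -> exists c1 epsu : R, [/\ 0 < c1, 0 < epsu &
  forall (Cu c : R) (a0 : nat), 0 <= Cu -> 0 < c -> exists2 C, 0 <= C & forall beta M, dioph_upto kappa tau beta M ->
  forall theta E u, is_sol lam beta theta E u -> growth_bound lam beta E Cu epsu ->
  (forall n : int, (absz n <= 3 * M)%N -> c / (absz n).+1%:R ^+ 2 <= chord (2 * theta + n%:~R * beta)) ->
  (forall n, cmod (u n) <= 1) -> forall a x : int, (absz a <= a0)%N -> (2 * absz (a - x)%R <= M)%N -> (2 * a0 <= M)%N ->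
  cmod (u a) * cmod (u x) <= C * expR (- (c1 * (absz (a - x)%R)%:R))].
Proof.
move=> tau0 l1; set L := ln `|lam|.
have L0 : 0 < L by rewrite ln_gt0.
have lam0 : 0 < `|lam| by lra.
have e0 : 0 < L / 96 by rewrite divr_gt0.
have [C1 [M0 [C10 step]]] := small_step kappa tau0 e0.
have [C2 [C20 poly]] := poly_le_exp 4 (@ltr01 R) e0.
(* As g is about D/24, the gain is 4L/96 per unit of D; the losses are L/96 times D + (D + m) + m <=
   5D/2, which leaves L/64. *)
exists (L / 64), (L / 96); split => // [|Cu c a0 Cu0 c0]; first by rewrite divr_gt0.
pose c' := Num.min 1 c.
have c'0 : 0 < c' by rewrite lt_min ltr01.
have c'1 : c' <= 1 by rewrite ge_min lexx.
pose A : R := (2 * a0 + 4)%:R.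
have A0 : 0 < A by rewrite ltr0n addn4.
pose C := expR (L / 64 * (M0 + 60)%:R) + 2 * Cu * A ^+ 4 / c' ^+ 2 * expR (C1 + C2 + 2 * L).
exists C.
  by rewrite addr_ge0 ?expR_ge0// !mulr_ge0 ?expR_ge0 ?invr_ge0 ?exprn_ge0// ltW.
move=> beta M dc theta E u su gb res u1 a x aa xM aM; set D := absz (a - x)%R.
have prod1 b y : cmod (u b) * cmod (u y) <= 1.
  by rewrite -[leRHS]mulr1; apply: ler_pM; rewrite ?cmod_ge0.
have e10 : 0 <= expR (- (L / 64 * D%:R)) by exact: expR_ge0.
have [Dsmall|Dbig] := leqP D (M0 + 60).
  apply: (le_trans (prod1 _ _)).
  apply: (@le_trans _ _ (expR (L / 64 * (M0 + 60)%:R) * expR (- (L / 64 * D%:R)))).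
    rewrite -expRD -[leLHS]expR0 ler_expR -mulrBr mulr_ge0// ?subr_ge0 ?ler_nat//.
    by rewrite divr_ge0// ltW.
  by rewrite ler_wpM2r// /C lerDl !mulr_ge0 ?expR_ge0 ?invr_ge0 ?exprn_ge0// ltW.
pose m := (D %/ 4)%N; pose g := (m.-1 %/ 6)%N.
have mD : (4 * m <= D < 4 * m + 4)%N by rewrite /m; clear; lia.
have gm : (6 * g < m)%N by rewrite /g /m; clear -Dbig; lia.
have gm2 : (m <= 6 * g + 6)%N by rewrite /g; clear; lia.
have g0 : (0 < g)%N by rewrite /g /m; clear -Dbig; lia.
clearbody m g.
pose eta := c' / (A * D.+1%:R) ^+ 2.
have AD1 : 1 <= A * D.+1%:R.
  by rewrite /A -natrM ler1n muln_gt0 addn4.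
have AD0 : 0 < A * D.+1%:R by lra.
have eta0 : 0 < eta by rewrite divr_gt0// exprn_gt0.
have eta1 : eta <= 1.
  rewrite ler_pdivrMr ?exprn_gt0// mul1r; apply: (le_trans c'1).
  by rewrite exprn_ege1.
have MM : (M0 <= M)%N by move: xM; rewrite -/D; clear -Dbig; lia.
have lam_n0 : lam != 0 by rewrite -normr_gt0.
(* No order has to be excluded here; the parameter n0 of [small_step] is set to a + x + 2g just to
   meet its side condition. *)
have n0E : (2 * g <= absz (a + x - (a + x + (2 * g)%:Z))%R)%N by clear; lia.
have NE : (absz (a - x)%R + m <= D + m < M)%N.
  by move: xM; rewrite -/D leqnn /=; clear -mD Dbig; lia.
have [|||x' [y' [d [_ /andP[gd dm] hu]]]] := step beta M MM dc lam theta E u Cu (L / 96) eta a x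
  (a + x + (2 * g)%:Z) m g (D + m)%N lam_n0 Cu0 (ltW e0) su gb _ g0 gm _ n0E NE.
- by rewrite eta0.
- by case/andP: mD.
- move=> p r hp hr _; set n := p + r + m%:Z - 1.
  have nb : (absz n <= 2 * a0 + 3 * D + 2)%N.
    rewrite /n; clear -hp hr aa mD; rewrite /D in mD *; lia.
  have n3 : (absz n <= 3 * M)%N.
    by move: xM nb; rewrite -/D; clear -aM Dbig; lia.
  apply: le_trans (res n n3); rewrite /eta.
  apply: ler_pM; rewrite ?invr_ge0 ?exprn_ge0 ?(ltW c'0) ?(ltW AD0)//; first by rewrite ge_min lexx orbT.
  rewrite lef_pV2 ?posrE ?exprn_gt0 ?ltr0n//; apply: lerXn2r; rewrite ?nnegrE ?(ltW AD0)//.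
  by rewrite /A -natrM ler_nat; clear -nb; nia.
apply: (le_trans hu); apply: (@le_trans _ _ (2 * Cu * expR (L / 96 * m%:R) / (eta ^+ 2 * expR (- (L / 96 * (D + m)%:R + C1))) / `|lam| ^+ d)).
  rewrite ler_piMr//; apply: mulr_ge0; last by rewrite invr_ge0 exprn_ge0.
  apply: mulr_ge0; first by rewrite !mulr_ge0 ?expR_ge0.
  by rewrite invr_ge0 mulr_ge0 ?expR_ge0// exprn_ge0// ltW.
apply: (@le_trans _ _ (2 * Cu * A ^+ 4 / c' ^+ 2 * expR (C1 + C2 + 2 * L) * expR (- (L / 64 * D%:R)))); last first.
  by rewrite ler_wpM2r// /C lerDr expR_ge0.
have p4 : D.+1%:R ^+ 4 <= expR (L / 96 * D%:R + C2).
  have := poly D; rewrite expRN => h; rewrite -lef_pV2 ?posrE ?expR_gt0 ?exprn_gt0 ?ltr0n//.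
  by apply: (le_trans h); rewrite ge_min mul1r lexx orbT.
have -> : `|lam| ^+ d = expR (L * d%:R) by rewrite expRM_natr lnK// posrE.
have -> : 2 * Cu * expR (L / 96 * m%:R) / (eta ^+ 2 * expR (- (L / 96 * (D + m)%:R + C1))) / expR (L * d%:R) =
  2 * Cu * A ^+ 4 / c' ^+ 2 * (D.+1%:R ^+ 4 * (expR (L / 96 * m%:R) * expR (L / 96 * (D + m)%:R + C1) * expR (- (L * d%:R)))).
  rewrite !expRN /eta; field.
  by rewrite !gt_eqF ?expR_gt0 ?ltr0n.
rewrite -[leRHS]mulrA; apply: ler_wpM2l.
  apply: mulr_ge0; last by rewrite invr_ge0 exprn_ge0// ltW.
  by rewrite mulr_ge0 ?mulr_ge0// exprn_ge0// ltW.
apply: (@le_trans _ _ (expR (L / 96 * D%:R + C2) * (expR (L / 96 * m%:R) * expR (L / 96 * (D + m)%:R + C1) * expR (- (L * d%:R))))).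
  by rewrite ler_wpM2r// !mulr_ge0 ?expR_ge0.
rewrite -!expRD ler_expR.
have dR : L * (g%:R : R) <= L * d%:R by rewrite ler_wpM2l ?ler_nat// ltW.
have mR : L * (m%:R * 4) <= L * D%:R.
  by rewrite ler_wpM2l ?(ltW L0)// -natrM ler_nat mulnC; case/andP: mD.
have DR : L * D%:R <= L * (4 * (6 * g%:R + 6) + 4).
  rewrite ler_wpM2l ?(ltW L0)// -natrM -natrD -natrM -natrD ler_nat; clear -mD gm2; lia.
rewrite natrD; clear -dR mR DR L0 C10 C20; lra.
Qed.

End RingBasis.

(** * Square-summable eigenfunctions *)

Section L2.
Variable R : realType.
Implicit Types (u v w : int -> R[i]) (f g : int -> R) (F G : nat -> R[i]) (z : R[i]).

Lemma sym_bigS (V : nmodType) (h : int -> V) N : \sum_(i < (N.+1.*2).+1) h (i%:Z - N.+1%:Z) =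
  \sum_(i < (N.*2).+1) h (i%:Z - N%:Z) + (h N.+1%:Z + h (- N.+1%:Z)).
Proof.
rewrite -(big_mkord xpredT (fun i => h (i%:Z - N.+1%:Z))) -(big_mkord xpredT (fun i => h (i%:Z - N%:Z))).
rewrite doubleS big_nat_recl// big_nat_recr//= sub0r.
have -> : h ((N.*2).+2%:Z - N.+1%:Z) = h N.+1%:Z by congr h; lia.
rewrite addrC -!addrA; congr (_ + _); rewrite !big_mkord.
by apply: eq_bigr => i _; congr h; lia.
Qed.

Lemma symsumS f N : symsum f N.+1 = symsum f N + (f (N.+1)%:Z + f (- (N.+1)%:Z)).
Proof. exact: sym_bigS. Qed.

Lemma symsum0 f : symsum f 0 = f 0.
Proof. by rewrite /symsum big_ord1. Qed.

Lemma symsumE f N : symsum f N = f 0 + \sum_(0 <= k < N) (f k.+1%:Z + f (- k.+1%:Z)).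
Proof.
elim: N => [|N IH]; first by rewrite symsum0 big_nil addr0.
by rewrite symsumS IH big_nat_recr //= !addrA.
Qed.

Lemma symsum_cvg f B : (forall N, symsum (fun n => `|f n|) N <= B) -> cvgn (symsum f).
Proof.
move=> h; pose a (k : nat) := f k.+1%:Z + f (- k.+1%:Z).
have ca : cvgn (series a).
  have aE N : [normed series a] N = \sum_(0 <= k < N) `|a k| by rewrite /normed_series_of seriesEnat.
  apply: normed_cvg; apply: nondecreasing_is_cvgn.
    by apply/nondecreasing_seqP => n; rewrite !aE big_nat_recr //= lerDl normr_ge0.
  exists B => _ [N _ <-]; apply: le_trans (h N); rewrite symsumE aE.
  apply: ler_wpDl => //; apply: ler_sum => k _; exact: ler_normD.
have -> : symsum f = (fun N => f 0 + series a N) by apply/funext => N; rewrite symsumE seriesEnat.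
by apply: is_cvgD => //; exact: is_cvg_cst.
Qed.

Lemma cvgn_dist (f : nat -> R) (e : R) : cvgn f -> 0 < e -> exists N0, forall N, (N0 <= N)%N -> `|f N - limn f| < e.
Proof.
move=> c e0; have /cvgrPdist_lt /(_ e e0) [N _ h] := c.
by exists N => n nn; rewrite distrC; exact: h.
Qed.

Definition csum (h : int -> R[i]) (N : nat) : R[i] := \sum_(i < (N.*2).+1) h (i%:Z - N%:Z).

Lemma Re_csum h N : complex.Re (csum h N) = symsum (fun n => complex.Re (h n)) N.
Proof. exact: (raddf_sum (@complex.Re R)). Qed.

Lemma Im_csum h N : complex.Im (csum h N) = symsum (fun n => complex.Im (h n)) N.
Proof. exact: (raddf_sum (@complex.Im R)). Qed.

Lemma csumS h N : csum h N.+1 = csum h N + (h (N.+1)%:Z + h (- (N.+1)%:Z)).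
Proof. exact: sym_bigS. Qed.

Definition ccvg F z := forall e : R, 0 < e -> exists N0, forall N, (N0 <= N)%N -> cmod (F N - z) < e.

Lemma ccvg_unique F z z' : ccvg F z -> ccvg F z' -> z = z'.
Proof.
move=> h h'; apply/eqP; rewrite -subr_eq0 -cmod_eq0; apply/negPn/negP => n0.
have e0 : 0 < cmod (z - z') / 2 by rewrite divr_gt0// lt_def n0 cmod_ge0.
have [N hN] := h _ e0; have [N' hN'] := h' _ e0.
have := hN (N + N')%N (leq_addr _ _); have := hN' (N + N')%N (leq_addl _ _).
have := cmodD (z - F (N + N')%N) (F (N + N')%N - z').
by rewrite (cmodBC z) addrA subrK; lra.
Qed.

Lemma ccvgD F G z z' : ccvg F z -> ccvg G z' -> ccvg (fun N => F N + G N) (z + z').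
Proof.
move=> h h' e e0; have e20 : 0 < e / 2 by rewrite divr_gt0.
have [N hN] := h _ e20; have [N' hN'] := h' _ e20.
exists (N + N')%N => n nn; have := hN n (leq_trans (leq_addr _ _) nn); have := hN' n (leq_trans (leq_addl _ _) nn).
have := cmodD (F n - z) (G n - z'); rewrite addrACA -opprD; lra.
Qed.

Lemma ccvg_cst z : ccvg (fun=> z) z.
Proof. by move=> e e0; exists 0%N => N _; rewrite subrr cmod0. Qed.

Lemma ccvgZ c F z : ccvg F z -> ccvg (fun N => c * F N) (c * z).
Proof.
move=> h e e0; have c0 : 0 < cmod c + 1 by rewrite ltr_wpDl ?cmod_ge0.
have [N hN] := h (e / (cmod c + 1)) (divr_gt0 e0 c0).
exists N => n nn; rewrite -mulrBr cmodM; have := hN n nn; rewrite ltr_pdivlMr// => hh.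
apply: le_lt_trans hh; rewrite mulrC ler_wpM2l ?cmod_ge0// lerDl//.
Qed.

Lemma ccvgN F z : ccvg F z -> ccvg (fun N => - F N) (- z).
Proof. by move=> /(ccvgZ (-1)); rewrite mulN1r => h e /h [N hN]; exists N => n /hN; rewrite mulN1r. Qed.

Lemma ccvg_conj F z : ccvg F z -> ccvg (fun N => conjc (F N)) (conjc z).
Proof. by move=> h e /h [N hN]; exists N => n /hN; rewrite -rmorphB cmod_conj. Qed.

Lemma ccvg_sum (I : Type) (r : seq I) (F : I -> nat -> R[i]) (z : I -> R[i]) :
  (forall i, ccvg (F i) (z i)) -> ccvg (fun N => \sum_(i <- r) F i N) (\sum_(i <- r) z i).
Proof.
move=> h; elim: r => [|i r IH].
  by move=> e e0; exists 0%N => N _; rewrite !big_nil subrr cmod0.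
move=> e e0; have [N hN] := ccvgD (h i) IH e0; exists N => n /hN; by rewrite !big_cons.
Qed.

Lemma ccvg_eq F G z (N0 : nat) : (forall N, (N0 <= N)%N -> F N = G N) -> ccvg F z -> ccvg G z.
Proof.
move=> FG h e /h [N hN]; exists (N + N0)%N => n nn.
rewrite -FG; last by apply: leq_trans nn; rewrite leq_addl.
by apply: hN; apply: leq_trans nn; rewrite leq_addr.
Qed.

Lemma ccvg_Re_le F z (b : R) (N0 : nat) : ccvg F z -> (forall N, (N0 <= N)%N -> complex.Re (F N) <= b) -> complex.Re z <= b.
Proof.
move=> h hb; rewrite leNgt; apply/negP => lt.
have [N hN] := h (complex.Re z - b) ltac:(by rewrite subr_gt0).
have := hN (N + N0)%N (leq_addr _ _); have := hb (N + N0)%N (leq_addl _ _).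
have := Re_le_cmod (F (N + N0)%N - z); rewrite raddfB /= ler_norml => /andP[a _]; lra.
Qed.

Definition l2b u := exists B : R, forall N, symsum (fun n => cmod (u n) ^+ 2) N <= B.

Definition window (N : nat) : seq int := [seq i%:Z - N%:Z | i <- iota 0 (N.*2).+1].

Lemma window_uniq N : uniq (window N).
Proof. by rewrite map_inj_uniq ?iota_uniq// => i j /addIr []. Qed.

Lemma mem_window N n : (n \in window N) = (absz n <= N)%N.
Proof.
apply/mapP/idP => [|h].
  by case=> i; rewrite mem_iota; lia.
by exists (absz (n + N%:Z)%R); rewrite ?mem_iota; lia.
Qed.

Lemma sym_window (V : nmodType) (h : int -> V) N : \sum_(i < (N.*2).+1) h (i%:Z - N%:Z) = \sum_(n <- window N) h n.
Proof. by rewrite big_map -(big_mkord xpredT (fun i => h (i%:Z - N%:Z))) /index_iota subn0. Qed.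

Lemma l2bP u : in_l2 u <-> l2b u.
Proof.
have win N : (\sum_(n \in [set` window N]) ((cmod (u n)) ^+ 2)%:E)%E = (symsum (fun n => cmod (u n) ^+ 2) N)%:E.
  by rewrite -fsbig_seq ?window_uniq// /symsum (sym_window (fun n => cmod (u n) ^+ 2)) sumEFin.
split=> [|[B hB]].
- rewrite /in_l2 /sqnorm => fin; exists (fine (\esum_(n in [set: int]) ((cmod (u n)) ^+ 2)%:E)) => N.
  rewrite -lee_fin fineK; last by rewrite ge0_fin_numE// esum_ge0// => n _; rewrite lee_fin sqr_ge0.
  rewrite -win; apply: esum_ge; exists [set` window N] => //.
  by split => //; exact: finite_seq.
- rewrite /in_l2 /sqnorm; apply: (@le_lt_trans _ _ (B%:E)); last exact: ltry.
  apply: ge_ereal_sup => _ [X [finX _] <-].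
  have [s Xs] := (finite_seqP X).1 finX.
  pose N := \max_(n <- s) absz n.
  apply: (@le_trans _ _ ((symsum (fun n => cmod (u n) ^+ 2) N)%:E)); last by rewrite lee_fin.
  rewrite -win; apply: lee_fsum_nneg_subset => //; first exact: finite_seq.
    move=> n; rewrite !inE Xs /= mem_window => ns.
    by rewrite /N (big_rem n)//= leq_maxl.
  by move=> n _; rewrite lee_fin sqr_ge0.
Qed.

Lemma symsum_le f g N : (forall n, f n <= g n) -> symsum f N <= symsum g N.
Proof. by move=> h; apply: ler_sum => i _; exact: h. Qed.

Lemma cmod_le_ReIm z : cmod z <= `|complex.Re z| + `|complex.Im z|.
Proof.
rewrite -(ler_pXn2r (ltn0Sn 1)) ?nnegrE ?cmod_ge0 ?addr_ge0// cmod_sqr sqrrD !real_normK ?num_real//.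
by rewrite lerD2r lerDl mulrn_wge0 ?mulr_ge0.
Qed.

Lemma inner_cvg u v : l2b u -> l2b v -> ccvg (csum (fun n => u n * conjc (v n))) (inner u v).
Proof.
move=> [B hB] [B' hB'].
have ab (h : R[i] -> R) : (forall z, `|h z| <= cmod z) -> cvgn (symsum (fun n => h (u n * conjc (v n)))).
  move=> hh; apply: (@symsum_cvg _ (B + B')) => N.
  apply: (@le_trans _ _ (symsum (fun n => cmod (u n) ^+ 2 + cmod (v n) ^+ 2) N)).
    apply: symsum_le => n; apply: (le_trans (hh _)); rewrite cmodM cmod_conj.
    have := sqr_ge0 (cmod (u n) - cmod (v n)); have := mulr_ge0 (cmod_ge0 (u n)) (cmod_ge0 (v n)); nra.
  by rewrite /symsum big_split /=; apply: lerD; [exact: hB|exact: hB'].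
have cR := ab _ (@Re_le_cmod R); have cI := ab _ (@Im_le_cmod R).
move=> e e0; have e20 : 0 < e / 2 by rewrite divr_gt0.
have [N1 h1] := cvgn_dist cR e20; have [N2 h2] := cvgn_dist cI e20.
exists (N1 + N2)%N => N NN; apply: (le_lt_trans (cmod_le_ReIm _)).
rewrite !raddfB /= Re_csum Im_csum.
have := h1 N (leq_trans (leq_addr _ _) NN); have := h2 N (leq_trans (leq_addl _ _) NN).
by rewrite /inner /=; lra.
Qed.

Lemma l2b_vanish u (e : R) : l2b u -> 0 < e -> exists N0, forall n, (N0 <= absz n)%N -> cmod (u n) < e.
Proof.
move=> [B hB] e0.
have e20 : 0 < e ^+ 2 / 2 by rewrite divr_gt0// exprn_gt0.
have c : cvgn (symsum (fun n => cmod (u n) ^+ 2)).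
  apply: (@symsum_cvg _ B) => N; apply: le_trans (hB N); apply: symsum_le => n.
  by rewrite ger0_norm ?sqr_ge0.
have [N1 h1] := cvgn_dist c e20.
exists N1.+1 => n nN; have [m nm] : exists m, absz n = m.+1 by exists (absz n).-1; lia.
rewrite -(ltr_pXn2r (ltn0Sn 1)) ?nnegrE ?cmod_ge0 ?ltW//.
have m1 : (N1 <= m)%N by lia.
have := h1 m m1; have := h1 m.+1 (leqW m1); rewrite /= symsumS => a b.
have : cmod (u n) ^+ 2 <= cmod (u m.+1%:Z) ^+ 2 + cmod (u (- m.+1%:Z)) ^+ 2.
  have [->|->] : n = m.+1%:Z \/ n = - m.+1%:Z by lia.
    by rewrite lerDl sqr_ge0.
  by rewrite lerDr sqr_ge0.
by move: a b; rewrite !ltr_norml => /andP[_ a] /andP[b _]; lra.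
Qed.

Lemma ccvg0_l2 u v (a b : nat -> int) : l2b u -> l2b v -> (forall N, (N <= absz (a N))%N) -> (forall N, (N <= absz (b N))%N) ->
  ccvg (fun N => u (a N) * v (b N)) 0.
Proof.
move=> lu lv ha hb e e0.
have [N1 h1] := l2b_vanish lu e0; have [N2 h2] := l2b_vanish lv ltr01.
exists (N1 + N2)%N => N NN; rewrite subr0 cmodM.
have := h1 (a N) (leq_trans (leq_trans (leq_addr _ _) NN) (ha N)).
have := h2 (b N) (leq_trans (leq_trans (leq_addl _ _) NN) (hb N)) => x1 x2.
by apply: le_lt_trans x2; rewrite ler_piMr ?cmod_ge0// ltW.
Qed.

Lemma l2b_conj u : l2b u -> l2b (fun n => conjc (u n)).
Proof. by move=> [B h]; exists B => N; under [X in symsum X]eq_fun do rewrite cmod_conj. Qed.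

Section Eigen.
Variables (lam alpha theta : R).

Lemma is_solD E u v a b : is_sol lam alpha theta E u -> is_sol lam alpha theta E v ->
  is_sol lam alpha theta E (fun n => a * u n + b * v n).
Proof.
move=> hu hv n; have -> : E * (a * u n + b * v n) = a * (E * u n) + b * (E * v n) by ring.
by rewrite -(hu n) -(hv n); ring.
Qed.

(** Lagrange's identity: the sum telescopes to Wronskians at the ends, which vanish in the limit.
    With u = v it shows that eigenvalues are real. *)
Lemma eigen_orth E E' u v : is_sol lam alpha theta E u -> is_sol lam alpha theta E' v -> l2b u -> l2b v ->
  (E - conjc E') * inner u v = 0.
Proof.
move=> hu hv lu lv.
have c1 := ccvgZ (E - conjc E') (inner_cvg lu lv).
pose W (n : int) := u (n + 1) * conjc (v n) - u n * conjc (v (n + 1)).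
have hv' n : conjc (v (n + 1)) + conjc (v (n - 1)) + ((2 * lam * cos (2 * pi * (theta + n%:~R * alpha)))%:C)%C * conjc (v n)
    = conjc E' * conjc (v n).
  have := congr1 conjc (hv n); rewrite rmorphD rmorphD rmorphM [in RHS]rmorphM.
  by move=> hh; apply: etrans hh; congr (_ + _ + _ * _); exact/esym/conjcR.
have step n : (E - conjc E') * (u n * conjc (v n)) = W n - W (n - 1).
  rewrite mulrBl mulrA -hu [conjc E' * _]mulrCA -hv' /W subrK; ring.
have sumW N : (E - conjc E') * csum (fun n => u n * conjc (v n)) N = W N%:Z - W (- N%:Z - 1).
  elim: N => [|N IH]; first by rewrite /csum big_ord1 step oppr0 !sub0r.
  rewrite csumS mulrDr IH mulrDr !step (_ : N.+1%:Z - 1 = N%:Z); last lia.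
  by rewrite (_ : - N.+1%:Z = - N%:Z - 1); [ring|lia].
apply: ccvg_unique (c1) _.
have lv' := l2b_conj lv.
have c0 : ccvg (fun N => W N%:Z - W (- N%:Z - 1)) (0 + -1 * 0 + (-1 * (0 + -1 * 0))).
  have g a b ha hb := @ccvg0_l2 u (fun n => conjc (v n)) a b lu lv' ha hb.
  apply: (@ccvg_eq (fun N => (u (N%:Z + 1) * conjc (v N%:Z) + -1 * (u N%:Z * conjc (v (N%:Z + 1)))) +
    (-1 * (u (- N%:Z - 1 + 1) * conjc (v (- N%:Z - 1)) + -1 * (u (- N%:Z - 1) * conjc (v (- N%:Z - 1 + 1))))))  _ _ 0%N).
    by move=> N _; rewrite /W; ring.
  apply: ccvgD; [apply: ccvgD|apply: ccvgZ; apply: ccvgD].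
  - by apply: (g (fun N => N%:Z + 1) (fun N => N%:Z)) => N; lia.
  - by apply: ccvgZ; apply: (g (fun N => N%:Z) (fun N => N%:Z + 1)) => N; lia.
  - by apply: (g (fun N => - N%:Z - 1 + 1) (fun N => - N%:Z - 1)) => N; lia.
  - by apply: ccvgZ; apply: (g (fun N => - N%:Z - 1) (fun N => - N%:Z - 1 + 1)) => N; lia.
rewrite !mulr0 !addr0 ?mulr0 ?addr0 in c0.
by apply: (@ccvg_eq _ _ _ 0%N _ c0) => N _; rewrite sumW.
Qed.

(** The Wronskian is constant and tends to 0 at infinity, so it is 0. *)
Lemma eigen_simple E u v : is_sol lam alpha theta E u -> is_sol lam alpha theta E v -> l2b u -> l2b v ->
  (exists n, u n != 0) -> exists c, forall n, v n = c * u n.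
Proof.
move=> hu hv lu lv [p up].
pose W (n : int) := u (n + 1) * v n - u n * v (n + 1).
have step n : W n = W (n - 1).
  apply/eqP; rewrite -subr_eq0; apply/eqP.
  have -> : W n - W (n - 1) = (E * u n) * v n - u n * (E * v n).
    by rewrite -hu -hv /W subrK; ring.
  ring.
have cst (k : nat) : W (p + k%:Z) = W p.
  by elim: k => [|k IH]; rewrite ?addr0// step -IH; congr W; lia.
have W0 : W p = 0.
  apply: (@ccvg_unique (fun=> W p)); first exact: ccvg_cst.
  have g a b ha hb := @ccvg0_l2 u v a b lu lv ha hb.
  have c0 : ccvg (fun N => u (p + (N + absz p)%N%:Z + 1) * v (p + (N + absz p)%N%:Z) +
     -1 * (u (p + (N + absz p)%N%:Z) * v (p + (N + absz p)%N%:Z + 1))) (0 + -1 * 0).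
    apply: ccvgD; last apply: ccvgZ.
      by apply: (g (fun N => p + (N + absz p)%N%:Z + 1) (fun N => p + (N + absz p)%N%:Z)) => N; lia.
    by apply: (g (fun N => p + (N + absz p)%N%:Z) (fun N => p + (N + absz p)%N%:Z + 1)) => N; lia.
  rewrite mulr0 addr0 in c0; apply: (@ccvg_eq _ _ _ 0%N _ c0) => N _.
  by rewrite -(cst (N + absz p)%N) /W mulN1r.
exists (v p / u p) => n; apply/eqP; rewrite -subr_eq0 -mulN1r addrC; apply/eqP.
have := is_solD (-1 * (v p / u p)) 1 hu hv => hw.
rewrite mulrA -[X in _ + X]mul1r; apply: (sol_zero (p := p) hw).
  by rewrite mul1r mulN1r mulNr divfK// addNr.
apply: (mulfI up); rewrite mulr0 -[RHS]oppr0 -W0 /W; field.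
exact: up.
Qed.

End Eigen.

Lemma csum_delta (a : int) (h : int -> R[i]) N : (absz a <= N)%N -> csum (fun n => (n == a)%:R * h n) N = h a.
Proof.
move=> aN; rewrite /csum (sym_window (fun n => (n == a)%:R * h n)) (bigD1_seq a) ?window_uniq ?mem_window//=.
by rewrite eqxx mul1r big1 ?addr0// => n /negPf ->; rewrite mul0r.
Qed.

Lemma csumD h h' N : csum (fun n => h n + h' n) N = csum h N + csum h' N.
Proof. exact: big_split. Qed.

Lemma csumZ c h N : csum (fun n => c * h n) N = c * csum h N.
Proof. by rewrite /csum mulr_sumr. Qed.

Lemma csum_sum (I : finType) (h : I -> int -> R[i]) N : csum (fun n => \sum_i h i n) N = \sum_i csum (h i) N.
Proof. exact: exchange_big. Qed.

Lemma conjcJ (y z : R[i]) : conjc (conjc y * z) = y * conjc z.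
Proof. by case: y z => a b [c d]; apply/eqP; rewrite eq_complex /=; apply/andP; split; apply/eqP; ring. Qed.

(** The component of the unit vector at a orthogonal to the family: on the left its value at x, on
    the right its squared norm. [chi] marks the members that are not zero padding. *)
Lemma bessel_defect (I : finType) (phi : I -> int -> R[i]) (chi : I -> bool) (a x : int) :
  (forall i, l2b (phi i)) -> (forall i j, inner (phi i) (phi j) = ((i == j) && chi i)%:R) ->
  (forall i, ~~ chi i -> forall n, phi i n = 0) ->
  cmod ((x == a)%:R - \sum_i conjc (phi i a) * phi i x) ^+ 2 <= 1 - \sum_i cmod (phi i a) ^+ 2.
Proof.
move=> l2 on z0; pose g n := (n == a)%:R - \sum_i conjc (phi i a) * phi i n.
pose F N := 1 + (- \sum_i phi i a * conjc (phi i a)) + (- \sum_i conjc (phi i a) * phi i a) +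
  \sum_i \sum_j (conjc (phi i a) * phi j a) * csum (fun n => phi i n * conjc (phi j n)) N.
have FE N : (absz a <= N)%N -> F N = csum (fun n => g n * conjc (g n)) N.
  move=> aN.
  have -> : (fun n => g n * conjc (g n)) = (fun n => ((n == a)%:R * 1 + (n == a)%:R * (- \sum_i phi i a * conjc (phi i n))) +
     (n == a)%:R * (- \sum_i conjc (phi i a) * phi i n) + \sum_i \sum_j (conjc (phi i a) * phi j a) * (phi i n * conjc (phi j n))).
    apply/funext => n; rewrite /g rmorphB rmorph_nat rmorph_sum /=.
    under [X in _ * (_ - X)]eq_bigr do rewrite conjcJ.
    have -> : \sum_i \sum_j (conjc (phi i a) * phi j a) * (phi i n * conjc (phi j n)) =
      (\sum_i conjc (phi i a) * phi i n) * (\sum_j phi j a * conjc (phi j n)).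
      by rewrite mulr_suml; apply: eq_bigr => i _; rewrite mulr_sumr; apply: eq_bigr => j _; ring.
    by case: (n == a) => /=; ring.
  rewrite !csumD !csum_delta// csum_sum /F; congr (_ + _); apply: eq_bigr => i _.
  by rewrite csum_sum; apply: eq_bigr => j _; rewrite csumZ.
have cF : ccvg F (1 - \sum_i phi i a * conjc (phi i a)).
  have -> : 1 - \sum_i phi i a * conjc (phi i a) = 1 + (- \sum_i phi i a * conjc (phi i a)) + (- \sum_i conjc (phi i a) * phi i a) +
    \sum_i \sum_j (conjc (phi i a) * phi j a) * inner (phi i) (phi j).
    have -> : \sum_i \sum_j (conjc (phi i a) * phi j a) * inner (phi i) (phi j) = \sum_i conjc (phi i a) * phi i a.
      apply: eq_bigr => i _; rewrite (bigD1 i)//= big1 => [|j /negPf ji]; rewrite on ?eqxx ?addr0.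
        by have [ci|/z0 z] := boolP (chi i); rewrite /= ?mulr1// z !mulr0.
      by rewrite eq_sym ji mulr0.
    by rewrite addrNK.
  apply: ccvgD; first exact: ccvg_cst.
  apply: ccvg_sum => i; apply: ccvg_sum => j; apply: ccvgZ; exact: inner_cvg.
have cN : ccvg (fun N => - F N) (- (1 - \sum_i phi i a * conjc (phi i a))) by exact: ccvgN.
have Rz (w : R[i]) : complex.Re (w * conjc w) = cmod w ^+ 2 by rewrite mulcJ.
have -> : 1 - \sum_i cmod (phi i a) ^+ 2 = complex.Re (1 - \sum_i phi i a * conjc (phi i a)).
  have E : complex.Re (\sum_i phi i a * conjc (phi i a)) = \sum_i cmod (phi i a) ^+ 2.
    by rewrite (raddf_sum (@complex.Re R)); apply: eq_bigr => i _; exact: Rz.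
  by rewrite -E; symmetry; exact: (raddfB (@complex.Re R) 1).
suff : complex.Re (- (1 - \sum_i phi i a * conjc (phi i a))) <= - cmod (g x) ^+ 2.
  by rewrite (raddfN (@complex.Re R)) lerN2.
apply: (ccvg_Re_le cN (N0 := (absz a + absz x)%N)) => N aN.
rewrite (raddfN (@complex.Re R)) lerN2 FE; last by lia.
have E : complex.Re (csum (fun n => g n * conjc (g n)) N) = symsum (fun n => cmod (g n) ^+ 2) N.
  by apply: etrans (Re_csum _ _) _; congr symsum; apply/funext => n; exact: Rz.
apply: (@le_trans _ _ (symsum (fun n => cmod (g n) ^+ 2) N)); last by rewrite -E; exact: lexx.
rewrite /symsum (sym_window (fun n => cmod (g n) ^+ 2)) (bigD1_seq x) ?window_uniq ?mem_window//=; last lia.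
by rewrite lerDl sumr_ge0// => n _; exact: sqr_ge0.
Qed.

End L2.

(** * Limits of ring eigenvectors *)

Section Stage.
Variable R : realType.
Arguments continuant : simpl never.
Implicit Types (t theta x : R) (E z : R[i]).

Lemma geom_window (r : R) h : 0 <= r < 1 -> symsum (fun k => r ^+ (absz k)) h <= 2 / (1 - r).
Proof.
move=> /andP[r0 r1]; have r10 : 0 < 1 - r by lra.
rewrite ler_pdivlMr//; apply: (@le_trans _ _ (2 - 2 * r ^+ h.+1)); last by rewrite gerBl mulr_ge0 ?exprn_ge0.
elim: h => [|h IH]; first by rewrite symsum0 /= expr0 expr1; lra.
rewrite symsumS mulrDl abszN /=.
have -> : (r ^+ h.+1 + r ^+ h.+1) * (1 - r) = 2 * r ^+ h.+1 - 2 * r ^+ h.+2 by rewrite [r ^+ h.+2]exprS; ring.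
by lra.
Qed.

Section PeriodSum.
Variables (V : zmodType) (f : int -> V) (q : nat).
Hypothesis per : forall n, f (n + q%:Z) = f n.

Lemma period_sum1 (b : int) : \sum_(i < q) f (b + 1 + i%:Z) = \sum_(i < q) f (b + i%:Z).
Proof.
have h (c : int) : \sum_(i < q) f (c + 1 + i%:Z) + f c = \sum_(i < q.+1) f (c + i%:Z).
  rewrite [RHS]big_ord_recl addr0 addrC; congr (_ + _); apply: eq_bigr => i _.
  by congr f; rewrite lift0; lia.
by apply: (addIr (f b)); rewrite h big_ord_recr /= per.
Qed.

Lemma period_sum (b : int) : \sum_(i < q) f (b + i%:Z) = \sum_(i < q) f i%:Z.
Proof.
have -> : \sum_(i < q) f i%:Z = \sum_(i < q) f (0 + i%:Z) by apply: eq_bigr => i _; rewrite add0r.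
case: b => k.
  elim: k => [//|k IH]; rewrite -IH -(period_sum1 k%:Z).
  by apply: eq_bigr => i _; congr f; lia.
elim: k => [|k IH].
  by rewrite -(period_sum1 (Negz 0)); apply: eq_bigr => i _; congr f; lia.
by rewrite -IH -(period_sum1 (Negz k.+1)); apply: eq_bigr => i _; congr f; lia.
Qed.

End PeriodSum.

Lemma window_in_period (V : nmodType) (f : int -> V) (q Y : nat) (a : int) : (2 * (Y + absz a) + 2 <= q)%N ->
  \sum_(i < q | (absz (a - (q./2)%:Z + i%:Z)%R <= Y)%N) f (a - (q./2)%:Z + i%:Z) = \sum_(i < (Y.*2).+1) f (i%:Z - Y%:Z).
Proof.
move=> qY; rewrite sym_window -(big_mkord (fun i => (absz (a - (q./2)%:Z + i%:Z)%R <= Y)%N) (fun i => f (a - (q./2)%:Z + i%:Z))).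
rewrite -(big_map (fun i : nat => a - (q./2)%:Z + i%:Z) (fun n => (absz n <= Y)%N) f) -big_filter.
apply: perm_big; apply: uniq_perm; rewrite ?window_uniq//.
  by rewrite filter_uniq// map_inj_uniq ?iota_uniq// => i j /addrI [].
move=> n; rewrite mem_window mem_filter andb_idr// => nY.
apply/mapP; exists (absz (n - a + (q./2)%:Z)%R); last by lia.
by rewrite mem_index_iota; lia.
Qed.

Variables (kappa : nat) (tau lam : R) (beta : nat -> R) (q : nat -> nat).
Hypotheses (tau0 : 0 < tau) (l1 : 1 < `|lam|).
Hypothesis (zq : forall l, expi ((q l)%:R * beta l) = 1).
Hypothesis (dc : forall l, dioph_upto kappa tau (beta l) (q l)).
Hypothesis (qinf : forall M, exists l0, forall l, (l0 <= l)%N -> (M <= q l)%N).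
Hypothesis (growth : forall eps : R, 0 < eps -> exists n : nat, forall e, `|e| <= 2 + 2 * `|lam| -> forall l, (n <= l)%N ->
  ring_eig lam beta q l e -> growth_bound lam (beta l) ((e%:C)%C) n%:R eps).

(* Along infinitely many approximants the phase is non-resonant with a bound uniform in the period; by
   Borel-Cantelli type measure estimates almost every phase qualifies. *)
Definition good_phase theta := exists2 c : R, 0 < c & forall l0, exists2 l, (l0 <= l)%N & forall n : int,
  (absz n <= 3 * q l)%N -> c / (absz n).+1%:R ^+ 2 <= chord (2 * theta + n%:~R * beta l).

(** The family is padded with zeros to a size N independent of l, and its bounds are uniform in l,
    so that limits can be taken index by index. *)
Record stage theta (a : int) (eta C c1 : R) (N l : nat) (phi : 'I_N -> int -> R[i]) (e : 'I_N -> R) (chi : 'I_N -> bool) : Prop := Stage {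
  stage_sol : forall i, is_sol lam (beta l) theta (((e i)%:C)%C) (phi i);
  stage_eig : forall i, `|e i| <= 2 + 2 * `|lam| /\ ring_eig lam beta q l (e i);
  stage_zero : forall i, ~~ chi i -> forall n, phi i n = 0;
  stage_le1 : forall i n, cmod (phi i n) <= 1;
  stage_decay : forall i n, (2 * absz (n - a)%R <= q l)%N -> cmod (phi i n) <= C * expR (- (c1 * (absz (n - a)%R)%:R));
  stage_orth : forall i j Y, (2 * (Y + absz a) + 2 <= q l)%N -> 
    cmod (csum (fun n => phi i n * conjc (phi j n)) Y - ((i == j) && chi i)%:R) <= C * expR (- (c1 * Y%:R));
  stage_mass : 1 - eta <= \sum_i cmod (phi i a) ^+ 2 }.

(** Keep the ring eigenvectors with |P s a| >= del. There are at most 1/del^2 of them, and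
    [tail_decay] localises them near a; the others carry little mass at a. *)
Lemma ring_stage theta a (eta : R) : good_phase theta -> 0 < eta -> exists (N : nat) (C c1 : R), 0 <= C /\ 0 < c1 /\
  forall l0, exists2 l, (l0 <= l)%N & exists phi e chi, @stage theta a eta C c1 N l phi e chi.
Proof.
move=> [c c0 hgood] eta0.
have [c1 [epsu [c10 eu0 tail]]] := tail_decay kappa tau0 l1.
have [n0 hgr] := growth eu0.
have [Ct Ct0 {}tail] := tail n0%:R c (absz a) (ler0n _ _) c0.
pose r := expR (- (c1 / 2)).
have r01 : 0 <= r < 1 by rewrite expR_ge0 -expR0 ltr_expR oppr_lt0 divr_gt0.
pose G : R := 2 / (1 - r).
have G0 : 0 < G by rewrite divr_gt0// subr_gt0; case/andP: r01.
have rE k : expR (- (c1 * k%:R)) = r ^+ k * r ^+ k.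
  by rewrite -!expRM_natr -expRD; congr expR; field.
have [Y hY] : exists Y, r ^+ Y < eta / (2 * (Ct * G + 1)).
  by apply: exists_expr_lt => //; rewrite divr_gt0// mulr_gt0// ltr_wpDl// mulr_ge0// ltW.
have rpos k : 0 < r ^+ k by rewrite exprn_gt0// expR_gt0.
(* Chosen so that the part within distance Y of a contributes eta/2; the choice of Y bounds the rest
   by eta/2. *)
pose d2 : R := eta * r ^+ Y / (2 * G).
have d20 : 0 < d2 by apply: divr_gt0; apply: mulr_gt0 => //; exact: rpos.
pose del := Num.sqrt d2.
have del0 : 0 < del by rewrite sqrtr_gt0.
have del2 : del ^+ 2 = d2 by rewrite sqr_sqrtr// ltW.
have [N hN] := archi_nat d2^-1.
pose C := Ct / del + (Ct / del) ^+ 2 * G * expR (c1 / 2 * (absz a)%:R).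
have Ctd0 : 0 <= Ct / del by rewrite divr_ge0// ltW.
have C0 : 0 <= C by rewrite addr_ge0// mulr_ge0 ?expR_ge0// mulr_ge0 ?exprn_ge0// ltW.
exists N, C, (c1 / 2); do 2![split; first by rewrite // divr_gt0] => l0.
have [l3 hl3] := qinf (2 * absz a + 3)%N.
have [l ll res] := hgood (l0 + n0 + l3)%N.
exists l; first by apply: leq_trans ll; rewrite -addnA leq_addr.
have q3 : (2 * absz a + 3 <= q l)%N by apply: hl3; apply: leq_trans ll; rewrite leq_addl.
have q2 : (2 < q l)%N by clear -q3; lia.
have nl : (n0 <= l)%N by clear -ll; lia.
have [q' qE] : exists q', q l = q'.+1 by exists (q l).-1; clear -q2; lia.
have zq' : expi (q'.+1%:R * beta l) = 1 by rewrite -qE.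
have [P [e [hsol hper horth hpars]]] := ring_basis lam theta zq'.
have dcl : dioph_upto kappa tau (beta l) q'.+1 by rewrite -qE.
have q2' : (2 < q'.+1)%N by rewrite -qE.
have Re_sqr (z : R[i]) : complex.Re (z * conjc z) = cmod z ^+ 2 by rewrite mulcJ.
have row1 s : \sum_(j < q'.+1) cmod (P s j%:Z) ^+ 2 = 1.
  have := congr1 (@complex.Re R) (horth s s); rewrite eqxx (raddf_sum (@complex.Re R)) => h.
  by rewrite -[RHS]h; apply: eq_bigr => j _; symmetry; exact: Re_sqr.
have col1 n : \sum_(s < q'.+1) cmod (P s n) ^+ 2 = 1.
  have := congr1 (@complex.Re R) (hpars n); rewrite (raddf_sum (@complex.Re R)) => h.
  by rewrite -[RHS]h; apply: eq_bigr => j _; symmetry; exact: Re_sqr.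
have le1 s n : cmod (P s n) <= 1.
  rewrite -(ler_pXn2r (ltn0Sn 1)) ?nnegrE ?cmod_ge0// expr1n -(col1 n) (bigD1 s)//= lerDl.
  by apply: sumr_ge0 => *; exact: sqr_ge0.
have cs (x y : int) : \sum_(s < q'.+1) cmod (P s x) * cmod (P s y) <= 1.
  have -> : (1 : R) = \sum_(s < q'.+1) (cmod (P s x) ^+ 2 + cmod (P s y) ^+ 2) / 2.
    by rewrite -mulr_suml big_split /= !col1; lra.
  by apply: ler_sum => s _; have := sqr_ge0 (cmod (P s x) - cmod (P s y)); rewrite sqrrB; lra.
have Pn0 s : exists n, P s n != 0.
  apply: contrapT => h; have := row1 s; rewrite big1 => [/eqP|j _]; first by rewrite eq_sym oner_eq0.
  by have [->|n0'] := eqVneq (P s j%:Z) 0; [rewrite cmod0 expr0n|case: h; exists j%:Z].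
have ebound s := ring_sol_bound q2' (hsol s) (hper s) (Pn0 s).
have eeig s : ring_eig lam beta q l (e s).
  by exists theta; rewrite qE; exact: (ring_sol_trace q2' (hsol s) (hper s) (Pn0 s)).
have T s (x : int) : (2 * absz (a - x)%R <= q'.+1)%N -> cmod (P s a) * cmod (P s x) <= Ct * expR (- (c1 * (absz (a - x)%R)%:R)).
  move=> h; apply: (tail (beta l) q'.+1 dcl theta (((e s)%:C)%C)) => //.
  - exact: hgr (ebound s) l nl (eeig s).
  - by rewrite -qE.
  - by rewrite -qE; clear -q3; lia.
pose h := (q'.+1)./2.
pose pos (i : nat) : int := a - h%:Z + i%:Z.
have posa i : absz (a - pos i)%R = absz (i%:Z - h%:Z)%R by rewrite /pos; clear; lia.
have posh (i : 'I_q'.+1) : (2 * absz (a - pos i)%R <= q'.+1)%N.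
  by rewrite posa /h; have := ltn_ord i; clear; lia.
have sumr : \sum_(i < q'.+1) r ^+ (absz (i%:Z - h%:Z)%R) <= G.
  apply: le_trans (geom_window h r01); rewrite /symsum.
  rewrite -(big_mkord xpredT (fun i => r ^+ (absz (i%:Z - h%:Z)%R))) -(big_mkord xpredT (fun i => r ^+ (absz (i%:Z - h%:Z)%R))).
  rewrite (@big_cat_nat _ _ _ q'.+1 0 (h.*2).+1)//=; last by rewrite /h; clear; lia.
  by rewrite lerDl sumr_ge0// => *; exact: ltW.
have per2 s s' n : P s (n + q'.+1%:Z) * conjc (P s' (n + q'.+1%:Z)) = P s n * conjc (P s' n) by rewrite !hper.
have percm s n : cmod (P s (n + q'.+1%:Z)) ^+ 2 = cmod (P s n) ^+ 2 by rewrite hper.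
have rowpos s : \sum_(i < q'.+1) cmod (P s (pos i)) ^+ 2 = 1.
  by rewrite (period_sum (percm s) (a - h%:Z)) row1.
(* Insert the unit norm of each row as a sum over sites. Within Y of a use |P s a|^2 < del^2 and the
   unit columns, beyond Y the decay of |P s a| |P s x|. *)
have small : \sum_(s < q'.+1 | cmod (P s a) < del) cmod (P s a) ^+ 2 <= eta.
  have -> : \sum_(s < q'.+1 | cmod (P s a) < del) cmod (P s a) ^+ 2 =
     \sum_(i < q'.+1) \sum_(s < q'.+1 | cmod (P s a) < del) cmod (P s a) ^+ 2 * cmod (P s (pos i)) ^+ 2.
    by rewrite exchange_big; apply: eq_bigr => s _; rewrite -mulr_sumr rowpos mulr1.
  apply: (@le_trans _ _ (\sum_(i < q'.+1) (d2 / r ^+ Y + Ct * r ^+ Y) * r ^+ (absz (i%:Z - h%:Z)%R))).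
    apply: ler_sum => i _; rewrite mulrDl; set D := absz _.
    have [DY|DY] := leqP D Y.
      apply: (@le_trans _ _ d2); last first.
        rewrite -[leLHS]addr0; apply: lerD; last by rewrite !mulr_ge0// ltW.
        rewrite -mulrA ler_peMr ?(ltW d20)// mulrC ler_pdivlMr// mul1r.
        by apply: ler_wiXn2l => //; case/andP: r01 => // _ /ltW.
      apply: (@le_trans _ _ (\sum_(s < q'.+1) d2 * cmod (P s (pos i)) ^+ 2)); last by rewrite -mulr_sumr col1 mulr1.
      rewrite big_mkcond; apply: ler_sum => s _; case: ifP => [sd|_].
        by rewrite ler_wpM2r ?sqr_ge0// -del2; apply: lerXn2r; rewrite ?nnegrE ?cmod_ge0// ltW.
      by rewrite mulr_ge0 ?sqr_ge0// ltW.
    apply: (@le_trans _ _ (Ct * r ^+ Y * r ^+ D)); last by rewrite lerDr mulr_ge0 ?(ltW (rpos _))// divr_ge0 ?(ltW d20) ?(ltW (rpos _)).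
    apply: (@le_trans _ _ (Ct * (r ^+ D * r ^+ D) * \sum_(s < q'.+1) cmod (P s a) * cmod (P s (pos i)))).
      rewrite mulr_sumr big_mkcond; apply: ler_sum => s _; have := T s (pos i) (posh i).
      rewrite posa -/D rE => Ts; case: ifP => _; last by rewrite !mulr_ge0 ?cmod_ge0// ltW.
      by rewrite -exprMn expr2 ler_wpM2r ?mulr_ge0 ?cmod_ge0.
    apply: (@le_trans _ _ (Ct * (r ^+ D * r ^+ D))); first by rewrite ler_piMr// !mulr_ge0// ltW.
    rewrite -mulrA ler_wpM2l// ler_wpM2r ?(ltW (rpos _))//.
    by apply: ler_wiXn2l; [case/andP: r01|case/andP: r01 => _ /ltW|exact: ltnW].
  rewrite -mulr_sumr; apply: (@le_trans _ _ ((d2 / r ^+ Y + Ct * r ^+ Y) * G)).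
    apply: ler_wpM2l => //; apply: addr_ge0; last by rewrite mulr_ge0 ?(ltW (rpos _)).
    by rewrite divr_ge0 ?(ltW d20) ?(ltW (rpos _)).
  have -> : d2 / r ^+ Y = eta / (2 * G) by rewrite /d2; field; rewrite !gt_eqF// expR_gt0.
  have CG : 0 <= Ct * G by rewrite mulr_ge0// ltW.
  have h1 : Ct * G * r ^+ Y <= eta / 2.
    apply: (@le_trans _ _ ((Ct * G + 1) * r ^+ Y)); first by rewrite ler_wpM2r ?(ltW (rpos _))//; lra.
    apply: (@le_trans _ _ ((Ct * G + 1) * (eta / (2 * (Ct * G + 1))))); first by rewrite ler_wpM2l ?(ltW hY)//; lra.
    by rewrite le_eqVlt; apply/orP; left; apply/eqP; field; rewrite gt_eqF//; lra.
  rewrite mulrDl (_ : eta / (2 * G) * G = eta / 2); last by field; rewrite gt_eqF.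
  by move: h1; rewrite mulrAC; lra.
pose A : pred 'I_q'.+1 := [pred s | del <= cmod (P s a)].
have massA : 1 - eta <= \sum_(s in A) cmod (P s a) ^+ 2.
  rewrite lerBlDr -[leLHS](col1 a) (bigID (mem A)) /= lerD2l; apply: le_trans small.
  by rewrite le_eqVlt; apply/orP; left; apply/eqP; apply: eq_bigl => s; rewrite !inE ltNge.
have cardA : (#|A| <= N)%N.
  have : #|A|%:R * d2 <= 1.
    rewrite -[leRHS](col1 a) mulr_natl -sumr_const [leRHS](bigID (mem A)) /=.
    apply: ler_wpDr; first by apply: sumr_ge0 => *; exact: sqr_ge0.
    apply: ler_sum => s; rewrite inE /= -del2 => hs.
    by apply: lerXn2r; rewrite ?nnegrE ?cmod_ge0// ltW.
  by rewrite -ler_pdivlMr// mul1r => /le_trans /(_ hN); rewrite ler_nat.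
pose sq := enum A.
have sqN : (size sq <= N)%N by rewrite -cardE.
pose chi (i : 'I_N) := (i < size sq)%N.
pose ix (i : nat) : 'I_q'.+1 := nth ord0 sq i.
pose phi (i : 'I_N) := if chi i then P (ix i) else fun=> 0.
have ixA i : chi i -> del <= cmod (P (ix i) a).
  by move=> ci; have := mem_nth ord0 ci; rewrite mem_enum inE.
have dec i n : (2 * absz (n - a)%R <= q'.+1)%N -> cmod (phi i n) <= Ct / del * expR (- (c1 * (absz (n - a)%R)%:R)).
  move=> hn; rewrite /phi; case: ifP => ci; last by rewrite cmod0 mulr_ge0 ?expR_ge0.
  have na : absz (n - a)%R = absz (a - n)%R by clear; lia.
  rewrite na in hn *; have := T (ix i) n hn => Tn.
  rewrite mulrAC ler_pdivlMr//; apply: le_trans Tn; rewrite mulrC ler_wpM2r ?cmod_ge0//.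
  exact: ixA.
exists phi, (fun i => e (ix i)), chi; split.
- move=> i n; rewrite /phi; case: ifP => _; last by rewrite !mulr0 !addr0.
  exact: hsol.
- by move=> i; split; [exact: ebound|exact: eeig].
- by move=> i /negPf ci n; rewrite /phi ci.
- by move=> i n; rewrite /phi; case: ifP => _; rewrite ?cmod0.
- move=> i n; rewrite qE => hn; apply: (le_trans (dec i n hn)); apply: ler_pM; rewrite ?expR_ge0//.
    by rewrite /C lerDl mulr_ge0 ?expR_ge0// mulr_ge0 ?exprn_ge0// ltW.
  by rewrite ler_expR lerN2 ler_wpM2r//; lra.
- move=> i j Y'; rewrite qE => hY'.
  have [ci|ci] := boolP (chi i); last first.
    have -> : csum (fun n => phi i n * conjc (phi j n)) Y' = 0.
      by rewrite /csum big1// => k _; rewrite /phi (negPf ci) mul0r.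
    by rewrite andbF subrr cmod0 mulr_ge0 ?expR_ge0.
  have [cj|cj] := boolP (chi j); last first.
    have -> : csum (fun n => phi i n * conjc (phi j n)) Y' = 0.
      by rewrite /csum big1// => k _; rewrite /phi (negPf cj) conjc0 mulr0.
    have -> : (i == j) = false by apply/eqP => ij; move: cj; rewrite -ij ci.
    by rewrite subrr cmod0 mulr_ge0 ?expR_ge0.
  (* Orthogonality is exact over a full period, so the defect is the sum outside the window, where
     both vectors have decayed. *)
  have -> : ((i == j) && true)%:R = \sum_(k < q'.+1) P (ix i) (pos k) * conjc (P (ix j) (pos k)) :> R[i].
    rewrite (period_sum (per2 (ix i) (ix j)) (a - h%:Z)) horth andbT /ix nth_uniq ?enum_uniq//.
  rewrite (bigID (fun k : 'I_q'.+1 => (absz (pos k) <= Y')%N)) /=.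
  rewrite (@window_in_period _ (fun n => P (ix i) n * conjc (P (ix j) n)) q'.+1 Y' a hY').
  rewrite /csum /phi ci cj opprD addrA subrr add0r cmodN.
  apply: (le_trans (cmod_sum _ _ _)).
  apply: (@le_trans _ _ (\sum_(k < q'.+1) (Ct / del) ^+ 2 * (expR (c1 / 2 * (absz a)%:R) * expR (- (c1 / 2 * Y'%:R))) * r ^+ (absz (k%:Z - h%:Z)%R))).
    rewrite big_mkcond; apply: ler_sum => k _; case: ifP => [kY|_]; last first.
      by rewrite mulr_ge0 ?(ltW (rpos _))// mulr_ge0 ?sqr_ge0// mulr_ge0 ?expR_ge0.
    have pk := posh k; have pk' : (2 * absz (pos k - a)%R <= q'.+1)%N by move: pk; clear; lia.
    have := dec i _ pk'; have := dec j _ pk'; rewrite /phi ci cj.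
    have -> : absz (pos k - a)%R = absz (k%:Z - h%:Z)%R by rewrite /pos; clear; lia.
    set D := absz _; rewrite rE => dj di; rewrite cmodM cmod_conj.
    apply: (@le_trans _ _ ((Ct / del * (r ^+ D * r ^+ D)) * (Ct / del * (r ^+ D * r ^+ D)))).
      by apply: ler_pM; rewrite ?cmod_ge0.
    have rD1 : r ^+ D <= 1 by rewrite exprn_ile1//; case/andP: r01 => // _ /ltW.
    have rD2 : r ^+ D <= expR (c1 / 2 * (absz a)%:R) * expR (- (c1 / 2 * Y'%:R)).
      rewrite -expRM_natr -expRD ler_expR.
      have YD : Y'%:R <= (absz a)%:R + D%:R :> R.
        rewrite -natrD ler_nat; move: kY; rewrite /pos /D; clear; lia.
      have : 0 <= c1 * ((absz a)%:R + D%:R - Y'%:R) by rewrite mulr_ge0 ?(ltW c10)// subr_ge0.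
      by lra.
    have -> : (Ct / del * (r ^+ D * r ^+ D)) * (Ct / del * (r ^+ D * r ^+ D)) = (Ct / del) ^+ 2 * (r ^+ D * (r ^+ D * r ^+ D)) * r ^+ D by ring.
    rewrite ler_wpM2r ?(ltW (rpos _))// ler_wpM2l ?sqr_ge0//; apply: le_trans rD2.
    by rewrite ler_piMr ?(ltW (rpos _))// mulr_ile1 ?(ltW (rpos _)).
  rewrite -mulr_sumr.
  apply: (@le_trans _ _ ((Ct / del) ^+ 2 * (expR (c1 / 2 * (absz a)%:R) * expR (- (c1 / 2 * Y'%:R))) * G)).
    by rewrite ler_wpM2l// mulr_ge0 ?sqr_ge0// mulr_ge0 ?expR_ge0.
  rewrite /C mulrDl; apply: (@le_trans _ _ ((Ct / del) ^+ 2 * G * expR (c1 / 2 * (absz a)%:R) * expR (- (c1 / 2 * Y'%:R)))).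
    by rewrite le_eqVlt; apply/orP; left; apply/eqP; ring.
  by rewrite lerDr mulr_ge0 ?expR_ge0.
- apply: (le_trans massA); rewrite -big_enum /= (big_nth ord0) big_mkord.
  rewrite (big_ord_widen N (fun i => cmod (P (ix i) a) ^+ 2) sqN) big_mkcond /=.
  by apply: ler_sum => i _; rewrite /phi /chi; case: ifP => _; rewrite ?sqr_ge0.
Qed.


End Stage.

(** * Passage to the limit along an ultrafilter *)

Section Limit.
Variable R : realType.
Arguments continuant : simpl never.
Implicit Types (t theta x : R) (E z : R[i]) (f g : nat -> R[i]).

Definition ultra_cvg (U : set_system nat) (f : nat -> R[i]) z :=
  ((fun m => complex.Re (f m)) @ U --> complex.Re z) /\ ((fun m => complex.Im (f m)) @ U --> complex.Im z).

Section Ultra.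
Variable U : set_system nat.
Context {UU : UltraFilter U}.

Lemma ultra_lim (f : nat -> R) (B : R) : (forall m, `|f m| <= B) -> exists x, f @ U --> x.
Proof.
move=> h; have fU : (f @ U) `[- B, B]%classic.
  by apply: (@filterE nat U _ [set m | `[- B, B]%classic (f m)]) => m; rewrite /= in_itv /= -ler_norml.
have [x [_ cx]] := @segment_compact R (- B) B (f @ U) _ fU.
exists x => V /= Vx; have [//|UV] := in_ultra_setVsetC (f @^-1` V) UU.
have [y [] //] := cx (~` V) V UV Vx.
Qed.

Lemma ultra_clim (f : nat -> R[i]) (B : R) : (forall m, cmod (f m) <= B) -> exists z, ultra_cvg U f z.
Proof.
move=> h; have [|x hx] := @ultra_lim (fun m => complex.Re (f m)) B.
  by move=> m; apply: le_trans (Re_le_cmod _) (h m).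
have [|y hy] := @ultra_lim (fun m => complex.Im (f m)) B.
  by move=> m; apply: le_trans (Im_le_cmod _) (h m).
by exists (Complex x y).
Qed.

Lemma uc_cst z : ultra_cvg U (fun=> z) z.
Proof. by split; exact: cvg_cst. Qed.

Lemma ucD f g z w : ultra_cvg U f z -> ultra_cvg U g w -> ultra_cvg U (fun m => f m + g m) (z + w).
Proof.
move=> [a b] [c d]; split.
  rewrite (raddfD (@complex.Re R)); under eq_fun do rewrite (raddfD (@complex.Re R)); exact: cvgD.
by rewrite (raddfD (@complex.Im R)); under eq_fun do rewrite (raddfD (@complex.Im R)); exact: cvgD.
Qed.

Lemma ucM f g z w : ultra_cvg U f z -> ultra_cvg U g w -> ultra_cvg U (fun m => f m * g m) (z * w).
Proof.
move=> [a b] [c d].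
have ReM (x y : R[i]) : complex.Re (x * y) = complex.Re x * complex.Re y - complex.Im x * complex.Im y by case: x y => ? ? [].
have ImM (x y : R[i]) : complex.Im (x * y) = complex.Re x * complex.Im y + complex.Im x * complex.Re y.
  by case: x y => x1 x2 [y1 y2] /=.
split.
  by rewrite ReM; under eq_fun do rewrite ReM; apply: cvgB; apply: cvgM.
by rewrite ImM; under eq_fun do rewrite ImM; apply: cvgD; apply: cvgM.
Qed.

Lemma uc_conj f z : ultra_cvg U f z -> ultra_cvg U (fun m => conjc (f m)) (conjc z).
Proof.
move=> [a b]; have Rj (x : R[i]) : complex.Re (conjc x) = complex.Re x by case: x.
have Ij (x : R[i]) : complex.Im (conjc x) = - complex.Im x by case: x.
split; first by rewrite Rj; under eq_fun do rewrite Rj.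
by rewrite Ij; under eq_fun do rewrite Ij; exact: cvgN.
Qed.

Lemma uc_real (f : nat -> R) x : f @ U --> x -> ultra_cvg U (fun m => ((f m)%:C)%C) ((x%:C)%C).
Proof. by move=> h; split => //=; exact: cvg_cst. Qed.

Lemma uc_sum (I : Type) (r : seq I) (F : I -> nat -> R[i]) (z : I -> R[i]) :
  (forall i, ultra_cvg U (F i) (z i)) -> ultra_cvg U (fun m => \sum_(i <- r) F i m) (\sum_(i <- r) z i).
Proof.
move=> h; elim: r => [|i r IH].
  by rewrite big_nil; under eq_fun do rewrite big_nil; exact: uc_cst.
by rewrite big_cons; under eq_fun do rewrite big_cons; exact: ucD.
Qed.

Lemma uc_unique f z w : ultra_cvg U f z -> ultra_cvg U f w -> z = w.
Proof.
move=> [a b] [c d]; apply/eqP; rewrite eq_complex; apply/andP; split; apply/eqP.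
  exact: (cvg_unique _ a c).
exact: (cvg_unique _ b d).
Qed.

Lemma uc_near f z (e : R) : ultra_cvg U f z -> 0 < e -> \forall m \near U, cmod (f m - z) < e.
Proof.
move=> [/cvgrPdist_lt a /cvgrPdist_lt b] e0; have e20 : 0 < e / 2 by rewrite divr_gt0.
near=> m; apply: (le_lt_trans (cmod_le_ReIm _)).
have : `|complex.Re z - complex.Re (f m)| < e / 2 by near: m; exact: a.
have : `|complex.Im z - complex.Im (f m)| < e / 2 by near: m; exact: b.
by rewrite (raddfB (@complex.Re R)) (raddfB (@complex.Im R)) distrC [X in _ -> X < _ -> _]distrC /=; lra.
Unshelve. all: by end_near. Qed.

Lemma uc_le f z (b : R) : ultra_cvg U f z -> (\forall m \near U, cmod (f m) <= b) -> cmod z <= b.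
Proof.
move=> h hb; rewrite leNgt; apply/negP => lt.
have e0 : 0 < cmod z - b by rewrite subr_gt0.
have [m [h1 h2]] := filter_ex (filterI (uc_near h e0) hb).
by have := cmodB_ge z (f m); rewrite cmodBC; lra.
Qed.

End Ultra.

Section Approx.
Variables (kappa : nat) (tau lam : R) (beta : nat -> R) (q : nat -> nat).
Hypotheses (tau0 : 0 < tau) (l1 : 1 < `|lam|).
Hypothesis (zq : forall l, expi ((q l)%:R * beta l) = 1).
Hypothesis (dc : forall l, dioph_upto kappa tau (beta l) (q l)).
Hypothesis (qinf : forall M, exists l0, forall l, (l0 <= l)%N -> (M <= q l)%N).
Hypothesis (growth : forall eps : R, 0 < eps -> exists n : nat, forall e, `|e| <= 2 + 2 * `|lam| -> forall l, (n <= l)%N ->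
  ring_eig lam beta q l e -> growth_bound lam (beta l) ((e%:C)%C) n%:R eps).

(** One ultrafilter gives the limits of all values, energies and flags at once. The uniform
    exponential bounds keep orthonormality, and a growth bound passes on because a continuant of
    fixed order is continuous in energy and frequency. *)
Lemma eigen_approximation alpha theta a (eta : R) : (forall d : R, 0 < d -> exists l0, forall l, (l0 <= l)%N -> `|beta l - alpha| < d) ->
  good_phase beta q theta -> 0 < eta -> exists (N : nat) (psi : 'I_N -> int -> R[i]) (e : 'I_N -> R) (chi : 'I_N -> bool),
  [/\ (forall i, is_sol lam alpha theta (((e i)%:C)%C) (psi i)) /\ (forall i, l2b (psi i)),
      forall i j, inner (psi i) (psi j) = ((i == j) && chi i)%:R,
      forall i, ~~ chi i -> forall n, psi i n = 0,
      forall i (eps : R) n, 0 < eps -> (forall e', `|e'| <= 2 + 2 * `|lam| -> forall l, (n <= l)%N ->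
        ring_eig lam beta q l e' -> growth_bound lam (beta l) ((e'%:C)%C) n%:R eps) ->
        growth_bound lam alpha (((e i)%:C)%C) n%:R eps &
      1 - eta <= \sum_i cmod (psi i a) ^+ 2].
Proof.
move=> betaa gth eta0; have [N [C [c1 [C0 [c10 hst]]]]] := ring_stage tau0 l1 zq dc qinf growth a gth eta0.
have /choice [L hL] : forall m : nat, exists l, (m <= l)%N /\ exists phi e chi, @stage R lam beta q theta a eta C c1 N l phi e chi.
  by move=> m; have [l ml h] := hst m; exists l.
have /choice [D hD] : forall m : nat, exists D : ('I_N -> int -> R[i]) * ('I_N -> R) * ('I_N -> bool),
    @stage R lam beta q theta a eta C c1 N (L m) D.1.1 D.1.2 D.2.
  by move=> m; have [_ [phi [e [chi h]]]] := hL m; exists (phi, e, chi).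
have Lm m : (m <= L m)%N by case: (hL m).
have [U [UU ooU]] := @ultraFilterLemma nat \oo _.
have near_ge m0 : \forall m \near U, (m0 <= m)%N by apply: ooU; exists m0.
have /choice [E hE] : forall i, exists x, (fun m => (D m).1.2 i) @ U --> x.
  move=> i; apply: (@ultra_lim U UU _ (2 + 2 * `|lam|)) => m.
  by have [] := stage_eig (hD m) i.
have /choice [psi hpsi] : forall i, exists f : int -> R[i], forall n, ultra_cvg U (fun m => (D m).1.1 i n) (f n).
  move=> i; have /choice [f hf] : forall n, exists z, ultra_cvg U (fun m => (D m).1.1 i n) z.
    by move=> n; apply: (@ultra_clim U UU _ 1) => m; exact: (stage_le1 (hD m)).
  by exists f.
pose chi i := `[< \forall m \near U, (D m).2 i >].
have chiE i : \forall m \near U, (D m).2 i = chi i.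
  have [h|h] := in_ultra_setVsetC [set m | (D m).2 i] UU.
    have -> : chi i = true by apply/asboolP.
    by apply: filterS h => m /= ->.
  have -> : chi i = false.
    apply/asboolP => h'; have [m [a1 a2]] := filter_ex (filterI h h').
    by apply: a1.
  by apply: filterS h => m /= /negP /negPf.
have betaU : (fun m => beta (L m)) @ U --> alpha.
  apply/cvgrPdist_lt => d d0; have [l0 hl0] := betaa d d0.
  by apply: filterS (near_ge l0) => m lm; rewrite distrC; apply: hl0; exact: leq_trans (Lm m).
have orthlim i j Y : cmod (csum (fun n => psi i n * conjc (psi j n)) Y - ((i == j) && chi i)%:R) <= C * expR (- (c1 * Y%:R)).
  apply: (@uc_le U UU (fun m => csum (fun n => (D m).1.1 i n * conjc ((D m).1.1 j n)) Y - ((i == j) && chi i)%:R)).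
    apply: ucD; last exact: uc_cst.
    by rewrite /csum; apply: uc_sum => k; apply: ucM => //; apply: uc_conj.
  have [m0 hm0] := qinf (2 * (Y + absz a) + 2)%N.
  apply: filterS (filterI (near_ge m0) (chiE i)) => m [/= mm <-].
  by apply: (stage_orth (hD m)); apply: hm0; exact: leq_trans (Lm m).
have l2p i : l2b (psi i).
  exists (1 + C) => Y; have := orthlim i i Y => h.
  have -> : symsum (fun n => cmod (psi i n) ^+ 2) Y = complex.Re (csum (fun n => psi i n * conjc (psi i n)) Y).
    by apply: etrans (esym (Re_csum _ _)); congr symsum; apply/funext => n; rewrite mulcJ.
  have r1 : C * expR (- (c1 * Y%:R)) <= C by rewrite ler_piMr// -expR0 ler_expR oppr_le0 mulr_ge0// ltW.
  have := Re_le_cmod (csum (fun n => psi i n * conjc (psi i n)) Y - ((i == i) && chi i)%:R).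
  rewrite (raddfB (@complex.Re R)) ler_norml => /andP[_] h2.
  have : complex.Re ((((i == i) && chi i)%:R : R[i])) <= 1 by case: (_ && _); rewrite /= ?ler01.
  by move=> h3; move: h2 => /=; move: h3 => /= h3 h2; lra.
exists N, psi, E, chi; split.
- split=> // i n; apply: (@uc_unique U UU (fun m => (((D m).1.2 i)%:C)%C * (D m).1.1 i n)); last first.
    by apply: ucM => //; exact: uc_real.
  have hs : (fun m => (((D m).1.2 i)%:C)%C * (D m).1.1 i n) = (fun m => (D m).1.1 i (n + 1) + (D m).1.1 i (n - 1) +
     ((2 * lam * cos (2 * pi * (theta + n%:~R * beta (L m))))%:C)%C * (D m).1.1 i n).
    by apply/funext => m; rewrite -(stage_sol (hD m) i n).
  rewrite hs; apply: ucD; first exact: ucD.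
  apply: ucM => //; apply: uc_real; apply: cvgM; first exact: cvg_cst.
  have hh : (fun m => 2 * pi * (theta + n%:~R * beta (L m))) @ U --> 2 * pi * (theta + n%:~R * alpha).
    apply: cvgM; first exact: cvg_cst.
    apply: cvgD; first exact: cvg_cst.
    by apply: cvgM => //; exact: cvg_cst.
  exact: (cvg_comp _ _ hh (@continuous_cos R _)).
- move=> i j; apply: (ccvg_unique (inner_cvg (l2p i) (l2p j))) => d d0.
  have r01 : 0 <= expR (- c1) < 1 by rewrite expR_ge0 -expR0 ltr_expR oppr_lt0.
  have [Y hY] := exists_expr_lt r01 (divr_gt0 d0 (ltr_wpDl C0 ltr01)).
  exists Y => Y' YY; apply: (le_lt_trans (orthlim i j Y')).
  have -> : - (c1 * Y'%:R) = - c1 * Y'%:R by ring.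
  rewrite expRM_natr; move: hY; rewrite ltr_pdivlMr; last by rewrite ltr_wpDl.
  apply: le_lt_trans; rewrite mulrC; apply: ler_pM; rewrite ?exprn_ge0 ?expR_ge0//; last by rewrite lerDl.
  by apply: ler_wiXn2l => //; case/andP: r01 => // _ /ltW.
- move=> i ci n; apply: (@uc_unique U UU (fun m => (D m).1.1 i n)) => //.
  have z : \forall m \near U, (D m).1.1 i n = 0.
    by apply: filterS (chiE i) => m e; apply: (stage_zero (hD m)); rewrite e.
  split; apply: cvg_near_cst; apply: filterS z => m ->//.
- move=> i eps n eps0 hg t j.
  have hEi : `|E i| <= 2 + 2 * `|lam|.
    have := @uc_le U UU (fun m => (((D m).1.2 i)%:C)%C) ((E i)%:C)%C (2 + 2 * `|lam|) (uc_real (hE i)).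
    rewrite cmodR; apply; apply: nearW => m; rewrite cmodR.
    by have [] := stage_eig (hD m) i.
  apply/ler_addgt0Pr => d d0.
  have hEi' : cmod ((E i)%:C)%C <= 3 + 2 * `|lam| by rewrite cmodR; lra.
  have [r r0 hr] := @continuant_near R lam alpha _ j d hEi' d0.
  have n1 : \forall m \near U, `|alpha - beta (L m)| < r by move/cvgrPdist_lt: betaU; exact.
  have n2 : \forall m \near U, `|E i - (D m).1.2 i| < r by move/cvgrPdist_lt: (hE i); exact.
  have [m [[m1 m2] m3]] := filter_ex (filterI (filterI n1 n2) (near_ge n)).
  have [eb ee] := stage_eig (hD m) i.
  have := hg _ eb (L m) (leq_trans m3 (Lm m)) ee t j.
  have eb' : cmod (((D m).1.2 i)%:C)%C <= 3 + 2 * `|lam| by rewrite cmodR; lra.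
  have := hr (beta (L m)) _ t eb' _ _ j (leqnn j); rewrite distrC m1 -rmorphB cmodR distrC m2 => /(_ isT isT).
  have := cmodB_ge (continuant (site_coef lam ((E i)%:C)%C alpha (expi t)) j) (continuant (site_coef lam (((D m).1.2 i)%:C)%C (beta (L m)) (expi t)) j).
  by rewrite cmodBC; lra.
- have : ultra_cvg U (fun m => \sum_i (D m).1.1 i a * conjc ((D m).1.1 i a)) (\sum_i psi i a * conjc (psi i a)).
    by apply: uc_sum => i; apply: ucM => //; exact: uc_conj.
  have Rs (f : 'I_N -> R[i]) : complex.Re (\sum_i f i * conjc (f i)) = \sum_i cmod (f i) ^+ 2.
    by rewrite (raddf_sum (@complex.Re R)); apply: eq_bigr => i _; exact: (congr1 (@complex.Re R) (mulcJ (f i))).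
  move=> [h _]; rewrite -Rs leNgt; apply/negP => lt.
  have e0 : 0 < 1 - eta - complex.Re (\sum_i psi i a * conjc (psi i a)) by rewrite subr_gt0.
  have /cvgrPdist_lt /(_ _ e0) hh := h; have [m] := filter_ex hh.
  by have := stage_mass (hD m); rewrite !Rs ltr_norml => a1 /andP[a2 _]; lra.
Qed.

End Approx.
End Limit.

(** * Eigenbases of the operator and their correlators *)

Section Onb.
Variable R : realType.
Arguments continuant : simpl never.
Implicit Types (t x : R) (E z : R[i]) (u v w : int -> R[i]).

Lemma l2bZ c u : l2b u -> l2b (fun n => c * u n).
Proof.
move=> [B h]; exists (cmod c ^+ 2 * B) => N.
have -> : symsum (fun n => cmod (c * u n) ^+ 2) N = cmod c ^+ 2 * symsum (fun n => cmod (u n) ^+ 2) N.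
  by rewrite /symsum mulr_sumr; apply: eq_bigr => i _; rewrite cmodM exprMn.
by rewrite ler_wpM2l ?sqr_ge0.
Qed.

Lemma innerZl c u v : l2b u -> l2b v -> inner (fun n => c * u n) v = c * inner u v.
Proof.
move=> lu lv; apply: (ccvg_unique (inner_cvg (l2bZ c lu) lv)).
apply: (@ccvg_eq _ (fun N => c * csum (fun n => u n * conjc (v n)) N) _ _ 0%N).
  by move=> N _; rewrite -csumZ; apply: eq_bigr => i _; rewrite mulrA.
by apply: ccvgZ; exact: inner_cvg.
Qed.

Lemma conjcC_mul (a b : R[i]) : conjc (a * conjc b) = b * conjc a.
Proof. by rewrite mulrC conjcJ. Qed.

Lemma inner_conj u v : l2b u -> l2b v -> inner v u = conjc (inner u v).
Proof.
move=> lu lv; apply: (ccvg_unique (inner_cvg lv lu)).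
apply: (@ccvg_eq _ (fun N => conjc (csum (fun n => u n * conjc (v n)) N)) _ _ 0%N); last by apply: ccvg_conj; exact: inner_cvg.
move=> N _; rewrite /csum (raddf_sum (@conjc R)); apply: eq_bigr => i _.
exact: conjcC_mul.
Qed.

Lemma innerZr c u v : l2b u -> l2b v -> inner u (fun n => c * v n) = conjc c * inner u v.
Proof.
move=> lu lv; rewrite (inner_conj (l2bZ c lv) lu) (innerZl c lv lu) (inner_conj lv lu).
by case: c => c1 c2; case: (inner v u) => a b /=; congr Complex; ring.
Qed.

Lemma inner_self u a : l2b u -> exists2 s : R, inner u u = ((s%:C)%C) & cmod (u a) ^+ 2 <= s.
Proof.
move=> lu; have ic := inner_conj lu lu; exists (complex.Re (inner u u)).
  move: ic; case: (inner u u) => x y /= [] /eqP; rewrite -addr_eq0 -mulr2n mulrn_eq0 /= => /eqP ->.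
  by [].
have cN := ccvgN (inner_cvg lu lu).
have := ccvg_Re_le (b := - cmod (u a) ^+ 2) cN (N0 := absz a); rewrite (raddfN (@complex.Re R)) lerN2; apply => N aN.
rewrite (raddfN (@complex.Re R)) lerN2.
have E : complex.Re (csum (fun n => u n * conjc (u n)) N) = symsum (fun n => cmod (u n) ^+ 2) N.
  by apply: etrans (Re_csum _ _) _; congr symsum; apply/funext => n; rewrite mulcJ.
apply: (@le_trans _ _ (symsum (fun n => cmod (u n) ^+ 2) N)); last by rewrite -E; exact: lexx.
rewrite /symsum (sym_window (fun n => cmod (u n) ^+ 2)) (bigD1_seq a) ?window_uniq ?mem_window//=.
by rewrite lerDl sumr_ge0// => n _; exact: sqr_ge0.
Qed.

Lemma normalize u : l2b u -> (exists n, u n != 0) -> exists2 c, c != 0 & inner (fun n => c * u n) (fun n => c * u n) = 1.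
Proof.
move=> lu [a ua]; have [s su sa] := inner_self a lu.
have s0 : 0 < s by apply: lt_le_trans sa; rewrite exprn_gt0// cmod_gt0.
have [q q0 sq] : exists2 q : R, 0 < q & s = q * q.
  by exists (Num.sqrt s); [rewrite sqrtr_gt0|rewrite -expr2 sqr_sqrtr// ltW].
exists ((q^-1)%:C)%C; first by rewrite realC_neq0// invr_neq0// gt_eqF.
rewrite (innerZl _ lu (l2bZ _ lu)) (innerZr _ lu lu) su sq.
have -> : conjc ((q^-1)%:C)%C = ((q^-1)%:C)%C :> R[i] by rewrite /= oppr0.
rewrite -!(rmorphM (real_complex R)) -[RHS]/((1%:C)%C); congr ((_%:C)%C); field.
exact: lt0r_neq0.
Qed.

Section Point.
Variables (lam alpha theta : R) (Gr : R -> Prop).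
Hypothesis approxH : forall (a : int) (eta : R), 0 < eta -> exists (N : nat) (psi : 'I_N -> int -> R[i]) (e : 'I_N -> R) (chi : 'I_N -> bool),
  [/\ (forall i, is_sol lam alpha theta (((e i)%:C)%C) (psi i)) /\ (forall i, l2b (psi i)),
      forall i j, inner (psi i) (psi j) = ((i == j) && chi i)%:R,
      forall i, ~~ chi i -> forall n, psi i n = 0,
      forall i, Gr (e i) & 1 - eta <= \sum_i cmod (psi i a) ^+ 2].

(** If w(a) were nonzero, adjoining the normalised w to the approximating family with eta =
    |w(a)|^2/2 would violate Bessel's inequality at a. *)
Lemma eigen_complete w : l2b w ->
  (forall psi (e : R), is_sol lam alpha theta ((e%:C)%C) psi -> l2b psi -> Gr e -> inner w psi = 0) -> forall n, w n = 0.
Proof.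
move=> lw h a; apply/eqP/negPn/negP => wa.
have [c c0 cw] := normalize lw (ex_intro _ a wa).
pose w' n := c * w n; have lw' : l2b w' by exact: l2bZ.
have w'a : 0 < cmod (w' a) ^+ 2 by rewrite exprn_gt0// cmod_gt0 mulf_neq0.
have [N [psi [e [chi [[sol lp] orth zer gr mass]]]]] := approxH a (divr_gt0 w'a (ltr0n _ 2)).
have w0 i : inner w' (psi i) = 0 by rewrite innerZl// (h _ (e i))// mulr0.
pose phi (o : option 'I_N) := if o is Some i then psi i else w'.
pose ch (o : option 'I_N) := if o is Some i then chi i else true.
have sE : \sum_(o : option 'I_N) cmod (phi o a) ^+ 2 = cmod (w' a) ^+ 2 + \sum_i cmod (psi i a) ^+ 2.
  rewrite (bigD1 None)//=; congr (_ + _).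
  rewrite (reindex_omap (Some : 'I_N -> option 'I_N) id) /=; last by case.
  by apply: eq_bigl => i; rewrite eqxx.
have := @bessel_defect R (option 'I_N) phi ch a a; rewrite sE eqxx => B. have : 0 <= 1 - (cmod (w' a) ^+ 2 + \sum_i cmod (psi i a) ^+ 2).
  apply: le_trans (sqr_ge0 _) (B _ _ _).
  - by case=> [i|]; [exact: lp|exact: lw'].
  - case=> [i|] [j|] /=; first exact: orth.
    + by rewrite (inner_conj lw' (lp i)) w0 conjc0.
    + exact: w0.
    + exact: cw.
  - by case=> [i|] //; exact: zer.
lra.
Qed.

Let eig u E := [/\ is_sol lam alpha theta E u, l2b u & inner u u = 1].

Let eig_ne u E : eig u E -> exists n, u n != 0.
Proof.
move=> [_ lu u1]; apply: contrapT => h.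
have u0 n : u n = 0 by apply/eqP/negPn/negP => un; apply: h; exists n.
have : inner u u = 0.
  apply: (ccvg_unique (inner_cvg lu lu)); apply: (@ccvg_eq _ (fun=> 0) _ _ 0%N); last exact: ccvg_cst.
  by move=> N _; rewrite /csum big1// => i _; rewrite u0 mul0r.
by rewrite u1 => /eqP; rewrite oner_eq0.
Qed.

Let eig_real u E : eig u E -> E = conjc E.
Proof. by move=> [s l u1]; have := eigen_orth s s l l; rewrite u1 mulr1 => /eqP; rewrite subr_eq0 => /eqP. Qed.

Let eig_orth u v E E' : eig u E -> eig v E' -> E != E' -> inner u v = 0.
Proof.
move=> hu hv EE; have [s l _] := hu; have [s' l' _] := hv.
have := eigen_orth s s' l l'; rewrite -(eig_real hv) => /eqP; rewrite mulf_eq0 subr_eq0 (negPf EE) => /eqP //.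
Qed.

(** Eigenvalues are simple and different ones have orthogonal eigenfunctions, so one normalised
    eigenfunction per energy is enough. *)
Lemma onb_exists : exists B, eigen_onb lam alpha theta B.
Proof.
pose pick E := xget (fun=> 0) [set v | eig v E].
have pickP E v : eig v E -> eig (pick E) E by move=> h; exact: (@xgetPex _ (fun=> 0) [set v | eig v E] (ex_intro _ v h)).
exists [set u | exists E, eig u E /\ u = pick E]; split.
- by move=> u [E [[_ l u1] _]]; split => //; exact/l2bP.
- move=> u v [E [hu ->]] [E' [hv ->]] uv; apply: eig_orth; [exact: pickP hu|exact: pickP hv|].
  by apply/eqP => EE; apply: uv; rewrite EE.
- move=> w /l2bP lw h; apply/funext; apply: (eigen_complete lw) => psi e sol lp _.
  have [[n pn]|p0] := pselect (exists n, psi n != 0); last first.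
    apply: (ccvg_unique (inner_cvg lw lp)); apply: (@ccvg_eq _ (fun=> 0) _ _ 0%N); last exact: ccvg_cst.
    move=> N _; rewrite /csum big1// => i _.
    by have [->|pn] := eqVneq (psi (i%:Z - N%:Z)) 0; [rewrite conjc0 mulr0|case: p0; exists (i%:Z - N%:Z)].
  have [c c0 c1] := normalize lp (ex_intro _ n pn).
  have ep : eig (fun n => c * psi n) ((e%:C)%C).
    split=> //; last exact: l2bZ.
    by have := is_solD c 0 sol sol => hh m; have := hh m; rewrite !mul0r !addr0.
  have hp := pickP _ _ ep; have [sp lpp _] := hp.
  have [d hd] := eigen_simple sp sol lpp lp (eig_ne hp).
  have -> : psi = (fun n => d * pick ((e%:C)%C) n) by apply/funext.
  by rewrite innerZr// h ?mulr0//; exists ((e%:C)%C).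
- move=> u [E [[s _ _] _]]; exists E; apply/funext => n; exact: s.
Qed.

Section Basis.
Variable B : set (int -> R[i]).
Hypothesis onb : eigen_onb lam alpha theta B.

Let Beig u : B u -> exists E, eig u E.
Proof.
have [h1 _ _ h4] := onb => Bu; have [l u1] := h1 u Bu; have [E hE] := h4 u Bu.
exists E; split => //; last exact/l2bP.
by move=> n; have := congr1 (fun f => f n) hE.
Qed.

(** A basis vector whose energy were not good would be orthogonal to all approximating
    eigenfunctions, against [eigen_complete]. *)
Lemma onb_growth u : B u -> exists e, [/\ Gr e, is_sol lam alpha theta ((e%:C)%C) u & l2b u].
Proof.
move=> Bu; have [E hu] := Beig Bu; have [s l u1] := hu.
apply: contrapT => no; have [n un] := eig_ne hu.
move: (un); rewrite (eigen_complete l) ?eqxx// => psi e sp lp gr.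
have := eigen_orth s sp l lp; rewrite [conjc _](_ : _ = (e%:C)%C); last by rewrite /= oppr0.
move=> /eqP; rewrite mulf_eq0 => /orP[|/eqP//]; rewrite subr_eq0 => /eqP Ee.
by case: no; exists e; rewrite -Ee.
Qed.

Lemma onb_bessel (s : seq (int -> R[i])) (x : int) : uniq s -> (forall u, u \in s -> B u) -> \sum_(u <- s) cmod (u x) ^+ 2 <= 1.
Proof.
move=> us sB; have [h1 h2 _ _] := onb.
rewrite (big_nth (fun=> 0)) big_mkord.
have Bi (i : 'I_(size s)) : B (nth (fun=> 0) s i) by apply: sB; exact: mem_nth.
have := @bessel_defect R 'I_(size s) (fun i => nth (fun=> 0) s i) (fun=> true) x x.
have b1 i : l2b (nth (fun=> 0) s i : int -> R[i]) \/ True by right.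
move=> h; rewrite -subr_ge0; apply: le_trans (sqr_ge0 _) (h _ _ _) => // [i|i j].
  by apply/l2bP; case: (h1 _ (Bi i)).
rewrite andbT; have [->|ij] := eqVneq i j; first by case: (h1 _ (Bi j)).
apply: h2 => // e; move: ij; rewrite -val_eqE /= => /eqP; apply.
by apply/eqP; rewrite -(nth_uniq (fun=> 0) _ _ us) ?e.
Qed.

(** Bessel's inequality counts each site of the window at most once; the bound 1 is its use at the
    sites 0 and k. *)
Lemma onb_upper (k N : nat) (A : R) : 0 <= A ->
  (forall u, B u -> cmod (u 0) * cmod (u k%:Z) <= A * \sum_(x <- window N) cmod (u x) ^+ 2) ->
  (\esum_(u in B) (cmod (u 0) * cmod (u k%:Z))%:E <= (Num.min 1 (A * (N.*2.+1)%:R))%:E)%E.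
Proof.
move=> A0 h; apply: ge_ereal_sup => _ [X [finX XB] <-].
have [s0 Xs] := (finite_seqP X).1 finX; pose s := undup s0.
have us : uniq s by exact: undup_uniq.
have {}Xs : X = [set` s] by rewrite Xs; apply/seteqP; split => u /=; rewrite mem_undup.
have sB u : u \in s -> B u by move=> su; apply: XB; rewrite Xs.
rewrite Xs -fsbig_seq// sumEFin lee_fin le_min; apply/andP; split.
  apply: (@le_trans _ _ (\sum_(u <- s) (cmod (u 0) ^+ 2 + cmod (u k%:Z) ^+ 2) / 2)).
    by apply: ler_sum => u _; have := sqr_ge0 (cmod (u 0) - cmod (u k%:Z)); rewrite sqrrB; lra.
  rewrite -mulr_suml big_split /=; have := onb_bessel 0 us sB; have := onb_bessel k%:Z us sB; lra.
apply: (@le_trans _ _ (\sum_(u <- s) A * \sum_(x <- window N) cmod (u x) ^+ 2)).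
  by rewrite big_seq [leRHS]big_seq; apply: ler_sum => u su; apply: h; exact: sB.
rewrite -mulr_sumr ler_wpM2l// exchange_big /=.
apply: (@le_trans _ _ (\sum_(x <- window N) 1)).
  by apply: ler_sum => x _; exact: onb_bessel.
by rewrite big_const_seq count_predT size_map size_iota iter_addr_0.
Qed.

Definition band_eval (l : seq (R[i] * int)) u : R[i] := \sum_(p <- l) p.1 * u p.2.

(* The continuant is a monic polynomial of degree [j] in the energy, and on an eigenfunction a power of the
   energy acts as a power of the Hamiltonian: hence the value at distance [j] plus values strictly nearer.
   Summed over an eigenbasis against [conjc (u 0)] with [j = k], the nearer values cancel by completeness. *)
Lemma banded (k : int) (j : nat) : exists l : seq (R[i] * int), (forall p, p \in l -> k - j%:Z < p.2) /\
  forall E u, is_sol lam alpha theta E u -> continuant (site_coef lam E alpha (expi theta)) j * u k = u (k - j%:Z) + band_eval l u.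
Proof.
pose V (n : int) := ((2 * lam * cos (2 * pi * (theta + n%:~R * alpha)))%:C)%C : R[i].
have cE E i : site_coef lam E alpha (expi theta) i = E - V i%:Z.
  by rewrite /site_coef -expiD -expiN expi_cos -rmorphM /= /V; congr (_ - (_%:C)%C); ring.
have stepE E u (i x : int) : is_sol lam alpha theta E u -> (E - V i) * u x = u (x - 1) + u (x + 1) + (V x - V i) * u x.
  by move=> h; rewrite mulrBl -h -/(V x); ring.
have evZ c l u : c * band_eval l u = \sum_(p <- l) p.1 * (c * u p.2).
  by rewrite /band_eval mulr_sumr; apply: eq_bigr => p _; ring.
pose up i (l : seq (R[i] * int)) := [seq (p.1, p.2 - 1) | p <- l] ++ [seq (p.1, p.2 + 1) | p <- l] ++ [seq (p.1 * (V p.2 - V i), p.2) | p <- l].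
have evup E u i l : is_sol lam alpha theta E u -> (E - V i) * band_eval l u = band_eval (up i l) u.
  move=> h; rewrite evZ /band_eval /up !big_cat !big_map /= -!big_split /=; apply: eq_bigr => p _.
  by rewrite (stepE _ _ _ _ h); ring.
elim/nat_ind2: j => [||j [l0 [p0 h0]] [l1 [p1 h1]]].
- by exists [::]; split => // E u _; rewrite continuant0 mul1r subr0 /band_eval big_nil addr0.
- exists [:: (1, k + 1); (V k - V 0, k)]; split.
    by move=> p; rewrite !inE => /orP[|] /eqP -> /=; lia.
  by move=> E u h; rewrite continuant1 cE (stepE _ _ _ _ h) /band_eval !big_cons big_nil /=; ring.
pose i := j.+1%:Z; pose x := k - j.+1%:Z.
exists ([:: (1, x + 1); (V x - V i, x)] ++ up i l1 ++ [:: (-1, k - j%:Z)] ++ [seq (- p.1, p.2) | p <- l0]); split.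
  move=> p; rewrite !mem_cat => /orP[|/orP[|/orP[|]]].
  - by rewrite !inE /x => /orP[|] /eqP -> /=; lia.
  - rewrite ?mem_cat => /orP[|/orP[|]] /mapP[r rl ->] /=; have := p1 r rl; move: (r.2) => y; lia.
  - by rewrite inE => /eqP -> /=; lia.
  - by move=> /mapP[r rl ->] /=; have := p0 r rl; move: (r.2) => y; lia.
move=> E u h; rewrite continuantSS cE mulrBl -mulrA h1// h0// mulrDr (evup _ _ _ _ h) (stepE _ _ _ _ h) -/x.
have -> : k - j.+2%:Z = x - 1 by rewrite /x; lia.
have evcat l l' : band_eval (l ++ l') u = band_eval l u + band_eval l' u by rewrite /band_eval big_cat.
have ev2 a rest : band_eval ([:: (1, x + 1); (a, x)] ++ rest) u = u (x + 1) + a * u x + band_eval rest u.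
  by rewrite /band_eval !big_cons /= mul1r addrA.
have ev1 rest : band_eval ([:: (-1, k - j%:Z)] ++ rest) u = - u (k - j%:Z) + band_eval rest u by rewrite /band_eval big_cons /= mulN1r.
rewrite ev2 (evcat (up i l1)) ev1.
have -> : band_eval [seq (- p.1, p.2) | p <- l0] u = - band_eval l0 u.
  by rewrite /band_eval big_map -sumrN; apply: eq_bigr => p _; rewrite mulNr.
ring.
Qed.

(** The completeness sum is evaluated on a finite approximating family, up to a small defect, and
    then transferred to B, which contains the family up to phases. *)
Lemma onb_lower (k : nat) (M : R) : (0 < k)%N -> 0 < M ->
  (forall e, Gr e -> cmod (continuant (site_coef lam ((e%:C)%C) alpha (expi theta)) k) <= M) ->
  ((2 * M)^-1%:E <= \esum_(u in B) (cmod (u 0) * cmod (u k%:Z))%:E)%E.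
Proof.
move=> k0 M0 hM; have [l [pl hl]] := banded k%:Z k.
pose S := \sum_(p <- l) cmod p.1.
have S0 : 0 <= S by apply: sumr_ge0 => p _; exact: cmod_ge0.
(* With eta = d^2, [bessel_defect] bounds each off-diagonal entry by d, so the terms of [banded],
   all at sites right of 0, add at most S d <= 1/4. *)
pose d : R := (4 * (S + 1))^-1.
have d0 : 0 < d by rewrite invr_gt0 mulr_gt0// ltr_wpDl.
have d1 : d <= 1 / 4 by rewrite /d mul1r lef_pV2 ?posrE ?mulr_gt0 ?ltr_wpDl//; lra.
have dS : S * d <= 1 / 4.
  by rewrite /d ler_pdivrMr ?mulr_gt0 ?ltr_wpDl//; lra.
have [N [psi [e [chi [[sol lp] orth zer gr mass]]]]] := approxH 0 (exprn_gt0 2 d0).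
have def (x : int) : x != 0 -> cmod (\sum_i conjc (psi i 0) * psi i x) <= d.
  move=> x0; rewrite -(ler_pXn2r (ltn0Sn 1)) ?nnegrE ?cmod_ge0 ?(ltW d0)//.
  have := bessel_defect 0 x lp orth zer; rewrite (negPf x0) sub0r cmodN; lra.
have key : \sum_i conjc (psi i 0) * (continuant (site_coef lam (((e i)%:C)%C) alpha (expi theta)) k * psi i k%:Z) =
   \sum_i conjc (psi i 0) * psi i 0 + \sum_(p <- l) p.1 * \sum_i conjc (psi i 0) * psi i p.2.
  under eq_bigr => i _ do rewrite (hl _ _ (sol i)) subrr mulrDr.
  rewrite big_split /=; congr (_ + _); rewrite /band_eval.
  under eq_bigr do rewrite mulr_sumr.
  by rewrite exchange_big /=; apply: eq_bigr => p _; rewrite mulr_sumr; apply: eq_bigr => i _; ring.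
have low : 1 / 2 <= M * \sum_i cmod (psi i 0) * cmod (psi i k%:Z).
  have h1 : cmod (\sum_i conjc (psi i 0) * (continuant (site_coef lam (((e i)%:C)%C) alpha (expi theta)) k * psi i k%:Z)) <= M * \sum_i cmod (psi i 0) * cmod (psi i k%:Z).
    apply: (le_trans (cmod_sum _ _ _)); rewrite mulr_sumr; apply: ler_sum => i _.
    by rewrite !cmodM cmod_conj mulrCA ler_wpM2r ?mulr_ge0 ?cmod_ge0// hM.
  apply: le_trans h1; rewrite key.
  have h2 : cmod (\sum_(p <- l) p.1 * \sum_i conjc (psi i 0) * psi i p.2) <= 1 / 4.
    apply: le_trans dS; apply: (le_trans (cmod_sum _ _ _)); rewrite /S mulr_suml big_seq [leRHS]big_seq.
    apply: ler_sum => p pin; rewrite cmodM ler_wpM2l ?cmod_ge0//; apply: def.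
    by have := pl p pin; rewrite subrr => /gt_eqF ->.
  have h3 : 1 - d ^+ 2 <= complex.Re (\sum_i conjc (psi i 0) * psi i 0).
    apply: (le_trans mass); rewrite (raddf_sum (@complex.Re R)); apply: ler_sum => i _.
    by rewrite mulrC mulcJ /=.
  have h4 := le_trans (ler_norm _) (Re_le_cmod (\sum_i conjc (psi i 0) * psi i 0)).
  have h5 := cmodB_ge (\sum_i conjc (psi i 0) * psi i 0) (- \sum_(p <- l) p.1 * \sum_i conjc (psi i 0) * psi i p.2).
  rewrite opprK cmodN in h5.
  have h6 : d ^+ 2 <= 1 / 4 by rewrite expr2; have := ler_pM (ltW d0) (ltW d0) d1 d1; lra.
  by move: h2 h3 h4 h5 h6 => /=; lra.
have [_ _ cpl _] := onb.
(* A nonzero psi is not orthogonal to all of B; by simplicity it is a multiple of the vector it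
   meets, and unit norms make the factor unimodular. *)
have pickB i : exists u, chi i -> B u /\ exists2 c, cmod c = 1 & forall n, psi i n = c * u n.
  have [ci|ci] := boolP (chi i); last by exists (fun=> 0).
  have ei : eig (psi i) (((e i)%:C)%C) by split => //; rewrite orth eqxx ci.
  have [u [Bu iu]] : exists u, B u /\ inner (psi i) u != 0.
    apply: contrapT => no; have [n pn] := eig_ne ei; move: pn.
    rewrite (cpl (psi i)) ?eqxx//; first exact/l2bP.
    by move=> u Bu; apply/eqP/negPn/negP => iu; apply: no; exists u.
  exists u => _; split => //; have [E hu] := Beig Bu.
  have EE : ((e i)%:C)%C = E by apply/eqP/negPn/negP => ne; move: iu; rewrite (eig_orth ei hu ne) eqxx.
  have [s lu u1] := hu; rewrite -EE in s.
  have [c hc] := eigen_simple s (sol i) lu (lp i) (eig_ne hu).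
  exists c => //.
  have : inner (psi i) (psi i) = 1 by rewrite orth eqxx ci.
  have -> : psi i = (fun n => c * u n) by apply/funext.
  rewrite (innerZl _ lu (l2bZ _ lu)) (innerZr _ lu lu) u1 mulr1 mulcJ => /(congr1 (@complex.Re R)) /= /eqP.
  by rewrite sqrp_eq1 ?cmod_ge0// => /eqP.
have [u hu] := choice pickB.
have up i : chi i -> cmod (psi i 0) * cmod (psi i k%:Z) = cmod (u i 0) * cmod (u i k%:Z).
  by move=> ci; have [_ [c c1 hc]] := hu i ci; rewrite !hc !cmodM c1 !mul1r.
pose s := [seq u i | i <- enum chi].
(* Two psi attached to the same basis vector would be parallel, against orthogonality. *)
have us : uniq s.
  rewrite map_inj_in_uniq ?enum_uniq// => i j; rewrite !mem_enum => ci cj uij.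
  apply/eqP/negPn/negP => ij; have [_ [c c1 hc]] := hu i ci; have [_ [c' c1' hc']] := hu j cj.
  have cn : c != 0 by rewrite -cmod_gt0 c1.
  have cn' : c' != 0 by rewrite -cmod_gt0 c1'.
  have := orth i j; rewrite (negPf ij) /=.
  have -> : psi j = (fun n => (c' / c) * psi i n).
    by apply/funext => n; rewrite hc hc' uij; field.
  rewrite (innerZr _ (lp i) (lp i)) orth eqxx (ci : chi i) mulr1 => /eqP; rewrite -cmod_eq0 cmod_conj cmod_eq0 mulf_eq0 invr_eq0.
  by rewrite (negPf cn) (negPf cn').
apply: (@le_trans _ _ ((\sum_(v <- s) cmod (v 0) * cmod (v k%:Z))%:E)).
  rewrite lee_fin /s big_map big_enum /= -(eq_bigr _ (fun i ci => up i ci)).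
  have e1 : \sum_i cmod (psi i 0) * cmod (psi i k%:Z) = \sum_(i in chi) cmod (psi i 0) * cmod (psi i k%:Z).
    rewrite [LHS](bigID chi) /= [X in _ + X]big1 ?addr0// => i ci.
    by rewrite (zer i ci) cmod0 mul0r.
  rewrite e1 in low; have -> : (2 * M)^-1 = M^-1 * (1 / 2) by rewrite invfM mulrC mul1r.
  by rewrite ler_pdivrMl.
apply: esum_ge; exists [set` s]; first split; first exact: finite_seq.
  have al : all (fun v => `[<B v>]) s.
    by rewrite all_map; apply/allP => i; rewrite mem_enum => ci; apply/asboolP; case: (hu i ci).
  by move=> v vs; apply/asboolP; exact: (allP al v vs).
by rewrite -fsbig_seq// sumEFin.
Qed.

End Basis.
End Point.
End Onb.

(** * Integration over the phase *)

Section Integral.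
Context d (T : measurableType d) (R : realType).
Variable mu : {measure set T -> \bar R}.

(* No measurability is needed: the integral of a nonnegative function is a supremum over simple functions
   below it, and the integrand in the theorem is not known to be measurable. *)
Lemma ge0_integral_mono (D : set T) (f g : T -> \bar R) : (forall x, D x -> 0 <= f x)%E ->
  (forall x, D x -> f x <= g x)%E -> (\int[mu]_(x in D) f x <= \int[mu]_(x in D) g x)%E.
Proof.
move=> f0 fg; have g0 x : D x -> (0 <= g x)%E by move=> Dx; apply: le_trans (f0 _ Dx) (fg _ Dx).
rewrite !ge0_integralE//; apply: ereal_sup_le => _ [h hf <-]; exists h => // x.
by apply: le_trans (hf x) _; apply: lee_restrict.
Qed.

Lemma ge0_integral_steps (D Z : set T) (n : nat) (c m : 'I_n -> R) (U : 'I_n -> set T) (f : T -> \bar R) :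
  measurable D -> measurable Z -> mu Z = 0%E -> (forall j, measurable (U j)) -> (forall j, 0 <= c j) ->
  (forall j, mu (U j) <= (m j)%:E)%E -> (forall x, D x -> 0 <= f x)%E ->
  (forall x, D x -> ~ Z x -> f x <= (\sum_j c j * \1_(U j) x)%:E)%E ->
  (\int[mu]_(x in D) f x <= (\sum_j c j * m j)%:E)%E.
Proof.
move=> mD mZ Z0 mU c0 mm f0 h.
(* The summand that is +oo on the null set Z dominates f there and integrates to 0. *)
pose F (o : option 'I_n) x : \bar R := if o is Some j then ((c j)%:E * (\1_(U j) x)%:E)%E else (+oo * (\1_Z x)%:E)%E.
have mI (A : set T) : measurable A -> measurable_fun D (EFin \o (\1_A : T -> R)).
  by move=> mA; apply: measurableT_comp => //; exact: measurable_indic.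
have mF o : measurable_fun D (F o) by case: o => [j|]; apply: measurable_funeM; exact: mI.
have F0 o x : D x -> (0 <= F o x)%E.
  by case: o => [j|] _; apply: mule_ge0; rewrite ?lee_fin ?leey// indicE ler0n.
have iF o : (\int[mu]_(x in D) F o x <= if o is Some j then (c j * m j)%:E else 0)%E.
  case: o => [j|] /=; rewrite ge0_integralZl ?integral_indic//; try by [exact: mI|move=> x _; rewrite lee_fin indicE ler0n|rewrite lee_fin].
    rewrite EFinM; apply: lee_wpmul2l; first by rewrite lee_fin.
    by apply: le_trans (mm j); apply: le_measure; rewrite ?inE//; exact: measurableI.
  rewrite (_ : mu _ = 0%E) ?mule0//; apply/eqP; rewrite eq_le measure_ge0 andbT -Z0.
  by apply: le_measure; rewrite ?inE//; exact: measurableI.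
apply: (@le_trans _ _ (\int[mu]_(x in D) (\sum_(o <- index_enum (option 'I_n)) F o x))%E).
  apply: ge0_integral_mono => // x Dx; have [Zx|Zx] := pselect (Z x).
    rewrite (bigD1 None)//= indicE mem_set// mule1; apply: le_trans (leey _) _.
    by rewrite leeDl//; apply: sume_ge0 => o _; exact: F0.
  apply: le_trans (h x Dx Zx) _; rewrite (bigD1 None)//= indicE memNset// mule0 add0e.
  rewrite (reindex_omap (Some : 'I_n -> option 'I_n) id) /=; last by case.
  rewrite -sumEFin; under [leRHS]eq_bigl => i do rewrite eqxx.
  by apply: lee_sum => i _; rewrite EFinM.
rewrite ge0_integral_sum//; apply: (@le_trans _ _ (\sum_(o : option 'I_n) if o is Some j then (c j * m j)%:E else 0)%E).
  by apply: lee_sum => o _; exact: iF.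
rewrite (bigD1 None)//= add0e (reindex_omap (Some : 'I_n -> option 'I_n) id) /=; last by case.
by rewrite -sumEFin; under eq_bigl => i do rewrite eqxx.
Qed.

Lemma integral_ge_cst (D Z : set T) (c : R) (f : T -> \bar R) : measurable D -> measurable Z -> mu D = 1%E -> mu Z = 0%E -> 0 <= c ->
  (forall x, D x -> 0 <= f x)%E -> (forall x, D x -> ~ Z x -> c%:E <= f x)%E -> (c%:E <= \int[mu]_(x in D) f x)%E.
Proof.
move=> mD mZ D1 Z0 c0 f0 h.
apply: (@le_trans _ _ (\int[mu]_(x in D) (c%:E * (\1_(~` Z) x)%:E))%E); last first.
  apply: ge0_integral_mono => x Dx; first by rewrite mule_ge0 ?lee_fin// indicE ler0n.
  have [Zx|Zx] := pselect (Z x); first by rewrite indicE memNset ?mule0 ?f0//; apply.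
  by rewrite indicE mem_set ?mule1 ?h.
rewrite ge0_integralZl ?lee_fin//; last first.
  by apply: measurableT_comp => //; apply: measurable_indic; exact: measurableC.
rewrite integral_indic//; last exact: measurableC.
have mDZ : measurable (D `&` Z) by exact: measurableI.
have mZD : measurable (~` Z `&` D) by apply: measurableI => //; exact: measurableC.
have DZ : mu (D `&` Z) = 0%E.
  by apply/eqP; rewrite eq_le measure_ge0 andbT -Z0; apply: le_measure; rewrite ?inE.
have UE : D `&` Z `|` ~` Z `&` D = D by rewrite [~` Z `&` D]setIC -setIUr setUv setIT.
have h1 : (mu D <= mu (D `&` Z) + mu (~` Z `&` D))%E by rewrite -{1}UE; exact: measureU2.
rewrite D1 DZ add0e in h1.
by rewrite -[leLHS]mule1; apply: lee_wpmul2l => //; rewrite lee_fin.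
Qed.

Lemma measure_bigsetU_le (I : Type) (r : seq I) (U : I -> set T) (m : I -> R) : (forall i, measurable (U i)) ->
  (forall i, mu (U i) <= (m i)%:E)%E -> measurable (\big[setU/set0]_(i <- r) U i) /\ (mu (\big[setU/set0]_(i <- r) U i) <= (\sum_(i <- r) m i)%:E)%E.
Proof.
move=> mU hm; elim: r => [|i r [mr hr]]; first by rewrite !big_nil measure0.
rewrite !big_cons; split; first exact: measurableU.
apply: le_trans (measureU2 mu (mU i) mr) _; rewrite EFinD; apply: leeD; [exact: hm|exact: hr].
Qed.

End Integral.

(** * Measure of the sets of resonant phases *)

Section Measure.
Variable R : realType.
Implicit Types (theta b s c : R).
Local Notation mu := (@lebesgue_measure R).

(* A crude cover, for [s <= 1], of the phases in [0, 1] with [chord (2 * theta + b) < s]: ten integers certainly suffice. *)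
Definition resonance b s : set R :=
  \big[setU/set0]_(j <- iota 0 10) `[((Num.floor b + j%:Z - 3)%:~R - b - s) / 2, ((Num.floor b + j%:Z - 3)%:~R - b + s) / 2]%classic.

Lemma resonance_measure b s : 0 <= s -> measurable (resonance b s) /\ (mu (resonance b s) <= (10 * s)%:E)%E.
Proof.
move=> s0.
have -> : 10 * s = \sum_(j <- iota 0 10) s by rewrite big_const_seq count_predT size_iota iter_addr_0 mulr_natl.
apply: (@measure_bigsetU_le _ _ R mu nat (iota 0 10) _ (fun=> s)) => i; first exact: measurable_itv.
apply: le_trans (_ : lebesgue_measure ([set` _] : set R) <= _)%E; first exact: lexx.
rewrite lebesgue_measure_itv /=; case: ifP => _; last by rewrite lee_fin.
by rewrite -EFinB lee_fin; lra.
Qed.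

Lemma chord_resonance theta b s : 0 <= theta <= 1 -> s <= 1 -> chord (2 * theta + b) < s -> resonance b s theta.
Proof.
move=> /andP[t0 t1] s1 ch; have [j hj] := chord_int (2 * theta + b).
have /andP[fb fb1] := floor_itv b.
have jb : (0 <= j - Num.floor b + 3 < 10)%R.
  move: hj; rewrite ler_norml => /andP[h1 h2].
  rewrite -(ltr_int R) -(ler_int R) !intrD rmorphN /=; move: fb1; rewrite intrD; lra.
pose i := absz (j - Num.floor b + 3).
have ij : Num.floor b + i%:Z - 3 = j by rewrite /i; move: (Num.floor b) jb => x; lia.
suff H : (`[(j%:~R - b - s) / 2, (j%:~R - b + s) / 2]%classic : set R) theta.
  rewrite /resonance -bigcup_seq; exists i; last by rewrite ij.
  have : i \in iota 0 10 by rewrite mem_iota /i; move: (Num.floor b) jb => x; lia.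
  by [].
rewrite /= in_itv /=; move: hj; rewrite ler_norml => /andP[h1 h2]; apply/andP; split; lra.
Qed.
Definition resonances (bb s : int -> R) N : set R := \big[setU/set0]_(n <- window N) resonance (bb n) (s n).

Lemma resonances_measure (bb s : int -> R) N : (forall n, 0 <= s n) ->
  measurable (resonances bb s N) /\ (mu (resonances bb s N) <= (\sum_(n <- window N) 10 * s n)%:E)%E.
Proof. by move=> s0; apply: (@measure_bigsetU_le _ _ R mu int) => n; case: (resonance_measure (bb n) (s0 n)). Qed.

Lemma chord_resonances (bb s : int -> R) N theta : 0 <= theta <= 1 -> (forall n, s n <= 1) -> ~ resonances bb s N theta ->
  forall n : int, (absz n <= N)%N -> s n <= chord (2 * theta + bb n).
Proof.
move=> t01 s1 h n nN; rewrite leNgt; apply/negP => c; apply: h.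
rewrite /resonances -bigcup_seq; exists n; last exact: chord_resonance.
by move: nN; rewrite -mem_window.
Qed.

Lemma sum_window_sqr N : \sum_(n <- window N) (absz n).+1%:R ^- 2 <= 3 :> R.
Proof.
rewrite -(sym_window (fun n => (absz n).+1%:R ^- 2)) -/(symsum (fun n => (absz n).+1%:R ^- 2) N).
(* The telescoping form of the bound, which the induction needs. *)
suff : symsum (fun n => (absz n).+1%:R ^- 2) N <= 3 - 2 / N.+1%:R :> R.
  by move=> h; apply: le_trans h _; rewrite gerBl divr_ge0.
elim: N => [|N IH]; first by rewrite symsum0 absz0 expr1n invr1; lra.
rewrite symsumS abszN absz_nat; apply: (le_trans (lerD IH (lexx _))).
have N0 : 0 <= N%:R :> R by [].
have N1 : (0 : R) < N.+1%:R by [].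
have N2 : (0 : R) < N.+2%:R by [].
have N12 : N.+2%:R = N.+1%:R + 1 :> R by rewrite -[N.+2]addn1 natrD.
have ab (a b c : R) : a <= b - c -> 3 - 2 * b + (a + a) <= 3 - 2 * c by lra.
apply: ab.
have -> : N.+1%:R^-1 - N.+2%:R^-1 = (N.+1%:R * N.+2%:R)^-1 :> R.
  have h (x : R) : 0 < x -> x^-1 - (x + 1)^-1 = (x * (x + 1))^-1.
    by move=> x0; field; apply/andP; split; apply: lt0r_neq0 => //; exact: ltr_wpDr.
  by rewrite N12; exact: h.
by rewrite lef_pV2 ?posrE ?mulr_gt0 ?exprn_gt0// expr2 ler_wpM2r// ler_nat.
Qed.

(** For c = 1/(m + 1) the bad set of each l has measure at most 30 c, uniformly in l. So has the
    increasing union of the sets of phases that are bad from some l on, and intersecting over m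
    leaves a null set. *)
Lemma ae_good (beta : nat -> R) (q : nat -> nat) :
  exists Z, [/\ measurable Z, mu Z = 0%E & forall theta, 0 <= theta <= 1 -> ~ Z theta -> good_phase beta q theta].
Proof.
pose s m (n : int) : R := m.+1%:R^-1 * (absz n).+1%:R ^- 2.
have s0 m n : 0 <= s m n by rewrite /s mulr_ge0 ?invr_ge0// exprn_ge0.
have s1 m n : s m n <= 1.
  rewrite /s -invfM invf_le1 ?mulr_gt0 ?exprn_gt0//.
  by rewrite -[leLHS]mulr1 ler_pM ?ler1n// exprn_ege1// ler1n.
pose Bad m l := resonances (fun n => n%:~R * beta l) (s m) (3 * q l).
have mB m l : measurable (Bad m l) by case: (resonances_measure (fun n => n%:~R * beta l) (3 * q l) (s0 m)).
have muB m l : (mu (Bad m l) <= (30 / m.+1%:R)%:E)%E.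
  case: (resonances_measure (fun n => n%:~R * beta l) (3 * q l) (s0 m)) => _ h; apply: le_trans h _.
  rewrite lee_fin -mulr_sumr /s -mulr_sumr.
  have := sum_window_sqr (3 * q l); have : (0 : R) < m.+1%:R^-1 by rewrite invr_gt0.
  move=> m0 h; have := ler_wpM2l (ltW m0) h; move: (m.+1%:R^-1) (\sum_(_ <- _) _) => a b; lra.
pose W m l0 := \bigcap_(l in [set l | (l0 <= l)%N]) Bad m l.
have mW m l0 : measurable (W m l0) by apply: bigcap_measurable => [|l _]; [exists l0 => /=|exact: mB].
have muW m l0 : (mu (W m l0) <= (30 / m.+1%:R)%:E)%E.
  apply: le_trans (muB m l0); apply: le_measure; rewrite ?inE; [exact: mW|exact: mB|move=> x; apply; exact: leqnn].
pose V m := \bigcup_l0 W m l0.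
have mV m : measurable (V m) by exact: bigcup_measurable.
have muV m : (mu (V m) <= (30 / m.+1%:R)%:E)%E.
  have cv : mu \o W m @ \oo --> mu (V m).
    apply: nondecreasing_cvg_mu => [i||a b ab]; [exact: mW|exact: mV|apply/subsetPset => x h l /= bl].
    by apply: h => /=; exact: leq_trans bl.
  rewrite -(cvg_lim _ cv)//; apply: lime_le; first by apply/cvg_ex; eexists; exact: cv.
  by apply: nearW => l0; exact: muW.
exists (\bigcap_m V m); split; first by apply: bigcap_measurable => [|m _]; [exists 0%N|exact: mV].
  apply/eqP; rewrite eq_le measure_ge0 andbT; apply/lee_addgt0Pr => e e0; rewrite add0e.
  have [m hm] := archi_nat (30 / e).
  apply: (@le_trans _ _ (mu (V m))); first by apply: le_measure; rewrite ?inE; [apply: bigcap_measurable => [|i _]; [exists 0%N|exact: mV]|exact: mV|move=> x; apply].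
  apply: le_trans (muV m) _; rewrite lee_fin ler_pdivrMr// mulrC -ler_pdivrMr//.
  by apply: le_trans hm _; rewrite ler_nat.
move=> theta t01 nZ; have [m nV] : exists m, ~ V m theta by apply/existsNP => h; apply: nZ => m _; exact: h.
exists m.+1%:R^-1; first by rewrite invr_gt0.
move=> l0; apply: contrapT => no; apply: nV; exists l0 => // l /= l0l; apply: contrapT => nB; apply: no.
exists l => // n nq; exact: (chord_resonances t01 (s1 m) nB nq).
Qed.
End Measure.

(** * Averaging over the phase *)

Section Final.
Variable R : realType.
Arguments continuant : simpl never.
Implicit Types (theta eps : R).
Local Notation mu := (@lebesgue_measure R).

Lemma exp_rate_cvg (f : nat -> \bar R) (L : R) :
  (forall eps, 0 < eps -> exists2 c : R, 0 < c & forall k, (0 < k)%N -> ((c * expR (- ((L + eps) * k%:R)))%:E <= f k)%E) ->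
  (forall eps, 0 < eps -> exists2 C : R, 0 < C & exists k0, forall k, (k0 <= k)%N -> (f k <= (C * expR (- ((L - eps) * k%:R)))%:E)%E) ->
  (fun k => - lne (f k) * (k%:R^-1)%:E)%E @ \oo --> L%:E.
Proof.
move=> lo up.
suff key e : 0 < e -> exists k1, forall k, (k1 <= k)%N -> exists2 x : R, (- lne (f k) * (k%:R^-1)%:E)%E = x%:E & `|L - x| <= e.
  apply/fine_cvgP; split.
    have [k1 h] := key 1 ltr01; exists k1 => // k /= /h[x -> _] //.
  apply/cvgrPdist_le => e e0; have [k1 h] := key e e0; exists k1 => // k /= /h[x /= -> ] //.
move=> e0; have eps0 : 0 < e / 2 by rewrite divr_gt0.
have [c c0 hc] := lo _ eps0; have [C C0 [k0 hC]] := up _ eps0.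
have [K hK] := archi_nat ((`|ln c| + `|ln C|) / (e / 2)).
exists (k0 + K).+1 => k kge.
have kp : (0 < k)%N by lia.
have h1 := hc k kp; have h2 := hC k ltac:(lia).
have kR : 0 < k%:R :> R by rewrite ltr0n.
have Kk : K%:R <= k%:R :> R by rewrite ler_nat; clear -kge; lia.
move: h1 h2; case: (f k) => [r| |] //=; rewrite !lee_fin => h1 h2.
have r0 : 0 < r by apply: lt_le_trans h1; rewrite mulr_gt0// expR_gt0.
exists (- ln r * k%:R^-1); first by rewrite leNgt r0 -EFinN -EFinM.
have g1 : ln c - (L + e / 2) * k%:R <= ln r.
  by rewrite -[X in _ - X]opprK opprK -[X in _ + X]expRK -lnM ?posrE ?expR_gt0// ler_ln ?posrE// mulr_gt0// expR_gt0.
have g2 : ln r <= ln C - (L - e / 2) * k%:R.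
  by rewrite -[X in _ + X]expRK -lnM ?posrE ?expR_gt0// ler_ln ?posrE// mulr_gt0// expR_gt0.
have -> : L - - ln r * k%:R^-1 = (L * k%:R + ln r) / k%:R by field; exact: lt0r_neq0.
rewrite normrM normfV [`|k%:R|]gtr0_norm// ler_pdivrMr//.
have n1 := ler_norm (ln C); have n2 := ler_norm (- ln c); rewrite normrN in n2.
have K1 : `|ln c| + `|ln C| <= e / 2 * k%:R.
  by rewrite mulrC -ler_pdivrMr//; apply: le_trans hK Kk.
have n3 := normr_ge0 (ln C); have n4 := normr_ge0 (ln c).
move: g1 g2; rewrite mulrDl mulrBl => g1 g2.
by rewrite ler_norml; apply/andP; split; clear -g1 g2 n1 n2 n3 n4 K1; lra.
Qed.

Variables (lam alpha : R).
Hypotheses (l1 : 1 < `|lam|) (dio : diophantine alpha).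
Let L := ln `|lam|.

Lemma eigenbasis_bounds : exists Z : set R, [/\ measurable Z, mu Z = 0%E,
  forall theta, 0 <= theta <= 1 -> ~ Z theta -> exists B, eigen_onb lam alpha theta B,
  forall eps, 0 < eps -> exists2 c : R, 0 < c & forall theta B k, 0 <= theta <= 1 -> ~ Z theta -> eigen_onb lam alpha theta B -> (0 < k)%N ->
    ((c * expR (- ((L + eps) * k%:R)))%:E <= \esum_(u in B) (cmod (u 0) * cmod (u k%:Z))%:E)%E &
  forall eps, 0 < eps -> exists k0, forall k, (k0 <= k)%N -> forall theta B, 0 <= theta <= 1 -> ~ Z theta -> eigen_onb lam alpha theta B ->
    (\esum_(u in B) (cmod (u 0) * cmod (u k%:Z))%:E <= 1)%E /\
    forall r0, 0 < r0 -> (forall n : int, (absz n <= 100 * k)%N -> r0 <= chord (2 * theta + n%:~R * alpha)) ->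
    (\esum_(u in B) (cmod (u 0) * cmod (u k%:Z))%:E <= (expR (- ((L - eps) * k%:R)) / r0 * ((100 * k).*2.+1)%:R)%:E)%E].
Proof.
have [kap [tau [beta [q [[tau0 dcA] zq dc ba [qinf _]]]]]] := ring_approximants dio.
have growth := ring_growth tau0 l1 zq dc ba qinf.
have [Z [mZ Z0 gZ]] := ae_good beta q.
(* An implication for all eps and n at once, so that one notion of good energy, and one null set,
   serve every eps. *)
pose Gr (e : R) := forall eps n, 0 < eps -> (forall e', `|e'| <= 2 + 2 * `|lam| -> forall l, (n <= l)%N ->
  ring_eig lam beta q l e' -> growth_bound lam (beta l) ((e'%:C)%C) n%:R eps) -> growth_bound lam alpha ((e%:C)%C) n%:R eps.
have apx theta : 0 <= theta <= 1 -> ~ Z theta -> forall (a : int) (eta : R), 0 < eta ->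
  exists (N : nat) (psi : 'I_N -> int -> R[i]) (e : 'I_N -> R) (chi : 'I_N -> bool),
  [/\ (forall i, is_sol lam alpha theta (((e i)%:C)%C) (psi i)) /\ (forall i, l2b (psi i)),
      forall i j, inner (psi i) (psi j) = ((i == j) && chi i)%:R,
      forall i, ~~ chi i -> forall n, psi i n = 0,
      forall i, Gr (e i) & 1 - eta <= \sum_i cmod (psi i a) ^+ 2].
  move=> t01 nZ a eta eta0; have gd := gZ theta t01 nZ.
  have [N [psi [e [chi [h1 h2 h3 h4 h5]]]]] := eigen_approximation tau0 l1 zq dc qinf growth a ba gd eta0.
  by exists N, psi, e, chi; split => // i eps n; exact: h4.
exists Z; split => //.
- by move=> theta t01 nZ; exact: onb_exists (apx theta t01 nZ).
- move=> eps eps0; have [n hn] := growth eps eps0.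
  exists (2 * n.+1%:R)^-1; first by rewrite invr_gt0 mulr_gt0.
  move=> theta B k t01 nZ onb k0.
  have lam0 : 0 < `|lam| := lt_trans ltr01 l1.
  pose M := n.+1%:R * `|lam| ^+ k * expR (eps * k%:R).
  have M0 : 0 < M by rewrite /M mulr_gt0 ?expR_gt0// mulr_gt0// exprn_gt0.
  have := onb_lower (apx theta t01 nZ) onb k0 M0; rewrite (_ : (2 * n.+1%:R)^-1 * _ = (2 * M)^-1); last first.
    have -> : M = n.+1%:R * expR ((L + eps) * k%:R).
      by rewrite /M -mulrA; congr (_ * _); rewrite mulrDl expRD /L [ln _ * _]mulrC expRM_natl lnK.
    by rewrite expRN -invfM mulrA.
  apply => e ge; apply: le_trans (ge eps n eps0 hn theta k) _.
  by rewrite /M ler_wpM2r ?expR_ge0// ler_wpM2r ?exprn_ge0// ler_nat.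
move=> eps eps0; have [epsu epsu0 tp] := two_point_decay kap tau0 l1 eps0.
have [n hn] := growth epsu epsu0.
have [|k0 hk] := tp n.+1%:R; first by rewrite ler1n.
exists k0 => k k0k theta B t01 nZ onb.
have win (u : int -> R[i]) N (x y : int) : (absz x <= N)%N -> (absz y <= N)%N ->
    cmod (u x) * cmod (u y) <= \sum_(z <- window N) cmod (u z) ^+ 2.
  have one z : (absz z <= N)%N -> cmod (u z) ^+ 2 <= \sum_(z <- window N) cmod (u z) ^+ 2.
    rewrite -mem_window => zN; rewrite (bigD1_seq z) ?window_uniq//= lerDl sumr_ge0// => i _; exact: sqr_ge0.
  move=> /one h1 /one h2; have := sqr_ge0 (cmod (u x) - cmod (u y)); rewrite sqrrB; lra.
split.
  apply: le_trans (onb_upper (N := k) (A := 1) onb _ _) _ => //; last by rewrite lee_fin ge_min lexx.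
  by move=> u _; rewrite mul1r; apply: win.
move=> r0 r00 hr.
apply: le_trans (onb_upper (N := (100 * k)%N) (A := expR (- ((L - eps) * k%:R)) / r0) onb _ _) _.
- by rewrite divr_ge0 ?expR_ge0// ltW.
- move=> u Bu; have [e [ge sol _]] := onb_growth (apx theta t01 nZ) onb Bu.
  apply: (hk k k0k alpha (100 * k).+1 (leqnn _) (dcA _) theta _ u sol) => //; last 2 first.
  + by apply: sumr_ge0 => z _; exact: sqr_ge0.
  + by move=> x y xN yN; exact: win.
  move=> t j; apply: le_trans (ge epsu n epsu0 hn t j) _.
  by rewrite ler_wpM2r ?expR_ge0// ler_wpM2r ?exprn_ge0// ler_nat.
- by rewrite lee_fin ge_min lexx orbT.
Qed.

Variable phi : R -> set (cvec R).
Hypothesis phiP : forall theta, (exists B, eigen_onb lam alpha theta B) -> eigen_onb lam alpha theta (phi theta).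

Let D01 (theta : R) : (`[0, 1]%classic : set R) theta -> 0 <= theta <= 1.
Proof. by rewrite /= in_itv. Qed.

Let F0 k theta : (0 <= \esum_(u in phi theta) (cmod (u 0) * cmod (u k%:Z))%:E)%E.
Proof. by apply: esum_ge0 => u _; rewrite lee_fin mulr_ge0 ?cmod_ge0. Qed.

Lemma corr_ge eps : 0 < eps -> exists2 c : R, 0 < c & forall k, (0 < k)%N -> ((c * expR (- ((L + eps) * k%:R)))%:E <= corr phi k)%E.
Proof.
move=> eps0; have [Z [mZ Z0 ex lo _]] := eigenbasis_bounds.
have [c c0 hc] := lo eps eps0; exists c => // k k0.
apply: (@integral_ge_cst _ _ R mu `[0%R, 1%R]%classic Z _ _ _ mZ _ Z0) => //.
- by apply: etrans (lebesgue_measure_itv `[0, 1]) _; rewrite /= lte_fin ltr01 oppr0 adde0.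
- by rewrite mulr_ge0 ?expR_ge0// ltW.
- by move=> theta /D01 t01 nZ; exact: (hc theta (phi theta) k t01 nZ (phiP (ex theta t01 nZ)) k0).
Qed.

(** A layer cake with finitely many levels s_j = e^(-e k j). The least j at which the phase is not
    s_j-resonant bounds the correlator by A/s_j, on a set of measure at most 10 W s_(j-1) when j >
    0; the product is the same for all such j. Phases resonant at all levels form a set of measure
    at most 10 W s_J, where the bound 1 is used. *)
Lemma corr_le eps : 0 < eps -> exists2 C : R, 0 < C & exists k0, forall k, (k0 <= k)%N -> (corr phi k <= (C * expR (- ((L - eps) * k%:R)))%:E)%E.
Proof.
(* Four losses of e: the pointwise estimate, the ratio of consecutive levels, and two factors W of
   polynomial size. *)
move=> eps0; pose e := eps / 4; have e0 : 0 < e by rewrite divr_gt0.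
have [Z [mZ Z0 ex _ up]] := eigenbasis_bounds.
have [k0 hk] := up e e0.
(* Enough levels for the deepest, s_J = e^(-e k J), to lie below e^(-L k). *)
have [J hJ] := archi_nat (L / e).
have L0 : 0 < L by rewrite ln_gt0.
pose P := 200 / e + 1.
have e200 : 0 <= 200 / e by apply: divr_ge0; [exact: (ler0n _ 200)|exact: ltW].
have P0 : 1 <= P by rewrite lerDr; exact: e200.
exists (J.+2%:R * (10 * P ^+ 2)); first by rewrite mulr_gt0// mulr_gt0// exprn_gt0// (lt_le_trans _ P0).
exists k0 => k k0k.
pose N := (100 * k)%N; pose W : R := N.*2.+1%:R.
have W1 : 1 <= W by rewrite ler1n.
have WP : W <= P * expR (e * k%:R).
  have -> : W = 200 * k%:R + 1 by rewrite /W /N -addn1 natrD -muln2 !natrM; ring.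
  apply: (@le_trans _ _ (P * (1 + e * k%:R))).
    have -> : P * (1 + e * k%:R) = 200 * k%:R + 1 + (200 / e + e * k%:R) by rewrite /P; field; exact: lt0r_neq0.
    by rewrite lerDl; apply: addr_ge0; [exact: e200|apply: mulr_ge0; [exact: ltW|exact: ler0n]].
  by rewrite ler_wpM2l ?expR_ge1Dx//; lra.
pose A := expR (- ((L - e) * k%:R)) * W.
pose s (j : nat) := expR (- (e * k%:R * j%:R)).
have s1 j : s j <= 1 by rewrite -expR0 ler_expR oppr_le0 !mulr_ge0// ltW.
have sp j : 0 < s j by exact: expR_gt0.
pose D : set R := `[0, 1]%classic.
pose U (j : 'I_J.+2) : set R := if val j is j'.+1 then resonances (fun n => n%:~R * alpha) (fun=> s j') N else D.
pose c (j : 'I_J.+2) : R := if (val j <= J)%N then A / s j else 1.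
pose m (j : 'I_J.+2) : R := if val j is j'.+1 then 10 * W * s j' else 1.
have A0 : 0 <= A by rewrite mulr_ge0 ?expR_ge0//; lra.
have c0 j : 0 <= c j by rewrite /c; case: ifP => // _; rewrite divr_ge0// ltW.
have mD : measurable D by exact: measurable_itv.
have muD : mu D = 1%E by apply: etrans (lebesgue_measure_itv `[0, 1]) _; rewrite /= lte_fin ltr01 oppr0 adde0.
have hU j : measurable (U j) /\ (mu (U j) <= (m j)%:E)%E.
  rewrite /U /m; case: (val j) => [|j']; first by rewrite muD.
  have [h1 h2] := @resonances_measure R (fun n => n%:~R * alpha) (fun=> s j') N (fun=> ltW (sp j')).
  split => //; apply: le_trans h2 _; rewrite lee_fin big_const_seq count_predT size_map size_iota iter_addr_0 -[leLHS]mulr_natr -/W.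
  by rewrite mulrAC.
apply: (@le_trans _ _ (\sum_j c j * m j)%:E).
  apply: (@ge0_integral_steps _ _ R mu D Z J.+2 c m U _ mD mZ Z0) => //; try by [move=> j; case: (hU j)|move=> x _; exact: F0].
  move=> theta /D01 t01 nZ; have onb := phiP (ex theta t01 nZ).
  have [le1 hr] := hk k k0k theta _ t01 nZ onb.
  have one j : U j theta -> c j <= \sum_j c j * \1_(U j) theta.
    move=> Uj; rewrite (bigD1 j)//= indicE mem_set// mulr1 lerDl sumr_ge0// => i _.
    by rewrite mulr_ge0// indicE ler0n.
  suff [j Uj hj] : exists2 j, U j theta & (\esum_(u in phi theta) (cmod (u 0) * cmod (u k%:Z))%:E <= (c j)%:E)%E.
    by apply: le_trans hj _; rewrite lee_fin; exact: one.
  have step (j : nat) (jJ : (j <= J)%N) : ~ resonances (fun n => n%:~R * alpha) (fun=> s j) N theta ->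
      (\esum_(u in phi theta) (cmod (u 0) * cmod (u k%:Z))%:E <= (A / s j)%:E)%E.
    move=> nr; have := hr (s j) (sp j) (chord_resonances t01 (fun=> s1 j) nr).
    by rewrite /A -/N -/W mulrAC.
  have [all_in|/existsNP[j0]] := pselect (forall j, (j <= J)%N -> resonances (fun n => n%:~R * alpha) (fun=> s j) N theta).
    exists ord_max; first by rewrite /U /=; exact: all_in.
    by rewrite /c /= ltnn.
  move=> /not_implyP[j0J nj0].
  have exP : exists j, `[< ~ resonances (fun n => n%:~R * alpha) (fun=> s j) N theta >] by exists j0; apply/asboolP.
  case: (ex_minnP exP) => j /asboolP nj jmin.
  have jJ : (j <= J)%N by apply: leq_trans j0J; apply: jmin; apply/asboolP.
  have jJ2 : (j < J.+2)%N by rewrite ltnS leqW.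
  exists (Ordinal jJ2); last by rewrite /c /= jJ; exact: step.
  rewrite /U /=; case: j nj jmin jJ jJ2 => [|j] nj jmin jJ jJ2; first by rewrite /D /= in_itv.
  by apply: contrapT => h; have := jmin j; rewrite ltnn => /(_ (introT (asboolP _) h)).
rewrite lee_fin; pose X := 10 * (W ^+ 2 * expR (- ((L - 2 * e) * k%:R))).
pose E := expR (- ((L - e) * k%:R)); pose Y := expR (e * k%:R).
have E0 : 0 < E by exact: expR_gt0.
have k0R : 0 <= k%:R :> R by [].
have Y1 : 1 <= Y by rewrite -expR0 ler_expR mulr_ge0// ltW.
have EX : expR (- ((L - 2 * e) * k%:R)) = E * Y by rewrite -expRD; congr expR; ring.
have W2 : W <= W ^+ 2 by rewrite expr2 ler_peMl//; lra.
have W0 : 0 < W by lra.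
have W20 : 0 < W ^+ 2 by rewrite exprn_gt0.
have bd j : c j * m j <= X.
  rewrite /c /m /X EX; case: j => -[|j] jlt /=.
    have -> : s 0%N = 1 by rewrite /s mulr0 oppr0 expR0.
    rewrite divr1 mulr1 /A -/E; have -> : 10 * (W ^+ 2 * (E * Y)) = E * (10 * (W ^+ 2 * Y)) by ring.
    have h1 : W ^+ 2 <= W ^+ 2 * Y by rewrite ler_peMr// ltW.
    by rewrite ler_wpM2l ?(ltW E0)//; clear -h1 W2 W20; lra.
  have sS : s j = s j.+1 * Y by rewrite /s /Y -expRD; congr expR; rewrite -addn1 natrD; ring.
  case: ifP => jJ.
    rewrite sS /A -/E; rewrite le_eqVlt; apply/orP; left; apply/eqP; field; exact: lt0r_neq0.
  have jE : j = J by apply/eqP; rewrite eqn_leq [(J <= j)%N]leqNgt jJ andbT; exact: jlt.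
  rewrite mul1r -mulrA ler_wpM2l// jE.
  have h1 : s J <= E * Y.
    rewrite -EX /s ler_expR lerN2; apply: (@le_trans _ _ (L * k%:R)); first by rewrite ler_wpM2r// lerBlDr lerDl mulr_ge0// ltW.
    by rewrite mulrAC ler_wpM2r// mulrC -ler_pdivrMr.
  by apply: ler_pM => //; exact: ltW.
apply: (@le_trans _ _ (\sum_(j < J.+2) X)); first by apply: ler_sum.
have -> : \sum_(j < J.+2) X = J.+2%:R * X by rewrite sumr_const card_ord mulr_natl.
rewrite -mulrA ler_wpM2l// /X -[leRHS]mulrA ler_wpM2l// EX.
have -> : expR (- ((L - eps) * k%:R)) = E * Y * Y ^+ 2.
  by rewrite expr2 /E /Y -!expRD; congr expR; rewrite /e; field.
rewrite [leRHS]mulrCA [leLHS]mulrC ler_wpM2l//; first by apply: mulr_ge0; [exact: ltW|exact: le_trans Y1].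
have PY : 0 <= P * Y by apply: mulr_ge0; [exact: le_trans P0|exact: le_trans Y1].
by rewrite -exprMn ler_pXn2r ?nnegrE// ltW.
Qed.

End Final.

Theorem theorem1p1 (R : realType) (lam alpha : R) (phi : R -> set (cvec R)) :
  1 < `|lam| -> diophantine alpha ->
  (forall theta : R, (exists B, eigen_onb lam alpha theta B) ->
                     eigen_onb lam alpha theta (phi theta)) ->
  limn_esup (rate phi) = (ln `|lam|)%:E /\
  limn_einf (rate phi) = (ln `|lam|)%:E.
Proof.
move=> l1 dio phiP.
have cv : rate phi @ \oo --> (ln `|lam|)%:E := exp_rate_cvg (corr_ge l1 dio phiP) (corr_le l1 dio phiP).
by have [hi hs] := cvg_limn_einf_sup cv; split.
Qed.
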